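(* Fix $0<\alpha<1$. For every closed subset $F$ of $[0,1]$ and every open subset $G$ of $[0,1]$, $$\limsup_{T\to\infty}\frac{\log T}{T}\log\mathbb P_\alpha\Big[\int_0^1\eta_s(0)\,ds\in F\Big]\le-\inf_{\beta\in F}\Upsilon_\alpha(\beta),\qquad \liminf_{T\to\infty}\frac{\log T}{T}\log\mathbb P_\alpha\Big[\int_0^1\eta_s(0)\,ds\in G\Big]\ge-\inf_{\beta\in G}\Upsilon_\alpha(\beta),$$ where $\Upsilon_\alpha:[0,1]\to\mathbb R_+$ is the rate function given by $$\Upsilon_\alpha(\beta)=\frac\pi2\Big\{\sin^{-1}(2\beta-1)-\sin^{-1}(2\alpha-1)\Big\}^2 .$$
   Context: For $T>1$, the speeded-up symmetric simple exclusion process on $\mathbb Z^2$ is the continuous-time Markov process $(\eta_s)_{s\ge0}$ on $\{0,1\}^{\mathbb Z^2}$ whose generator acts on functions $f$ depending on finitely many coordinates as $(L_Tf)(\eta)=\frac T2\sum_{j=1}^2\sum_{x\in\mathbb Z^2}\{f(\sigma^{x,x+e_j}\eta)-f(\eta)\}$, where $\{e_1,e_2\}$ is the canonical basis of $\mathbb R^2$ and $\sigma^{x,y}\eta$ is obtained from $\eta$ by exchanging $\eta(x)$ and $\eta(y)$. $\nu_\alpha$ is the Bernoulli product measure on $\{0,1\}^{\mathbb Z^2}$ with $\nu_\alpha\{\eta(x)=1\}=\alpha$ for all $x$. $\mathbb P_\alpha=\mathbb P_{T,\alpha}$ is the law on $D(\mathbb R_+,\{0,1\}^{\mathbb Z^2})$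 (right-continuous paths with left limits, Skorohod topology) of the process with generator $L_T$ started from $\nu_\alpha$. *)

(* Defs.v *)
From HB Require Import structures.
From mathcomp Require Import all_boot all_order all_algebra.
From mathcomp Require Import all_classical all_reals all_analysis.

Set Implicit Arguments.
Unset Strict Implicit.
Unset Printing Implicit Defensive.

Import Order.TTheory GRing.Theory Num.Theory.
Import numFieldNormedType.Exports.

Local Open Scope classical_set_scope.
Local Open Scope ring_scope.

Notation site := 'rV[int]_2.

Definition unit_vector (j : 'I_2) : site := delta_mx 0 j.

(* {0,1}^(Z^2) with the product of the discrete topologies *)
Definition config : Type := prod_topology (fun _ : site => bool).

HB.instance Definition _ := Pointed.on config.
HB.instance Definition _ := Uniform.on config.

Definition exchange (x y : site) (eta : config) : config :=
  fun z => if z == x then eta y else if z == y then eta x else eta z.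

Definition cylinder (R : realType) (f : config -> R) : Prop :=
  exists A : seq site, forall eta zeta : config,
    (forall z, z \in A -> eta z = zeta z) -> f eta = f zeta.

(* For a cylinder function only finitely many terms of the sum over the sites
   are nonzero, so that the finitely supported sum is the actual sum. *)
Definition ssep_generator (R : realType) (T : R) (f : config -> R)
    (eta : config) : R :=
  T / 2 * \sum_(j < 2) \sum_(x \in [set: site])
    (f (exchange x (x + unit_vector j) eta) - f eta).

(* Markov semigroups on C(config); the values of S at negative times and at
   discontinuous functions are irrelevant. *)
Record markov_semigroup (R : realType)
    (S : R -> (config -> R) -> (config -> R)) : Prop := {
  semigroup_continuous : forall (t : R) (f : config -> R),
    0 <= t -> continuous f -> continuous (S t f) ;
  semigroup_linear : forall (t a : R) (f g : config -> R),
    0 <= t -> continuous f -> continuous g ->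
    S t (fun eta => a * f eta + g eta) =
    (fun eta => a * S t f eta + S t g eta) ;
  semigroup0 : forall f : config -> R, continuous f -> S 0 f = f ;
  semigroupD : forall (s t : R) (f : config -> R),
    0 <= s -> 0 <= t -> continuous f -> S (s + t) f = S s (S t f) ;
  semigroup1 : forall t : R, 0 <= t -> S t (fun=> 1) = (fun=> 1) ;
  semigroup_ge0 : forall (t : R) (f : config -> R),
    0 <= t -> continuous f ->
    (forall eta, 0 <= f eta) -> forall eta, 0 <= S t f eta ;
  semigroup_right_continuous : forall (t : R) (f : config -> R),
    0 <= t -> continuous f -> {uniform, S u f @[u --> t^'+] --> S t f}
}.

(* f is in the domain of the generator of S, which maps f to g. *)
Definition generator_graph (R : realType)
    (S : R -> (config -> R) -> (config -> R)) (f g : config -> R) : Prop :=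
  [/\ continuous f, continuous g &
    {uniform, (fun eta => (S t f eta - f eta) / t) @[t --> 0^'+] --> g}].

(* The elements of D(R_+, config) are encoded as functions on R that are
   constant on the negative half-line, so that each path has exactly one
   encoding. *)
Record cadlag_path (R : realType) : Type := CadlagPath {
  path_fun :> R -> config ;
  path_right_continuous :
    forall t : R, 0 <= t -> path_fun s @[s --> t^'+] --> path_fun t ;
  path_left_limit :
    forall t : R, 0 < t -> cvg (path_fun s @[s --> t^'-]) ;
  path_negative : forall t : R, t < 0 -> path_fun t = path_fun 0
}.

Lemma path_cst_right_continuous (R : realType) (eta : config) (t : R) :
  0 <= t -> (fun=> eta) s @[s --> t^'+] --> (fun=> eta) t.
Proof. by move=> _; exact: cvg_cst. Qed.

Lemma path_cst_left_limit (R : realType) (eta : config) (t : R) :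
  0 < t -> cvg ((fun=> eta) s @[s --> t^'-]).
Proof. by move=> _; exact: is_cvg_cst. Qed.

Definition path_cst (R : realType) (eta : config) : cadlag_path R :=
  CadlagPath (@path_cst_right_continuous R eta) (@path_cst_left_limit R eta)
    (fun _ _ => erefl).

HB.instance Definition _ (R : realType) := gen_eqMixin (cadlag_path R).
HB.instance Definition _ (R : realType) := gen_choiceMixin (cadlag_path R).
HB.instance Definition _ (R : realType) :=
  isPointed.Build (cadlag_path R) (path_cst R point).

(* Only the restriction of l to the nonnegative half-line matters. *)
Definition time_change (R : realType) (l : R -> R) : Prop :=
  {in `[0, +oo[ &, {homo l : s t / s < t}} /\
  l @` `[0, +oo[%classic = `[0, +oo[%classic.

Definition skorohod_cvg (R : realType) (x_ : nat -> cadlag_path R)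
    (x : cadlag_path R) : Prop :=
  exists l : nat -> R -> R,
    (forall n, time_change (l n)) /\
    forall N : R, 0 < N ->
      {uniform `[0, N], l @ \oo --> (id : R -> R)} /\
      (forall E : set (config * config), entourage E ->
        \forall n \near \oo,
          forall s : R, 0 <= s <= N -> E (x_ n s, x (l n s))).

(* The Skorohod topology is metrizable, so that its open sets are the
   sequentially open ones. *)
Definition skorohod_open (R : realType) (U : set (cadlag_path R)) : Prop :=
  forall (x : cadlag_path R) (x_ : nat -> cadlag_path R),
    U x -> skorohod_cvg x_ x -> \forall n \near \oo, U (x_ n).

(* D(R_+, config) with the Borel sigma-algebra of the Skorohod topology *)
Notation path_space R := (g_sigma_algebraType (@skorohod_open R)).

(* The sigma-algebra generated by the coordinates at times r <= s *)
Definition past (R : realType) (s : R) : set (set (cadlag_path R)) :=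
  <<s [set A | exists (r : R) (z : site),
         0 <= r <= s /\ A = [set x : cadlag_path R | x r z]] >>.

Definition starts_from_bernoulli (R : realType) (alpha : R)
    (P : probability (path_space R) R) : Prop :=
  forall (A : seq site) (zeta : config), uniq A ->
    P [set x : cadlag_path R | forall z : site, z \in A -> x 0 z = zeta z] =
    (\prod_(z <- A) (if zeta z then alpha else 1 - alpha))%:E.

(* E[f(x (s + t)) | past s] = (S t f)(x s) *)
Definition markov_property (R : realType)
    (S : R -> (config -> R) -> (config -> R))
    (P : probability (path_space R) R) : Prop :=
  forall (s t : R) (f : config -> R) (A : set (cadlag_path R)),
    0 <= s -> 0 <= t -> continuous f -> past s A ->
    \int[P]_(x in A) f ((x : cadlag_path R) (s + t)) =
    \int[P]_(x in A) S t f ((x : cadlag_path R) s).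

(* P is the law of the Markov process with generator L_T started from nu_alpha:
   the cylinder functions being a core, L_T on cylinder functions determines
   the semigroup S. *)
Definition ssep_law (R : realType) (T alpha : R)
    (P : probability (path_space R) R) : Prop :=
  exists S : R -> (config -> R) -> (config -> R),
    [/\ markov_semigroup S,
      (forall f, cylinder f -> generator_graph S f (ssep_generator T f)),
      starts_from_bernoulli alpha P &
      markov_property S P].

Definition occupation_time (R : realType) (x : cadlag_path R) : R :=
  \int[lebesgue_measure]_(s in `[0, 1]) (x s 0)%:R.

Definition rate (R : realType) (alpha beta : R) : R :=
  pi / 2 * (asin (2 * beta - 1) - asin (2 * alpha - 1)) ^+ 2.

(* Main.v *)
Require Import Defs.
From HB Require Import structures.
From mathcomp Require Import all_boot all_order all_algebra.
From mathcomp Require Import all_classical all_reals all_analysis.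
From mathcomp Require Import ring lra zify.
From mathcomp Require Import measurable_realfun.

Set Implicit Arguments.
Unset Strict Implicit.
Unset Printing Implicit Defensive.
Import Order.TTheory GRing.Theory Num.Theory.
Import numFieldNormedType.Exports.
Local Open Scope classical_set_scope.
Local Open Scope ring_scope.

(* Write alpha = sin^2 a0 and b for an angle of density sin^2 b, so that the rate
   is 2 pi (b - a0)^2. Both bounds reduce to the exponential moments of the
   occupation time at the scale T / log T. Let u be the Green function of the
   planar walk up to time 2M, divided by its value G ~ log M / pi at the origin,
   and let phi0 be the square root of the density, with respect to nu_alpha, of
   the product measure with angle a0 + (b - a0) u(x) at x; the Dirichlet energy
   of u is of order 1 / G.
   Lower bound: discretize the Feynman-Kac semigroup, symmetrize it and use the
   log-convexity of <phi0, B^n phi0>; this leaves the Dirichlet form of phi0.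
   Upper bound: a positive supersolution bounds the symmetric Feynman-Kac
   semigroup (Schur test). The function phi0 fails to be one only by terms
   quadratic in the centred occupations; multiplying it by the exponential of a
   quadratic form cancels them up to a negative semidefinite form. The Laplacian
   of u has a point mass at 0, which yields the occupation time, and a diffuse
   part, which yields a linear statistic negligible under nu_alpha.
   The optimal tilt is strictly increasing in b, so the exponential moments
   give the large deviation bounds by Chebyshev and by exponential tilting. *)

(** * Finitely supported sums *)

Section FiniteSums.
Variables (R : realType) (V : zmodType).
Implicit Types (f g : V -> R).

(** Angles are used because the affinity of two Bernoulli laws of densities [sin^2 a] and [sin^2 b]
    is [cos (a - b)]: the Dirichlet form of [phi0] becomes a sum of squared sines of angle
    increments, smallest for an almost harmonic angle, whence the arcsines of the rate. With
    [w^2 = 1 / G] the gradient of the profile is of order [w] in l2, so all main terms are of order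
    [T w^2], that is [T / log T]. The obstacle is that the quadratic terms are of order [w^2] as
    well, neither small nor of one sign. After their cancellation the errors are [eps w^2] and
    [w^3], the latter with a constant depending on the corrector: [eps] is fixed first, then the
    corrector, then [T]. The two bounds use different scales. For [M] of order [T] the linear
    statistic is negligible. The supremum of [phi0], of size [exp (C M w^2)], requires [M] much
    smaller than [T] in the lower bound, and [T / log T] is taken; [log M ~ log T] in both cases.
    The generator is given on cylinder functions only, so the semigroup is reached through Euler
    schemes. *)

Definition fsupp f := exists s : seq V, forall x, f x != 0 -> x \in s.

(** The finitely supported sum is 0 by default when infinitely many terms are nonzero; this is why
    additivity and monotonicity carry [fsupp] hypotheses. *)
Definition lsum f : R := \sum_(x \in [set: V]) f x.

Lemma lsum_seq (s : seq V) f :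
  uniq s -> (forall x, f x != 0 -> x \in s) -> lsum f = \sum_(x <- s) f x.
Proof.
move=> us fs; rewrite fsbig_seq//; apply/esym/fsbig_widen => // x [_ /= xs].
by apply/eqP; apply: contra_notT xs => /fs.
Qed.

Lemma fsupp_seq f : fsupp f -> exists2 s, uniq s & forall x, f x != 0 -> x \in s.
Proof.
move=> [s fs]; exists (undup s); first exact: undup_uniq.
by move=> x /fs; rewrite mem_undup.
Qed.

Lemma fsupp_seq2 f g : fsupp f -> fsupp g ->
  exists s, [/\ uniq s, forall x, f x != 0 -> x \in s & forall x, g x != 0 -> x \in s].
Proof.
move=> [s fs] [t gt]; exists (undup (s ++ t)); split; first exact: undup_uniq.
- by move=> x /fs; rewrite mem_undup mem_cat => ->.
- by move=> x /gt; rewrite mem_undup mem_cat => ->; rewrite orbT.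
Qed.

Lemma fsupp_sub f g : fsupp f -> (forall x, f x = 0 -> g x = 0) -> fsupp g.
Proof.
move=> [s fs] fg; exists s => x gx; apply: fs; apply: contra gx => /eqP/fg ->.
by rewrite eqxx.
Qed.

Lemma fsupp0 : fsupp (fun=> 0).
Proof. by exists [::] => x; rewrite eqxx. Qed.

Lemma fsupp_delta a : fsupp (fun x => (x == a)%:R).
Proof. by exists [:: a] => x; rewrite inE; case: (x == a) => //; rewrite eqxx. Qed.

Lemma fsuppD f g : fsupp f -> fsupp g -> fsupp (fun x => f x + g x).
Proof.
move=> [s fs] [t gt]; exists (s ++ t) => x; rewrite mem_cat.
have [f0|/fs ->//] := eqVneq (f x) 0; rewrite f0 add0r => /gt ->.
by rewrite orbT.
Qed.

Lemma fsuppMl f g : fsupp f -> fsupp (fun x => f x * g x).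
Proof. by move=> /fsupp_sub; apply=> x ->; rewrite mul0r. Qed.

Lemma fsuppMr f g : fsupp g -> fsupp (fun x => f x * g x).
Proof. by move=> /fsupp_sub; apply=> x ->; rewrite mulr0. Qed.

Lemma fsuppN f : fsupp f -> fsupp (fun x => - f x).
Proof. by move=> /fsupp_sub; apply=> x ->; rewrite oppr0. Qed.

Lemma fsuppB f g : fsupp f -> fsupp g -> fsupp (fun x => f x - g x).
Proof. by move=> ff fg; apply: fsuppD => //; exact: fsuppN. Qed.

Lemma fsuppX f n : fsupp f -> fsupp (fun x => f x ^+ n.+1).
Proof. by move=> /fsupp_sub; apply=> x ->; rewrite expr0n. Qed.

Lemma fsupp_norm f : fsupp f -> fsupp (fun x => `|f x|).
Proof. by move=> /fsupp_sub; apply=> x ->; rewrite normr0. Qed.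

Lemma fsupp_shift f a : fsupp f -> fsupp (fun x => f (x + a)).
Proof.
move=> [s fs]; exists [seq y - a | y <- s] => x /fs xs.
by apply/mapP; exists (x + a) => //; rewrite addrK.
Qed.

Lemma fsupp_shiftl f a : fsupp f -> fsupp (fun x => f (a + x)).
Proof. by move=> /fsupp_shift => /(_ a) [s fs]; exists s => x; rewrite addrC; exact: fs. Qed.

Lemma fsupp_shiftN f a : fsupp f -> fsupp (fun x => f (a - x)).
Proof.
move=> [s fs]; exists [seq a - y | y <- s] => x /fs xs.
by apply/mapP; exists (a - x) => //; rewrite subKr.
Qed.

Lemma fsupp_sum (I : Type) (r : seq I) (P : pred I) (F : I -> V -> R) :
  (forall i, fsupp (F i)) -> fsupp (fun x => \sum_(i <- r | P i) F i x).
Proof.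
move=> FF; elim: r => [|i r IH].
  by apply: fsupp_sub fsupp0 _ => x _; rewrite big_nil.
apply: (@fsupp_sub (fun x => F i x * (P i)%:R + \sum_(i <- r | P i) F i x)).
  by apply: fsuppD => //; exact: fsuppMl.
by move=> x; rewrite big_cons; case: (P i); rewrite ?mulr1// mulr0 add0r.
Qed.

Lemma eq_lsum f g : f =1 g -> lsum f = lsum g.
Proof. by move=> /funext ->. Qed.

Lemma lsum0 : lsum (fun=> 0) = 0.
Proof. by rewrite (@lsum_seq [::])// ?big_nil// => x; rewrite eqxx. Qed.

Lemma lsumD f g : fsupp f -> fsupp g ->
  lsum (fun x => f x + g x) = lsum f + lsum g.
Proof.
move=> ff fg; have [s [us fs gs]] := fsupp_seq2 ff fg.
rewrite (lsum_seq us fs) (lsum_seq us gs) -big_split/=; apply: lsum_seq => // x.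
have [f0|/fs ->//] := eqVneq (f x) 0; rewrite f0 add0r; exact: gs.
Qed.

Lemma lsumZ c f : lsum (fun x => c * f x) = c * lsum f.
Proof. by rewrite /lsum mulr_fsumr. Qed.

Lemma lsumZr c f : lsum (fun x => f x * c) = lsum f * c.
Proof. by rewrite /lsum mulr_fsuml. Qed.

Lemma lsumN f : lsum (fun x => - f x) = - lsum f.
Proof. by rewrite -mulN1r -lsumZ; apply: eq_lsum => x; rewrite mulN1r. Qed.

Lemma lsumB f g : fsupp f -> fsupp g ->
  lsum (fun x => f x - g x) = lsum f - lsum g.
Proof. by move=> ff fg; rewrite lsumD ?lsumN//; exact: fsuppN. Qed.

Lemma lsum_sum (I : Type) (r : seq I) (P : pred I) (F : I -> V -> R) :
  (forall i, fsupp (F i)) ->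
  lsum (fun x => \sum_(i <- r | P i) F i x) = \sum_(i <- r | P i) lsum (F i).
Proof.
move=> FF; elim: r => [|i r IH].
  by rewrite big_nil -[RHS]lsum0; apply: eq_lsum => x; rewrite big_nil.
rewrite big_cons -IH; case: ifP => Pi.
  rewrite -lsumD//; last exact: fsupp_sum.
  by apply: eq_lsum => x; rewrite big_cons Pi.
by apply: eq_lsum => x; rewrite big_cons Pi.
Qed.

Lemma lsum_shift f a : lsum (fun x => f (x + a)) = lsum f.
Proof.
rewrite /lsum [RHS](reindex_fsbigT (fun x => x + a))//.
by exists (fun x => x - a) => x; rewrite ?addrK ?subrK.
Qed.

Lemma lsum_opp f : lsum (fun x => f (- x)) = lsum f.
Proof.
by rewrite /lsum [RHS](reindex_fsbigT -%R).
Qed.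

Lemma ge0_lsum f : (forall x, 0 <= f x) -> 0 <= lsum f.
Proof. by move=> f0; apply: fsumr_ge0 => x _. Qed.

Lemma le_lsum f g : fsupp f -> fsupp g -> (forall x, f x <= g x) -> lsum f <= lsum g.
Proof.
move=> ff fg fgx; rewrite -subr_ge0 -lsumB//; apply: ge0_lsum => x.
by rewrite subr_ge0.
Qed.

Lemma ler_norm_lsum f : fsupp f -> `|lsum f| <= lsum (fun x => `|f x|).
Proof.
move=> ff; have [s us fs] := fsupp_seq ff.
rewrite (lsum_seq us fs) (lsum_seq us); first exact: ler_norm_sum.
by move=> x; rewrite normr_eq0; exact: fs.
Qed.

Lemma lsum_delta f a : lsum (fun x => (x == a)%:R * f x) = f a.
Proof.
rewrite (@lsum_seq [:: a])//; first by rewrite big_seq1 eqxx mul1r.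
by move=> x; rewrite inE; case: (x == a) => //; rewrite mul0r eqxx.
Qed.

Lemma exchange_lsum (s t : seq V) (F : V -> V -> R) :
  (forall x y, F x y != 0 -> (x \in s) && (y \in t)) ->
  lsum (fun x => lsum (F x)) = lsum (fun y => lsum (F^~ y)).
Proof.
move=> Fst; have us := undup_uniq s; have ut := undup_uniq t.
have H1 x : lsum (F x) = \sum_(y <- undup t) F x y.
  by apply: lsum_seq => // y /Fst /andP[_]; rewrite mem_undup.
have H2 y : lsum (F^~ y) = \sum_(x <- undup s) F x y.
  by apply: lsum_seq => // x /Fst /andP[+ _]; rewrite mem_undup.
under eq_lsum do rewrite H1; under [RHS]eq_lsum do rewrite H2.
rewrite (lsum_seq us); last first.
  move=> x; apply: contraR => xs; rewrite big1_seq// => y _; apply/eqP.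
  by apply: contraR xs => /Fst/andP[+ _]; rewrite mem_undup.
rewrite (lsum_seq ut); last first.
  move=> y; apply: contraR => yt; rewrite big1_seq// => x _; apply/eqP.
  by apply: contraR yt => /Fst/andP[_]; rewrite mem_undup.
exact: exchange_big.
Qed.

Lemma lsum_ge_term f a : fsupp f -> (forall x, 0 <= f x) -> f a <= lsum f.
Proof.
move=> ff f0; rewrite -(lsum_delta f a); apply: le_lsum => //; first exact: fsuppMr.
by move=> x; case: eqP; rewrite ?mul1r ?mul0r.
Qed.

Lemma lsum_CS f g : fsupp f -> fsupp g ->
  lsum (fun x => f x * g x) ^+ 2 <= lsum (fun x => f x ^+ 2) * lsum (fun x => g x ^+ 2).
Proof.
move=> ff fg.
set a := lsum (fun x => f x ^+ 2); set b := lsum _; set c := lsum (fun x => g x ^+ 2).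
have q l m : 0 <= l ^+ 2 * a + 2 * l * m * b + m ^+ 2 * c.
  have fa : fsupp (fun x => f x ^+ 2) by exact: fsuppX.
  have fc : fsupp (fun x => g x ^+ 2) by exact: fsuppX.
  have fb : fsupp (fun x => f x * g x) by exact: fsuppMl.
  rewrite -!lsumZ -lsumD; [|exact: fsuppMr|exact: fsuppMr].
  rewrite -lsumD; [|by apply: fsuppD; exact: fsuppMr|exact: fsuppMr].
  apply: ge0_lsum => x; have := sqr_ge0 (l * f x + m * g x); nra.
have a0 : 0 <= a by apply: ge0_lsum => x; exact: sqr_ge0.
have c0 : 0 <= c by apply: ge0_lsum => x; exact: sqr_ge0.
have [a00|a00] := eqVneq a 0.
  have [->|b0] := eqVneq b 0; first by rewrite a00 mul0r expr0n.
  (* For [a = 0] the form is affine in its first argument; this argument would give it the value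
     -1. *)
  have := q (- (c + 1) / (2 * b)) 1; rewrite a00 mulr0 add0r.
  have -> : 2 * (- (c + 1) / (2 * b)) * 1 * b = - (c + 1) by field.
  lra.
have {}a0 : 0 < a by rewrite lt_def a00.
have := q (- b) a; nra.
Qed.

Lemma lsum_CS_norm f g : fsupp f -> fsupp g ->
  lsum (fun x => `|f x| * `|g x|) <=
  Num.sqrt (lsum (fun x => f x ^+ 2)) * Num.sqrt (lsum (fun x => g x ^+ 2)).
Proof.
move=> ff fg; have h0 h : 0 <= lsum (fun x => h x ^+ 2).
  by apply: ge0_lsum => x; exact: sqr_ge0.
rewrite -sqrtrM// -[leLHS]ger0_norm; last first.
  by apply: ge0_lsum => x; rewrite mulr_ge0.
rewrite -sqrtr_sqr ler_wsqrtr//; have := lsum_CS (fsupp_norm ff) (fsupp_norm fg).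
by under [X in _ <= X * _]eq_lsum do rewrite real_normK ?num_real//;
   under [X in _ <= _ * X]eq_lsum do rewrite real_normK ?num_real//.
Qed.

(** The support condition bears on [g] because [f] will be the occupation field, [g] a function cut
    off by the profile. *)
Lemma lsum_by_parts f g e : fsupp g ->
  lsum (fun x => (f (x + e) + f (x - e) - 2 * f x) * g x) =
  - lsum (fun x => (f (x + e) - f x) * (g (x + e) - g x)).
Proof.
move=> fg.
have E1 : lsum (fun x => (f (x - e) - f x) * g x) =
          - lsum (fun x => (f (x + e) - f x) * g (x + e)).
  rewrite -(lsum_shift _ e) -lsumN; apply: eq_lsum => x; rewrite addrK; ring.
have -> : lsum (fun x => (f (x + e) - f x) * (g (x + e) - g x)) =
   lsum (fun x => (f (x + e) - f x) * g (x + e)) - lsum (fun x => (f (x + e) - f x) * g x).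
  rewrite -lsumB; first by apply: eq_lsum => x; ring.
  - by apply: fsuppMr; exact: fsupp_shift.
  - exact: fsuppMr.
rewrite opprB -E1 -lsumD; first by apply: eq_lsum => x; ring.
- exact: fsuppMr.
- exact: fsuppMr.
Qed.

End FiniteSums.

Ltac fsup := match goal with
  | H : fsupp ?f |- fsupp ?f => exact H
  | H : fsupp ?f |- fsupp (fun x => ?f x) => exact H
  | H : forall i, fsupp (?f i) |- fsupp (?f _) => exact: H
  | H : forall i, fsupp (?f i) |- fsupp (fun x => ?f _ x) => exact: H
  | |- fsupp (fun x => 0) => exact: fsupp0
  | |- fsupp (fun x => (nat_of_bool _)%:R) => exact: fsupp_delta
  | |- fsupp (fun x => _ + _) => apply: fsuppD; fsup
  | |- fsupp (fun x => - _) => apply: fsuppN; fsup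
  | |- fsupp (fun x => _ * _) => first [apply: fsuppMr; fsup | apply: fsuppMl; fsup]
  | |- fsupp (fun x => _ ^+ _) => apply: fsuppX; fsup
  | |- fsupp (fun x => `|_|) => apply: fsupp_norm; fsup
  | |- fsupp (fun x => \sum_(i <- _ | _) _) => apply: fsupp_sum => ?; fsup
  | |- fsupp (fun x => ?f (x + ?a)) => apply: (@fsupp_shift _ _ f a); fsup
  | |- fsupp (fun x => ?f (?a - x)) => apply: (@fsupp_shiftN _ _ f a); fsup
  | |- fsupp (fun x => ?f (?y + x)) => apply: (@fsupp_shiftl _ _ f y); fsup
  end.

(** * Simple random walks *)

Section Walk1D.
Variable R : realType.

Fixpoint srw (n : nat) (s : int) : R :=
  if n is n'.+1 then (srw n' (s - 1) + srw n' (s + 1)) / 2 else (s == 0)%:R.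

Definition dsrw (n : nat) (s : int) : R := srw n (s - 1) - srw n (s + 1).

Lemma srw_ge0 n s : 0 <= srw n s.
Proof.
elim: n s => [|n IH] s /=; first by case: (s == 0).
by rewrite divr_ge0// addr_ge0.
Qed.

Lemma srwN n s : srw n (- s) = srw n s.
Proof.
elim: n s => [|n IH] s /=; first by rewrite oppr_eq0.
by rewrite -[in LHS]opprD IH -[- s + 1]opprK opprD opprK IH addrC.
Qed.

Lemma dsrwN n s : dsrw n (- s) = - dsrw n s.
Proof.
by rewrite /dsrw -opprD srwN -[- s + 1]opprK opprD opprK srwN; ring.
Qed.

Lemma fsupp_srw n : fsupp (srw n).
Proof. by elim: n => [|n IH] /=; [exact: fsupp_delta|fsup]. Qed.

Lemma lsum_srw n : lsum (srw n) = 1.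
Proof.
have fn := fsupp_srw; elim: n => [|n IH].
  by rewrite -[RHS](lsum_delta (fun=> 1) (0 : int)); apply: eq_lsum => x; rewrite mulr1.
rewrite [LHS]lsumZr lsumD; [|by fsup|by fsup].
by rewrite !lsum_shift IH; field.
Qed.

Lemma srw_le1 n s : srw n s <= 1.
Proof. by rewrite -(lsum_srw n); apply: lsum_ge_term; [exact: fsupp_srw|exact: srw_ge0]. Qed.

Lemma srw_parity n s : odd (n + `|s|)%N -> srw n s = 0.
Proof.
elim: n s => [|n IH] s /= h.
  by case: eqP h => // ->.
by rewrite !IH ?addr0 ?mul0r//; lia.
Qed.

(** [srw n s] is [2^-n] times a binomial coefficient with lower index [(n + s) / 2]. This is the
    ratio of consecutive coefficients cleared of denominators, a form that holds for every [s] and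
    passes through the induction on [n]. *)
Lemma srw_ratio n s :
  (n%:R - s%:~R : R) * srw n s = (n%:R + s%:~R + 2 : R) * srw n (s + 2).
Proof.
elim: n s => [|n IH] s.
  rewrite /=; have [->|s0] := eqVneq s 0; first by rewrite subrr mul0r mulr0.
  have [s2|s2] := eqVneq (s + 2) 0; rewrite ?mulr0//.
  have -> : s = - 2 by lia.
  by rewrite add0r rmorphN addNr mul0r.
rewrite /=; have := IH (s - 1); have := IH (s + 1).
have -> : s - 1 + 2 = s + 1 by ring.
have -> : s + 2 - 1 = s + 1 by ring.
have -> : s + 1 + 2 = s + 2 + 1 by ring.
rewrite !rmorphD !rmorphN /= -[n.+1%:R]natr1 => h1 h2.
have {}h1 : (n%:R - (s%:~R + 1)) * srw n (s + 1) = (n%:R + (s%:~R + 1) + 2) * srw n (s + 2 + 1) by exact: h1.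
have {}h2 : (n%:R - (s%:~R - 1)) * srw n (s - 1) = (n%:R + (s%:~R - 1) + 2) * srw n (s + 1) by exact: h2.
apply/eqP; rewrite -subr_eq0; apply/eqP; move: h1 h2.
move: (s%:~R) (n%:R) => S N h1 h2.
apply: (@mulfI _ 2) => //; rewrite mulr0.
have -> : 2 * ((N + 1 - S) * ((srw n (s - 1) + srw n (s + 1)) / 2) -
  (N + 1 + S + 2) * ((srw n (s + 1) + srw n (s + 2 + 1)) / 2)) =
  (N - (S - 1)) * srw n (s - 1) + (N - S + 1) * srw n (s + 1)
  - (N + S + 3) * srw n (s + 1) - (N + (S + 1) + 2) * srw n (s + 2 + 1) by field.
rewrite -h1 h2; ring.
Qed.

(** Unimodality along a parity class. Starting at -1 lets the induction close: there both sides
    agree by symmetry, and otherwise [k - 1] is again at least -1. *)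
Lemma srw_decr n (k : int) : -1 <= k -> srw n (k + 2) <= srw n k.
Proof.
elim: n k => [|n IH] k hk.
  rewrite /=; case: (eqVneq k 0) => [->//|k0]; case: (eqVneq (k + 2) 0) => [|//]; lia.
have [->|k1] := eqVneq k (-1); first by rewrite -[in leRHS]srwN.
rewrite /= ler_pM2r// lerD//.
  have -> : k + 2 - 1 = (k - 1) + 2 by ring.
  apply: IH; lia.
have -> : k + 2 + 1 = (k + 1) + 2 by ring.
apply: IH; lia.
Qed.

(** The central binomial probability [binom (2m) m / 4^m]; its square is the return probability of
    the planar walk, see [srw2_even0]. *)
Definition wallis (m : nat) : R := srw m.*2 0.

Lemma wallis_srw2 m : srw m.*2 2 = wallis m * (m%:R / m.+1%:R).
Proof.
have := srw_ratio m.*2 0; rewrite -/(wallis m) mulr0z subr0 addr0 -[in _%:R]muln2 natrM add0r => h.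
have m0 : m.+1%:R != 0 :> R by rewrite pnatr_eq0.
apply: (@mulfI _ (2 * m.+1%:R)); first by rewrite mulf_neq0.
have -> : 2 * m.+1%:R * srw m.*2 2 = (m%:R * 2 + 2) * srw m.*2 2 by rewrite -natr1; ring.
by rewrite -h; field.
Qed.

Lemma wallisS m : wallis m.+1 = wallis m * ((m.*2.+1)%:R / (m.*2.+2)%:R).
Proof.
rewrite /wallis doubleS /=.
have -> : srw m.*2 (0 - 1 - 1) = srw m.*2 2 by rewrite -[RHS]srwN.
have -> : 0 - 1 + 1 = 0 :> int by [].
have -> : 0 + 1 - 1 = 0 :> int by [].
have -> : 0 + 1 + 1 = 2 :> int by [].
rewrite wallis_srw2 /wallis -[m.*2.+2%:R]natr1 -[m.*2.+1%:R]natr1 -[m.+1%:R]natr1.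
rewrite -[in m.*2%:R]muln2 natrM.
have m0 : m%:R + 1 != 0 :> R by rewrite natr1 pnatr_eq0.
have m1 : m%:R * 2 + 1 + 1 != 0 :> R.
  by have -> : m%:R * 2 + 1 + 1 = (m%:R + 1) * 2 :> R by ring; rewrite mulf_neq0.
by field; apply/andP.
Qed.

Lemma wallis_gt0 m : 0 < wallis m.
Proof.
elim: m => [|m IH]; first by rewrite /wallis /= ltr01.
by rewrite wallisS mulr_gt0// divr_gt0// ltr0n.
Qed.

(** The left side is nonincreasing in [m] because [(2m+1) (2m+3) <= (2m+2)^2]. This crude form of
    the decay serves wherever the constant is irrelevant. *)
Lemma wallis_sqr_le m : wallis m ^+ 2 * (m.*2.+1)%:R <= 1.
Proof.
elim: m => [|m IH]; first by rewrite /wallis /= expr1n mulr1.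
apply: le_trans IH; rewrite wallisS exprMn -mulrA ler_wpM2l ?sqr_ge0//.
rewrite doubleS -[(m.*2.+3)%:R]natr1 -[(m.*2.+2)%:R]natr1 expr_div_n mulrAC.
have : 0 <= m.*2.+1%:R :> R by [].
move: (m.*2.+1%:R) => x x0; rewrite ler_pdivrMr; last by rewrite exprn_gt0//; lra.
nra.
Qed.

Lemma srw_le_wallis m s : srw m.*2 s <= wallis m.
Proof.
wlog s0 : s / 0 <= s.
  move=> H; have [/H//|s0] := leP 0 s; rewrite -srwN; apply: H; lia.
have [s2|s2] := boolP (odd `|s|); first by rewrite srw_parity ?wallis_gt0 ?ltW ?wallis_gt0//; lia.
have [k ->] : exists k : nat, s = (k.*2)%:Z by exists (`|s|./2)%N; lia.
elim: k => // k IH; apply: le_trans IH.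
have -> : (k.+1.*2)%:Z = k.*2%:Z + 2 by lia.
by apply: srw_decr; lia.
Qed.

Lemma srw_odd_le_wallis m s : srw m.*2.+1 s <= wallis m.
Proof. by rewrite /=; have := srw_le_wallis m (s - 1); have := srw_le_wallis m (s + 1); lra. Qed.

Lemma dsrw_ge0 n s : 0 <= s -> 0 <= dsrw n s.
Proof.
move=> s0; rewrite /dsrw subr_ge0; have -> : s + 1 = s - 1 + 2 by ring.
apply: srw_decr; lia.
Qed.

Lemma fsupp_dsrw n : fsupp (dsrw n).
Proof. by have := fsupp_srw n => fn; rewrite /dsrw; fsup. Qed.

Lemma dsrwS n s : dsrw n.+1 s = (dsrw n (s - 1) + dsrw n (s + 1)) / 2.
Proof.
rewrite /dsrw /=; have -> : s + 1 - 1 = s - 1 + 1 by ring.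
ring.
Qed.

Lemma srw_support n (s : int) : srw n s != 0 -> (`|s| <= n)%N.
Proof.
elim: n s => [|n IH] s /=; first by have [->|_] := eqVneq s 0; rewrite ?eqxx.
move=> h; have : (srw n (s - 1) != 0) || (srw n (s + 1) != 0).
  by rewrite -negb_and; apply: contra h => /andP[/eqP -> /eqP ->]; rewrite addr0 mul0r.
by move=> /orP[] /IH; lia.
Qed.

(** [dsrw n] is odd, and nonnegative on the right half-line, where its sum telescopes to the two
    central values. *)
Lemma lsum_dsrw n : lsum (fun s => `|dsrw n s|) <= 2 * (srw n 0 + srw n 1).
Proof.
pose K := n.+2.
have tel k : \sum_(i < k) dsrw n i.+1%:Z = srw n 0 + srw n 1 - srw n k%:Z - srw n k.+1%:Z.
  elim: k => [|k IH]; first by rewrite big_ord0; ring.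
  rewrite big_ord_recr/= IH /dsrw.
  have -> : k.+1%:Z - 1 = k%:Z by lia.
  have -> : k.+1%:Z + 1 = k.+2%:Z by lia.
  ring.
have H0 i : (K <= i)%N -> srw n i%:Z = 0.
  by move=> Ki; apply/eqP; apply: contraTT Ki => /srw_support; rewrite /K; lia.
pose s := 0 :: [seq i.+1%:Z | i <- iota 0 K] ++ [seq - i.+1%:Z | i <- iota 0 K] : seq int.
rewrite (@lsum_seq _ _ s).
- rewrite big_cons big_cat !big_map -!/(index_iota 0 K) !big_mkord.
  have -> : dsrw n 0 = 0 by have := dsrwN n 0; rewrite oppr0; lra.
  rewrite normr0 add0r.
  have E1 : \sum_(i < K) `|dsrw n i.+1%:Z| = \sum_(i < K) dsrw n i.+1%:Z.
    by apply: eq_bigr => i _; rewrite ger0_norm ?dsrw_ge0.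
  have E2 : \sum_(i < K) `|dsrw n (- i.+1%:Z)| = \sum_(i < K) dsrw n i.+1%:Z.
    by rewrite -E1; apply: eq_bigr => i _; rewrite dsrwN normrN.
  rewrite E1 E2.
  rewrite tel /=; have := srw_ge0 n K%:Z; have := srw_ge0 n K.+1%:Z; lra.
- rewrite /s cons_uniq cat_uniq !map_inj_uniq ?iota_uniq ?andbT; [|by move=> i j /oppr_inj []|by move=> i j []].
  apply/andP; split.
    rewrite mem_cat; apply/negP => /orP[] /mapP[i _]; lia.
  by apply/hasPn => x /mapP[i _ ->]; apply/negP => /mapP[j _]; lia.
- move=> x; rewrite normr_eq0 /dsrw => h.
  have : (srw n (x - 1) != 0) || (srw n (x + 1) != 0).
    by rewrite -negb_and; apply: contra h => /andP[/eqP -> /eqP ->]; rewrite subr0.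
  move=> h'; have {h'} xn : (`|x| <= n.+1)%N by case/orP: h' => /srw_support; lia.
  rewrite /s inE mem_cat.
  have [->//|x0] := eqVneq x 0; rewrite orFb.
  have [xp|xm] := leP 0 x; apply/orP; [left|right]; apply/mapP; exists (`|x|.-1)%N;
    rewrite ?mem_iota /K; lia.
Qed.

(** At even times the difference is [wallis m / m.+1], at odd times it vanishes by parity, so the
    sum is dominated by that of the inverse squares. The constant 2 matters: it gives
    [quadsum M e0 <= 1], which keeps a denominator of the corrector away from 0. *)
Lemma dsrw1_sum M : \sum_(i < M.*2) dsrw i 1 ^+ 2 <= 2.
Proof.
have E m : dsrw m.*2 1 ^+ 2 + dsrw m.*2.+1 1 ^+ 2 <= (m.+1%:R ^+ 2)^-1.
  have -> : dsrw m.*2.+1 1 = 0.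
    by rewrite /dsrw !srw_parity ?subrr//; lia.
  rewrite /dsrw subrr [srw _ (1 + 1)]wallis_srw2 -/(wallis m) expr0n addr0.
  have m0 : m.+1%:R != 0 :> R by rewrite pnatr_eq0.
  have -> : wallis m - wallis m * (m%:R / m.+1%:R) = wallis m / m.+1%:R.
    rewrite -natr1; rewrite -natr1 in m0; by field.
  rewrite expr_div_n ler_pdivrMr ?exprn_gt0// mulVf ?expf_neq0//.
  by rewrite expr_le1 ?(ltW (wallis_gt0 m)) ?srw_le1.
(* Strengthened for the induction by [1 / (m+1)^2 <= 1 / m - 1 / (m+1)]. For [M = 0] the inverse is
   0 by default. *)
suff : \sum_(i < M.*2) dsrw i 1 ^+ 2 <= 2 - (M%:R)^-1.
  by move=> h; apply: le_trans h _; rewrite lerBlDr lerDl invr_ge0.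
case: M => [|M]; first by rewrite big_ord0 invr0; lra.
elim: M => [|M IH].
  by rewrite !big_ord_recr big_ord0 /= add0r; apply: le_trans (E 0) _; rewrite expr1n invr1; lra.
rewrite doubleS big_ord_recr big_ord_recr/= -addrA.
apply: le_trans (lerD IH (E M.+1)) _.
have m1 : M.+1%:R != 0 :> R by rewrite pnatr_eq0.
have : 0 < M.+1%:R :> R by rewrite ltr0n.
rewrite -[in M.+2%:R]natr1; move: (M.+1%:R) m1 => x x0 xp.
rewrite -subr_ge0.
have -> : 2 - (x + 1)^-1 - (2 - x^-1 + ((x + 1) ^+ 2)^-1) = (x * (x + 1) ^+ 2)^-1.
  by field; apply/andP; split; lra.
by rewrite invr_ge0 mulr_ge0// ?sqr_ge0// ltW.
Qed.

End Walk1D.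

Notation e0 := (unit_vector ord0).
Notation e1 := (unit_vector ord_max).
Notation c0 x := ((x : site) ord0 ord0).
Notation c1 x := ((x : site) ord0 ord_max).

(** * The planar walk and its Green function *)

Section Walk2D.
Variable R : realType.
Implicit Types (f g A B : site -> R).

Definition nbsum f (x : site) : R := \sum_(j < 2) (f (x + unit_vector j) + f (x - unit_vector j)).
Definition lap f (x : site) : R := \sum_(j < 2) (f (x + unit_vector j) + f (x - unit_vector j) - 2 * f x).

Lemma sum2 (F : 'I_2 -> R) : \sum_(j < 2) F j = F ord0 + F ord_max.
Proof. by rewrite big_ord_recr big_ord1 /=; congr (F _ + F _); apply: val_inj. Qed.

Lemma nbsumE f x : nbsum f x = f (x + e0) + f (x - e0) + f (x + e1) + f (x - e1).
Proof. by rewrite /nbsum sum2 addrA. Qed.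

Lemma lapE f x : lap f x = nbsum f x - 4 * f x.
Proof. by rewrite /lap nbsumE sum2; ring. Qed.

Lemma e00 : c0 e0 = 1. Proof. by rewrite /unit_vector mxE. Qed.
Lemma e01 : c1 e0 = 0. Proof. by rewrite /unit_vector mxE. Qed.
Lemma e10 : c0 e1 = 0. Proof. by rewrite /unit_vector mxE. Qed.
Lemma e11 : c1 e1 = 1. Proof. by rewrite /unit_vector mxE. Qed.

Lemma site_eq (x y : site) : c0 x = c0 y -> c1 x = c1 y -> x = y.
Proof.
move=> h0 h1; apply/matrixP => i j; rewrite ord1.
have : j \in [:: ord0; ord_max] by case: j => [[|[|[]]]] //= *; rewrite !inE.
by rewrite !inE => /orP[]/eqP ->.
Qed.

Lemma site_eqE (x y : site) : (x == y) = (c0 x == c0 y) && (c1 x == c1 y).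
Proof.
apply/eqP/andP => [->//|[/eqP h0 /eqP h1]]; exact: site_eq.
Qed.

Lemma coordE (x : site) :
  ((c0 (x + e0) = c0 x + 1) * (c1 (x + e0) = c1 x) * (c0 (x - e0) = c0 x - 1) * (c1 (x - e0) = c1 x)) *
  ((c0 (x + e1) = c0 x) * (c1 (x + e1) = c1 x + 1) * (c0 (x - e1) = c0 x) * (c1 (x - e1) = c1 x - 1)).
Proof.
have mD (u v : site) i j : (u + v) i j = u i j + v i j by rewrite mxE.
have mN (u : site) i j : (- u) i j = - u i j by rewrite mxE.
by do !split; rewrite mD ?mN ?e00 ?e01 ?e10 ?e11 ?oppr0 ?addr0.
Qed.

(* In the coordinates x1 + x2 and x1 - x2 the planar walk is a pair of
   independent one-dimensional walks. *)
Definition rot (a b : int -> R) (x : site) : R := a (c0 x + c1 x) * b (c0 x - c1 x).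

Lemma nbsum_rot a b x :
  nbsum (rot a b) x = rot (fun s => a (s - 1) + a (s + 1)) (fun s => b (s - 1) + b (s + 1)) x.
Proof.
rewrite nbsumE /rot !coordE.
set s := c0 x; set t := c1 x.
have -> : s + 1 + t = s + t + 1 by ring.
have -> : s + 1 - t = s - t + 1 by ring.
have -> : s - 1 + t = s + t - 1 by ring.
have -> : s - 1 - t = s - t - 1 by ring.
have -> : s + (t + 1) = s + t + 1 by ring.
have -> : s + (t - 1) = s + t - 1 by ring.
have -> : s - (t + 1) = s - t - 1 by ring.
have -> : s - (t - 1) = s - t + 1 by ring.
ring.
Qed.

Lemma fsupp_rot a b : fsupp a -> fsupp b -> fsupp (rot a b).
Proof.
move=> [s sa] [t tb].
pose mk (p : int * int) : site := \row_j (if j == ord0 then ((p.1 + p.2) %/ 2)%Z else ((p.1 - p.2) %/ 2)%Z).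
exists [seq mk p | p <- allpairs pair s t] => x.
rewrite mulf_eq0 negb_or => /andP[/sa xs /tb xt].
apply/mapP; exists (c0 x + c1 x, c0 x - c1 x); first by apply/allpairsP; exists (c0 x + c1 x, c0 x - c1 x).
by apply: site_eq; rewrite /mk !mxE /=; lia.
Qed.

(** Only an inequality: the sum and the difference of the coordinates of a site have the same
    parity, so the rotated sites fill half of the product lattice. *)
Lemma lsum_rot_le a b : fsupp a -> fsupp b -> (forall s, 0 <= a s) -> (forall s, 0 <= b s) ->
  lsum (rot a b) <= lsum a * lsum b.
Proof.
move=> fa fb a0 b0.
have [r ur rs] := fsupp_seq (fsupp_rot fa fb).
have [s us sa] := fsupp_seq fa; have [t ut tb] := fsupp_seq fb.
rewrite (lsum_seq ur rs) (lsum_seq us sa) (lsum_seq ut tb).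
have -> : (\sum_(x <- s) a x) * (\sum_(y <- t) b y) = \sum_(p <- allpairs pair s t) a p.1 * b p.2.
  by rewrite big_allpairs_dep big_distrlr.
pose h (x : site) := (c0 x + c1 x, c0 x - c1 x).
have hi : injective h.
  by move=> x y [h1 h2]; apply: site_eq; lia.
have -> : \sum_(i <- r) rot a b i = \sum_(p <- map h r) a p.1 * b p.2 by rewrite big_map.
rewrite (bigID (mem (allpairs pair s t))) /= [X in _ + X]big1 ?addr0; last first.
  move=> [p q]; apply: contraNeq; rewrite mulf_eq0 negb_or => /andP[/sa ? /tb ?].
  by apply/allpairsP; exists (p, q).
rewrite -big_filter [X in _ <= X](bigID (mem (map h r))) /= -[X in _ <= X + _]big_filter.
rewrite [X in _ <= X + _](perm_big [seq p <- map h r | p \in allpairs pair s t]).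
  by rewrite lerDl sumr_ge0// => p _; rewrite mulr_ge0.
apply: uniq_perm.
- by rewrite filter_uniq// allpairs_uniq// => -[? ?] [? ?].
- by rewrite filter_uniq// map_inj_uniq.
- by move=> p; rewrite !mem_filter andbC.
Qed.

Definition srw2 (n : nat) : site -> R := rot (srw R n) (srw R n).
(** Heat evolution of a quadrupole: at time 0 it is half the sum of the point masses at the two
    horizontal neighbours of the origin minus the same for the vertical ones ([quad20]). It
    separates the two directions in the corrector. *)
Definition quad2 (n : nat) (x : site) : R := rot (dsrw R n) (dsrw R n) x / 2.

Lemma fsupp_srw2 n : fsupp (srw2 n).
Proof. by apply: fsupp_rot; exact: fsupp_srw. Qed.

Lemma fsupp_quad2 n : fsupp (quad2 n).
Proof. by apply: fsuppMl; apply: fsupp_rot; exact: fsupp_dsrw. Qed.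

Lemma srw2_ge0 n x : 0 <= srw2 n x.
Proof. by rewrite mulr_ge0// srw_ge0. Qed.

Lemma srw2S n x : srw2 n.+1 x = nbsum (srw2 n) x / 4.
Proof. by rewrite nbsum_rot /srw2 /rot /=; field. Qed.

Lemma quad2S n x : quad2 n.+1 x = nbsum (quad2 n) x / 4.
Proof.
have -> : nbsum (quad2 n) x = nbsum (rot (dsrw R n) (dsrw R n)) x / 2.
  by rewrite !nbsumE /quad2; field.
by rewrite nbsum_rot /quad2 /rot !dsrwS; field.
Qed.

Lemma srw20 x : srw2 0 x = (x == 0)%:R.
Proof.
rewrite /srw2 /rot /= -natrM mulnb; congr ((_ : bool)%:R).
by rewrite site_eqE !mxE; apply/andP/andP => -[/eqP h0 /eqP h1]; split; lia.
Qed.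

Lemma quad20 x : quad2 0 x = ((x == e0)%:R + (x == - e0)%:R - (x == e1)%:R - (x == - e1)%:R) / 2.
Proof.
rewrite /quad2 /rot /dsrw /= !site_eqE !mxE /= !oppr0.
set s := c0 x; set t := c1 x.
have andR (p q : bool) : (p%:R * q%:R : R) = (p && q)%:R by rewrite -natrM mulnb.
have E1 : (s + t - 1 == 0) && (s - t - 1 == 0) = (s == 1) && (t == 0) by lia.
have E2 : (s + t - 1 == 0) && (s - t + 1 == 0) = (s == 0) && (t == 1) by lia.
have E3 : (s + t + 1 == 0) && (s - t - 1 == 0) = (s == 0) && (t == -1) by lia.
have E4 : (s + t + 1 == 0) && (s - t + 1 == 0) = (s == -1) && (t == 0) by lia.
rewrite -E1 -E2 -E3 -E4 -!andR; ring.
Qed.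

Lemma lsum_nbsum f : fsupp f -> lsum (nbsum f) = 4 * lsum f.
Proof.
move=> ff; rewrite (eq_lsum (nbsumE f)) !lsumD; try fsup.
by rewrite !lsum_shift; ring.
Qed.

Lemma lsum_srw2 n : lsum (srw2 n) = 1.
Proof.
elim: n => [|n IH].
  rewrite (eq_lsum srw20) -[RHS](lsum_delta (fun=> 1) (0 : site)).
  by apply: eq_lsum => x; rewrite mulr1.
have := fsupp_srw2 n => fn.
by rewrite (eq_lsum (srw2S n)) lsumZr lsum_nbsum// IH; field.
Qed.

Lemma srw2_le1 n x : srw2 n x <= 1.
Proof. by rewrite -(lsum_srw2 n); apply: lsum_ge_term; [exact: fsupp_srw2|exact: srw2_ge0]. Qed.

Lemma srw2N n x : srw2 n (- x) = srw2 n x.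
Proof.
rewrite /srw2 /rot !mxE -opprD srwN; congr (_ * _).
by rewrite -[RHS]srwN; congr srw; ring.
Qed.

Lemma quad2N n x : quad2 n (- x) = quad2 n x.
Proof.
rewrite /quad2 /rot !mxE -opprD dsrwN.
have -> : - c0 x - - c1 x = - (c0 x - c1 x) by ring.
by rewrite dsrwN mulrNN.
Qed.

Lemma srw2_CK m k y : srw2 (m + k) y = lsum (fun z => srw2 m z * srw2 k (y - z)).
Proof.
have fn := fsupp_srw2.
elim: m y => [|m IH] y.
  rewrite add0n; have := lsum_delta (fun z => srw2 k (y - z)) (0 : site).
  by rewrite subr0 => <-; apply: eq_lsum => z; rewrite srw20.
rewrite addSn srw2S nbsumE !IH.
under [RHS]eq_lsum => z do rewrite srw2S nbsumE.
have S (v : site) : lsum (fun z => srw2 m (z + v) * srw2 k (y - z)) = lsum (fun z => srw2 m z * srw2 k (y + v - z)).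
  rewrite -[RHS](lsum_shift _ v); apply: eq_lsum => z.
  by congr (_ * srw2 _ _); rewrite opprD addrACA subrr addr0.
have -> : (fun z => (srw2 m (z + e0) + srw2 m (z - e0) + srw2 m (z + e1) + srw2 m (z - e1)) / 4 * srw2 k (y - z)) =
   (fun z => (srw2 m (z + e0) * srw2 k (y - z) + srw2 m (z - e0) * srw2 k (y - z) + srw2 m (z + e1) * srw2 k (y - z) + srw2 m (z - e1) * srw2 k (y - z)) / 4).
  by apply/funext => z; field.
have fm v : fsupp (fun z => srw2 m (z + v) * srw2 k (y - z)) by have := fn m => fm; fsup.
rewrite lsumZr !lsumD ?S//; repeat apply: fsuppD => //.
Qed.

Lemma srw2_le m x : srw2 m.*2 x <= wallis R m ^+ 2 /\ srw2 m.*2.+1 x <= wallis R m ^+ 2.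
Proof.
by split; rewrite /srw2 /rot expr2 ler_pM ?srw_ge0 ?srw_le_wallis ?srw_odd_le_wallis.
Qed.

(** The alternative is there because the inverse of 0 is 0, which does not bound the kernel at time
    0. *)
Lemma srw2_le_inv n x : srw2 n x <= (n%:R)^-1 \/ n = 0%N.
Proof.
case: n => [|n]; [by right|left].
have [m [hn hm]] : exists m, (n.+1 = m.*2 \/ n.+1 = m.*2.+1) /\ (n.+1 <= m.*2.+1)%N.
  by exists (n.+1)./2; split; [case: (boolP (odd n.+1)) => _; lia|lia].
have h : srw2 n.+1 x <= wallis R m ^+ 2.
  by have [h1 h2] := srw2_le m x; case: hn => ->.
apply: le_trans h _; have := wallis_sqr_le R m => h.
have m0 : 0 < (m.*2.+1)%:R :> R by rewrite ltr0n.
apply: (@le_trans _ _ (m.*2.+1%:R)^-1); first by rewrite -[leRHS]mul1r ler_pdivlMr.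
by rewrite lef_pV2 ?posrE ?ltr0n// ler_nat.
Qed.

(** By parity only one of two consecutive times can reach [x], so the pair costs no more than one
    return to the origin. Summation puts the maximum of the Green function at 0. *)
Lemma srw2_pair m x : srw2 m.*2 x + srw2 m.*2.+1 x <= wallis R m ^+ 2.
Proof.
have [h1 h2] := srw2_le m x.
have [p|p] := boolP (odd `|(c0 x + c1 x)%R|).
  suff -> : srw2 m.*2 x = 0 by rewrite add0r.
  by rewrite /srw2 /rot srw_parity ?mul0r//; lia.
suff -> : srw2 m.*2.+1 x = 0 by rewrite addr0.
by rewrite /srw2 /rot srw_parity ?mul0r//; lia.
Qed.

Lemma srw2_even0 m : srw2 m.*2 0 = wallis R m ^+ 2.
Proof. by rewrite /srw2 /rot !mxE !addr0 expr2. Qed.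

Lemma srw2_odd0 m : srw2 m.*2.+1 0 = 0.
Proof. by rewrite /srw2 /rot !mxE !addr0 srw_parity ?mul0r//; lia. Qed.

Lemma sum_double (F : nat -> R) M : \sum_(i < M.*2) F i = \sum_(m < M) (F m.*2 + F m.*2.+1).
Proof.
elim: M => [|M IH]; first by rewrite !big_ord0.
by rewrite doubleS big_ord_recr big_ord_recr /= IH [RHS]big_ord_recr /= addrA.
Qed.

(** The number of times is even so that they can be grouped in pairs [2m], [2m+1] as in
    [srw2_pair]. *)
Definition green (M : nat) (x : site) : R := \sum_(i < M.*2) srw2 i x.

Lemma green0 M : green M 0 = \sum_(m < M) wallis R m ^+ 2.
Proof.
rewrite /green (sum_double (fun i => srw2 i 0)); apply: eq_bigr => m _.
by rewrite srw2_even0 srw2_odd0 addr0.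
Qed.

Lemma green_le M x : green M x <= green M 0.
Proof.
rewrite green0 /green (sum_double (fun i => srw2 i x)); apply: ler_sum => m _.
exact: srw2_pair.
Qed.

Lemma green_ge0 M x : 0 <= green M x.
Proof. by apply: sumr_ge0 => i _; exact: srw2_ge0. Qed.

Lemma fsupp_green M : fsupp (green M).
Proof. by apply: fsupp_sum => i; exact: fsupp_srw2. Qed.

Lemma lsum_green M : lsum (green M) = M.*2%:R.
Proof.
rewrite lsum_sum; last by move=> i; exact: fsupp_srw2.
under eq_bigr do rewrite lsum_srw2.
by rewrite sumr_const card_ord.
Qed.

(** Under the heat recursion the Laplacian of the [i]-th term is [4 (F i.+1 - F i)], and the sum
    telescopes. *)
Lemma lap_sum n (F : nat -> site -> R) x : (forall i y, F i.+1 y = nbsum (F i) y / 4) ->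
  lap (fun y => \sum_(i < n) F i y) x = 4 * (F n x - F 0 x).
Proof.
move=> FS; rewrite lapE; elim: n => [|n IH].
  by rewrite nbsumE !big_ord0 subrr; ring.
have -> : nbsum (fun y => \sum_(i < n.+1) F i y) x = nbsum (fun y => \sum_(i < n) F i y) x + nbsum (F n) x.
  by rewrite !nbsumE !big_ord_recr /=; ring.
have -> : nbsum (F n) x = 4 * F n.+1 x by rewrite FS; field.
rewrite big_ord_recr /=; move: IH; lra.
Qed.

Lemma lap_green M x : lap (green M) x = 4 * (srw2 M.*2 x - (x == 0)%:R).
Proof. by rewrite -srw20; apply: lap_sum => i y; exact: srw2S. Qed.

End Walk2D.

(** * The two-point corrector *)

Section Corrector.
Variable R : realType.
Implicit Types (g : site -> R).

Definition nbrk (j : 'I_2) (z : site) : R :=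
  ((z == unit_vector j)%:R + (z == - unit_vector j)%:R) / 2.

(* To leading order the exclusion generator maps bil g v v to
   bil (pair_kernel g) v v (see sum_dQ); the last summand of the kernel comes
   from the exchanges of the two particles themselves. *)
Definition pair_kernel g (z : site) : R :=
  2 * lap g z + \sum_(j < 2) (g 0 - g (unit_vector j)) * (4 * (z == 0)%:R - 4 * nbrk j z).

Definition quadsum (M : nat) (x : site) : R := \sum_(i < M.*2) quad2 R i x.

Lemma fsupp_quadsum M : fsupp (quadsum M).
Proof. by apply: fsupp_sum => i; exact: fsupp_quad2. Qed.

Lemma greenN M x : green R M (- x) = green R M x.
Proof. by apply: eq_bigr => i _; rewrite srw2N. Qed.

Lemma quadsumN M x : quadsum M (- x) = quadsum M x.
Proof. by apply: eq_bigr => i _; rewrite quad2N. Qed.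

Lemma quad20E x : quad2 R 0 x = nbrk ord0 x - nbrk ord_max x.
Proof. by rewrite quad20 /nbrk; field. Qed.

(** By the symmetries of the lattice the four neighbours of the origin carry the same value, which
    the Laplacian at 0 determines. *)
Lemma green_unit M j : green R M (unit_vector j) = green R M 0 - 1 + wallis R M ^+ 2.
Proof.
have swap : green R M e1 = green R M e0.
  apply: eq_bigr => i _; rewrite /srw2 /rot e00 e01 e10 e11 !add0r !addr0.
  by rewrite srwN.
have -> : green R M (unit_vector j) = green R M e0.
  by case: (unliftP ord0 j) => [k ->|->//]; rewrite ord1 -swap; congr (green R M (unit_vector _)); apply: val_inj.
have := lap_green R M 0; rewrite lapE nbsumE !add0r !greenN swap srw2_even0 eqxx /=; lra.
Qed.

Lemma quad2_0 i : quad2 R i 0 = 0.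
Proof.
have d0 n : dsrw R n 0 = 0 by have := dsrwN R n 0; rewrite oppr0; lra.
by rewrite /quad2 /rot !mxE !addr0 d0 !mul0r.
Qed.

Lemma quadsum0 M : quadsum M 0 = 0.
Proof. by rewrite /quadsum big1// => i _; exact: quad2_0. Qed.

Lemma quad2_e0 i : quad2 R i e0 = dsrw R i 1 ^+ 2 / 2.
Proof. by rewrite /quad2 /rot e00 e01 !addr0 expr2. Qed.

Lemma quad2_e1 i : quad2 R i e1 = - (dsrw R i 1 ^+ 2 / 2).
Proof. by rewrite /quad2 /rot e10 e11 add0r sub0r dsrwN mulrN expr2 mulNr. Qed.

Lemma quadsum_e0 M : 0 <= quadsum M e0 <= 1.
Proof.
apply/andP; split.
  by apply: sumr_ge0 => i _; rewrite quad2_e0 divr_ge0// sqr_ge0.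
rewrite /quadsum; under eq_bigr do rewrite quad2_e0.
by rewrite -mulr_suml; have := dsrw1_sum R M; lra.
Qed.

Lemma quadsum_e1 M : quadsum M e1 = - quadsum M e0.
Proof.
by rewrite /quadsum -sumrN; apply: eq_bigr => i _; rewrite quad2_e0 quad2_e1.
Qed.

Lemma lap_quadsum M x : lap (quadsum M) x = 4 * (quad2 R M.*2 x - (nbrk ord0 x - nbrk ord_max x)).
Proof. by rewrite -quad20E; apply: lap_sum => i y; exact: quad2S. Qed.

(** Each of the two difference factors has l1 norm at most [2 wallis], so the quadrupole fades out
    in l1 as [M] grows, whereas [srw2] keeps mass 1. *)
Lemma lsum_quad2 M : lsum (fun x => `|quad2 R M.*2 x|) <= 2 * wallis R M ^+ 2.
Proof.
pose a s := `|dsrw R M.*2 s|.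
have fa : fsupp a by apply: fsupp_norm; exact: fsupp_dsrw.
have -> : (fun x => `|quad2 R M.*2 x|) = (fun x => rot a a x / 2).
  apply/funext => x; rewrite /quad2 normrM normfV (ger0_norm (_ : 0 <= 2))//.
  by rewrite /rot normrM.
rewrite lsumZr; have := lsum_rot_le fa fa (fun=> normr_ge0 _) (fun=> normr_ge0 _).
have : lsum a <= 2 * wallis R M.
  apply: le_trans (lsum_dsrw R _) _; rewrite -/(wallis R M).
  by rewrite [srw R _ 1]srw_parity ?addr0//; lia.
have : 0 <= lsum a by apply: ge0_lsum => s; exact: normr_ge0.
nra.
Qed.

Lemma fsupp_nbrk j : fsupp (nbrk j).
Proof. by rewrite /nbrk; fsup. Qed.

Lemma lsum_nbrk j : lsum (nbrk j) = 1.
Proof.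
have L (a : site) : lsum (fun x => (x == a)%:R) = 1 :> R.
  by rewrite -[RHS](lsum_delta (fun=> 1) a); apply: eq_lsum => x; rewrite mulr1.
by rewrite lsumZr lsumD ?L; [field|fsup|fsup].
Qed.

Lemma nbrk_ge0 j z : 0 <= nbrk j z.
Proof. by rewrite divr_ge0// addr_ge0. Qed.

Lemma pair_kernel_green M z : pair_kernel (green R M) z =
  8 * srw2 R M.*2 z - 8 * wallis R M ^+ 2 * (z == 0)%:R
  - 4 * (1 - wallis R M ^+ 2) * (nbrk ord0 z + nbrk ord_max z).
Proof. by rewrite /pair_kernel sum2 lap_green !green_unit; ring. Qed.

Lemma pair_kernel_quadsum M z : pair_kernel (quadsum M) z =
  8 * quad2 R M.*2 z - (8 - 4 * quadsum M e0) * (nbrk ord0 z - nbrk ord_max z).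
Proof. by rewrite /pair_kernel sum2 lap_quadsum quadsum0 quadsum_e1; ring. Qed.

Lemma pair_kernel_lin g g' a b z :
  pair_kernel (fun x => a * g x + b * g' x) z = a * pair_kernel g z + b * pair_kernel g' z.
Proof. by rewrite /pair_kernel !lapE !nbsumE !sum2; ring. Qed.

(* srw2 R M.*2 is the kernel of an even power of the walk, hence positive
   semidefinite: an upper bound may drop it. *)
Lemma corrector (j : 'I_2) (eps : R) : 0 < eps -> exists g M,
  [/\ fsupp g, forall z, g (- z) = g z &
   lsum (fun z => `|pair_kernel g z - (nbrk j z - srw2 R M.*2 z)|) <= eps].
Proof.
(* The final error is [4 wallis^2], and [wallis^2 <= 1 / (2M+1)]. *)
move=> e0p; pose M := Num.truncn (4 / eps).
have Meps : 4 * wallis R M ^+ 2 <= eps.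
  have := wallis_sqr_le R M; have : 4 / eps < M.+1%:R by exact: truncnS_gt.
  rewrite ltr_pdivrMr// => h1 h2.
  have h3 : M.+1%:R <= M.*2.+1%:R :> R by rewrite ler_nat; lia.
  have h4 := sqr_ge0 (wallis R M).
  have h5 : 4 * wallis R M ^+ 2 < M.+1%:R * eps * wallis R M ^+ 2 \/ wallis R M ^+ 2 = 0.
    have [->|w0] := eqVneq (wallis R M ^+ 2) 0; [by right|left].
    by rewrite ltr_pM2r// lt_def w0.
  have h6 : wallis R M ^+ 2 * M.+1%:R <= 1 by nra.
  case: h5 => [h5|->]; last lra.
  have : eps * (wallis R M ^+ 2 * M.+1%:R) <= eps by rewrite ler_piMr// ltW.
  lra.
have [d0 d1] := andP (quadsum_e0 M).
(* [nbrk j] is half the sum of both kernels plus [sg] times half their difference. Up to terms in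
   [wallis^2], the multiple -1/8 of [green] produces the half sum and [- srw2 R M.*2], while [b] is
   tuned for [quadsum] to produce the half difference; [quadsum M e0 <= 1] keeps the denominator of
   [b] at least 8. *)
pose sg : R := if j == ord0 then 1 else -1.
pose b : R := - sg / (16 - 8 * quadsum M e0).
exists (fun x => (- 8^-1) * green R M x + b * quadsum M x), M; split.
- by apply: fsuppD; apply: fsuppMr; [exact: fsupp_green|exact: fsupp_quadsum].
- by move=> z; rewrite greenN quadsumN.
have fw := fsupp_srw2 R M.*2; have fq := fsupp_quad2 R M.*2.
have fk0 := fsupp_nbrk ord0; have fk1 := fsupp_nbrk ord_max.
have w0 := sqr_ge0 (wallis R M).
have jE z : nbrk j z = (nbrk ord0 z + nbrk ord_max z) / 2 + sg * (nbrk ord0 z - nbrk ord_max z) / 2.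
  rewrite /sg; have [->|j0] := eqVneq j ord0; first by field.
  have -> : j = ord_max.
    by case: j j0 {sg b} => [[|[|[]]]]//= *; apply: val_inj.
  by field.
have sg1 : `|sg| = 1 by rewrite /sg; case: ifP => _; rewrite ?normrN normr1.
apply: (@le_trans _ _ (lsum (fun z => wallis R M ^+ 2 * (z == 0)%:R +
   wallis R M ^+ 2 / 2 * (nbrk ord0 z + nbrk ord_max z) + `|quad2 R M.*2 z|))); last first.
  rewrite !lsumD; try fsup.
  rewrite !lsumZ lsumD// !lsum_nbrk.
  have -> : lsum (fun x : site => (x == 0)%:R) = 1 :> R.
    by rewrite -[RHS](lsum_delta (fun=> 1) (0 : site)); apply: eq_lsum => x; rewrite mulr1.
  have := lsum_quad2 M; lra.
apply: le_lsum.
- apply: fsupp_norm; apply: fsuppB; last by apply: fsuppB => //; exact: fsupp_nbrk.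
  have -> : pair_kernel (fun x => - 8^-1 * green R M x + b * quadsum M x) =
     fun z => - 8^-1 * pair_kernel (green R M) z + b * pair_kernel (quadsum M) z.
    by apply/funext => z; exact: pair_kernel_lin.
  rewrite (funext (pair_kernel_green M)) (funext (pair_kernel_quadsum M)).
  by apply: fsuppD; apply: fsuppMr; fsup.
- by fsup.
move=> z; rewrite pair_kernel_lin pair_kernel_green pair_kernel_quadsum jE.
have dd : 16 - 8 * quadsum M e0 != 0 by lra.
have -> : - 8^-1 * (8 * srw2 R M.*2 z - 8 * wallis R M ^+ 2 * (z == 0)%:R -
    4 * (1 - wallis R M ^+ 2) * (nbrk ord0 z + nbrk ord_max z)) +
   b * (8 * quad2 R M.*2 z - (8 - 4 * quadsum M e0) * (nbrk ord0 z - nbrk ord_max z)) -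
   ((nbrk ord0 z + nbrk ord_max z) / 2 + sg * (nbrk ord0 z - nbrk ord_max z) / 2 - srw2 R M.*2 z) =
   wallis R M ^+ 2 * (z == 0)%:R - wallis R M ^+ 2 / 2 * (nbrk ord0 z + nbrk ord_max z)
   + 8 * b * quad2 R M.*2 z by rewrite /b; field.
have n0 := nbrk_ge0 ord0 z; have n1 := nbrk_ge0 ord_max z.
apply: le_trans (ler_normD _ _) _; apply: lerD.
  apply: le_trans (ler_normB _ _) _.
  by rewrite !ger0_norm// mulr_ge0// ?addr_ge0// divr_ge0.
rewrite normrM ler_piMl// /b !normrM normrN sg1 normfV mul1r ger0_norm//.
rewrite ger0_norm; last lra.
rewrite ler_pdivrMr; lra.
Qed.

End Corrector.

(** * Quadratic forms in the centred occupations *)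

Section QuadraticForms.
Variables (R : realType).
Implicit Types (f g h v w t : site -> R).

Definition conv g v (x : site) : R := lsum (fun z => g z * v (x + z)).
(** [conv] is a correlation, so this is the sum of [g (y - x) v x w y] over pairs of sites. *)
Definition bil g v w : R := lsum (fun x => v x * conv g w x).
Definition norm1 g : R := lsum (fun z => `|g z|).
Definition norm2 g : R := Num.sqrt (lsum (fun z => g z ^+ 2)).

Lemma norm1_ge0 g : 0 <= norm1 g.
Proof. exact: ge0_lsum. Qed.

Lemma norm2_ge0 g : 0 <= norm2 g.
Proof. exact: sqrtr_ge0. Qed.

Lemma norm2_sqr g : norm2 g ^+ 2 = lsum (fun z => g z ^+ 2).
Proof. by rewrite sqr_sqrtr// ge0_lsum// => z; exact: sqr_ge0. Qed.

Lemma norm2_shift g a : norm2 (fun x => g (x + a)) = norm2 g.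
Proof. by rewrite /norm2 (lsum_shift (fun z => g z ^+ 2)). Qed.

Lemma norm2_le_mono f g : fsupp f -> fsupp g -> (forall x, `|f x| <= `|g x|) -> norm2 f <= norm2 g.
Proof.
move=> ff fg fgx; apply: ler_wsqrtr; apply: le_lsum; try fsup.
by move=> x; rewrite -[leLHS]real_normK ?num_real// -[leRHS]real_normK ?num_real// lerXn2r ?nnegrE.
Qed.

Lemma norm_le_norm2 f x : fsupp f -> `|f x| <= norm2 f.
Proof.
move=> ff; rewrite -sqrtr_sqr ler_wsqrtr// -/((fun x => f x ^+ 2) x).
by apply: (@lsum_ge_term _ _ (fun z => f z ^+ 2)) => [|y]; [fsup|exact: sqr_ge0].
Qed.

Lemma norm_le_norm1 f x : fsupp f -> `|f x| <= norm1 f.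
Proof. by move=> ff; apply: (@lsum_ge_term _ _ (fun z => `|f z|)) => //; fsup. Qed.

Lemma lsum_norm_CS f g : fsupp f -> fsupp g ->
  lsum (fun x => `|f x| * `|g x|) <= norm2 f * norm2 g.
Proof. exact: lsum_CS_norm. Qed.

Lemma exchange_fg (f g : site -> R) (F : site -> site -> R) : fsupp f -> fsupp g ->
  (forall x y, f x = 0 -> F x y = 0) -> (forall x y, g y = 0 -> F x y = 0) ->
  lsum (fun x => lsum (F x)) = lsum (fun y => lsum (F^~ y)).
Proof.
move=> [s fs] [t gt] F1 F2; apply: (@exchange_lsum _ _ s t) => x y Fxy.
apply/andP; split; [apply: fs|apply: gt]; apply: contra Fxy => /eqP h; apply/eqP; auto.
Qed.

Lemma fsupp_conv g v : fsupp g -> fsupp v -> fsupp (conv g v).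
Proof.
move=> [s gs] [t vt]; exists [seq y - z | y <- t, z <- s] => x.
apply: contraR => xn; rewrite /conv; apply/eqP.
rewrite -[RHS](@lsum0 R site); apply: eq_lsum => z.
have [->|/gs zs] := eqVneq (g z) 0; first by rewrite mul0r.
have [->|/vt xt] := eqVneq (v (x + z)) 0; first by rewrite mulr0.
by case/negP: xn; apply/allpairsP; exists (x + z, z); rewrite /= addrK.
Qed.

Lemma convDr g v w x : fsupp g -> conv g (fun y => v y + w y) x = conv g v x + conv g w x.
Proof.
move=> fg; rewrite /conv -lsumD; try fsup.
by apply: eq_lsum => z; rewrite mulrDr.
Qed.

Lemma convZr g v c x : conv g (fun y => c * v y) x = c * conv g v x.
Proof. by rewrite /conv -lsumZ; apply: eq_lsum => z; rewrite mulrCA. Qed.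

Lemma conv_delta g a x : conv g (fun y => (y == a)%:R) x = g (a - x).
Proof.
rewrite /conv -[RHS](lsum_delta g); apply: eq_lsum => z.
have -> : (z == a - x) = (x + z == a) by rewrite eq_sym subr_eq eq_sym addrC.
exact: mulrC.
Qed.

Lemma bilC g v w : fsupp g -> (forall z, g (- z) = g z) -> fsupp v -> fsupp w ->
  bil g v w = bil g w v.
Proof.
move=> fg ge fv fw; rewrite /bil /conv.
under eq_lsum do rewrite -lsumZ; under [RHS]eq_lsum do rewrite -lsumZ.
rewrite (exchange_fg fv fg); [|by move=> x y ->; rewrite mul0r|by move=> x y ->; rewrite mul0r mulr0].
rewrite [RHS](exchange_fg fw fg); [|by move=> x y ->; rewrite mul0r|by move=> x y ->; rewrite mul0r mulr0].
rewrite -lsum_opp; apply: eq_lsum => z; rewrite -(lsum_shift _ z); apply: eq_lsum => x.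
by rewrite ge addrK; ring.
Qed.

Lemma bilDl g v v' w : fsupp v -> fsupp v' -> bil g (fun y => v y + v' y) w = bil g v w + bil g v' w.
Proof.
move=> fv fv'; rewrite /bil -lsumD; try fsup.
by apply: eq_lsum => x; rewrite mulrDl.
Qed.

Lemma bilZl g v w c : bil g (fun y => c * v y) w = c * bil g v w.
Proof. by rewrite /bil -lsumZ; apply: eq_lsum => x; rewrite mulrA. Qed.

Lemma bilDr g v w w' : fsupp g -> fsupp v -> bil g v (fun y => w y + w' y) = bil g v w + bil g v w'.
Proof.
move=> fg fv; rewrite /bil -lsumD; try fsup.
by apply: eq_lsum => x; rewrite convDr// mulrDr.
Qed.

Lemma bil_delta g w a : bil g (fun y => (y == a)%:R) w = conv g w a.
Proof. exact: (lsum_delta (conv g w)). Qed.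

Lemma conv_norm g v x (tau : R) : fsupp g -> fsupp v -> (forall y, `|v y| <= tau) ->
  `|conv g v x| <= norm1 g * tau.
Proof.
move=> fg fv vt; apply: le_trans (ler_norm_lsum _) _; first by fsup.
rewrite /norm1 -lsumZr; apply: le_lsum; try fsup.
by move=> z; rewrite normrM ler_wpM2l.
Qed.

(** Young's inequality between l1 and l2: Cauchy-Schwarz with [|g|] split into two square roots,
    then summation over [x] first. *)
Lemma conv_norm2 g v : fsupp g -> fsupp v -> norm2 (conv g v) <= norm1 g * norm2 v.
Proof.
move=> fg fv; rewrite -(@ler_pXn2r _ 2)// ?nnegrE ?mulr_ge0 ?norm1_ge0 ?norm2_ge0//.
rewrite exprMn !norm2_sqr.
have f1 : fsupp (fun z => Num.sqrt `|g z|) by apply: fsupp_sub fg _ => x ->; rewrite normr0 sqrtr0.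
have key x : conv g v x ^+ 2 <= norm1 g * lsum (fun z => `|g z| * v (x + z) ^+ 2).
  have h0 : `|conv g v x| <= lsum (fun z => Num.sqrt `|g z| * (Num.sqrt `|g z| * `|v (x + z)|)).
    apply: le_trans (ler_norm_lsum _) _; first by fsup.
    apply: le_lsum; try fsup.
    by move=> z; rewrite normrM mulrA -expr2 sqr_sqrtr.
  have := lsum_CS f1 (fsuppMl (fun z => `|v (x + z)|) f1).
  have -> : lsum (fun z => Num.sqrt `|g z| ^+ 2) = norm1 g.
    by apply: eq_lsum => z; rewrite sqr_sqrtr.
  have -> : lsum (fun z => (Num.sqrt `|g z| * `|v (x + z)|) ^+ 2) = lsum (fun z => `|g z| * v (x + z) ^+ 2).
    by apply: eq_lsum => z; rewrite exprMn sqr_sqrtr// real_normK ?num_real.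
  apply: le_trans; rewrite -[leLHS]real_normK ?num_real//.
  by rewrite lerXn2r ?nnegrE// (le_trans _ h0).
have fc := fsupp_conv fg fv.
have fK : fsupp (fun x => lsum (fun z => `|g z| * v (x + z) ^+ 2)).
  apply: (fsupp_sub (fsupp_conv (fsupp_norm fg) (fsuppX 1 fv))) => x /eqP.
  by rewrite /conv => /eqP.
apply: (@le_trans _ _ (lsum (fun x => norm1 g * lsum (fun z => `|g z| * v (x + z) ^+ 2)))).
  by apply: le_lsum; try fsup; exact: key.
rewrite lsumZ expr2 -mulrA ler_wpM2l ?norm1_ge0//.
have [s gs] := fg; have [r vr] := fv.
rewrite (@exchange_lsum _ _ [seq y - z | y <- r, z <- s] s); last first.
  move=> x y; rewrite mulf_eq0 normr_eq0 expf_eq0 /= negb_or => /andP[/gs ys /vr xr].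
  by rewrite ys andbT; apply/allpairsP; exists (x + y, y); rewrite /= addrK.
under eq_lsum => y.
  rewrite lsumZ (lsum_shift (fun x => v x ^+ 2)); over.
by rewrite lsumZr.
Qed.

Variables (g t rho : site -> R).
Hypotheses (fg : fsupp g) (ge : forall z, g (- z) = g z) (ft : fsupp t).

(** The cut-off [t] sits in the variables rather than in the kernel, so that [bil g] keeps a
    translation invariant kernel. *)
Definition cen (eta : site -> R) (x : site) : R := t x * (eta x - rho x).

Lemma fsupp_cen eta : fsupp (cen eta).
Proof. exact: fsuppMl. Qed.

(** The exchange is written additively, so that the increment of a quadratic form is an explicit
    quadratic polynomial in [eta y - eta x]. *)
Definition swapped (x y : site) (eta : site -> R) (z : site) : R :=
  eta z + (eta y - eta x) * ((z == x)%:R - (z == y)%:R).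

(* The increment of bil g (cen eta) (cen eta) when eta is exchanged across x, y. *)
Definition dQ eta (x y : site) : R :=
  2 * (eta y - eta x) * (t x * conv g (cen eta) x - t y * conv g (cen eta) y)
  + (eta y - eta x) ^+ 2 * (g 0 * (t x ^+ 2 + t y ^+ 2) - 2 * t x * t y * g (y - x)).

Lemma bil_swapped eta x y :
  bil g (cen (swapped x y eta)) (cen (swapped x y eta)) = bil g (cen eta) (cen eta) + dQ eta x y.
Proof.
set d := eta y - eta x.
pose del z := d * (t x * (z == x)%:R + - t y * (z == y)%:R).
have -> : cen (swapped x y eta) = fun z => cen eta z + del z.
  apply/funext => z; rewrite /cen /swapped /del -/d.
  have tE a : t z * (z == a)%:R = t a * (z == a)%:R by case: eqP => [->//|]; rewrite !mulr0.
  have -> : d * (t x * (z == x)%:R + - t y * (z == y)%:R) = d * (t z * (z == x)%:R - t z * (z == y)%:R).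
    by rewrite !tE mulNr.
  ring.
have fv := fsupp_cen eta.
have fd : fsupp del by rewrite /del; fsup.
rewrite bilDl// !bilDr// (bilC fg ge fv fd).
have bd w : bil g del w = d * (t x * conv g w x - t y * conv g w y).
  rewrite /del bilZl bilDl; try fsup.
  by rewrite !bilZl !bil_delta mulNr.
have cd z : conv g del z = d * (t x * g (x - z) - t y * g (y - z)).
  by rewrite /del convZr convDr// !convZr !conv_delta mulNr.
rewrite !bd !cd !subrr /dQ -/d.
have -> : g (x - y) = g (y - x) by rewrite -ge opprB.
ring.
Qed.

Lemma dQ_le eta tau x y : (forall z, 0 <= eta z <= 1) -> (forall z, 0 <= rho z <= 1) ->
  (forall z, `|t z| <= tau) ->
  `|dQ eta x y| <= 4 * norm1 g * tau * (`|t x| + `|t y|).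
Proof.
move=> e01 r01 tt; rewrite /dQ.
have z1 z : `|eta z - rho z| <= 1.
  by rewrite ler_norml; have /andP[? ?] := e01 z; have /andP[? ?] := r01 z; apply/andP; split; lra.
have tau0 : 0 <= tau by exact: le_trans (tt 0).
have ct z : `|conv g (cen eta) z| <= norm1 g * tau.
  apply: conv_norm => // [|u]; first exact: fsupp_cen.
  by rewrite normrM -[leRHS]mulr1 ler_pM.
have d1 : `|eta y - eta x| <= 1.
  by rewrite ler_norml; have /andP[? ?] := e01 x; have /andP[? ?] := e01 y; apply/andP; split; lra.
have n0 := norm1_ge0 g.
have ga z : `|g z| <= norm1 g by exact: norm_le_norm1.
have tx := tt x; have ty := tt y.
apply: (@le_trans _ _ (2 * 1 * (`|t x| * (norm1 g * tau) + `|t y| * (norm1 g * tau)) +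
   1 * (norm1 g * (`|t x| * tau + `|t y| * tau) + 2 * (`|t x| * tau) * norm1 g / 2 + 2 * (`|t y| * tau) * norm1 g / 2))).
  apply: le_trans (ler_normD _ _) _; apply: lerD.
    rewrite normrM (normrM 2) ger0_norm// ler_pM// ?mulr_ge0// ?ler_pM//.
    apply: le_trans (ler_normB _ _) _; rewrite !normrM lerD// ler_wpM2l//.
  rewrite normrM normrX; apply: ler_pM => //; first by rewrite expr_le1.
  apply: le_trans (ler_normB _ _) _; rewrite !normrM -addrA; apply: lerD.
    rewrite ler_pM// ger0_norm ?addr_ge0 ?sqr_ge0//.
    by rewrite -(real_normK (num_real (t x))) -(real_normK (num_real (t y))) !expr2 lerD// ler_wpM2l.
  rewrite ger0_norm//.
  have h : `|t x| * `|t y| <= (`|t x| * tau + `|t y| * tau) / 2.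
    have := normr_ge0 (t x); have := normr_ge0 (t y); nra.
  have := ga (y - x); have := normr_ge0 (g (y - x)); have := normr_ge0 (t x); have := normr_ge0 (t y).
  move=> y0 x0 g0 gn.
  have : `|t x| * `|t y| * `|g (y - x)| <= (`|t x| * tau + `|t y| * tau) / 2 * norm1 g.
    by rewrite ler_pM// mulr_ge0.
  lra.
have := normr_ge0 (t x); have := normr_ge0 (t y); nra.
Qed.

End QuadraticForms.

(** * Drift of a quadratic form under the exclusion dynamics *)

Section QuadraticDrift.
Variables (R : realType) (g t rho : site -> R).
Hypotheses (fg : fsupp g) (ge : forall z, g (- z) = g z) (ft : fsupp t).
Variables (eta : site -> R) (s q kappa : R).
Hypotheses (e01 : forall z, 0 <= eta z <= 1) (r01 : forall z, 0 <= rho z <= 1).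
Hypotheses (t1 : forall z, `|t z| <= 1) (ts : norm2 t <= s).
Hypotheses (tq : forall j, norm2 (fun x => t (x + unit_vector j) - t x) <= q).
Hypotheses (flr : fsupp (lap rho)) (rq : norm2 (lap rho) <= q).
Hypotheses (rk : forall x j, `|rho (x + unit_vector j) - rho x| <= kappa).

Let v := cen t rho eta.
Let C := conv g v.
Let zeta x := eta x - rho x.
Let N := norm1 g.

Lemma fsupp_v : fsupp v. Proof. exact: fsupp_cen. Qed.
Local Notation fv := fsupp_v.
Lemma fsupp_C : fsupp C. Proof. by apply: fsupp_conv => //; exact: fsupp_v. Qed.
Local Notation fC := fsupp_C.
Lemma N_ge0 : 0 <= N. Proof. exact: norm1_ge0. Qed.
Local Notation N0 := N_ge0.
Lemma s_ge0 : 0 <= s. Proof. exact: le_trans (norm2_ge0 _) ts. Qed.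
Local Notation s0 := s_ge0.
Lemma q_ge0 : 0 <= q. Proof. exact: le_trans (norm2_ge0 _) rq. Qed.
Local Notation q0 := q_ge0.

Lemma zeta_le1 x : `|zeta x| <= 1.
Proof.
by rewrite ler_norml; have /andP[? ?] := e01 x; have /andP[? ?] := r01 x; apply/andP; split; rewrite /zeta; lra.
Qed.
Local Notation zeta1 := zeta_le1.

Lemma norm2_conv_cen : norm2 C <= N * s.
Proof.
apply: le_trans (conv_norm2 fg fv) _; rewrite ler_wpM2l ?N0//.
apply: le_trans _ ts; apply: norm2_le_mono => [|//|x]; first exact: fsupp_v.
by rewrite normrM ler_piMr// zeta1.
Qed.
Local Notation normC := norm2_conv_cen.

Lemma conv_lap x : conv (lap g) v x = lap C x.
Proof.
have hfv := fsupp_v; have hfC := fsupp_C.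
have E (e : site) : lsum (fun z => g (z + e) * v (x + z)) = C (x - e).
  rewrite /C /conv -[RHS](lsum_shift _ e); apply: eq_lsum => z /=.
  by congr (_ * v _); rewrite [z + e]addrC addrA subrK.
rewrite /conv (eq_lsum (g := fun z => \sum_(j < 2) (g (z + unit_vector j) * v (x + z) + g (z - unit_vector j) * v (x + z) - 2 * (g z * v (x + z))))).
  rewrite lsum_sum => [|j]; last by fsup.
  rewrite /lap; apply: eq_bigr => j _; rewrite lsumB; try fsup.
  rewrite lsumD; try fsup.
  by rewrite lsumZ !E opprK [C (x - _) + _]addrC.
by move=> z; rewrite /lap mulr_suml; apply: eq_bigr => j _; ring.
Qed.

Lemma norm2_backward j : norm2 (fun x => t (x - unit_vector j) - t x) <= q.
Proof.
apply: le_trans _ (tq j); rewrite -(norm2_shift _ (unit_vector j)).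
have -> : (fun x => t (x + unit_vector j - unit_vector j) - t (x + unit_vector j)) =
  fun x => t x - t (x + unit_vector j) by apply/funext => x; rewrite addrK.
apply: norm2_le_mono; try fsup.
by move=> x; rewrite distrC.
Qed.
Local Notation tN := norm2_backward.

(** The second difference moves from [zeta] to [C]. What is left is its commutator with the cut-off
    [t], a difference of [t] of l2 norm at most [q] against [C] of norm at most [N s], once for each
    of the two shifts. *)
Lemma drift_part j : `|lsum (fun x => (zeta (x + unit_vector j) + zeta (x - unit_vector j) - 2 * zeta x) * (t x * C x))
  - lsum (fun x => v x * (C (x + unit_vector j) + C (x - unit_vector j) - 2 * C x))| <= 2 * (N * (q * s)).
Proof.
have hfv := fsupp_v; have hfC := fsupp_C.
set e := unit_vector j.
have fc : fsupp (fun x => t x * C x) by fsup.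
have -> : lsum (fun x => (zeta (x + e) + zeta (x - e) - 2 * zeta x) * (t x * C x)) =
   lsum (fun x => zeta x * (t (x + e) * C (x + e))) + lsum (fun x => zeta x * (t (x - e) * C (x - e)))
   - lsum (fun x => 2 * (zeta x * (t x * C x))).
  rewrite -[X in _ = X + _ - _](lsum_shift _ (- e)) -[X in _ = _ + X - _](lsum_shift _ e) /=.
  under [X in _ = X + _ - _]eq_lsum do rewrite subrK.
  under [X in _ = _ + X - _]eq_lsum do rewrite addrK.
  rewrite -lsumD; try fsup.
  rewrite -lsumB; try fsup.
  by apply: eq_lsum => x; ring.
have -> : lsum (fun x => v x * (C (x + e) + C (x - e) - 2 * C x)) =
   lsum (fun x => zeta x * (t x * C (x + e))) + lsum (fun x => zeta x * (t x * C (x - e)))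
   - lsum (fun x => 2 * (zeta x * (t x * C x))).
  rewrite -lsumD; try fsup.
  rewrite -lsumB; try fsup.
  by apply: eq_lsum => x; rewrite /v /cen -/(zeta x); ring.
have f1 : fsupp (fun x => zeta x * (t (x + e) * C (x + e))) by do ?apply: fsuppMr; fsup.
have f2 : fsupp (fun x => zeta x * (t (x - e) * C (x - e))) by do ?apply: fsuppMr; fsup.
have bnd (T1 C1 : site -> R) : fsupp T1 -> fsupp C1 -> norm2 T1 <= q -> norm2 C1 <= N * s ->
    `|lsum (fun x => zeta x * (T1 x * C1 x))| <= N * (q * s).
  move=> fT fC1 hT hC; apply: le_trans (ler_norm_lsum _) _; first by fsup.
  apply: (@le_trans _ _ (lsum (fun x => `|T1 x| * `|C1 x|))).
    by apply: le_lsum; try fsup; move=> x; rewrite !normrM ler_piMl ?mulr_ge0// zeta1.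
  apply: le_trans (lsum_norm_CS fT fC1) _.
  have -> : N * (q * s) = q * (N * s) by ring.
  by rewrite ler_pM// norm2_ge0.
have E1 : lsum (fun x => zeta x * (t (x + e) * C (x + e))) - lsum (fun x => zeta x * (t x * C (x + e)))
   = lsum (fun x => zeta x * ((t (x + e) - t x) * C (x + e))).
  by rewrite -lsumB; try fsup; apply: eq_lsum => x; ring.
have E2 : lsum (fun x => zeta x * (t (x - e) * C (x - e))) - lsum (fun x => zeta x * (t x * C (x - e)))
   = lsum (fun x => zeta x * ((t (x - e) - t x) * C (x - e))).
  by rewrite -lsumB; try fsup; apply: eq_lsum => x; ring.
have B1 : `|lsum (fun x => zeta x * ((t (x + e) - t x) * C (x + e)))| <= N * (q * s).
  by apply: (bnd (fun x => t (x + e) - t x) (fun x => C (x + e))); [fsup|fsup|exact: tq|rewrite (norm2_shift C); exact: normC].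
have B2 : `|lsum (fun x => zeta x * ((t (x - e) - t x) * C (x - e)))| <= N * (q * s).
  by apply: (bnd (fun x => t (x - e) - t x) (fun x => C (x - e))); [fsup|fsup|exact: tN|rewrite (norm2_shift C); exact: normC].
move: E1 E2 B1 B2; rewrite !ler_norml => <- <- /andP[? ?] /andP[? ?]; apply/andP; split; lra.
Qed.

(** Up to a difference of [t], both expressions are [2 t x t y (g 0 - g e)] times a squared
    increment along the bond, of [eta] in one and of [zeta] in the other; these differ only through
    the increment of [rho], of size [kappa]. *)
Lemma square_part j : `|lsum (fun x => (eta (x + unit_vector j) - eta x) ^+ 2 *
     (g 0 * (t x ^+ 2 + t (x + unit_vector j) ^+ 2) - 2 * t x * t (x + unit_vector j) * g (unit_vector j)))
   - (g 0 - g (unit_vector j)) * (4 * lsum (fun x => v x * v x) - 4 * lsum (fun x => v x * v (x + unit_vector j)))|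
  <= N * (q ^+ 2 + 8 * (q * s) + 12 * (kappa * s ^+ 2)).
Proof.
have hfv := fsupp_v; have hfC := fsupp_C.
set e := unit_vector j; set k := g 0 - g e.
have fvv : fsupp (fun x => v x * v x) by fsup.
have fvv' : fsupp (fun x => v (x + e) * v (x + e)) by fsup.
have fvw : fsupp (fun x => v x * v (x + e)) by fsup.
have -> : 4 * lsum (fun x => v x * v x) - 4 * lsum (fun x => v x * v (x + e)) =
   lsum (fun x => 2 * (v x * v x) + 2 * (v (x + e) * v (x + e)) - 4 * (v x * v (x + e))).
  rewrite lsumB; try fsup.
  rewrite lsumD; try fsup.
  rewrite !lsumZ (lsum_shift (fun x => v x * v x)); ring.
rewrite -lsumZ -lsumB; last 2 first.
- by apply: fsuppMr; apply: fsuppB; [apply: fsuppMr; apply: fsuppD; fsup|do 2 apply: fsuppMl; apply: fsuppMr; fsup].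
- by fsup.
have fm : fsupp (fun x => eta x * 0) by apply: fsupp_sub (@fsupp0 R site) _ => x; rewrite mulr0.
have ga z : `|g z| <= N by exact: norm_le_norm1.
have kN : `|k| <= 2 * N.
  by apply: le_trans (ler_normB _ _) _; have := ga 0; have := ga e; lra.
pose dt x := t (x + e) - t x.
have fdt : fsupp dt by rewrite /dt; fsup.
have ft' : fsupp (fun x => t (x + e)) by fsup.
apply: le_trans (ler_norm_lsum _) _.
  apply: fsuppB; last by fsup.
  by apply: fsuppMr; apply: fsuppB; [apply: fsuppMr; apply: fsuppD; fsup|do 2 apply: fsuppMl; apply: fsuppMr; fsup].
apply: (@le_trans _ _ (lsum (fun x => N * (dt x ^+ 2 +
   (4 * (`|dt x| * `|t x|) + 4 * (`|dt x| * `|t (x + e)|) + 12 * kappa * (`|t x| * `|t (x + e)|)))))).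
  apply: le_lsum.
  - apply: fsupp_norm; apply: fsuppB; last by fsup.
    by apply: fsuppMr; apply: fsuppB; [apply: fsuppMr; apply: fsuppD; fsup|do 2 apply: fsuppMl; apply: fsuppMr; fsup].
  - by apply: fsuppMr; apply: fsuppD; [fsup|apply: fsuppD; [apply: fsuppD|]; apply: fsuppMr; apply: fsuppMl; fsup].
  move=> x; set y := x + e.
  have dr := rk x j; rewrite -/e -/y in dr.
  have -> : (eta y - eta x) ^+ 2 * (g 0 * (t x ^+ 2 + t y ^+ 2) - 2 * t x * t y * g e) -
     k * (2 * (v x * v x) + 2 * (v y * v y) - 4 * (v x * v y)) =
     (eta y - eta x) ^+ 2 * (g 0 * dt x ^+ 2) +
     k * (2 * (dt x * (t x * zeta x ^+ 2) - dt x * (t y * zeta y ^+ 2)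
        + t x * t y * ((rho y - rho x) * (2 * (eta y - eta x) - (rho y - rho x))))).
    by rewrite /k /dt /v /cen -/y /zeta; ring.
  have d1 : `|eta y - eta x| <= 1.
    by rewrite ler_norml; have /andP[? ?] := e01 x; have /andP[? ?] := e01 y; apply/andP; split; lra.
  have r1 : `|rho y - rho x| <= 1.
    by rewrite ler_norml; have /andP[? ?] := r01 x; have /andP[? ?] := r01 y; apply/andP; split; lra.
  have z2 u : `|zeta u ^+ 2| <= 1 by rewrite normrX expr_le1// zeta1.
  rewrite [leRHS]mulrDr; apply: le_trans (ler_normD _ _) _; apply: lerD.
    rewrite normrM (normrM (g 0)) -[leRHS]mul1r; apply: ler_pM; [by []|by rewrite mulr_ge0|by rewrite normrX expr_le1|].
    by rewrite (ger0_norm (sqr_ge0 (dt x))) ler_wpM2r ?sqr_ge0.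
  rewrite normrM.
  have -> : N * (4 * (`|dt x| * `|t x|) + 4 * (`|dt x| * `|t y|) + 12 * kappa * (`|t x| * `|t y|)) =
     2 * N * (2 * (`|dt x| * `|t x| + `|dt x| * `|t y| + `|t x| * `|t y| * (kappa * 3))) by ring.
  apply: ler_pM => //; rewrite normrM ger0_norm// ler_wpM2l//.
  apply: le_trans (ler_normD _ _) _; apply: lerD.
    apply: le_trans (ler_normB _ _) _; apply: lerD;
      rewrite (normrM (dt x)) (normrM (t _)) ler_wpM2l// ler_piMr//; exact: z2.
  rewrite !normrM ler_wpM2l ?mulr_ge0// ler_pM//.
  by apply: le_trans (ler_normB _ _) _; rewrite normrM ger0_norm//; lra.
have dtq : norm2 dt <= q by exact: tq.
have ts' : norm2 (fun x => t (x + e)) <= s by rewrite (norm2_shift t).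
have n20 := @norm2_ge0 R.
have h1 : lsum (fun x => dt x ^+ 2) <= q ^+ 2.
  by rewrite -norm2_sqr lerXn2r ?nnegrE ?n20 ?q0.
have h2 : lsum (fun x => `|dt x| * `|t x|) <= q * s.
  by apply: le_trans (lsum_norm_CS fdt ft) _; rewrite ler_pM ?n20.
have h3 : lsum (fun x => `|dt x| * `|t (x + e)|) <= q * s.
  by apply: le_trans (lsum_norm_CS fdt ft') _; rewrite ler_pM ?n20.
have h4 : lsum (fun x => `|t x| * `|t (x + e)|) <= s ^+ 2.
  by apply: le_trans (lsum_norm_CS ft ft') _; rewrite expr2 ler_pM ?n20.
have k0 : 0 <= kappa by exact: le_trans (rk 0 j).
rewrite lsumZ ler_wpM2l ?N0// !lsumD ?lsumZ; try by fsup.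
all: try by apply: fsuppMr; apply: fsuppMl; fsup.
all: try by apply: fsuppD; try apply: fsuppD; apply: fsuppMr; apply: fsuppMl; fsup.
have : kappa * lsum (fun x => `|t x| * `|t (x + e)|) <= kappa * s ^+ 2 by rewrite ler_wpM2l.
lra.
Qed.

(** The linear part of [dQ] is summed by parts into the second differences of [eta = zeta + rho]:
    the [zeta] part yields [2 lap g], the squared part yields the other summand of [pair_kernel],
    and [lap rho] is an error. For the tilted profile [s] and [kappa] are of order [w] and [q] of
    order [w^2], so the error is of order [w^3] against a main term of order [w^2]. *)
Lemma sum_dQ : `|\sum_(j < 2) lsum (fun x => dQ g t rho eta x (x + unit_vector j))
    - bil (pair_kernel g) v v| <= N * (26 * (q * s) + 2 * q ^+ 2 + 24 * (kappa * s ^+ 2)).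
Proof.
have hfv := fsupp_v; have hfC := fsupp_C.
have fc : fsupp (fun x => t x * C x) by fsup.
have E1 j : lsum (fun x => dQ g t rho eta x (x + unit_vector j)) =
   2 * lsum (fun x => (zeta (x + unit_vector j) + zeta (x - unit_vector j) - 2 * zeta x) * (t x * C x))
   + 2 * lsum (fun x => (rho (x + unit_vector j) + rho (x - unit_vector j) - 2 * rho x) * (t x * C x))
   + lsum (fun x => (eta (x + unit_vector j) - eta x) ^+ 2 *
     (g 0 * (t x ^+ 2 + t (x + unit_vector j) ^+ 2) - 2 * t x * t (x + unit_vector j) * g (unit_vector j))).
  set e := unit_vector j.
  have fx : fsupp (fun x => t x ^+ 2) by fsup.
  have fxe : fsupp (fun x => t (x + e) ^+ 2) by fsup.
  have fS : fsupp (fun x => (eta (x + e) - eta x) ^+ 2 * (g 0 * (t x ^+ 2 + t (x + e) ^+ 2) - 2 * t x * t (x + e) * g e)).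
    by apply: fsuppMr; apply: fsuppB; [apply: fsuppMr; fsup|do 2 apply: fsuppMl; apply: fsuppMr; fsup].
  rewrite -!lsumZ -lsumD; try fsup.
  have -> : (fun x => 2 * ((zeta (x + e) + zeta (x - e) - 2 * zeta x) * (t x * C x)) +
      2 * ((rho (x + e) + rho (x - e) - 2 * rho x) * (t x * C x))) =
      fun x => 2 * ((eta (x + e) + eta (x - e) - 2 * eta x) * (t x * C x)).
    by apply/funext => x; rewrite /zeta; ring.
  rewrite lsumZ lsum_by_parts// mulrN -mulNr -lsumZ -lsumD; try fsup.
    apply: eq_lsum => x; rewrite /dQ -/v -/C.
    have -> : x + e - x = e by rewrite addrC addKr.
    ring.
have E2 : bil (pair_kernel g) v v = 2 * (\sum_(j < 2) lsum (fun x => v x * (C (x + unit_vector j) + C (x - unit_vector j) - 2 * C x)))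
   + \sum_(j < 2) (g 0 - g (unit_vector j)) * (4 * lsum (fun x => v x * v x) - 4 * lsum (fun x => v x * v (x + unit_vector j))).
  have flap : fsupp (lap g) by rewrite /lap; apply: fsupp_sum => j; fsup.
  have fK j : fsupp (fun z : site => (4 * (z == 0)%:R - 4 * nbrk R j z)).
    by have := fsupp_nbrk R j => fk; fsup.
  have convE x : conv (pair_kernel g) v x = 2 * conv (lap g) v x +
    \sum_(j < 2) (g 0 - g (unit_vector j)) * (4 * v x - 2 * (v (x + unit_vector j) + v (x - unit_vector j))).
    rewrite /conv /pair_kernel.
    rewrite (eq_lsum (g := fun z => 2 * (lap g z * v (x + z)) +
       \sum_(j < 2) ((g 0 - g (unit_vector j)) * ((4 * (z == 0)%:R - 4 * nbrk R j z) * v (x + z))))); last first.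
      move=> z; rewrite mulrDl mulrA; congr (_ + _); rewrite mulr_suml; apply: eq_bigr => j _; ring.
    rewrite lsumD; last 2 first.
    - by fsup.
    - by apply: fsupp_sum => j; apply: fsuppMr; exact: fsuppMl.
    rewrite lsumZ lsum_sum => [|j]; last by apply: fsuppMr; exact: fsuppMl.
    congr (_ + _); apply: eq_bigr => j _; rewrite lsumZ; congr (_ * _).
    have D (a : site) : lsum (fun z => (z == a)%:R * v (x + z)) = v (x + a).
      by rewrite (lsum_delta (fun z => v (x + z))).
    rewrite (eq_lsum (g := fun z => 4 * ((z == 0)%:R * v (x + z)) -
       2 * ((z == unit_vector j)%:R * v (x + z) + (z == - unit_vector j)%:R * v (x + z)))); last first.
      by move=> z; rewrite /nbrk; field.
    rewrite lsumB; try fsup.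
    rewrite !lsumZ lsumD; try fsup.
    by rewrite !D addr0.
  rewrite /bil; under eq_lsum => x do rewrite convE conv_lap mulrDr.
  rewrite lsumD; last 2 first.
  - by fsup.
  - by fsup.
  congr (_ + _).
    rewrite mulr_sumr; under [RHS]eq_bigr do rewrite -lsumZ.
    rewrite -lsum_sum => [|j]; last by fsup.
    by apply: eq_lsum => x; rewrite /lap mulrCA mulr_sumr mulr_sumr; apply: eq_bigr => j _; ring.
  rewrite (eq_lsum (g := fun x => \sum_(j < 2) (g 0 - g (unit_vector j)) *
     (4 * (v x * v x) - 2 * (v x * v (x + unit_vector j)) - 2 * (v x * v (x - unit_vector j))))); last first.
    by move=> x; rewrite mulr_sumr; apply: eq_bigr => j _; ring.
  rewrite lsum_sum => [|j]; last by apply: fsuppMr; apply: fsuppB; [apply: fsuppB|]; fsup.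
  apply: eq_bigr => j _; rewrite lsumZ; congr (_ * _).
  rewrite lsumB; try fsup.
  rewrite lsumB; try fsup.
  rewrite !lsumZ.
  have -> : lsum (fun x => v x * v (x - unit_vector j)) = lsum (fun x => v x * v (x + unit_vector j)).
    rewrite -(lsum_shift _ (unit_vector j)); apply: eq_lsum => x.
    by rewrite addrK mulrC.
  ring.
have L : `|lsum (fun x => lap rho x * (t x * C x))| <= N * (q * s).
  apply: le_trans (ler_norm_lsum _) _; first by fsup.
  apply: (@le_trans _ _ (lsum (fun x => `|lap rho x| * `|C x|))).
    apply: le_lsum; try fsup.
    by move=> x; rewrite !normrM ler_wpM2l// ler_piMl.
  apply: le_trans (lsum_norm_CS flr fC) _.
  have -> : N * (q * s) = q * (N * s) by ring.
  by rewrite ler_pM ?norm2_ge0// normC.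
have E3 : lsum (fun x => lap rho x * (t x * C x)) =
   \sum_(j < 2) lsum (fun x => (rho (x + unit_vector j) + rho (x - unit_vector j) - 2 * rho x) * (t x * C x)).
  rewrite -lsum_sum => [|j]; last by fsup.
  by apply: eq_lsum => x; rewrite /lap mulr_suml.
under eq_bigr do rewrite E1.
rewrite E2; rewrite E3 in L.
have dp := drift_part; have sp := square_part.
rewrite !sum2 in L *.
move: (dp ord0) (dp ord_max) (sp ord0) (sp ord_max) L; rewrite !ler_norml.
repeat (move: (lsum _) => ?).
move=> /andP[? ?] /andP[? ?] /andP[? ?] /andP[? ?] /andP[? ?]; apply/andP; split; lra.
Qed.

End QuadraticDrift.

(** * Elementary inequalities for sine, cosine and exponential *)

Section Trigonometry.
Variable R : realType.
Implicit Types (x y a b t : R).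

Lemma mvt_lip (f df : R -> R) (K : R) a b : (forall x, is_derive x 1 f (df x)) ->
  (forall x, Num.min a b <= x <= Num.max a b -> `|df x| <= K) -> `|f b - f a| <= K * `|b - a|.
Proof.
move=> fd; wlog ab : a b / a <= b => [H|] dK.
  have [ab|/ltW ba] := leP a b; first exact: H.
  by rewrite distrC [in leRHS]distrC; apply: H => // x; rewrite minC maxC; exact: dK.
have cf : {within `[a, b], continuous f}.
  apply: derivable_within_continuous => x _; exact: (@ex_derive _ _ _ _ _ _ _ (fd x)).
have [c cab ->] := MVT_segment ab (fun x _ => fd x) cf.
rewrite normrM ler_wpM2r// dK// min_l// max_r//.
Qed.

Lemma sin_lip a b : `|sin b - sin a| <= `|b - a|.
Proof.
by rewrite -[leRHS]mul1r; apply: (mvt_lip (df := cos)) => x _; rewrite cos_max.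
Qed.

Lemma cos_lip a b : `|cos b - cos a| <= `|b - a|.
Proof.
rewrite -[leRHS]mul1r; apply: (mvt_lip (df := fun x => - sin x)) => x _; last by rewrite normrN sin_max.
Qed.

Lemma norm_sin_le x : `|sin x| <= `|x|.
Proof. by have := sin_lip 0 x; rewrite sin0 !subr0. Qed.

Lemma one_sub_cos x : 0 <= 1 - cos x <= x ^+ 2.
Proof.
have := sin2cos2 (x / 2); have := cos_mulr2n (x / 2); have := norm_sin_le (x / 2).
have -> : x / 2 *+ 2 = x by rewrite -mulr_natr; field.
rewrite -(@ler_pXn2r _ 2)// ?nnegrE// !real_normK ?num_real// => h -> h2.
have := sqr_ge0 (sin (x / 2)); have : (x / 2) ^+ 2 = x ^+ 2 / 4 by field.
move=> e h3; apply/andP; split; first by rewrite -mulr_natr; lra.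
by have := sqr_ge0 x; rewrite -mulr_natr; lra.
Qed.

Lemma sin_sub_id x : `|sin x - x| <= `|x| ^+ 3.
Proof.
have -> : `|sin x - x| = `|(sin x - x) - (sin 0 - 0)| by rewrite sin0 !subr0.
have -> : `|x| ^+ 3 = `|x| ^+ 2 * `|x - 0| by rewrite subr0 exprSr.
apply: (mvt_lip (f := sin - id) (df := fun y => cos y - 1)) => y.
move=> hy; have /andP[c0 c1] := one_sub_cos y.
rewrite distrC ger0_norm// (le_trans c1)// -[leLHS]real_normK ?num_real// lerXn2r ?nnegrE//.
move: hy; have [x0|x0] := leP 0 x.
  by move=> /andP[? ?]; rewrite !ger0_norm//; lra.
by move=> /andP[? ?]; rewrite (ler0_norm (ltW x0)) ler0_norm//; lra.
Qed.

Lemma sin_sqr_lower x : x ^+ 2 - 2 * `|x| ^+ 3 * `|x| <= sin x ^+ 2.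
Proof.
have h1 := sin_sub_id x; have h2 := norm_sin_le x.
have -> : sin x ^+ 2 = x ^+ 2 + (sin x - x) * (sin x + x) by ring.
have : `|(sin x - x) * (sin x + x)| <= `|x| ^+ 3 * (2 * `|x|).
  rewrite normrM ler_pM//; apply: le_trans (ler_normD _ _) _; lra.
rewrite ler_norml => /andP[? ?]; lra.
Qed.

Lemma sin_sqr_le x : sin x ^+ 2 <= x ^+ 2.
Proof.
by rewrite -[leLHS]real_normK ?num_real// -[leRHS]real_normK ?num_real// lerXn2r ?nnegrE ?norm_sin_le.
Qed.

(** A consequence of [expR t * (1 - t) <= 1]. *)
Lemma expR_le_quadratic t : t <= 2^-1 -> expR t <= 1 + t + 2 * t ^+ 2.
Proof.
move=> t2; have h := expR_ge1Dx (- t); have := expRxMexpNx_1 t.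
have e0 := expR_gt0 t; have : 0 < 1 - t by lra.
move=> h1 h2.
have h3 : expR t * (1 - t) <= 1 by rewrite -[leRHS]h2 ler_wpM2l// ltW.
have h4 : 1 <= (1 + t + 2 * t ^+ 2) * (1 - t).
  have : 0 <= t ^+ 2 * (1 - 2 * t) by rewrite mulr_ge0 ?sqr_ge0//; lra.
  nra.
by rewrite -(ler_pM2r h1) (le_trans h3).
Qed.

Lemma xcos_le_sin x : 0 <= x <= pi / 2 -> x * cos x <= sin x.
Proof.
move=> /andP[x0 x1].
suff : sin 0 - 0 * cos 0 <= sin x - x * cos x by rewrite sin0 mul0r subrr subr_ge0.
have fd (y : R) : is_derive y 1 (sin - (id * cos)) (y * sin y).
  have -> : y * sin y = cos y - (y *: (- sin y) + cos y *: 1).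
    rewrite /GRing.scale /=; ring.
  exact: is_deriveB.
apply: (@ger0_derive1_le_cc _ (sin - (id * cos)) 0 x).
- by move=> y _; exact: (@ex_derive _ _ _ _ _ _ _ (fd y)).
- move=> y; rewrite in_itv /= => /andP[y0 y1]; rewrite derive1E (@derive_val _ _ _ _ _ _ _ (fd y)).
  by rewrite mulr_ge0 ?(ltW y0)// sin_ge0_pi// (ltW y0)/=; have := @pi_gt0 R; lra.
- by apply: derivable_within_continuous => y _; exact: (@ex_derive _ _ _ _ _ _ _ (fd y)).
- by rewrite in_itv/= lexx.
- by rewrite in_itv/= lexx andbT.
- by [].
Qed.

End Trigonometry.

Section Norms.
Variable R : realType.
Implicit Types (f g : site -> R).

Lemma norm2D f g : fsupp f -> fsupp g -> norm2 (fun x => f x + g x) <= norm2 f + norm2 g.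
Proof.
move=> ff fg; rewrite -(@ler_pXn2r _ 2)// ?nnegrE ?addr_ge0 ?norm2_ge0//.
rewrite norm2_sqr sqrrD !norm2_sqr -mulr_natr.
have -> : lsum (fun z => (f z + g z) ^+ 2) =
   lsum (fun z => f z ^+ 2) + lsum (fun z => f z * g z) * 2 + lsum (fun z => g z ^+ 2).
  rewrite -lsumZr -!lsumD; try fsup.
  by apply: eq_lsum => z; ring.
have : lsum (fun z => f z * g z) <= norm2 f * norm2 g.
  apply: le_trans (ler_norm _) _; apply: le_trans (ler_norm_lsum _) _; first by fsup.
  apply: le_trans _ (lsum_norm_CS ff fg); apply: le_lsum; try fsup.
  by move=> x; rewrite normrM.
lra.
Qed.

Lemma norm2Z c f : norm2 (fun x => c * f x) = `|c| * norm2 f.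
Proof.
rewrite /norm2 -sqrtr_sqr -sqrtrM ?sqr_ge0//; congr Num.sqrt.
by rewrite -lsumZ; apply: eq_lsum => x; rewrite exprMn.
Qed.

Lemma norm2_norm f : norm2 (fun x => `|f x|) = norm2 f.
Proof. by congr Num.sqrt; apply: eq_lsum => x; rewrite real_normK ?num_real. Qed.

Lemma norm2_sqr_le f c : 0 <= c -> norm2 f <= c -> lsum (fun x => f x ^+ 2) <= c ^+ 2.
Proof. by move=> c0 h; rewrite -norm2_sqr lerXn2r ?nnegrE// norm2_ge0. Qed.

Lemma norm2_le_sqr f c : 0 <= c -> lsum (fun x => f x ^+ 2) <= c ^+ 2 -> norm2 f <= c.
Proof. by move=> c0 h; rewrite -(@ler_pXn2r _ 2)// ?nnegrE ?norm2_ge0// norm2_sqr. Qed.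

Lemma lsum_by_parts_sym (f g : site -> R) e : fsupp g ->
  lsum (fun x => f x * (g (x + e) + g (x - e) - 2 * g x)) =
  - lsum (fun x => (f (x + e) - f x) * (g (x + e) - g x)).
Proof.
move=> fg; rewrite -lsum_by_parts//.
have -> : lsum (fun x => f x * (g (x + e) + g (x - e) - 2 * g x)) =
   lsum (fun x => f x * g (x + e)) + lsum (fun x => f x * g (x - e)) - lsum (fun x => 2 * f x * g x).
  rewrite -lsumD; try fsup.
  rewrite -lsumB; try fsup.
  by apply: eq_lsum => x; ring.
rewrite -[X in X + _ - _](lsum_shift _ (- e)) -[X in _ + X - _](lsum_shift _ e) /=.
under [X in X + _ - _]eq_lsum do rewrite subrK.
under [X in _ + X - _]eq_lsum do rewrite addrK.
rewrite -lsumD; try fsup.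
rewrite -lsumB; try fsup.
by apply: eq_lsum => x; ring.
Qed.

End Norms.

(** * The Green profile and the supersolution inequality *)

Section GreenProfile.
Variables (R : realType) (M : nat).
Hypothesis M0 : (0 < M)%N.

Definition green_mass : R := green R M 0.
Local Notation G := green_mass.
(** The small parameter of the proof: its square is of order [pi / ln M] ([gunit_sqr_bounds]), and
    the gradient of the profile has this order in l2. *)
Definition gunit : R := (Num.sqrt G)^-1.
Local Notation w := gunit.
Definition gprof (x : site) : R := green R M x / G.
Local Notation u := gprof.
Definition grad (j : 'I_2) (f : site -> R) (x : site) : R := f (x + unit_vector j) - f x.

Lemma green_mass_ge1 : 1 <= G.
Proof.
rewrite /G green0; case: M M0 => // m _; rewrite big_ord_recl /=.
have -> : wallis R 0 = 1 by [].
by rewrite expr1n lerDl sumr_ge0// => i _; rewrite sqr_ge0.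
Qed.

Lemma green_mass_gt0 : 0 < G. Proof. exact: lt_le_trans ltr01 green_mass_ge1. Qed.

Lemma gunit_gt0 : 0 < w. Proof. by rewrite invr_gt0 sqrtr_gt0 green_mass_gt0. Qed.

Lemma gunit_sqr : w ^+ 2 = G^-1.
Proof. by rewrite exprVn sqr_sqrtr// ltW// green_mass_gt0. Qed.

Lemma gunit_le1 : w <= 1.
Proof.
have := green_mass_ge1; have := gunit_sqr; have := gunit_gt0 => w0 h h1.
have : w ^+ 2 <= 1 by rewrite h invf_le1// green_mass_gt0.
by rewrite expr_le1// ltW.
Qed.

Lemma fsupp_gprof : fsupp u.
Proof. by have := fsupp_green R M => fgr; rewrite /gprof; fsup. Qed.

Lemma gprof01 x : 0 <= u x <= 1.
Proof.
rewrite divr_ge0 ?green_ge0//=.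
by rewrite ler_pdivrMr ?green_mass_gt0// mul1r green_le.
Qed.

Lemma gprof0 : u 0 = 1.
Proof. by rewrite /gprof divff// gt_eqF// green_mass_gt0. Qed.

Lemma lsum_gprof : lsum u = M.*2%:R * w ^+ 2.
Proof. by rewrite lsumZr lsum_green gunit_sqr. Qed.

Lemma lap_gprof x : lap u x = 4 * w ^+ 2 * (srw2 R M.*2 x - (x == 0)%:R).
Proof.
have -> : lap u x = lap (green R M) x / G by rewrite !lapE !nbsumE /gprof; ring.
by rewrite lap_green gunit_sqr; ring.
Qed.

(** By Chapman-Kolmogorov the sum is [w^2] times the sum of the return probabilities at the times
    from [2M] to [4M - 1], each at most [1 / (2M)]. *)
Lemma lsum_gprof_srw2 : 0 <= lsum (fun x => u x * srw2 R M.*2 x) <= w ^+ 2.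
Proof.
have fu := fsupp_gprof; have fs := fsupp_srw2 R.
apply/andP; split.
  by apply: ge0_lsum => x; rewrite mulr_ge0 ?srw2_ge0//; have /andP[] := gprof01 x.
have -> : (fun x => u x * srw2 R M.*2 x) = fun x => \sum_(i < M.*2) (srw2 R M.*2 x * srw2 R i x) * w ^+ 2.
  apply/funext => x; rewrite /gprof /green gunit_sqr mulr_suml mulr_suml; apply: eq_bigr => i _; ring.
rewrite lsum_sum => [|i]; last by fsup.
have CK i : lsum (fun x => srw2 R M.*2 x * srw2 R i x) = srw2 R (M.*2 + i) 0.
  by rewrite srw2_CK; apply: eq_lsum => z; rewrite sub0r srw2N.
under eq_bigr do rewrite lsumZr CK.
rewrite -mulr_suml ler_piMl ?sqr_ge0//.
have N0 : (0 < M.*2%:R :> R) by rewrite ltr0n; lia.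
apply: (@le_trans _ _ (\sum_(i < M.*2) (M.*2%:R)^-1)).
  apply: ler_sum => i _; case: (srw2_le_inv R (M.*2 + i) 0) => [h|]; last by lia.
  by apply: le_trans h _; rewrite lef_pV2 ?posrE ?ltr0n ?ler_nat; lia.
by rewrite sumr_const card_ord -[X in X <= _]mulr_natl divff// gt_eqF.
Qed.

Lemma grad_energy : \sum_(j < 2) lsum (fun x => grad j u x ^+ 2) =
  4 * w ^+ 2 * (1 - lsum (fun x => u x * srw2 R M.*2 x)).
Proof.
have fu := fsupp_gprof; have fs := fsupp_srw2 R.
have E j : lsum (fun x => grad j u x ^+ 2) = - lsum (fun x => u x * (u (x + unit_vector j) + u (x - unit_vector j) - 2 * u x)).
  by rewrite lsum_by_parts_sym// opprK; apply: eq_lsum => x; rewrite expr2.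
under eq_bigr do rewrite E.
rewrite sumrN -lsum_sum => [|j]; last by fsup.
have -> : (fun x => \sum_(j < 2) u x * (u (x + unit_vector j) + u (x - unit_vector j) - 2 * u x)) =
   fun x => 4 * w ^+ 2 * (u x * srw2 R M.*2 x - (x == 0)%:R * u x).
  by apply/funext => x; rewrite -mulr_sumr -/(lap u x) lap_gprof; ring.
rewrite lsumZ lsumB; try fsup.
rewrite lsum_delta gprof0; ring.
Qed.

Lemma grad_energy_le : \sum_(j < 2) lsum (fun x => grad j u x ^+ 2) <= 4 * w ^+ 2.
Proof.
rewrite grad_energy; have /andP[h _] := lsum_gprof_srw2.
have := sqr_ge0 w; nra.
Qed.

Lemma fsupp_grad j f : fsupp f -> fsupp (grad j f).
Proof. by move=> ff; rewrite /grad; fsup. Qed.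

Lemma norm2_grad j : norm2 (grad j u) <= 2 * w.
Proof.
apply: norm2_le_sqr; first by rewrite mulr_ge0// ltW// gunit_gt0.
have -> : (2 * w) ^+ 2 = 4 * w ^+ 2 by ring.
apply: le_trans grad_energy_le; rewrite (bigD1 j)//= lerDl sumr_ge0// => i _.
by apply: ge0_lsum => x; exact: sqr_ge0.
Qed.

Lemma grad_sup j x : `|grad j u x| <= 2 * w.
Proof.
by apply: le_trans (norm_le_norm2 x _) (norm2_grad j); apply: fsupp_grad; exact: fsupp_gprof.
Qed.

(** A discrete Bochner identity: differences commute, so all squared second differences together sum
    to the squared l2 norm of [lap u], which is explicit and at most [32 w^4]. *)
Lemma norm2_grad2 i j : norm2 (grad i (grad j u)) <= 6 * w ^+ 2.
Proof.
have fu := fsupp_gprof; have fs := fsupp_srw2 R M.*2.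
have w0 := sqr_ge0 w.
apply: norm2_le_sqr; first by rewrite mulr_ge0.
pose D (k : 'I_2) (f : site -> R) x := f (x + unit_vector k) + f (x - unit_vector k) - 2 * f x.
have fD k f : fsupp f -> fsupp (D k f) by move=> ff; rewrite /D; fsup.
have E k l : lsum (fun x => grad k (grad l u) x ^+ 2) = lsum (fun x => D k u x * D l u x).
  have fg := fsupp_grad l fu.
  have -> : lsum (fun x => grad k (grad l u) x ^+ 2) = - lsum (fun x => grad l u x * D k (grad l u) x).
    by rewrite /D lsum_by_parts_sym// opprK; apply: eq_lsum => x; rewrite expr2.
  have -> : D k (grad l u) = grad l (D k u).
    apply/funext => x; rewrite /D /grad.
    rewrite ![x + unit_vector l + _]addrAC ![x + unit_vector k + _]addrAC [x - unit_vector k + _]addrAC; ring.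
  rewrite -lsum_by_parts; last exact: fD.
  by apply: eq_lsum => x; rewrite mulrC.
have -> : lsum (fun x => grad i (grad j u) x ^+ 2) = lsum (fun x => D i u x * D j u x) by exact: E.
have T : \sum_(k < 2) \sum_(l < 2) lsum (fun x => D k u x * D l u x) = lsum (fun x => lap u x ^+ 2).
  have fdd k l : fsupp (fun x => D k u x * D l u x) by have fk := fD k _ fu; fsup.
  under eq_bigr => k _ do rewrite -lsum_sum//.
  rewrite -lsum_sum => [|k]; last by apply: fsupp_sum.
  apply: eq_lsum => x; rewrite expr2 {1}/lap mulr_suml; apply: eq_bigr => k _.
  by rewrite /lap mulr_sumr.
apply: (@le_trans _ _ (lsum (fun x => lap u x ^+ 2))).
  rewrite -T (bigD1 i)//= (bigD1 j)//= -addrA lerDl addr_ge0//.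
    by apply: sumr_ge0 => l _; rewrite -E; apply: ge0_lsum => x; exact: sqr_ge0.
  apply: sumr_ge0 => k _; apply: sumr_ge0 => l _; rewrite -E; apply: ge0_lsum => x; exact: sqr_ge0.
rewrite (eq_lsum (g := fun x => 16 * w ^+ 4 * (srw2 R M.*2 x - (x == 0)%:R) ^+ 2)); last first.
  by move=> x; rewrite lap_gprof; ring.
rewrite lsumZ.
have h : lsum (fun x : site => (srw2 R M.*2 x - (x == 0)%:R) ^+ 2) <= 2.
  have -> : 2 = lsum (fun x => srw2 R M.*2 x + (x == 0)%:R * 1) by rewrite lsumD ?lsum_srw2 ?lsum_delta; [|by fsup|by fsup].
  apply: le_lsum; try fsup.
  move=> x; have := srw2_ge0 R M.*2 x; have := srw2_le1 R M.*2 x.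
  by case: (x == 0) => /=; nra.
have -> : (6 * w ^+ 2) ^+ 2 = 36 * w ^+ 4 by ring.
have : 0 <= w ^+ 4 by rewrite exprn_ge0// ltW// gunit_gt0.
nra.
Qed.

End GreenProfile.

(** * The tilted density profile *)

Section Tilt.
Variables (R : realType) (M : nat) (a0 a1 B : R).
Hypothesis M0 : (0 < M)%N.
Hypothesis B1 : 1 <= B.
Hypothesis HB : forall z, Num.min a0 a1 <= z <= Num.max a0 a1 ->
  [/\ 0 < sin z, 0 < cos z & 1 <= B * (sin z * cos z)].
Local Notation D := (a1 - a0).
Hypothesis DB : `|D| <= B.
Local Notation u := (gprof R M).
Local Notation w := (gunit R M).

Definition angle (x : site) : R := a0 + D * u x.
Definition dens x := sin (angle x) ^+ 2.
(** The inverse standard deviation of an occupation of density [sin^2 (angle x)]; [xi] is thus the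
    normalized occupation. *)
Definition rfac x := (sin (angle x) * cos (angle x))^-1.
Definition xi (eta : site -> R) x := rfac x * (eta x - dens x).
Definition sgrad (j : 'I_2) x := sin (D * grad j u x).
(** Chosen so that [cen (tgrad j) dens eta] is [sgrad j] times [xi eta], the variable in which the
    quadratic error is expressed. *)
Definition tgrad (j : 'I_2) x := rfac x * sgrad j x.

Lemma angle_grad j x : angle (x + unit_vector j) - angle x = D * grad j u x.
Proof. by rewrite /angle /grad; ring. Qed.

Lemma angle_trig x : [/\ 0 < sin (angle x), 0 < cos (angle x) & 1 <= B * (sin (angle x) * cos (angle x))].
Proof.
apply: HB; have /andP[u0 u1] := gprof01 R M0 x; rewrite /angle.
have [h|/ltW h] := leP a0 a1; apply/andP; split; nra.
Qed.

Lemma rfac_bound x : 0 < rfac x <= B.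
Proof.
have [s c h] := angle_trig x; rewrite invr_gt0 mulr_gt0//=.
by rewrite -[leLHS]mul1r ler_pdivrMr// mulr_gt0.
Qed.

Lemma dens01 x : 0 <= dens x <= 1.
Proof.
by rewrite sqr_ge0 /= expr_le1// ?sin_le1//; have [/ltW] := angle_trig x.
Qed.

Lemma dens_lip x y : `|dens y - dens x| <= 2 * `|angle y - angle x|.
Proof.
rewrite /dens; have -> : sin (angle y) ^+ 2 - sin (angle x) ^+ 2 =
  (sin (angle y) - sin (angle x)) * (sin (angle y) + sin (angle x)) by ring.
rewrite normrM mulrC ler_pM ?sin_lip//.
by apply: le_trans (ler_normD _ _) _; have := sin_max (angle x); have := sin_max (angle y); lra.
Qed.

Lemma rfac_lip x y : `|rfac y - rfac x| <= 2 * B ^+ 2 * `|angle y - angle x|.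
Proof.
have [sx cx _] := angle_trig x; have [sy cy _] := angle_trig y.
set p := sin (angle x) * cos (angle x); set q := sin (angle y) * cos (angle y).
have p0 : p != 0 by rewrite mulf_neq0// gt_eqF.
have q0 : q != 0 by rewrite mulf_neq0// gt_eqF.
have -> : rfac y - rfac x = rfac x * rfac y * (p - q).
  by rewrite /rfac -/p -/q; field; rewrite p0 q0.
have /andP[rx rxB] := rfac_bound x; have /andP[ry ryB] := rfac_bound y.
rewrite normrM (gtr0_norm (mulr_gt0 rx ry)).
have -> : 2 * B ^+ 2 * `|angle y - angle x| = B * B * (2 * `|angle y - angle x|) by ring.
apply: ler_pM => //; [by rewrite mulr_ge0 ?ltW|by rewrite ler_pM ?(ltW rx) ?(ltW ry)|].
have -> : p - q = - ((sin (angle y) - sin (angle x)) * cos (angle y) + sin (angle x) * (cos (angle y) - cos (angle x))).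
  by rewrite /p /q; ring.
rewrite normrN; apply: le_trans (ler_normD _ _) _; rewrite !normrM.
have h1 := sin_lip (angle x) (angle y); have h2 := cos_lip (angle x) (angle y).
have h3 := cos_max (angle y); have h4 := sin_max (angle x).
have -> : 2 * `|angle y - angle x| = `|angle y - angle x| * 1 + 1 * `|angle y - angle x| by ring.
by apply: lerD; apply: ler_pM.
Qed.

Let w0 : 0 < w. Proof. exact: gunit_gt0. Qed.
Let B0 : 0 < B. Proof. exact: lt_le_trans ltr01 B1. Qed.
Let fu : fsupp u. Proof. exact: fsupp_gprof. Qed.

Lemma Dgrad_le j x : `|D * grad j u x| <= B * `|grad j u x|.
Proof. by rewrite normrM ler_wpM2r. Qed.

Lemma Dgrad_sup j x : `|D * grad j u x| <= 2 * B * w.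
Proof.
apply: le_trans (Dgrad_le j x) _.
by have := grad_sup R M0 j x; have := B0; nra.
Qed.

Lemma fsupp_sgrad j : fsupp (sgrad j).
Proof. by apply: fsupp_sub (fsupp_grad j fu) _ => x; rewrite /sgrad => ->; rewrite mulr0 sin0. Qed.

Lemma fsupp_tgrad j : fsupp (tgrad j).
Proof. by apply: fsuppMr; exact: fsupp_sgrad. Qed.

Lemma sgrad_le j x : `|sgrad j x| <= B * `|grad j u x|.
Proof. exact: le_trans (norm_sin_le _) (Dgrad_le j x). Qed.

Lemma tgrad_le j x : `|tgrad j x| <= B ^+ 2 * `|grad j u x|.
Proof.
have /andP[r0 rB] := rfac_bound x.
rewrite normrM (gtr0_norm r0) expr2 -mulrA ler_pM ?(ltW r0)//; exact: sgrad_le.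
Qed.

Lemma tgrad_sup j x : `|tgrad j x| <= 2 * B ^+ 2 * w.
Proof.
apply: le_trans (tgrad_le j x) _; have := grad_sup R M0 j x; have := sqr_ge0 B; nra.
Qed.

Lemma norm2_tgrad j : norm2 (tgrad j) <= 2 * B ^+ 2 * w.
Proof.
apply: (@le_trans _ _ (norm2 (fun x => B ^+ 2 * grad j u x))).
  apply: norm2_le_mono; [exact: fsupp_tgrad|by apply: fsuppMr; exact: fsupp_grad|move=> x].
  by apply: le_trans (tgrad_le j x) _; rewrite normrM (ger0_norm (sqr_ge0 B)).
rewrite norm2Z (ger0_norm (sqr_ge0 B)); have := norm2_grad R M0 j; have := sqr_ge0 B; nra.
Qed.

(** Of second order in [w] by the product rule: a second difference of [u], or a product of two
    first differences, one of them bounded in supremum. *)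
Lemma norm2_tgrad_grad i j : norm2 (grad i (tgrad j)) <= 30 * B ^+ 4 * w ^+ 2.
Proof.
have fg := fsupp_grad j fu; have fgg := fsupp_grad i fg.
have ft := fsupp_tgrad j.
apply: (@le_trans _ _ (norm2 (fun x => B ^+ 2 * `|grad i (grad j u) x| + 4 * B ^+ 4 * w * `|grad j u x|))).
  apply: norm2_le_mono; [exact: fsupp_grad|by fsup|move=> x].
  set y := x + unit_vector i.
  have -> : grad i (tgrad j) x = rfac y * (sgrad j y - sgrad j x) + (rfac y - rfac x) * sgrad j x.
    by rewrite /grad /tgrad -/y; ring.
  have /andP[r0 rB] := rfac_bound y.
  rewrite [leRHS]ger0_norm; last first.
    by rewrite addr_ge0// ?mulr_ge0// ?sqr_ge0 ?exprn_ge0 ?(ltW B0) ?(ltW w0).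
  apply: le_trans (ler_normD _ _) _; rewrite !normrM; apply: lerD.
    rewrite (gtr0_norm r0) expr2 -mulrA ler_pM ?(ltW r0)//.
    apply: le_trans (sin_lip _ _) _; rewrite -mulrBr normrM ler_wpM2r//.
  have h1 := rfac_lip x y; rewrite angle_grad in h1.
  have h2 := Dgrad_sup i x; have h3 := sgrad_le j x.
  have : `|rfac y - rfac x| <= 2 * B ^+ 2 * (2 * B * w).
    by apply: le_trans h1 _; rewrite ler_wpM2l// mulr_ge0// sqr_ge0.
  move=> h4; have -> : 4 * B ^+ 4 * w * `|grad j u x| = 2 * B ^+ 2 * (2 * B * w) * (B * `|grad j u x|) by ring.
  by rewrite ler_pM.
apply: le_trans (norm2D _ _) _; try fsup.
rewrite !norm2Z !norm2_norm.
have h1 := norm2_grad2 R M0 i j; have h2 := norm2_grad R M0 j.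
have w0' := ltW w0.
rewrite !ger0_norm ?mulr_ge0 ?exprn_ge0 ?(ltW B0)//.
have b2 : B ^+ 2 <= B ^+ 4 by rewrite ler_weXn2l.
have : B ^+ 2 * norm2 (grad i (grad j u)) <= B ^+ 4 * (6 * w ^+ 2).
  by rewrite ler_pM ?norm2_ge0// exprn_ge0// ltW.
have : 4 * B ^+ 4 * w * norm2 (grad j u) <= 4 * B ^+ 4 * w * (2 * w).
  by rewrite ler_wpM2l// mulr_ge0// mulr_ge0// exprn_ge0// ltW.
have : 0 <= B ^+ 4 * w ^+ 2 by rewrite mulr_ge0 ?exprn_ge0// ltW.
have -> : 4 * B ^+ 4 * w * (2 * w) = 8 * (B ^+ 4 * w ^+ 2) by ring.
lra.
Qed.

(** By [sin^2 (p + q) - sin^2 p = sin q sin (2 p + q)] the two increments cancel at first order; a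
    second difference of [u] and a product of two first differences are left. *)
Lemma lap_dens_le x : `|lap dens x| <= \sum_(j < 2)
  (B * `|grad j (grad j u) (x - unit_vector j)| + 4 * B ^+ 2 * w * `|grad j u (x - unit_vector j)|).
Proof.
rewrite /lap; apply: le_trans (ler_norm_sum _ _ _) _; apply: ler_sum => j _.
set e := unit_vector j.
pose h := D * grad j u x; pose k := D * grad j u (x - e).
have Eh : angle (x + e) = angle x + h by rewrite /h -angle_grad; ring.
have Ek : angle (x - e) = angle x - k by rewrite /k -angle_grad subrK; ring.
have -> : dens (x + e) + dens (x - e) - 2 * dens x =
  (sin h - sin k) * sin (2 * angle x + h) + sin k * (sin (2 * angle x + h) - sin (2 * angle x - k)).
  have S (p q : R) : sin (p + q) ^+ 2 - sin p ^+ 2 = sin q * sin (2 * p + q).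
    have -> : 2 * p + q = p + (p + q) by ring.
    rewrite !sinD !cosD.
    have -> : (sin p * cos q + cos p * sin q) ^+ 2 - sin p ^+ 2 =
       sin p ^+ 2 * (cos q ^+ 2 - 1) + 2 * sin p * cos p * sin q * cos q + cos p ^+ 2 * sin q ^+ 2 by ring.
    rewrite (cos2sin2 q); ring.
  have -> : dens (x + e) + dens (x - e) - 2 * dens x =
     (sin (angle x + h) ^+ 2 - sin (angle x) ^+ 2) + (sin (angle x + - k) ^+ 2 - sin (angle x) ^+ 2).
    by rewrite /dens Eh Ek; ring.
  rewrite !S sinN; ring.
have hk : h - k = D * grad j (grad j u) (x - e).
  by rewrite /h /k /grad subrK; ring.
apply: le_trans (ler_normD _ _) _; rewrite !normrM; apply: lerD.
  apply: (@le_trans _ _ (`|h - k| * 1)).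
    by rewrite ler_pM ?sin_lip ?sin_max.
  by rewrite mulr1 hk normrM ler_wpM2r.
have h1 : `|sin k| <= B * `|grad j u (x - e)|.
  by apply: le_trans (norm_sin_le _) _; exact: Dgrad_le.
have h2 : `|sin (2 * angle x + h) - sin (2 * angle x - k)| <= 4 * B * w.
  apply: le_trans (sin_lip _ _) _.
  have -> : 2 * angle x + h - (2 * angle x - k) = h + k by ring.
  apply: le_trans (ler_normD _ _) _.
  have := Dgrad_sup j x; have := Dgrad_sup j (x - e); rewrite -/h -/k; lra.
have -> : 4 * B ^+ 2 * w * `|grad j u (x - e)| = B * `|grad j u (x - e)| * (4 * B * w) by ring.
by rewrite ler_pM.
Qed.

Lemma fsupp_lap_dens : fsupp (lap dens).
Proof.
have fg j := fsupp_grad j fu; have fgg j := fsupp_grad j (fg j).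
apply: (@fsupp_sub _ _ (fun x => \sum_(j < 2)
  (B * `|grad j (grad j u) (x - unit_vector j)| + 4 * B ^+ 2 * w * `|grad j u (x - unit_vector j)|))).
  apply: fsupp_sum => j; have f1 := fg j; have f2 := fgg j.
  have f3 : fsupp (fun x => grad j (grad j u) (x - unit_vector j)) by fsup.
  have f4 : fsupp (fun x => grad j u (x - unit_vector j)) by fsup.
  by fsup.
by move=> x h; have := lap_dens_le x; rewrite h normr_le0 => /eqP.
Qed.

Lemma norm2_lap_dens : norm2 (lap dens) <= 30 * B ^+ 4 * w ^+ 2.
Proof.
have fg j := fsupp_grad j fu; have fgg j := fsupp_grad j (fg j).
pose F j x := B * `|grad j (grad j u) (x - unit_vector j)| + 4 * B ^+ 2 * w * `|grad j u (x - unit_vector j)|.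
have fF j : fsupp (F j).
  have f1 := fg j; have f2 := fgg j.
  have f3 : fsupp (fun x => grad j (grad j u) (x - unit_vector j)) by fsup.
  have f4 : fsupp (fun x => grad j u (x - unit_vector j)) by fsup.
  by rewrite /F; fsup.
have w0' := ltW w0; have B0' := ltW B0.
have nF j : norm2 (F j) <= 14 * B ^+ 2 * w ^+ 2.
  have f1 := fg j; have f2 := fgg j.
  have f3 : fsupp (fun x => grad j (grad j u) (x - unit_vector j)) by fsup.
  have f4 : fsupp (fun x => grad j u (x - unit_vector j)) by fsup.
  rewrite /F; apply: le_trans (norm2D _ _) _; try fsup.
  rewrite !norm2Z !norm2_norm (norm2_shift (grad j (grad j u))) (norm2_shift (grad j u)).
  have h1 := norm2_grad2 R M0 j j; have h2 := norm2_grad R M0 j.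
  rewrite !ger0_norm ?mulr_ge0 ?exprn_ge0//.
  have b2 : B <= B ^+ 2 by rewrite -{1}[B]expr1 ler_weXn2l.
  have : B * norm2 (grad j (grad j u)) <= B ^+ 2 * (6 * w ^+ 2) by rewrite ler_pM ?norm2_ge0.
  have : 4 * B ^+ 2 * w * norm2 (grad j u) <= 4 * B ^+ 2 * w * (2 * w).
    by rewrite ler_wpM2l// !mulr_ge0// exprn_ge0.
  have -> : 4 * B ^+ 2 * w * (2 * w) = 8 * (B ^+ 2 * w ^+ 2) by ring.
  lra.
apply: (@le_trans _ _ (norm2 (fun x => F ord0 x + F ord_max x))).
  apply: norm2_le_mono; [exact: fsupp_lap_dens|exact: fsuppD|move=> x].
  by rewrite -(sum2 (F^~ x)); apply: le_trans (lap_dens_le x) (ler_norm _).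
apply: le_trans (norm2D (fF _) (fF _)) _.
have b2 : B ^+ 2 <= B ^+ 4 by rewrite ler_weXn2l.
have : B ^+ 2 * w ^+ 2 <= B ^+ 4 * w ^+ 2 by rewrite ler_wpM2r// sqr_ge0.
have : 0 <= B ^+ 4 * w ^+ 2 by rewrite mulr_ge0 ?exprn_ge0.
have := nF ord0; have := nF ord_max; lra.
Qed.

Lemma dens_grad_sup x j : `|dens (x + unit_vector j) - dens x| <= 4 * B * w.
Proof.
by apply: le_trans (dens_lip _ _) _; rewrite angle_grad; have := Dgrad_sup j x; lra.
Qed.

Lemma xi_le eta x : 0 <= eta x <= 1 -> `|xi eta x| <= B.
Proof.
move=> /andP[e0 e1]; have /andP[r0 rB] := rfac_bound x; have /andP[d0 d1] := dens01 x.
rewrite normrM (gtr0_norm r0) -[leRHS]mulr1 ler_pM ?(ltW r0)//.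
by rewrite ler_norml; apply/andP; split; lra.
Qed.

End Tilt.

Section BilinearBounds.
Variable R : realType.
Implicit Types (g h v : site -> R).

Lemma bilDg g h v : fsupp g -> fsupp h -> fsupp v ->
  bil (fun z => g z + h z) v v = bil g v v + bil h v v.
Proof.
move=> fg fh fv; rewrite /bil -lsumD; try fsup.
apply: eq_lsum => x; rewrite -mulrDr /conv -lsumD; try fsup.
by congr (_ * _); apply: eq_lsum => z; rewrite mulrDl.
Qed.

Lemma bilNg g v : bil (fun z => - g z) v v = - bil g v v.
Proof.
rewrite /bil -lsumN; apply: eq_lsum => x; rewrite -mulrN /conv -lsumN.
by congr (_ * _); apply: eq_lsum => z; rewrite mulNr.
Qed.

Lemma norm_bil g v : fsupp g -> fsupp v -> `|bil g v v| <= norm1 g * norm2 v ^+ 2.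
Proof.
move=> fg fv; have fc := fsupp_conv fg fv.
apply: le_trans (ler_norm_lsum _) _; first by fsup.
apply: (@le_trans _ _ (norm2 v * norm2 (conv g v))).
  apply: le_trans _ (lsum_norm_CS fv fc); apply: le_lsum; try fsup.
  by move=> x; rewrite normrM.
have := conv_norm2 fg fv; have := @norm2_ge0 R v; nra.
Qed.

Lemma bil_nbrk j v : fsupp v -> bil (nbrk R j) v v = lsum (fun x => v x * v (x + unit_vector j)).
Proof.
move=> fv.
have cE x : conv (nbrk R j) v x = (v (x + unit_vector j) + v (x - unit_vector j)) / 2.
  have D (a : site) : lsum (fun z => (z == a)%:R * v (x + z)) = v (x + a).
    by rewrite (lsum_delta (fun z => v (x + z))).
  rewrite /conv /nbrk -!D -lsumD; try fsup.
  rewrite -lsumZr; apply: eq_lsum => z; ring.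
have -> : bil (nbrk R j) v v = lsum (fun x => (v x * v (x + unit_vector j) + v x * v (x - unit_vector j)) / 2).
  by apply: eq_lsum => x; rewrite cE; ring.
rewrite lsumZr lsumD; try fsup.
have -> : lsum (fun x => v x * v (x - unit_vector j)) = lsum (fun x => v x * v (x + unit_vector j)).
  by rewrite -(lsum_shift _ (unit_vector j)); apply: eq_lsum => x; rewrite addrK mulrC.
by field.
Qed.

Lemma conv_srw2 m v x : fsupp v -> conv (srw2 R m.*2) v x = conv (srw2 R m) (conv (srw2 R m) v) x.
Proof.
move=> fv; have fm := fsupp_srw2 R m.
rewrite {1}/conv; under eq_lsum do rewrite -addnn srw2_CK -lsumZr.
have [s sm] := fm; have [r rv] := fv.
rewrite (@exchange_lsum _ _ [seq y - x | y <- r] s); last first.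
  move=> z y; rewrite mulf_eq0 negb_or => /andP[+ /rv zr]; rewrite mulf_eq0 negb_or => /andP[/sm ys _].
  by rewrite ys andbT; apply/mapP; exists (x + z) => //; rewrite addrC addKr.
rewrite [RHS]/conv; apply: eq_lsum => y; rewrite [conv _ _ _]/conv -lsumZ -[LHS](lsum_shift _ y); apply: eq_lsum => z.
by rewrite addrK -mulrA; congr (_ * (_ * v _)); rewrite addrA addrAC.
Qed.

(** The kernel at time [2m] is the square of a symmetric kernel, so the form is a squared l2
    norm. *)
Lemma bil_srw2_ge0 m v : fsupp v -> 0 <= bil (srw2 R m.*2) v v.
Proof.
move=> fv; have fm := fsupp_srw2 R m; have fc := fsupp_conv fm fv.
have -> : bil (srw2 R m.*2) v v = bil (srw2 R m) v (conv (srw2 R m) v).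
  by apply: eq_lsum => x; rewrite conv_srw2.
rewrite bilC//; last by move=> z; exact: srw2N.
by apply: ge0_lsum => x; rewrite -expr2 sqr_ge0.
Qed.

End BilinearBounds.

(** * Expansion of the test function bond by bond *)

Section Supersolution.
Variables (R : realType) (M : nat) (a0 a1 B : R).
Hypothesis M0 : (0 < M)%N.
Hypothesis B1 : 1 <= B.
Hypothesis HB : forall z, Num.min a0 a1 <= z <= Num.max a0 a1 ->
  [/\ 0 < sin z, 0 < cos z & 1 <= B * (sin z * cos z)].
Local Notation D := (a1 - a0).
Hypothesis DB : `|D| <= B.
Local Notation u := (gprof R M).
Local Notation w := (gunit R M).
Local Notation xi := (xi M a0 a1).
Local Notation dens := (dens M a0 a1).
Local Notation sgrad := (sgrad M a0 a1).
Local Notation tgrad := (tgrad M a0 a1).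
Variables (g : 'I_2 -> site -> R) (Mc : 'I_2 -> nat) (N eps : R).
Hypotheses (fg : forall i, fsupp (g i)) (ge : forall i z, g i (- z) = g i z).
Hypothesis geps : forall i, lsum (fun z => `|pair_kernel (g i) z - (nbrk R i z - srw2 R (Mc i).*2 z)|) <= eps.
Hypotheses (N1 : 1 <= N) (gN : forall i, norm1 (g i) <= N).
Hypothesis small : 64 * N * B ^+ 4 * w <= 2^-1.
Variable eta : site -> R.
Hypothesis e01 : forall z, 0 <= eta z <= 1.

Definition bondG (j : 'I_2) x := \sum_(i < 2) dQ (g i) (tgrad i) dens eta x (x + unit_vector j).
(* phi0 is multiplied by 1 + bondX j x, exactly, when the occupations of x and
   x + unit_vector j are exchanged; the quadratic form changes by bondG j x. *)
Definition bondX (j : 'I_2) x :=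
  - sgrad j x ^+ 2 * (1 + xi eta x * xi eta (x + unit_vector j))
  + sgrad j x * cos (D * grad j u x) * (xi eta x - xi eta (x + unit_vector j)).

Let w0 : 0 < w. Proof. exact: gunit_gt0. Qed.
Let w1 : w <= 1. Proof. exact: gunit_le1. Qed.
Let B0 : 0 < B. Proof. exact: lt_le_trans ltr01 B1. Qed.
Let N0 : 0 < N. Proof. exact: lt_le_trans ltr01 N1. Qed.
Let fu : fsupp u. Proof. exact: fsupp_gprof. Qed.
Let B4 : 1 <= B ^+ 4. Proof. exact: exprn_ege1. Qed.
Let B2 : 1 <= B ^+ 2. Proof. exact: exprn_ege1. Qed.
Let S j x := \sum_(i < 2) (`|tgrad i x| + `|tgrad i (x + unit_vector j)|).

Lemma bondG_le j x : `|bondG j x| <= 8 * N * B ^+ 2 * w * S j x.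
Proof.
rewrite /bondG /S mulr_sumr; apply: le_trans (ler_norm_sum _ _ _) _; apply: ler_sum => i _.
have ft := fsupp_tgrad M a0 a1 i.
apply: le_trans (dQ_le (fg i) ft _ _ e01 (dens01 M0 HB) (tgrad_sup M0 HB DB i)) _.
have -> : 4 * norm1 (g i) * (2 * B ^+ 2 * w) = norm1 (g i) * (8 * B ^+ 2 * w) by ring.
have -> : 8 * N * B ^+ 2 * w = N * (8 * B ^+ 2 * w) by ring.
by rewrite ler_wpM2r ?addr_ge0// ler_wpM2r// !mulr_ge0// ?(ltW w0) ?(ltW B0).
Qed.

Lemma bondG_half j x : `|bondG j x| <= 2^-1.
Proof.
apply: le_trans (bondG_le j x) _; apply: le_trans _ small.
have t i y := tgrad_sup M0 HB DB i y.
have : S j x <= 8 * B ^+ 2 * w.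
  rewrite /S sum2; have := t ord0 x; have := t ord0 (x + unit_vector j).
  have := t ord_max x; have := t ord_max (x + unit_vector j); lra.
move=> h; have p : 0 <= 8 * N * B ^+ 2 * w.
  by rewrite !mulr_ge0 ?(ltW w0) ?(ltW N0) ?(ltW B0).
apply: le_trans (ler_wpM2l p h) _.
have -> : 8 * N * B ^+ 2 * w * (8 * B ^+ 2 * w) = 64 * N * B ^+ 4 * w * w by ring.
by rewrite ler_piMr// !mulr_ge0 ?(ltW w0) ?(ltW N0) ?(ltW B0).
Qed.

Lemma bondX_le j x : `|bondX j x| <= 4 * B ^+ 3 * `|grad j u x|.
Proof.
have xb y := xi_le M0 HB (e01 y).
have h1 := sgrad_le M DB j x; set y := x + unit_vector j.
have h3 : `|sgrad j x| <= 1 by exact: sin_max.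
rewrite /bondX -/y; apply: le_trans (ler_normD _ _) _.
have -> : 4 * B ^+ 3 * `|grad j u x| = B * `|grad j u x| * 1 * (2 * B ^+ 2) + B * `|grad j u x| * 1 * (2 * B ^+ 2) by ring.
apply: lerD; rewrite !normrM ?normrN.
  apply: ler_pM; rewrite ?normr_ge0//.
    by rewrite normrX expr2 ler_pM.
  apply: le_trans (ler_normD _ _) _; rewrite normr1 normrM.
  have : `|xi eta x| * `|xi eta y| <= B * B by rewrite ler_pM.
  have := B2; rewrite !expr2; lra.
apply: ler_pM; rewrite ?mulr_ge0//.
  by rewrite ler_pM// cos_max.
apply: le_trans (ler_normB _ _) _; have := xb x; have := xb y.
have : B <= B ^+ 2 by rewrite -{1}[B]expr1 ler_weXn2l.
lra.
Qed.

(** The factor splits as [(cos d + sin d xi x) (cos d - sin d xi y)], one factor for each end of the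
    bond; [small] keeps both nonnegative. *)
Lemma bondX_gt j x : 0 <= 1 + bondX j x.
Proof.
have /andP[rx rxB] := rfac_bound M0 HB x; set y := x + unit_vector j.
have xb z := xi_le M0 HB (e01 z).
set d := D * grad j u x.
have -> : 1 + bondX j x = (cos d + sin d * xi eta x) * (cos d - sin d * xi eta y).
  rewrite /bondX -/y /sgrad -/d; have := cos2Dsin2 d; move: (cos d) (sin d) => c s E.
  rewrite -[X in X + (_ + _) = _]E; ring.
have h := sgrad_le M DB j x; have h2 := grad_sup R M0 j x.
have hs : `|sin d| <= 2 * B * w by apply: le_trans h _; nra.
have c2 := sin2cos2 d; have c1 := one_sub_cos d.
have dB := Dgrad_sup M0 B1 DB j x; rewrite -/d in dB.
have k z : `|sin d * xi eta z| <= 2^-1.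
  rewrite normrM; apply: (@le_trans _ _ (2 * B * w * B)); first by rewrite ler_pM.
  have -> : 2 * B * w * B = 2 * (B ^+ 2 * w) by ring.
  have : B ^+ 2 * w <= 64^-1.
    have : 64 * (B ^+ 2 * w) <= 2 * (64 * N * B ^+ 4 * w).
      have -> : 2 * (64 * N * B ^+ 4 * w) = 64 * (B ^+ 2 * w) * (2 * N * B ^+ 2) by ring.
      rewrite ler_peMr ?mulr_ge0 ?(ltW w0) ?(le_trans ler01 B2)//; have := N1; have := B2; nra.
    move: small; lra.
  lra.
have cd : 2^-1 <= cos d.
  have : d ^+ 2 <= 2^-1.
    rewrite -[leLHS]real_normK ?num_real//.
    have : `|d| <= 2^-1.
      apply: le_trans dB _.
      have : 64 * (B * w) <= 2 * (64 * N * B ^+ 4 * w).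
        have -> : 2 * (64 * N * B ^+ 4 * w) = 64 * (B * w) * (2 * N * B ^+ 3) by ring.
        have b3 : 1 <= B ^+ 3 by exact: exprn_ege1.
        rewrite ler_peMr ?mulr_ge0 ?(ltW w0) ?(ltW B0)//; have := N1; nra.
      move: small; lra.
    have := normr_ge0 d; nra.
  case/andP: c1 => _; lra.
have := k x; have := k y; rewrite !ler_norml => /andP[? ?] /andP[? ?].
by rewrite mulr_ge0//; lra.
Qed.

(** Only the exponential is expanded, as [1 + bondX] is exact; this uses [|bondG| <= 1/2], and the
    sign of [1 + bondX] to multiply the inequality. *)
Lemma bond_pointwise j x : (1 + bondX j x) * expR (bondG j x) - 1 <=
  bondX j x + bondG j x + 2 * (`|bondG j x| * (`|bondG j x| + `|bondX j x|)).
Proof.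
have h1 := bondG_half j x; have h2 := bondX_gt j x.
have h3 : expR (bondG j x) <= 1 + bondG j x + 2 * bondG j x ^+ 2.
  by apply: expR_le_quadratic; apply: le_trans (ler_norm _) h1.
have h4 : bondG j x ^+ 2 = `|bondG j x| ^+ 2 by rewrite real_normK ?num_real.
have h5 : bondX j x * bondG j x <= `|bondX j x| * `|bondG j x| by rewrite -normrM ler_norm.
have h6 : bondX j x * bondG j x ^+ 2 <= `|bondX j x| * `|bondG j x| * 2^-1.
  rewrite h4 expr2 mulrA; apply: (@le_trans _ _ (`|bondX j x| * `|bondG j x| * `|bondG j x|)).
    by rewrite ler_wpM2r// ler_wpM2r// ler_norm.
  by rewrite ler_wpM2l// mulr_ge0.
have h7 : (1 + bondX j x) * expR (bondG j x) <= (1 + bondX j x) * (1 + bondG j x + 2 * bondG j x ^+ 2).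
  by rewrite ler_wpM2l.
rewrite h4 in h6 h7.
apply: (@le_trans _ _ ((1 + bondX j x) * (1 + bondG j x + 2 * `|bondG j x| ^+ 2) - 1)); first by lra.
have e : (1 + bondX j x) * (1 + bondG j x + 2 * `|bondG j x| ^+ 2) - 1 =
  bondX j x + bondG j x + 2 * `|bondG j x| ^+ 2 + bondX j x * bondG j x + 2 * (bondX j x * `|bondG j x| ^+ 2) by ring.
rewrite e; lra.
Qed.

Lemma fsupp_S j : fsupp (S j).
Proof.
have ft i := fsupp_tgrad M a0 a1 i.
by rewrite /S; apply: fsupp_sum => i; have fti := ft i; fsup.
Qed.

Lemma fsupp_bondG j : fsupp (bondG j).
Proof.
apply: fsupp_sub (fsupp_S j) _ => x h; apply/eqP; rewrite -normr_le0.
by apply: le_trans (bondG_le j x) _; rewrite h mulr0.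
Qed.

Lemma fsupp_bondX j : fsupp (bondX j).
Proof.
apply: fsupp_sub (fsupp_grad j fu) _ => x h; apply/eqP; rewrite -normr_le0.
by apply: le_trans (bondX_le j x) _; rewrite h normr0 mulr0.
Qed.

Lemma fsupp_bond j : fsupp (fun x => (1 + bondX j x) * expR (bondG j x) - 1).
Proof.
have fG := fsupp_bondG j; have fX := fsupp_bondX j.
have fE : fsupp (fun x => expR (bondG j x) - 1).
  by apply: fsupp_sub fG _ => x ->; rewrite expR0 subrr.
have -> : (fun x => (1 + bondX j x) * expR (bondG j x) - 1) =
  fun x => bondX j x * expR (bondG j x) + (expR (bondG j x) - 1).
  by apply/funext => x; ring.
by apply: fsuppD => //; exact: fsuppMl.
Qed.

(** [bondG] is [w] times a first difference, hence of order [w^2] in l2, where [bondX] is of order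
    [w]: by Cauchy-Schwarz the products are of order [w^3]. *)
Lemma cross_error j : lsum (fun x => 2 * (`|bondG j x| * (`|bondG j x| + `|bondX j x|)))
  <= 100 * 100 * N ^+ 2 * B ^+ 8 * w ^+ 3.
Proof.
have fS := fsupp_S j; have fG := fsupp_bondG j; have fgr := fsupp_grad j fu.
have w0' := ltW w0; have N0' := ltW N0; have B0' := ltW B0.
have nS : norm2 (S j) <= 8 * B ^+ 2 * w.
  have -> : S j = fun x => (`|tgrad ord0 x| + `|tgrad ord0 (x + unit_vector j)|) +
      (`|tgrad ord_max x| + `|tgrad ord_max (x + unit_vector j)|).
    by apply/funext => x; rewrite /S sum2.
  have f0 := fsupp_tgrad M a0 a1 ord0; have f1 := fsupp_tgrad M a0 a1 ord_max.
  apply: le_trans (norm2D _ _) _; try fsup.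
  have h i : fsupp (tgrad i) -> norm2 (fun x => `|tgrad i x| + `|tgrad i (x + unit_vector j)|) <= 4 * B ^+ 2 * w.
    move=> fi; apply: le_trans (norm2D _ _) _; try fsup.
    rewrite norm2_norm (norm2_shift (fun x => `|tgrad i x|)) norm2_norm.
    have := norm2_tgrad M0 HB DB i; lra.
  have := h ord0 f0; have := h ord_max f1; lra.
have S0 x : 0 <= S j x by apply: sumr_ge0 => i _; rewrite addr_ge0.
have c1 : lsum (fun x => S j x ^+ 2) <= 64 * B ^+ 4 * w ^+ 2.
  have -> : 64 * B ^+ 4 * w ^+ 2 = (8 * B ^+ 2 * w) ^+ 2 by ring.
  by apply: norm2_sqr_le => //; rewrite !mulr_ge0// exprn_ge0.
have c2 : lsum (fun x => `|S j x| * `|grad j u x|) <= 16 * B ^+ 2 * w ^+ 2.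
  apply: le_trans (lsum_norm_CS fS fgr) _.
  have -> : 16 * B ^+ 2 * w ^+ 2 = 8 * B ^+ 2 * w * (2 * w) by ring.
  by rewrite ler_pM ?norm2_ge0// norm2_grad.
apply: (@le_trans _ _ (lsum (fun x => 128 * N ^+ 2 * B ^+ 4 * w ^+ 2 * S j x ^+ 2 +
   64 * N * B ^+ 5 * w * (`|S j x| * `|grad j u x|)))).
  apply: le_lsum; [by fsup|by fsup|move=> x].
  have hG := bondG_le j x; have hX := bondX_le j x.
  rewrite (ger0_norm (S0 x)).
  have -> : 128 * N ^+ 2 * B ^+ 4 * w ^+ 2 * S j x ^+ 2 + 64 * N * B ^+ 5 * w * (S j x * `|grad j u x|) =
     2 * (8 * N * B ^+ 2 * w * S j x * (8 * N * B ^+ 2 * w * S j x + 4 * B ^+ 3 * `|grad j u x|)) by ring.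
  by rewrite ler_wpM2l// ler_pM ?addr_ge0// lerD.
rewrite lsumD; [|by fsup|by fsup].
rewrite !lsumZ.
have p1 : 0 <= 128 * N ^+ 2 * B ^+ 4 * w ^+ 2 by rewrite !mulr_ge0// ?exprn_ge0.
have p2 : 0 <= 64 * N * B ^+ 5 * w by rewrite !mulr_ge0// ?exprn_ge0.
apply: le_trans (lerD (ler_wpM2l p1 c1) (ler_wpM2l p2 c2)) _.
have q1 : N <= N ^+ 2 by rewrite -{1}[N]expr1 ler_weXn2l.
have q2 : B ^+ 7 <= B ^+ 8 by rewrite ler_weXn2l.
have q3 : w ^+ 4 <= w ^+ 3 by rewrite ler_wiXn2l.
have w3 : 0 <= w ^+ 3 by rewrite exprn_ge0.
have n8 : 0 <= N ^+ 2 * B ^+ 8 by rewrite mulr_ge0// exprn_ge0.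
have h1 : N ^+ 2 * B ^+ 8 * w ^+ 4 <= N ^+ 2 * B ^+ 8 * w ^+ 3 by rewrite ler_wpM2l.
have h2 : N * B ^+ 7 * w ^+ 3 <= N ^+ 2 * B ^+ 8 * w ^+ 3.
  by rewrite ler_wpM2r// ler_pM// exprn_ge0.
have -> : 128 * N ^+ 2 * B ^+ 4 * w ^+ 2 * (64 * B ^+ 4 * w ^+ 2) + 64 * N * B ^+ 5 * w * (16 * B ^+ 2 * w ^+ 2)
  = 8192 * (N ^+ 2 * B ^+ 8 * w ^+ 4) + 1024 * (N * B ^+ 7 * w ^+ 3) by ring.
have n83 : 0 <= N ^+ 2 * B ^+ 8 * w ^+ 3 by rewrite mulr_ge0.
lra.
Qed.

End Supersolution.

(** * The supersolution inequality *)

Section SupersolutionInequality.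
Variables (R : realType) (M : nat) (a0 a1 B : R).
Hypothesis M0 : (0 < M)%N.
Hypothesis B1 : 1 <= B.
Hypothesis HB : forall z, Num.min a0 a1 <= z <= Num.max a0 a1 ->
  [/\ 0 < sin z, 0 < cos z & 1 <= B * (sin z * cos z)].
Local Notation D := (a1 - a0).
Hypothesis DB : `|D| <= B.
Local Notation u := (gprof R M).
Local Notation w := (gunit R M).
Local Notation xi := (xi M a0 a1).
Local Notation dens := (dens M a0 a1).
Local Notation sgrad := (sgrad M a0 a1).
Local Notation tgrad := (tgrad M a0 a1).
Variables (g : 'I_2 -> site -> R) (Mc : 'I_2 -> nat) (N eps : R).
Hypotheses (fg : forall i, fsupp (g i)) (ge : forall i z, g i (- z) = g i z).
Hypothesis geps : forall i, lsum (fun z => `|pair_kernel (g i) z - (nbrk R i z - srw2 R (Mc i).*2 z)|) <= eps.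
Hypotheses (N1 : 1 <= N) (gN : forall i, norm1 (g i) <= N).
Hypothesis small : 64 * N * B ^+ 4 * w <= 2^-1.
Variable eta : site -> R.
Hypothesis e01 : forall z, 0 <= eta z <= 1.

Let w0 : 0 < w. Proof. exact: gunit_gt0. Qed.
Let w1 : w <= 1. Proof. exact: gunit_le1. Qed.
Let B0 : 0 < B. Proof. exact: lt_le_trans ltr01 B1. Qed.
Let N0 : 0 < N. Proof. exact: lt_le_trans ltr01 N1. Qed.
Let fu : fsupp u. Proof. exact: fsupp_gprof. Qed.
Let B4 : 1 <= B ^+ 4. Proof. exact: exprn_ege1. Qed.
Let B2 : 1 <= B ^+ 2. Proof. exact: exprn_ege1. Qed.

Local Notation bondG := (bondG M a0 a1 g eta).
Local Notation bondX := (bondX M a0 a1 eta).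
Local Notation v i := (cen (tgrad i) dens eta).

Let gr0 j : fsupp (grad j u). Proof. exact: fsupp_grad. Qed.
Let fs j : fsupp (sgrad j). Proof. exact: fsupp_sgrad. Qed.
Let ft j : fsupp (tgrad j). Proof. exact: fsupp_tgrad. Qed.
Let fv j : fsupp (v j). Proof. exact: fsupp_cen. Qed.
Let xb y : `|xi eta y| <= B. Proof. by have := @xi_le _ _ _ _ _ M0 HB eta y (e01 y). Qed.
Let D2 : D ^+ 2 <= B ^+ 2.
Proof. by rewrite -[leLHS]real_normK ?num_real// lerXn2r ?nnegrE// ltW. Qed.
Let grad2 := \sum_(j < 2) lsum (fun x => grad j u x ^+ 2).

(** Replacing [sin] by its argument costs [w^4], and so does the diffuse part of [lap u] in the
    energy of [u]. *)
Lemma sgrad_energy : 4 * D ^+ 2 * w ^+ 2 - 36 * B ^+ 4 * w ^+ 4 <= \sum_(j < 2) lsum (fun x => sgrad j x ^+ 2).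
Proof.
apply: (@le_trans _ _ (D ^+ 2 * (1 - 8 * B ^+ 2 * w ^+ 2) * grad2)).
  have h1 : grad2 <= 4 * w ^+ 2 by exact: grad_energy_le.
  have h2 : 4 * w ^+ 2 * (1 - w ^+ 2) <= grad2.
    rewrite /grad2 grad_energy//; apply: ler_wpM2l; first by rewrite mulr_ge0// sqr_ge0.
    by have /andP[_ ?] := lsum_gprof_srw2 R M0; lra.
  have h3 : D ^+ 2 * (4 * w ^+ 2 * (1 - w ^+ 2)) <= D ^+ 2 * grad2 by rewrite ler_wpM2l ?sqr_ge0.
  have h4 : D ^+ 2 * (8 * B ^+ 2 * w ^+ 2) * grad2 <= D ^+ 2 * (8 * B ^+ 2 * w ^+ 2) * (4 * w ^+ 2).
    apply: ler_wpM2l => //; apply: mulr_ge0; first exact: sqr_ge0.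
    by apply: mulr_ge0; [apply: mulr_ge0 => //|]; exact: sqr_ge0.
  have h5 : D ^+ 2 * (B ^+ 2 * w ^+ 4) <= B ^+ 2 * (B ^+ 2 * w ^+ 4).
    by rewrite ler_wpM2r// mulr_ge0 ?sqr_ge0 ?exprn_ge0 ?(ltW w0).
  have h6 : D ^+ 2 * w ^+ 4 <= B ^+ 4 * w ^+ 4.
    rewrite ler_wpM2r ?exprn_ge0 ?(ltW w0)//; apply: le_trans D2 _.
    by rewrite ler_weXn2l.
  have -> : D ^+ 2 * (1 - 8 * B ^+ 2 * w ^+ 2) * grad2 = D ^+ 2 * grad2 - D ^+ 2 * (8 * B ^+ 2 * w ^+ 2) * grad2 by ring.
  have e1 : D ^+ 2 * (4 * w ^+ 2 * (1 - w ^+ 2)) = 4 * D ^+ 2 * w ^+ 2 - 4 * (D ^+ 2 * w ^+ 4) by ring.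
  have e2 : D ^+ 2 * (8 * B ^+ 2 * w ^+ 2) * (4 * w ^+ 2) = 32 * (D ^+ 2 * (B ^+ 2 * w ^+ 4)) by ring.
  have e3 : B ^+ 2 * (B ^+ 2 * w ^+ 4) = B ^+ 4 * w ^+ 4 by ring.
  lra.
rewrite /grad2 mulr_sumr; apply: ler_sum => j _; rewrite -lsumZ.
have fj := gr0 j; have fsj := fs j; apply: le_lsum; [by fsup|by fsup|move=> x].
apply: le_trans _ (sin_sqr_lower _).
have h := Dgrad_sup M0 B1 DB j x; set d := D * grad j u x in h *.
have -> : D ^+ 2 * (1 - 8 * B ^+ 2 * w ^+ 2) * grad j u x ^+ 2 = d ^+ 2 - 2 * ((2 * B * w) ^+ 2 * d ^+ 2).
  by rewrite /d; ring.
have -> : 2 * `|d| ^+ 3 * `|d| = 2 * (`|d| ^+ 2 * d ^+ 2) by rewrite -(real_normK (num_real d)); ring.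
have : `|d| ^+ 2 * d ^+ 2 <= (2 * B * w) ^+ 2 * d ^+ 2.
  by rewrite ler_wpM2r ?sqr_ge0// lerXn2r ?nnegrE// !mulr_ge0 ?(ltW B0) ?(ltW w0).
lra.
Qed.

(** [sin d cos d] is [d] up to a cubic error. The part linear in [d] is summed by parts, so that
    [lap u] acts on [xi]. *)
Lemma linear_part : \sum_(j < 2) lsum (fun x => sgrad j x * cos (D * grad j u x) * (xi eta x - xi eta (x + unit_vector j)))
  <= 4 * w ^+ 2 * (D * lsum (fun x => xi eta x * srw2 R M.*2 x) - D * xi eta 0) + 64 * B ^+ 4 * w ^+ 3.
Proof.
have E : \sum_(j < 2) lsum (fun x => D * (grad j u x * (xi eta x - xi eta (x + unit_vector j)))) =
   4 * w ^+ 2 * (D * lsum (fun x => xi eta x * srw2 R M.*2 x) - D * xi eta 0).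
  have fP := fsupp_srw2 R M.*2.
  have -> : \sum_(j < 2) lsum (fun x => D * (grad j u x * (xi eta x - xi eta (x + unit_vector j)))) =
     D * lsum (fun x => xi eta x * lap u x).
    under eq_bigr do rewrite lsumZ.
    rewrite -mulr_sumr; congr (_ * _).
    have -> : (fun x => xi eta x * lap u x) = fun x => \sum_(j < 2) xi eta x * (u (x + unit_vector j) + u (x - unit_vector j) - 2 * u x).
      by apply/funext => x; rewrite /lap mulr_sumr.
    rewrite lsum_sum => [|j]; last by fsup.
    apply: eq_bigr => j _; rewrite lsum_by_parts_sym// -lsumN.
    by apply: eq_lsum => x; rewrite /grad; ring.
  have -> : (fun x => xi eta x * lap u x) = fun x => 4 * w ^+ 2 * (xi eta x * srw2 R M.*2 x - (x == 0)%:R * xi eta x).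
    by apply/funext => x; rewrite lap_gprof//; ring.
  rewrite lsumZ lsumB; [|by fsup|by fsup].
  rewrite lsum_delta; ring.
rewrite -E -lerBlDl -sumrB.
apply: (@le_trans _ _ (\sum_(j < 2) lsum (fun x => 16 * B ^+ 4 * w * grad j u x ^+ 2))); last first.
  under eq_bigr do rewrite lsumZ.
  rewrite -mulr_sumr; have h : grad2 <= 4 * w ^+ 2 by exact: grad_energy_le.
  have -> : 64 * B ^+ 4 * w ^+ 3 = 16 * B ^+ 4 * w * (4 * w ^+ 2) by ring.
  by rewrite ler_wpM2l// !mulr_ge0 ?exprn_ge0 ?(ltW B0) ?(ltW w0).
apply: ler_sum => j _; have fj := gr0 j; have fsj := fs j.
rewrite -lsumB; [|by fsup|by fsup].
apply: le_lsum; [by fsup|by fsup|move=> x].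
have h := Dgrad_sup M0 B1 DB j x; have hD := Dgrad_le M DB j x; rewrite /(sgrad _ _); set d := D * grad j u x in h hD *.
have -> : sin d * cos d * (xi eta x - xi eta (x + unit_vector j)) - D * (grad j u x * (xi eta x - xi eta (x + unit_vector j)))
  = (sin d * cos d - d) * (xi eta x - xi eta (x + unit_vector j)) by rewrite /d; ring.
apply: le_trans (ler_norm _) _; rewrite normrM.
have h1 : `|sin d * cos d - d| <= 4 * `|d| ^+ 3.
  have := sin_sub_id (2 * d).
  have -> : sin (2 * d) - 2 * d = 2 * (sin d * cos d - d).
    have -> : sin (2 * d) = sin (d + d) by congr sin; ring.
    by rewrite sinD; ring.
  rewrite !normrM ger0_norm// exprMn; lra.
have h2 : `|xi eta x - xi eta (x + unit_vector j)| <= 2 * B.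
  by apply: le_trans (ler_normB _ _) _; have := xb x; have := xb (x + unit_vector j); lra.
apply: le_trans (ler_pM _ _ h1 h2) _ => //.
have h3 : `|d| ^+ 3 <= 2 * B * w * (B * `|grad j u x|) ^+ 2.
  by rewrite exprS ler_pM ?exprn_ge0// lerXn2r ?nnegrE// mulr_ge0// ltW.
have e : (B * `|grad j u x|) ^+ 2 = B ^+ 2 * grad j u x ^+ 2 by rewrite exprMn real_normK ?num_real.
rewrite e in h3.
have -> : 16 * B ^+ 4 * w * grad j u x ^+ 2 = 4 * (2 * B * w * (B ^+ 2 * grad j u x ^+ 2)) * (2 * B) by ring.
by rewrite ler_wpM2r ?mulr_ge0 ?(ltW B0)// ler_wpM2l.
Qed.

(** Moving one factor [sgrad] from [x] to its neighbour costs a second difference of [u]; it brings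
    the product of occupations to the form [v x * v y] that the corrector treats. *)
Lemma pair_part j : lsum (fun x => v j x * v j (x + unit_vector j)) - 12 * B ^+ 4 * w ^+ 3 <=
  lsum (fun x => sgrad j x ^+ 2 * (xi eta x * xi eta (x + unit_vector j))).
Proof.
have ftj := ft j; have fsj := fs j; have fvj := fv j; have fj := gr0 j.
have fgj := fsupp_grad j fj.
rewrite lerBlDr -lerBlDl -lsumB; [|by fsup|by fsup].
apply: (@le_trans _ _ (lsum (fun x => B ^+ 2 * (`|tgrad j x| * `|grad j (grad j u) x|)))); last first.
  rewrite lsumZ; have -> : 12 * B ^+ 4 * w ^+ 3 = B ^+ 2 * (2 * B ^+ 2 * w * (6 * w ^+ 2)) by ring.
  rewrite ler_wpM2l ?sqr_ge0//; apply: le_trans (lsum_norm_CS ftj fgj) _.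
  by apply: ler_pM; [exact: norm2_ge0|exact: norm2_ge0|exact: (norm2_tgrad M0 HB DB)|exact: norm2_grad2].
apply: le_lsum; [by fsup|by fsup|move=> x]; set y := x + unit_vector j.
have /andP[e0 e1] := e01 x; have /andP[r0 r1] := dens01 M0 HB x.
have vx z : v j z = sgrad j z * xi eta z by rewrite /cen /(tgrad _ _) /(xi _ _); ring.
have -> : v j x * v j y - sgrad j x ^+ 2 * (xi eta x * xi eta y) =
   v j x * ((sgrad j y - sgrad j x) * xi eta y).
  by rewrite !vx; move: (sgrad j x) (sgrad j y) (xi eta x) (xi eta y) => p q r t; ring.
apply: le_trans (ler_norm _) _; rewrite (normrM (v j x)) (normrM (_ - _)).
have h1 : `|v j x| <= `|tgrad j x|.
  by rewrite normrM ler_piMr// ler_norml; apply/andP; split; lra.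
have h2 : `|sgrad j y - sgrad j x| <= B * `|grad j (grad j u) x|.
  by apply: le_trans (sin_lip _ _) _; rewrite -mulrBr normrM ler_wpM2r.
have -> : B ^+ 2 * (`|tgrad j x| * `|grad j (grad j u) x|) = `|tgrad j x| * (B * `|grad j (grad j u) x| * B) by ring.
by apply: ler_pM => //; apply: ler_pM.
Qed.

(** The corrector turns the drift of [bil (g i)] into the nearest-neighbour form up to [eps]. The
    form with kernel [srw2] enters with a minus sign and is dropped, being nonnegative. *)
Lemma quadratic_part i : \sum_(j < 2) lsum (fun x => dQ (g i) (tgrad i) dens eta x (x + unit_vector j))
  <= lsum (fun x => v i x * v i (x + unit_vector i)) + 4 * eps * B ^+ 4 * w ^+ 2 + 3744 * N * B ^+ 8 * w ^+ 3.
Proof.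
have w0' := ltW w0; have B0' := ltW B0; have N0' := ltW N0.
have t1 z : `|tgrad i z| <= 1.
  apply: le_trans (tgrad_sup M0 HB DB i z) _.
  have : 2 * B ^+ 2 * w <= 64 * N * B ^+ 4 * w.
    rewrite ler_wpM2r//; have : B ^+ 2 <= B ^+ 4 by rewrite ler_weXn2l.
    have := N1; have := B4; nra.
  move: small; lra.
have q0 : forall j, norm2 (fun x => tgrad i (x + unit_vector j) - tgrad i x) <= 30 * B ^+ 4 * w ^+ 2.
  by move=> j; exact: (norm2_tgrad_grad M0 B1 HB DB j i).
have h := sum_dQ (fg i) (ft i) e01 (dens01 M0 HB) t1 (norm2_tgrad M0 HB DB i) q0
  (fsupp_lap_dens M0 B1 DB) (norm2_lap_dens M0 B1 DB) (dens_grad_sup M0 B1 DB).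
have fP := fsupp_srw2 R (Mc i).*2; have fn := fsupp_nbrk R i; have fgi := fg i.
have fK : fsupp (pair_kernel (g i)).
  by rewrite /pair_kernel /lap; apply: fsuppD; [apply: fsuppMr; apply: fsupp_sum => j; fsup|
    apply: fsupp_sum => j; have fnj := fsupp_nbrk R j; fsup].
pose E z := pair_kernel (g i) z - (nbrk R i z - srw2 R (Mc i).*2 z).
have fE : fsupp E by rewrite /E; fsup.
have bK : bil (pair_kernel (g i)) (v i) (v i) <= lsum (fun x => v i x * v i (x + unit_vector i)) + 4 * eps * B ^+ 4 * w ^+ 2.
  have -> : pair_kernel (g i) = fun z => nbrk R i z + (- srw2 R (Mc i).*2 z + E z).
    by apply/funext => z; rewrite /E; ring.
  have fNP := fsuppN fP.
  rewrite (bilDg fn (fsuppD fNP fE) (fv i)) (bilDg fNP fE (fv i)) bilNg bil_nbrk//.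
  have p := bil_srw2_ge0 (Mc i) (fv i).
  have nv : norm2 (v i) ^+ 2 <= 4 * B ^+ 4 * w ^+ 2.
    have -> : 4 * B ^+ 4 * w ^+ 2 = (2 * B ^+ 2 * w) ^+ 2 by ring.
    rewrite lerXn2r ?nnegrE ?norm2_ge0 ?mulr_ge0 ?sqr_ge0//.
    apply: le_trans _ (norm2_tgrad M0 HB DB i); apply: norm2_le_mono => // x.
    have /andP[e0 e1] := e01 x; have /andP[r0 r1] := dens01 M0 HB x.
    by rewrite normrM ler_piMr// ler_norml; apply/andP; split; lra.
  have : `|bil E (v i) (v i)| <= eps * (4 * B ^+ 4 * w ^+ 2).
    apply: le_trans (norm_bil fE (fv i)) _.
    by rewrite ler_pM ?norm1_ge0 ?sqr_ge0// geps.
  rewrite ler_norml => /andP[_ ?]; lra.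
have n1 := gN i; have n0 := @norm1_ge0 R (g i).
set X := 26 * _ + _ + _ in h.
have hX : X <= 3744 * B ^+ 8 * w ^+ 3.
  have w43 : w ^+ 4 <= w ^+ 3 by rewrite ler_wiXn2l.
  have w3 : 0 <= w ^+ 3 by rewrite exprn_ge0.
  have b6 : B ^+ 6 * w ^+ 3 <= B ^+ 8 * w ^+ 3 by rewrite ler_wpM2r// ler_weXn2l.
  have b5 : B ^+ 5 * w ^+ 3 <= B ^+ 8 * w ^+ 3 by rewrite ler_wpM2r// ler_weXn2l.
  have b8 : B ^+ 8 * w ^+ 4 <= B ^+ 8 * w ^+ 3 by rewrite ler_wpM2l// exprn_ge0.
  have -> : X = 1560 * (B ^+ 6 * w ^+ 3) + 1800 * (B ^+ 8 * w ^+ 4) + 384 * (B ^+ 5 * w ^+ 3) by rewrite /X; ring.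
  lra.
have X0 : 0 <= X by rewrite /X !addr_ge0// !mulr_ge0// ?exprn_ge0// !mulr_ge0// ?exprn_ge0.
have : norm1 (g i) * X <= N * (3744 * B ^+ 8 * w ^+ 3) by rewrite ler_pM.
move: h; rewrite ler_norml => /andP[_ ?]; lra.
Qed.

(** The nearest-neighbour forms of [pair_part] and [quadratic_part] enter with opposite signs and
    cancel. The factor 8 is 4 for each direction, and [300 * 100] rounds up the collected
    constants. *)
Lemma super_ineq : \sum_(j < 2) lsum (fun x => (1 + bondX j x) * expR (bondG j x) - 1) <=
  4 * w ^+ 2 * (D * lsum (fun x => xi eta x * srw2 R M.*2 x) - D * xi eta 0 - D ^+ 2)
  + 8 * eps * B ^+ 4 * w ^+ 2 + 300 * 100 * N ^+ 2 * B ^+ 8 * w ^+ 3.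
Proof.
have w0' := ltW w0; have B0' := ltW B0; have N0' := ltW N0.
have fX j := fsupp_bondX M0 B1 HB DB e01 j.
have fG j := fsupp_bondG M0 B1 HB DB fg gN e01 j.
have S1 j : lsum (fun x => (1 + bondX j x) * expR (bondG j x) - 1) <=
   lsum (bondX j) + lsum (bondG j) + 100 * 100 * N ^+ 2 * B ^+ 8 * w ^+ 3.
  have fXj := fX j; have fGj := fG j.
  have := cross_error M0 B1 HB DB fg N1 gN e01 j.
  have : lsum (fun x => (1 + bondX j x) * expR (bondG j x) - 1) <=
     lsum (fun x => (bondX j x + bondG j x) + 2 * (`|bondG j x| * (`|bondG j x| + `|bondX j x|))).
    apply: le_lsum; [exact: (fsupp_bond M0 B1 HB DB fg gN e01)|by fsup|move=> x].
    exact: (bond_pointwise M0 B1 HB DB fg N1 gN small e01).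
  have -> : lsum (fun x => (bondX j x + bondG j x) + 2 * (`|bondG j x| * (`|bondG j x| + `|bondX j x|))) =
     lsum (bondX j) + lsum (bondG j) + lsum (fun x => 2 * (`|bondG j x| * (`|bondG j x| + `|bondX j x|))).
    rewrite lsumD; [|by fsup|by fsup].
    by rewrite lsumD.
  lra.
have S2 j : lsum (bondX j) = - lsum (fun x => sgrad j x ^+ 2)
   - lsum (fun x => sgrad j x ^+ 2 * (xi eta x * xi eta (x + unit_vector j)))
   + lsum (fun x => sgrad j x * cos (D * grad j u x) * (xi eta x - xi eta (x + unit_vector j))).
  have fsj := fs j.
  rewrite -lsumN -lsumB; [|by fsup|by fsup].
  rewrite -lsumD; [|by fsup|by fsup].
  by apply: eq_lsum => x; rewrite /(bondX _ _); ring.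
have S3 : \sum_(j < 2) lsum (bondG j) = \sum_(i < 2) \sum_(j < 2) lsum (fun x => dQ (g i) (tgrad i) dens eta x (x + unit_vector j)).
  rewrite exchange_big; apply: eq_bigr => j _; rewrite /(bondG _ _) lsum_sum// => i.
  have fti := ft i; have fci := fsupp_conv (fg i) (fv i).
  rewrite /dQ; apply: fsuppD; first by fsup.
  by apply: fsuppMr; apply: fsuppB; [apply: fsuppMr; fsup|do 2 apply: fsuppMl; apply: fsuppMr; fsup].
have := sgrad_energy; have := linear_part; have := S3.
have := quadratic_part ord0; have := quadratic_part ord_max.
have := pair_part ord0; have := pair_part ord_max.
rewrite !sum2; move: (S1 ord0) (S1 ord_max) (S2 ord0) (S2 ord_max).
repeat (move: (lsum _) => ?).
have w43 : w ^+ 4 <= w ^+ 3 by rewrite ler_wiXn2l.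
have w3 : 0 <= w ^+ 3 by rewrite exprn_ge0.
have q1 : 1 <= N ^+ 2 by rewrite exprn_ege1.
have q2 : N <= N ^+ 2 by rewrite -{1}[N]expr1 ler_weXn2l.
have b48 : B ^+ 4 <= B ^+ 8 by rewrite ler_weXn2l.
have b8 : 0 <= B ^+ 8 by rewrite exprn_ge0.
have k1 : B ^+ 4 * w ^+ 3 <= N ^+ 2 * (B ^+ 8 * w ^+ 3).
  apply: (@le_trans _ _ (B ^+ 8 * w ^+ 3)); first by rewrite ler_wpM2r.
  by rewrite ler_peMl// mulr_ge0.
have k2 : N * (B ^+ 8 * w ^+ 3) <= N ^+ 2 * (B ^+ 8 * w ^+ 3) by rewrite ler_wpM2r// mulr_ge0.
have k3 : B ^+ 4 * w ^+ 4 <= B ^+ 4 * w ^+ 3 by rewrite ler_wpM2l// exprn_ge0.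
have k0 : 0 <= N ^+ 2 * (B ^+ 8 * w ^+ 3) by rewrite !mulr_ge0// exprn_ge0.
lra.
Qed.

End SupersolutionInequality.

(** * The semigroup on cylinder functions *)

Section Cylinder.
Variable R : realType.
Implicit Types (f g : config -> R) (eta zeta : config) (A : seq site).

Definition dep A f := forall eta zeta, (forall z, z \in A -> eta z = zeta z) -> f eta = f zeta.

Definition config_of (s : seq site) : config := fun z => z \in s.

Lemma dep_sub A B f : {subset A <= B} -> dep A f -> dep B f.
Proof. by move=> AB Af eta zeta h; apply: Af => z /AB; exact: h. Qed.

Lemma cylinder_cst (c : R) : cylinder (fun=> c). Proof. by exists [::]. Qed.

Lemma cylinder_comp2 (h : R -> R -> R) f g : cylinder f -> cylinder g -> cylinder (fun eta => h (f eta) (g eta)).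
Proof.
move=> [A Af] [B Bg]; exists (A ++ B) => eta zeta e.
by rewrite (Af eta zeta) 1?(Bg eta zeta)// => z zA; apply: e; rewrite mem_cat zA ?orbT.
Qed.

Lemma cylinder_comp (h : R -> R) f : cylinder f -> cylinder (fun eta => h (f eta)).
Proof. by move=> cf; apply: (cylinder_comp2 (fun x _ => h x) cf cf). Qed.

Lemma cylinderD f g : cylinder f -> cylinder g -> cylinder (fun eta => f eta + g eta).
Proof. exact: cylinder_comp2. Qed.

Lemma cylinderM f g : cylinder f -> cylinder g -> cylinder (fun eta => f eta * g eta).
Proof. exact: cylinder_comp2. Qed.

Lemma cylinder_at (z : site) (h : bool -> R) : cylinder (fun eta => h (eta z)).
Proof. by exists [:: z] => eta zeta -> //; rewrite inE. Qed.

Lemma cylinder_sum (I : Type) (r : seq I) (P : pred I) (F : I -> config -> R) :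
  (forall i, cylinder (F i)) -> cylinder (fun eta => \sum_(i <- r | P i) F i eta).
Proof.
move=> cF; elim: r => [|i r IH].
  by exists [::] => eta zeta _; rewrite !big_nil.
under [X in cylinder X]funext => eta do rewrite big_cons.
by case: (P i) => //; exact: cylinderD.
Qed.

Lemma cylinder_prod (I : Type) (r : seq I) (F : I -> config -> R) :
  (forall i, cylinder (F i)) -> cylinder (fun eta => \prod_(i <- r) F i eta).
Proof.
move=> cF; elim: r => [|i r IH].
  by exists [::] => eta zeta _; rewrite !big_nil.
under [X in cylinder X]funext => eta do rewrite big_cons.
exact: cylinderM.
Qed.

Definition swap (x y z : site) : site := if z == x then y else if z == y then x else z.

Lemma exchangeE x y eta z : exchange x y eta z = eta (swap x y z).
Proof. by rewrite /exchange /swap; case: eqP => // _; case: eqP. Qed.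

Lemma swapK x y : involutive (swap x y).
Proof.
move=> z; rewrite /swap; case: (eqVneq z x) => [->|zx].
  by rewrite eqxx; case: eqP.
by case: (eqVneq z y) => [->|zy]; rewrite ?eqxx// (negbTE zx) (negbTE zy).
Qed.

Lemma exchangeK x y : involutive (exchange x y).
Proof. by move=> eta; apply/funext => z; rewrite !exchangeE swapK. Qed.

Lemma dep_exchange A x y f : dep A f -> dep [seq swap x y z | z <- A] (fun eta => f (exchange x y eta)).
Proof.
move=> Af eta zeta e; apply: Af => z zA; rewrite !exchangeE; apply: e.
by apply/mapP; exists z.
Qed.

Lemma cylinder_exchange x y f : cylinder f -> cylinder (fun eta => f (exchange x y eta)).
Proof. by move=> [A Af]; exists [seq swap x y z | z <- A]; exact: dep_exchange. Qed.

Lemma exchange_out A x y f eta : dep A f -> x \notin A -> y \notin A -> f (exchange x y eta) = f eta.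
Proof.
move=> Af xA yA; apply: Af => z zA; rewrite /exchange.
case: eqP => [zx|_]; first by move: zA; rewrite zx (negbTE xA).
by case: eqP => [zy|//]; move: zA; rewrite zy (negbTE yA).
Qed.

(** Reduces cylinder functions to indicators of patterns, the events to which the Markov property
    and the initial law apply. *)
Lemma cylinder_pattern A f : dep A f -> forall eta, f eta =
  \sum_(m : (size A).-tuple bool) f (config_of (mask m A)) * ([seq eta z | z <- A] == m)%:R.
Proof.
move=> Af eta.
have sz : size [seq eta z | z <- A] == size A by rewrite size_map.
rewrite (bigD1 (Tuple sz))//= eqxx mulr1 [X in _ + X]big1 ?addr0.
  apply: Af => z zA; rewrite /config_of -filter_mask mem_filter zA andbT //.
by move=> m; rewrite -val_eqE /= eq_sym => /negbTE ->; rewrite mulr0.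
Qed.

Lemma cylinder_bounded f : cylinder f -> exists2 c, 0 <= c & forall eta, `|f eta| <= c.
Proof.
move=> [A Af]; exists (\sum_(m : (size A).-tuple bool) `|f (config_of (mask m A))|).
  exact: sumr_ge0.
move=> eta; rewrite (cylinder_pattern Af); apply: le_trans (ler_norm_sum _ _ _) _.
apply: ler_sum => m _; rewrite normrM; case: (_ == _); rewrite ?normr1 ?mulr1//.
by rewrite normr0 mulr0.
Qed.

(** Sums of functions of at most [k] sites each, with sup norms adding up to at most [c]. An
    exchange permutes sites, so the generator keeps [k] and multiplies [c] by a constant: its powers
    grow geometrically although their supports keep growing. *)
Inductive cls (k : nat) : R -> (config -> R) -> Prop :=
| cls_atom A c f : (size A <= k)%N -> dep A f -> (forall eta, `|f eta| <= c) -> cls k c f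
| cls_add c d f g : cls k c f -> cls k d g -> cls k (c + d) (fun eta => f eta + g eta).

Lemma cls_le k c f : cls k c f -> forall eta, `|f eta| <= c.
Proof.
elim=> [//|{}c d {}f g _ hf _ hg] eta.
by apply: le_trans (ler_normD _ _) _; apply: lerD.
Qed.

Lemma cls_cylinder k c f : cls k c f -> cylinder f.
Proof. by elim=> [A {}c {}f _ Af _|{}c d {}f g _ cf _ cg]; [exists A|exact: cylinderD]. Qed.

Lemma cls_ge0 k c f : cls k c f -> 0 <= c.
Proof. by move=> /cls_le /(_ point); exact: le_trans. Qed.

Lemma cls_scale k c a f : cls k c f -> cls k (`|a| * c) (fun eta => a * f eta).
Proof.
elim=> [A {}c {}f sA Af fc|{}c d {}f g _ cf _ cg].
  apply: (@cls_atom k A) => // [eta zeta e|eta]; first by rewrite (Af eta zeta).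
  by rewrite normrM ler_wpM2l.
rewrite mulrDr; under [X in cls _ _ X]funext => eta do rewrite mulrDr.
exact: cls_add.
Qed.

Lemma cls_sum k (I : Type) (r : seq I) (c : I -> R) (F : I -> config -> R) :
  (forall i, cls k (c i) (F i)) -> cls k (\sum_(i <- r) c i) (fun eta => \sum_(i <- r) F i eta).
Proof.
move=> h; elim: r => [|i r IH].
  under [X in cls _ _ X]funext => eta do rewrite big_nil.
  by rewrite big_nil; apply: (@cls_atom k [::]) => // eta; rewrite normr0.
under [X in cls _ _ X]funext => eta do rewrite big_cons.
by rewrite big_cons; exact: cls_add.
Qed.

Lemma cylinder_cls f : cylinder f -> exists k c, cls k c f.
Proof.
move=> cf; have [c _ fc] := cylinder_bounded cf; have [A Af] := cf.
by exists (size A), c; apply: (@cls_atom _ A).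
Qed.

Variable T : R.
Hypothesis T0 : 0 <= T.
Local Notation L := (ssep_generator T).

(** The starting points of all bonds that touch [A], both directions in one list. *)
Definition bonds A := undup (A ++ [seq z - unit_vector ord0 | z <- A] ++ [seq z - unit_vector ord_max | z <- A]).

Lemma size_bonds A : (size (bonds A) <= 3 * size A)%N.
Proof. by apply: leq_trans (size_undup _) _; rewrite !size_cat !size_map !mulSn mul0n addn0. Qed.

Lemma mem_bonds A x j : x \notin bonds A -> x \notin A /\ x + unit_vector j \notin A.
Proof.
rewrite mem_undup !mem_cat !negb_or => /and3P[xA x0 x1]; split => //.
have h i : x \notin [seq z - unit_vector i | z <- A] -> x + unit_vector i \notin A.
  by apply: contra => xi; apply/mapP; exists (x + unit_vector i) => //; rewrite addrK.
have : j \in [:: ord0; ord_max] by case: j => [[|[|[]]]] //= *; rewrite !inE.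
by rewrite !inE => /orP[] /eqP ->; exact: h.
Qed.

Lemma generator_seq A f eta : dep A f -> L f eta =
  \sum_(j < 2) \sum_(x <- bonds A) (T / 2 * (f (exchange x (x + unit_vector j) eta) - f eta)).
Proof.
move=> Af; rewrite /ssep_generator mulr_sumr; apply: eq_bigr => j _.
rewrite -mulr_sumr; congr (_ * _); apply: (@lsum_seq _ site) => [|x]; first exact: undup_uniq.
apply: contraR => /(mem_bonds j) [xA yA]; by rewrite (exchange_out _ Af xA yA) subrr.
Qed.

Lemma generator_fsupp f eta j : cylinder f ->
  fsupp (fun x => f (exchange x (x + unit_vector j) eta) - f eta).
Proof.
move=> [A Af]; exists (bonds A) => x.
apply: contraR => /(mem_bonds j) [xA yA]; by rewrite (exchange_out _ Af xA yA) subrr.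
Qed.

Lemma generatorE f eta : L f eta = T / 2 * \sum_(j < 2) lsum (fun x => f (exchange x (x + unit_vector j) eta) - f eta).
Proof. by []. Qed.

Lemma generator_lin a f g eta : cylinder f -> cylinder g ->
  L (fun eta => a * f eta + g eta) eta = a * L f eta + L g eta.
Proof.
move=> cf cg; rewrite !generatorE !sum2.
have E j : lsum (fun x => a * f (exchange x (x + unit_vector j) eta) + g (exchange x (x + unit_vector j) eta) - (a * f eta + g eta)) =
  a * lsum (fun x => f (exchange x (x + unit_vector j) eta) - f eta) + lsum (fun x => g (exchange x (x + unit_vector j) eta) - g eta).
  have f1 := generator_fsupp eta j cf; have f2 := generator_fsupp eta j cg.
  rewrite -lsumZ -lsumD//; last exact: fsuppMr.
  by apply: eq_lsum => x; ring.
by rewrite !E; ring.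
Qed.

Lemma generatorD f g eta : cylinder f -> cylinder g ->
  L (fun eta => f eta + g eta) eta = L f eta + L g eta.
Proof.
move=> cf cg; rewrite -[L f eta]mul1r -generator_lin//.
by congr (L _ eta); apply/funext => z; rewrite mul1r.
Qed.

Lemma cylinder_generator f : cylinder f -> cylinder (L f).
Proof.
move=> [A Af]; under [X in cylinder X]funext => eta do rewrite (generator_seq _ Af).
apply: cylinder_sum => j; apply: cylinder_sum => x.
apply: cylinderM; first exact: cylinder_cst.
apply: (cylinder_comp2 (fun a b => a - b)); last by exists A.
by apply: cylinder_exchange; exists A.
Qed.

(** At most [3 k] starting points and 2 directions, each bond contributing [T / 2] times a
    difference of norm at most [2 c]: hence the factor [6 k T]. *)
Lemma cls_generator k c f : cls k c f -> cls k (6 * k%:R * T * c) (L f).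
Proof.
elim=> [A {}c {}f sA Af fc|{}c d {}f g cf hf cg hg]; last first.
  rewrite mulrDr; under [X in cls _ _ X]funext => eta do
    rewrite (generatorD _ (cls_cylinder cf) (cls_cylinder cg)).
  exact: cls_add.
have c0 : 0 <= c by exact: le_trans (fc point).
have atom x y : cls k (T * c) (fun eta => T / 2 * (f (exchange x y eta) - f eta)).
  have -> : T * c = `|T / 2| * (c + c) by rewrite ger0_norm ?divr_ge0//; field.
  apply: cls_scale; apply: cls_add.
    by apply: (@cls_atom k [seq swap x y z | z <- A]); rewrite ?size_map//; exact: dep_exchange.
  apply: (@cls_atom k A) => // [eta zeta e|eta]; first by rewrite (Af _ _ e).
  by rewrite normrN.
under [X in cls _ _ X]funext => eta do rewrite (generator_seq _ Af).
have h : cls k (\sum_(j < 2) \sum_(x <- bonds A) T * c)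
   (fun eta => \sum_(j < 2) \sum_(x <- bonds A) (T / 2 * (f (exchange x (x + unit_vector j) eta) - f eta))).
  by apply: cls_sum => j; apply: cls_sum => x.
have e : \sum_(j < 2) \sum_(x <- bonds A) T * c <= 6 * k%:R * T * c.
  rewrite sum2 big_const_seq iter_addr_0 count_predT -mulr2n -mulrnA -[leLHS]mulr_natl.
  rewrite -[leRHS]mulrA ler_wpM2r ?mulr_ge0// -natrM ler_nat.
  by have := size_bonds A; move: sA; lia.
have -> : 6 * k%:R * T * c = \sum_(j < 2) \sum_(x <- bonds A) T * c + (6 * k%:R * T * c - \sum_(j < 2) \sum_(x <- bonds A) T * c) by ring.
have h0 : cls k (6 * k%:R * T * c - \sum_(j < 2) \sum_(x <- bonds A) T * c) (fun=> 0).
  by apply: (@cls_atom k [::]) => // eta; rewrite normr0 subr_ge0.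
have := cls_add h h0; congr (cls k _ _).
by apply/funext => eta; rewrite addr0.
Qed.

End Cylinder.

(** * Euler approximation of the semigroup *)

Section SemigroupEstimates.
Variables (R : realType) (T : R) (S : R -> (config -> R) -> (config -> R)).
Hypothesis T0 : 0 <= T.
Hypothesis HS : markov_semigroup S.
Local Notation L := (ssep_generator T).
Hypothesis core : forall f, cylinder f -> generator_graph S f (L f).
Implicit Types (f g : config -> R) (eta : config).

Lemma cylinder_continuous f : cylinder f -> continuous f.
Proof. by move=> /core[]. Qed.

Lemma continuous_lin a f g : continuous f -> continuous g -> continuous (fun eta => a * f eta + g eta).
Proof.
move=> cf cg x; apply: cvgD; last exact: cg.
by apply: cvgM; [exact: cvg_cst|exact: cf].
Qed.

Lemma continuous_mul f g : continuous f -> continuous g -> continuous (fun eta => f eta * g eta).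
Proof. by move=> cf cg x; apply: cvgM; [exact: cf|exact: cg]. Qed.

Lemma continuous_cst (c : R) : continuous (fun _ : config => c).
Proof. by move=> x; exact: cst_continuous. Qed.

Lemma S_lin t a f g eta : 0 <= t -> continuous f -> continuous g ->
  S t (fun eta => a * f eta + g eta) eta = a * S t f eta + S t g eta.
Proof. by move=> t0 cf cg; rewrite (semigroup_linear HS). Qed.

Lemma S_zero t eta : 0 <= t -> S t (fun=> 0) eta = 0.
Proof.
move=> t0; have c0 := @continuous_cst 0; have := S_lin (-1) eta t0 c0 c0.
have -> : (fun _ : config => -1 * 0 + 0) = (fun=> 0) :> (config -> R) by apply/funext => x; ring.
lra.
Qed.

Lemma S_scale t a f eta : 0 <= t -> continuous f -> S t (fun eta => a * f eta) eta = a * S t f eta.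
Proof.
move=> t0 cf; rewrite -[RHS]addr0 -(S_zero eta t0) -S_lin//; last exact: continuous_cst.
by congr (S t _ eta); apply/funext => x; rewrite addr0.
Qed.

Lemma S_add t f g eta : 0 <= t -> continuous f -> continuous g ->
  S t (fun eta => f eta + g eta) eta = S t f eta + S t g eta.
Proof.
move=> t0 cf cg; rewrite -[S t f eta]mul1r -S_lin//.
by congr (S t _ eta); apply/funext => x; rewrite mul1r.
Qed.

Lemma S_sub t f g eta : 0 <= t -> continuous f -> continuous g ->
  S t (fun eta => f eta - g eta) eta = S t f eta - S t g eta.
Proof.
move=> t0 cf cg; rewrite addrC -mulN1r -S_lin//.
by congr (S t _ eta); apply/funext => x; rewrite mulN1r addrC.
Qed.

Lemma S_cst t c eta : 0 <= t -> S t (fun=> c) eta = c.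
Proof.
move=> t0; rewrite -[RHS]mulr1.
have -> : 1 = S t (fun=> 1) eta by rewrite (semigroup1 HS).
rewrite -S_scale//; last exact: continuous_cst.
by congr (S t _ eta); apply/funext => x; rewrite mulr1.
Qed.

Lemma S_le t f g eta : 0 <= t -> continuous f -> continuous g -> (forall z, f z <= g z) ->
  S t f eta <= S t g eta.
Proof.
move=> t0 cf cg fg; rewrite -subr_ge0 -S_sub//.
apply: (semigroup_ge0 HS) => // [|z]; last by rewrite subr_ge0.
have -> : (fun z => g z - f z) = fun z => -1 * f z + g z by apply/funext => z; ring.
exact: continuous_lin.
Qed.

Lemma S_contr t f c eta : 0 <= t -> continuous f -> (forall z, `|f z| <= c) -> `|S t f eta| <= c.
Proof.
move=> t0 cf fc; rewrite ler_norml -[in X in X <= _](S_cst c eta t0) -[in X in _ && (_ <= X)](S_cst c eta t0).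
rewrite -mulN1r -S_scale//; last exact: continuous_cst.
rewrite !S_le//; try exact: continuous_cst.
- by move=> z; have := fc z; rewrite ler_norml => /andP[].
- by move=> z; have := fc z; rewrite ler_norml mulN1r => /andP[].
Qed.

Lemma S_small f e : cylinder f -> 0 < e -> exists2 d, 0 < d &
  forall h, 0 < h < d -> forall eta, `|S h f eta - f eta - h * L f eta| <= h * e.
Proof.
move=> /core[_ _ cv] e0.
have : nbhs (L f : {uniform config -> R}) [set u | forall y, [set: config] y -> `|L f y - u y| < e].
  apply/uniform_nbhs; exists [set xy | `|xy.1 - xy.2| < e]; split => //.
  by rewrite -(@entourage_ballE R R); exists e.
move=> /cv; rewrite /nbhs /= => -[d /= d0 H].
exists d => // h /andP[h0 hd] eta.
have := H h; rewrite /ball_ /= sub0r normrN gtr0_norm// => /(_ hd h0 eta I) /ltW.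
rewrite distrC => H1.
have -> : S h f eta - f eta - h * L f eta = h * ((S h f eta - f eta) / h - L f eta).
  by field; rewrite gt_eqF.
by rewrite normrM gtr0_norm// ler_wpM2l// ltW.
Qed.

Lemma S_step s h f eta : 0 <= s -> 0 <= h -> continuous f ->
  S (s + h) f eta - f eta = S s (fun z => S h f z - f z) eta + (S s f eta - f eta).
Proof.
move=> s0 h0 cf; rewrite (semigroupD HS)// S_sub//; last exact: (semigroup_continuous HS).
by ring.
Qed.

Lemma exists_step (t d : R) : 0 < t -> 0 < d -> exists n : nat, (0 < n)%N /\ 0 < t / n%:R < d.
Proof.
move=> t0 d0; exists (Num.truncn (t / d)).+1; split=> //.
have n0 : 0 < (Num.truncn (t / d)).+1%:R :> R by rewrite ltr0n.
rewrite divr_gt0//= ltr_pdivrMr// mulrC -ltr_pdivrMr//; exact: truncnS_gt.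
Qed.

(** Only the derivative of the semigroup at time 0 is given: [[0, t]] is cut into short steps,
    contraction carries the increment of each step, and the arbitrary error [e] is removed at the
    end. *)
Lemma S_lip t f b eta : cylinder f -> 0 <= t -> (forall z, `|L f z| <= b) -> `|S t f eta - f eta| <= t * b.
Proof.
move=> cf t0 fb; have [->|tn0] := eqVneq t 0.
  by rewrite (semigroup0 HS) ?subrr ?normr0 ?mul0r//; exact: cylinder_continuous.
have {tn0}t0 : 0 < t by rewrite lt_def tn0.
have cc := cylinder_continuous cf.
apply/ler_addgt0Pr => e e0.
have et : 0 < e / t by rewrite divr_gt0.
have [d d0 H] := S_small cf et.
have [n [n0 /andP[h0 hd]]] := exists_step t0 d0; set h := t / n%:R in h0 hd.
have h1 z : `|S h f z - f z| <= h * (b + e / t).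
  have := H h; rewrite h0 hd => /(_ isT z) h1; have := fb z => h2.
  have -> : S h f z - f z = (S h f z - f z - h * L f z) + h * L f z by ring.
  apply: le_trans (ler_normD _ _) _; rewrite mulrDr addrC; apply: lerD => //.
  by rewrite normrM gtr0_norm// ler_wpM2l// ltW.
have nh i : 0 <= i%:R * h by rewrite mulr_ge0// ltW.
have ch : continuous (fun z => S h f z - f z).
  have -> : (fun z => S h f z - f z) = fun z => -1 * f z + S h f z by apply/funext => z; ring.
  by apply: continuous_lin => //; apply: (semigroup_continuous HS) => //; exact: ltW.
have claim i : `|S (i%:R * h) f eta - f eta| <= i%:R * (h * (b + e / t)).
  elim: i => [|i IH]; first by rewrite !mul0r (semigroup0 HS)// subrr normr0.
  have -> : i.+1%:R * h = i%:R * h + h by rewrite -natr1; ring.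
  rewrite S_step// ?(ltW h0)//; apply: le_trans (ler_normD _ _) _.
  rewrite -natr1 mulrDl mul1r addrC; apply: lerD => //; exact: S_contr.
have := claim n; have nn : n%:R != 0 :> R by rewrite pnatr_eq0 -lt0n.
have -> : n%:R * h = t by rewrite /h; field.
have -> : n%:R * (h * (b + e / t)) = t * b + e.
  by rewrite /h; field; rewrite nn gt_eqF.
by [].
Qed.

(** The same cutting; in the [i]-th step [S (i h) (L f)] is compared with [L f] by [S_lip], which
    brings in [L (L f)]. *)
Lemma S_taylor t f b eta : cylinder f -> 0 <= t -> (forall z, `|L (L f) z| <= b) ->
  `|S t f eta - f eta - t * L f eta| <= t ^+ 2 * b.
Proof.
move=> cf t0 fb; have [->|tn0] := eqVneq t 0.
  rewrite (semigroup0 HS) ?subrr ?mul0r ?subrr ?normr0 ?expr0n ?mul0r//; exact: cylinder_continuous.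
have {tn0}t0 : 0 < t by rewrite lt_def tn0.
have cc := cylinder_continuous cf; have cL := cylinder_generator T cf.
have ccL := cylinder_continuous cL.
apply/ler_addgt0Pr => e e0.
have et : 0 < e / t by rewrite divr_gt0.
have [d d0 H] := S_small cf et.
have [n [n0 /andP[h0 hd]]] := exists_step t0 d0; set h := t / n%:R in h0 hd.
have nn : n%:R != 0 :> R by rewrite pnatr_eq0 -lt0n.
have b0 : 0 <= b by exact: le_trans (fb point).
have nh i : 0 <= i%:R * h by rewrite mulr_ge0// ltW.
pose D z := S h f z - f z - h * L f z.
have cD : continuous D.
  have -> : D = fun z => - h * L f z + (-1 * f z + S h f z) by apply/funext => z; rewrite /D; ring.
  by do ?apply: continuous_lin => //; apply: (semigroup_continuous HS) => //; exact: ltW.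
have Db z : `|D z| <= h * (e / t) by apply: H; rewrite h0.
have claim i : (i <= n)%N -> `|S (i%:R * h) f eta - f eta - i%:R * h * L f eta| <= i%:R * (h * (e / t) + h * (t * b)).
  elim: i => [|i IH] ile; first by rewrite !mul0r (semigroup0 HS)// !subrr normr0.
  have -> : i.+1%:R * h = i%:R * h + h by rewrite -natr1; ring.
  have -> : S (i%:R * h + h) f eta - f eta - (i%:R * h + h) * L f eta =
     S (i%:R * h) D eta + h * (S (i%:R * h) (L f) eta - L f eta) + (S (i%:R * h) f eta - f eta - i%:R * h * L f eta).
    rewrite addrAC -addrA.
    have -> : S (i%:R * h) D eta = S (i%:R * h) (fun z => S h f z - f z) eta - h * S (i%:R * h) (L f) eta.
      rewrite -S_scale// -S_sub//.
      - have -> : (fun z => S h f z - f z) = fun z => -1 * f z + S h f z by apply/funext => z; ring.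
        by apply: continuous_lin => //; apply: (semigroup_continuous HS) => //; exact: ltW.
      - have -> : (fun z => h * L f z) = fun z => h * L f z + 0 by apply/funext => z; ring.
        by apply: continuous_lin => //; exact: continuous_cst.
    have := S_step eta (nh i) (ltW h0) cc.
    set A := S (i%:R * h + h) f eta; set Q := S _ (fun z => _) eta; set P := S (i%:R * h) f eta.
    move=> hA; have -> : A = Q + (P - f eta) + f eta by rewrite -hA; ring.
    ring.
  apply: le_trans (ler_normD _ _) _.
  rewrite -[i.+1%:R]natr1 mulrDl mul1r addrC; apply: lerD; first by apply: IH; lia.
  apply: le_trans (ler_normD _ _) _; apply: lerD; first exact: S_contr.
  rewrite normrM gtr0_norm// ler_wpM2l ?(ltW h0)//.
  apply: le_trans (S_lip _ cL (nh i) fb) _; rewrite ler_wpM2r//.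
  by rewrite /h mulrA ler_pdivrMr ?ltr0n// mulrC ler_wpM2l ?(ltW t0)// ler_nat ltnW.
have := claim n (leqnn n).
have -> : n%:R * h = t by rewrite /h; field.
have -> : n%:R * (h * (e / t) + h * (t * b)) = t ^+ 2 * b + e.
  by rewrite /h; field; rewrite nn gt_eqF.
by [].
Qed.

Definition euler (h : R) f : config -> R := fun eta => f eta + h * L f eta.

Lemma cls_euler k c h f : 0 <= h -> cls k c f -> cls k ((1 + h * (6 * k%:R * T)) * c) (euler h f).
Proof.
move=> h0 cf; rewrite mulrDl mul1r; apply: cls_add => //.
rewrite -mulrA -[X in X * _](ger0_norm h0); apply: cls_scale; exact: cls_generator.
Qed.

(** Telescoping between the semigroup and the scheme: each local error is of second order by
    [S_taylor], and [cls] controls [L (L f)] along the iterates. *)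
Lemma euler_error k c h f n eta : 0 <= h -> cls k c f ->
  `|S (n%:R * h) f eta - iter n (euler h) f eta| <=
  n%:R * (h ^+ 2 * (6 * k%:R * T) ^+ 2 * ((1 + h * (6 * k%:R * T)) ^+ n * c)).
Proof.
move=> h0; set K := 6 * k%:R * T.
have K0 : 0 <= K by rewrite !mulr_ge0.
have hK : 1 <= 1 + h * K by rewrite lerDl mulr_ge0.
elim: n c f => [|n IH] c f cf.
  rewrite !mul0r (semigroup0 HS) ?subrr ?normr0//; exact: cylinder_continuous (cls_cylinder cf).
have cc := cylinder_continuous (cls_cylinder cf).
have c0 := cls_ge0 cf.
have cE := cls_euler h0 cf; have ccE := cylinder_continuous (cls_cylinder cE).
have nh : 0 <= n%:R * h by rewrite mulr_ge0.
have -> : n.+1%:R * h = n%:R * h + h by rewrite -natr1; ring.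
have cSh : continuous (S h f) by exact: (semigroup_continuous HS).
have -> : S (n%:R * h + h) f eta - iter n.+1 (euler h) f eta =
   S (n%:R * h) (fun z => S h f z - euler h f z) eta + (S (n%:R * h) (euler h f) eta - iter n (euler h) (euler h f) eta).
  by rewrite (semigroupD HS)// S_sub// -iterSr; ring.
apply: le_trans (ler_normD _ _) _.
rewrite -natr1 mulrDl mul1r addrC; apply: lerD.
  have := IH _ _ cE; congr (_ <= _); rewrite -/K [_ ^+ n.+1]exprSr; ring.
apply: S_contr => //.
  have -> : (fun z => S h f z - euler h f z) = fun z => -1 * euler h f z + S h f z by apply/funext => z; ring.
  exact: continuous_lin.
move=> z; have -> : S h f z - euler h f z = S h f z - f z - h * L f z by rewrite /euler; ring.
have L2 := cls_le (cls_generator T0 (cls_generator T0 cf)).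
apply: le_trans (S_taylor z (cls_cylinder cf) h0 L2) _.
have -> : h ^+ 2 * (6 * k%:R * T * (6 * k%:R * T * c)) = h ^+ 2 * K ^+ 2 * c by rewrite /K; ring.
by rewrite ler_wpM2l ?mulr_ge0 ?sqr_ge0// ler_peMl// exprn_ege1.
Qed.

(** Makes the semigroup a uniform limit of explicit cylinder functions; its symmetry and the
    stability of [qcyl] come from here. *)
Lemma euler_cvg t f e : cylinder f -> 0 <= t -> 0 < e ->
  exists N, forall n, (N <= n)%N -> forall eta,
    `|S t f eta - iter n.+1 (euler (t / n.+1%:R)) f eta| <= e.
Proof.
move=> /cylinder_cls[k [c cf]] t0 e0; set K := 6 * k%:R * T.
have K0 : 0 <= K by rewrite !mulr_ge0.
have c0 := cls_ge0 cf.
set Z := t ^+ 2 * K ^+ 2 * (expR (t * K) * c).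
have Z0 : 0 <= Z by rewrite !mulr_ge0 ?sqr_ge0// expR_ge0.
exists (Num.truncn (Z / e)) => n Nn eta.
have n0 : 0 < n.+1%:R :> R by rewrite ltr0n.
have nn : n.+1%:R != 0 :> R by rewrite gt_eqF.
have h0 : 0 <= t / n.+1%:R by rewrite divr_ge0.
have := euler_error n.+1 eta h0 cf.
have -> : n.+1%:R * (t / n.+1%:R) = t by field.
move=> /le_trans; apply.
have q : (1 + t / n.+1%:R * K) ^+ n.+1 <= expR (t * K).
  have -> : t * K = (t / n.+1%:R * K) * n.+1%:R by field.
  rewrite expRM_natr lerXn2r ?nnegrE ?expR_ge0 ?expR_ge1Dx//.
  by rewrite addr_ge0// mulr_ge0.
apply: (@le_trans _ _ (Z / n.+1%:R)).
  rewrite -/K; have -> : Z / n.+1%:R = n.+1%:R * ((t / n.+1%:R) ^+ 2 * K ^+ 2 * (expR (t * K) * c)).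
    by rewrite /Z; field.
  by rewrite ler_wpM2l// ler_wpM2l ?mulr_ge0 ?sqr_ge0// ler_wpM2r.
rewrite ler_pdivrMr// mulrC -ler_pdivrMr//; apply: ltW; apply: lt_le_trans (truncnS_gt _) _.
by rewrite ler_nat ltnS.
Qed.

End SemigroupEstimates.

(** * Reversibility and the discrete Feynman-Kac semigroup *)

Section QuasiCylinder.
Variables (R : realType) (T : R) (S : R -> (config -> R) -> (config -> R)).
Hypothesis T0 : 0 <= T.
Hypothesis HS : markov_semigroup S.
Local Notation L := (ssep_generator T).
Hypothesis core : forall f, cylinder f -> generator_graph S f (L f).
Implicit Types (f g : config -> R) (eta : config).

(** The uniform closure of the cylinder functions: an algebra that the semigroup preserves
    ([qcyl_S]), unlike the cylinder functions themselves. *)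
Definition qcyl f := continuous f /\
  forall e, 0 < e -> exists2 g, cylinder g & forall eta, `|f eta - g eta| <= e.

Lemma qcyl_cyl f : cylinder f -> qcyl f.
Proof.
move=> cf; split; first exact: (cylinder_continuous core cf).
by move=> e e0; exists f => // eta; rewrite subrr normr0 ltW.
Qed.

Lemma qcyl_bounded f : qcyl f -> exists2 c, 0 <= c & forall eta, `|f eta| <= c.
Proof.
move=> [_ /(_ 1 ltr01)[g cg fg]]; have [c c0 gc] := cylinder_bounded cg.
exists (1 + c); first by rewrite addr_ge0.
move=> eta; rewrite -[f eta](subrK (g eta)); apply: le_trans (ler_normD _ _) _.
exact: lerD.
Qed.

Lemma qcyl_lin a f g : qcyl f -> qcyl g -> qcyl (fun eta => a * f eta + g eta).
Proof.
move=> [cf qf] [cg qg]; split; first exact: continuous_lin.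
move=> e e0; have a0 : 0 < `|a| + 1 by rewrite ltr_wpDl.
have e1 : 0 < e / (`|a| + 1) / 2 by rewrite !divr_gt0.
have e2 : 0 < e / 2 by rewrite divr_gt0.
have [f1 cf1 h1] := qf _ e1; have [g1 cg1 h2] := qg _ e2.
exists (fun eta => a * f1 eta + g1 eta).
  by apply: (cylinder_comp2 (fun x y => a * x + y)).
move=> eta.
have -> : a * f eta + g eta - (a * f1 eta + g1 eta) = a * (f eta - f1 eta) + (g eta - g1 eta) by ring.
apply: le_trans (ler_normD _ _) _; rewrite [e]splitr lerD// normrM.
apply: (@le_trans _ _ ((`|a| + 1) * (e / (`|a| + 1) / 2))).
  by apply: ler_pM => //; rewrite lerDl.
by rewrite le_eqVlt; apply/orP; left; apply/eqP; field; rewrite gt_eqF.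
Qed.

Lemma qcyl_mul f g : qcyl f -> qcyl g -> qcyl (fun eta => f eta * g eta).
Proof.
move=> qf qg; have [b b0 fb] := qcyl_bounded qf.
case: (qf) => cf af; case: (qg) => cg ag; split; first exact: continuous_mul.
move=> e e0; have b1 : 0 < b + 1 by rewrite ltr_wpDl.
have e2 : 0 < e / (b + 1) / 2 by rewrite !divr_gt0.
have [g1 cg1 h2] := ag _ e2.
have [d d0 gd] := cylinder_bounded cg1.
have d1 : 0 < d + 1 by rewrite ltr_wpDl.
have e1 : 0 < e / (d + 1) / 2 by rewrite !divr_gt0.
have [f1 cf1 h1] := af _ e1.
exists (fun eta => f1 eta * g1 eta); first exact: cylinderM.
move=> eta.
have -> : f eta * g eta - f1 eta * g1 eta = f eta * (g eta - g1 eta) + (f eta - f1 eta) * g1 eta by ring.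
apply: le_trans (ler_normD _ _) _; rewrite [e]splitr !normrM; apply: lerD.
  apply: (@le_trans _ _ ((b + 1) * (e / (b + 1) / 2))).
    by apply: ler_pM => //; apply: le_trans (fb _) _; rewrite lerDl.
  by rewrite le_eqVlt; apply/orP; left; apply/eqP; field; rewrite gt_eqF.
apply: (@le_trans _ _ ((e / (d + 1) / 2) * (d + 1))).
  by apply: ler_pM => //; apply: le_trans (gd _) _; rewrite lerDl.
by rewrite le_eqVlt; apply/orP; left; apply/eqP; field; rewrite gt_eqF.
Qed.

Lemma qcyl_cst (c : R) : qcyl (fun=> c).
Proof. exact/qcyl_cyl/cylinder_cst. Qed.

Lemma qcyl_add f g : qcyl f -> qcyl g -> qcyl (fun eta => f eta + g eta).
Proof.
move=> qf qg; have := qcyl_lin 1 qf qg.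
by under [X in qcyl X -> _]funext => eta do rewrite mul1r.
Qed.

Lemma qcyl_sub f g : qcyl f -> qcyl g -> qcyl (fun eta => f eta - g eta).
Proof.
move=> qf qg; have := qcyl_lin (-1) qg qf.
by under [X in qcyl X -> _]funext => eta do rewrite mulN1r addrC.
Qed.

Lemma qcyl_scale a f : qcyl f -> qcyl (fun eta => a * f eta).
Proof. by move=> qf; apply: qcyl_mul => //; exact: qcyl_cst. Qed.

Lemma cylinder_iter_euler h n f : cylinder f -> cylinder (iter n (euler T h) f).
Proof.
elim: n f => // n IH f cf; rewrite iterS.
apply: (cylinder_comp2 (fun x y => x + h * y)); first exact: IH.
exact/cylinder_generator/IH.
Qed.

Lemma qcyl_S t f : 0 <= t -> qcyl f -> qcyl (S t f).
Proof.
move=> t0 [cf qf]; split; first exact: (semigroup_continuous HS).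
move=> e e0; have e2 : 0 < e / 2 by rewrite divr_gt0.
have [g cg fg] := qf _ e2.
have [n H] := euler_cvg T0 HS core cg t0 e2.
exists (iter n.+1 (euler T (t / n.+1%:R)) g); first exact: cylinder_iter_euler.
move=> eta.
rewrite -[S t f eta](subrK (S t g eta)) -addrA; apply: le_trans (ler_normD _ _) _.
rewrite [e]splitr; apply: lerD; last exact: H.
have cc := cylinder_continuous core cg.
rewrite -(S_sub HS)//; apply: (S_contr HS) => //.
have -> : (fun z => f z - g z) = fun z => -1 * g z + f z by apply/funext => z; ring.
exact: continuous_lin.
Qed.

(** An abstract exchange-invariant expectation; it will be the expectation over the initial
    configuration. *)
Variable mu : (config -> R) -> R.
Hypothesis mu_lin : forall a f g, qcyl f -> qcyl g -> mu (fun eta => a * f eta + g eta) = a * mu f + mu g.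
Hypothesis mu_ge0 : forall f, qcyl f -> (forall eta, 0 <= f eta) -> 0 <= mu f.
Hypothesis mu1 : mu (fun=> 1) = 1.
Hypothesis mu_exchange : forall x y f, cylinder f -> mu (fun eta => f (exchange x y eta)) = mu f.

Lemma mu_add f g : qcyl f -> qcyl g -> mu (fun eta => f eta + g eta) = mu f + mu g.
Proof.
move=> qf qg; rewrite -[mu f]mul1r -mu_lin//; congr mu; apply/funext => z; by rewrite mul1r.
Qed.

Lemma mu_sub f g : qcyl f -> qcyl g -> mu (fun eta => f eta - g eta) = mu f - mu g.
Proof.
move=> qf qg; rewrite addrC -mulN1r -mu_lin//; congr mu; apply/funext => z; by rewrite mulN1r addrC.
Qed.

Lemma mu_scale a f : qcyl f -> mu (fun eta => a * f eta) = a * mu f.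
Proof.
move=> qf; have := mu_lin a qf (qcyl_cst 0); have := mu_sub (qcyl_cst 0) (qcyl_cst 0).
rewrite !subrr => ->; rewrite addr0 => <-; congr mu; apply/funext => z; by rewrite addr0.
Qed.

Lemma mu_cst c : mu (fun=> c) = c.
Proof.
rewrite -[RHS]mulr1 -mu1 -mu_scale; last exact: qcyl_cst.
by congr mu; apply/funext => z; rewrite mulr1.
Qed.

Lemma mu_le f g : qcyl f -> qcyl g -> (forall eta, f eta <= g eta) -> mu f <= mu g.
Proof.
move=> qf qg fg; rewrite -subr_ge0 -mu_sub//; apply: mu_ge0; first exact: qcyl_sub.
by move=> eta; rewrite subr_ge0.
Qed.

Lemma mu_norm f c : qcyl f -> (forall eta, `|f eta| <= c) -> `|mu f| <= c.
Proof.
move=> qf fc; rewrite ler_norml -[in X in X <= _](mu_cst (- c)) -[in X in _ && (_ <= X)](mu_cst c).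
rewrite !mu_le//; try exact: qcyl_cst.
- by move=> z; have := fc z; rewrite ler_norml => /andP[].
- by move=> z; have := fc z; rewrite ler_norml => /andP[].
Qed.

Lemma mu_close f g e : qcyl f -> qcyl g -> (forall eta, `|f eta - g eta| <= e) -> `|mu f - mu g| <= e.
Proof. by move=> qf qg fg; rewrite -mu_sub//; apply: mu_norm => //; exact: qcyl_sub. Qed.

Lemma mu_sum (I : Type) (r : seq I) (F : I -> config -> R) : (forall i, qcyl (F i)) ->
  qcyl (fun eta => \sum_(i <- r) F i eta) /\ mu (fun eta => \sum_(i <- r) F i eta) = \sum_(i <- r) mu (F i).
Proof.
move=> qF; elim: r => [|i r [IH1 IH2]].
  rewrite big_nil; under [X in qcyl X]funext => eta do rewrite big_nil.
  under [X in mu X]funext => eta do rewrite big_nil.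
  by rewrite mu_cst; split => //; exact: qcyl_cst.
rewrite big_cons; under [X in qcyl X]funext => eta do rewrite big_cons.
under [X in mu X]funext => eta do rewrite big_cons.
by rewrite mu_add ?IH2//; split => //; exact: qcyl_add.
Qed.

(** Reversibility bond by bond: an exchange is an involution that preserves [mu]. *)
Lemma mu_generator_sym f g : cylinder f -> cylinder g ->
  mu (fun eta => f eta * L g eta) = mu (fun eta => L f eta * g eta).
Proof.
move=> cf cg; have [A Af] := cf; have [A' Ag] := cg.
have {}Af : dep (A ++ A') f by apply: dep_sub Af => z zA; rewrite mem_cat zA.
have {}Ag : dep (A ++ A') g by apply: dep_sub Ag => z zA; rewrite mem_cat zA orbT.
have E h1 h2 : cylinder h1 -> cylinder h2 -> dep (A ++ A') h2 ->
    mu (fun eta => h1 eta * L h2 eta) = \sum_(j < 2) \sum_(x <- bonds (A ++ A'))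
      (T / 2 * (mu (fun eta => h1 eta * h2 (exchange x (x + unit_vector j) eta)) - mu (fun eta => h1 eta * h2 eta))).
  move=> c1 c2 A2.
  under [X in mu X]funext => eta do rewrite (generator_seq _ _ A2) mulr_sumr.
  have cy (j : 'I_2) x : cylinder (fun eta => h1 eta * (T / 2 * (h2 (exchange x (x + unit_vector j) eta) - h2 eta))).
    apply: (cylinderM c1); apply: (cylinder_comp2 (fun x y => T / 2 * (x - y))) => //.
    exact: cylinder_exchange.
  rewrite (mu_sum _ _).2; last first.
    move=> j; under [X in qcyl X]funext => eta do rewrite mulr_sumr.
    by apply: (mu_sum _ _).1 => x; exact: qcyl_cyl.
  apply: eq_bigr => j _.
  under [X in mu X]funext => eta do rewrite mulr_sumr.
  rewrite (mu_sum _ _).2; last by move=> x; exact: qcyl_cyl.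
  apply: eq_bigr => x _; rewrite -mu_sub; try exact/qcyl_cyl/cylinderM/cylinder_exchange.
    rewrite -mu_scale; first by congr mu; apply/funext => eta; ring.
    by apply: qcyl_sub; apply: qcyl_cyl; apply: cylinderM => //; exact: cylinder_exchange.
  by apply: qcyl_cyl; apply: cylinderM.
rewrite E//.
have -> : (fun eta => L f eta * g eta) = fun eta => g eta * L f eta by apply/funext => eta; rewrite mulrC.
rewrite E//; apply: eq_bigr => j _; apply: eq_bigr => x _; congr (_ * (_ - _)).
  rewrite -(mu_exchange x (x + unit_vector j)); last by apply: cylinderM => //; exact: cylinder_exchange.
  by congr mu; apply/funext => eta; rewrite exchangeK mulrC.
by congr mu; apply/funext => eta; rewrite mulrC.
Qed.

Lemma mu_euler_sym h n f g : cylinder f -> cylinder g ->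
  mu (fun eta => f eta * iter n (euler T h) g eta) = mu (fun eta => iter n (euler T h) f eta * g eta).
Proof.
elim: n f g => // n IH f g cf cg.
have step u v : cylinder u -> cylinder v ->
   mu (fun eta => u eta * euler T h v eta) = mu (fun eta => euler T h u eta * v eta).
  move=> cu cv; have cLu := cylinder_generator T cu; have cLv := cylinder_generator T cv.
  have q1 : qcyl (fun eta => u eta * v eta) by exact/qcyl_cyl/cylinderM.
  have q2 : qcyl (fun eta => u eta * L v eta) by exact/qcyl_cyl/cylinderM.
  have q3 : qcyl (fun eta => L u eta * v eta) by exact/qcyl_cyl/cylinderM.
  have := mu_lin h q2 q1; rewrite mu_generator_sym// -mu_lin// => e.
  transitivity (mu (fun eta => h * (u eta * L v eta) + u eta * v eta)).
    by congr mu; apply/funext => eta; rewrite /euler; ring.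
  by rewrite e; congr mu; apply/funext => eta; rewrite /euler; ring.
rewrite [iter n.+1 (euler T h) g]iterSr IH//; last exact: (@cylinder_iter_euler h 1).
by rewrite step//; exact: cylinder_iter_euler.
Qed.

Lemma mu_S_sym_cyl t f g : 0 <= t -> cylinder f -> cylinder g ->
  mu (fun eta => f eta * S t g eta) = mu (fun eta => S t f eta * g eta).
Proof.
move=> t0 cf cg; apply/eqP; rewrite -subr_eq0 -normr_le0; apply/ler_addgt0Pr => e e0; rewrite add0r.
have [b b0 fb] := cylinder_bounded cf; have [d d0 gd] := cylinder_bounded cg.
set c := b + d + 1; have c0 : 0 < c by rewrite ltr_wpDl ?addr_ge0.
have ec : 0 < e / c by rewrite divr_gt0.
have [n1 H1] := euler_cvg T0 HS core cf t0 ec.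
have [n2 H2] := euler_cvg T0 HS core cg t0 ec.
pose n := maxn n1 n2; pose h := t / n.+1%:R.
have {}H1 := H1 n (leq_maxl _ _); have {}H2 := H2 n (leq_maxr _ _).
have cEf := cylinder_iter_euler h n.+1 cf; have cEg := cylinder_iter_euler h n.+1 cg.
have qf := qcyl_cyl cf; have qg := qcyl_cyl cg.
have A1 : `|mu (fun eta => f eta * S t g eta) - mu (fun eta => f eta * iter n.+1 (euler T h) g eta)| <= b * (e / c).
  apply: mu_close; try (apply: qcyl_mul => //; first [exact: qcyl_S|exact: qcyl_cyl]).
  by move=> eta; rewrite -mulrBr normrM ler_pM.
have A2 : `|mu (fun eta => S t f eta * g eta) - mu (fun eta => iter n.+1 (euler T h) f eta * g eta)| <= (e / c) * d.
  apply: mu_close; try (apply: qcyl_mul => //; first [exact: qcyl_S|exact: qcyl_cyl]).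
  by move=> eta; rewrite -mulrBl normrM ler_pM.
move: A1 A2; rewrite mu_euler_sym//.
set x := mu _; set y := mu _; set z := mu _ => A1 A2.
have -> : x - z = (x - y) - (z - y) by ring.
apply: le_trans (ler_normB _ _) _.
apply: (@le_trans _ _ (b * (e / c) + e / c * d)); first by rewrite lerD.
have -> : b * (e / c) + e / c * d = (b + d) / c * e by ring.
by rewrite -[leRHS]mul1r ler_pM2r// ler_pdivrMr// mul1r lerDl.
Qed.

Lemma mu_S_sym t f g : 0 <= t -> qcyl f -> qcyl g ->
  mu (fun eta => f eta * S t g eta) = mu (fun eta => S t f eta * g eta).
Proof.
move=> t0 qf qg; apply/eqP; rewrite -subr_eq0 -normr_le0; apply/ler_addgt0Pr => e e0; rewrite add0r.
have [b b0 fb] := qcyl_bounded qf; have [d d0 gd] := qcyl_bounded qg.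
set c := 2 * (b + d + 1); have c0 : 0 < c by rewrite mulr_gt0// ltr_wpDl ?addr_ge0.
have ec : 0 < Num.min 1 (e / c) by rewrite lt_min ltr01 divr_gt0.
have [f1 cf1 h1] := qf.2 _ ec; have [g1 cg1 h2] := qg.2 _ ec.
set k := Num.min _ _ in ec h1 h2.
have [k1 kec] : k <= 1 /\ k <= e / c by rewrite /k; split; rewrite ge_min lexx ?orbT.
have f1b eta : `|f1 eta| <= b + 1.
  rewrite -[f1 eta](subrK (f eta)) addrC; apply: le_trans (ler_normD _ _) _.
  by rewrite lerD// distrC; exact: le_trans (h1 _) k1.
have q1 := qcyl_cyl cf1; have q2 := qcyl_cyl cg1.
have Sb u v r : qcyl u -> qcyl v -> (forall eta, `|u eta - v eta| <= r) -> forall eta, `|S t u eta - S t v eta| <= r.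
  move=> qu qv uv eta; rewrite -(S_sub HS) ?qu.1 ?qv.1//; try by [case: qu|case: qv].
  by apply: (S_contr HS) => //; case: (qcyl_sub qu qv).
have A1 : `|mu (fun eta => f eta * S t g eta) - mu (fun eta => f1 eta * S t g1 eta)| <= k * d + (b + 1) * k.
  apply: mu_close; try (apply: qcyl_mul => //; exact: qcyl_S).
  move=> eta; have -> : f eta * S t g eta - f1 eta * S t g1 eta =
    (f eta - f1 eta) * S t g eta + f1 eta * (S t g eta - S t g1 eta) by ring.
  apply: le_trans (ler_normD _ _) _; rewrite !normrM; apply: lerD; apply: ler_pM => //.
    by apply: (S_contr HS) => //; case: qg.
  exact: Sb.
have A2 : `|mu (fun eta => S t f eta * g eta) - mu (fun eta => S t f1 eta * g1 eta)| <= k * d + (b + 1) * k.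
  apply: mu_close; try (apply: qcyl_mul => //; exact: qcyl_S).
  move=> eta; have -> : S t f eta * g eta - S t f1 eta * g1 eta =
    (S t f eta - S t f1 eta) * g eta + S t f1 eta * (g eta - g1 eta) by ring.
  apply: le_trans (ler_normD _ _) _; rewrite !normrM; apply: lerD; apply: ler_pM => //.
    exact: Sb.
  by apply: (S_contr HS) => //; case: q1.
move: A1 A2; rewrite (mu_S_sym_cyl t0 cf1 cg1).
set x := mu _; set y := mu _; set z := mu _ => A1 A2.
have -> : x - z = (x - y) - (z - y) by ring.
apply: le_trans (ler_normB _ _) _.
apply: (@le_trans _ _ (c * k)).
  by apply: le_trans (lerD A1 A2) _; rewrite /c; lra.
by rewrite mulrC -ler_pdivlMr.
Qed.

Lemma mu_S t f : 0 <= t -> qcyl f -> mu (S t f) = mu f.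
Proof.
move=> t0 qf; have := mu_S_sym t0 (qcyl_cst 1) qf.
under [X in mu X = _ -> _]funext => eta do rewrite mul1r.
move=> ->; congr mu; apply/funext => eta.
by rewrite (semigroup1 HS)// mul1r.
Qed.

Lemma mu_CS f g : qcyl f -> qcyl g ->
  mu (fun eta => f eta * g eta) ^+ 2 <= mu (fun eta => f eta ^+ 2) * mu (fun eta => g eta ^+ 2).
Proof.
move=> qf qg.
have qff : qcyl (fun eta => f eta ^+ 2) by exact: qcyl_mul.
have qgg : qcyl (fun eta => g eta ^+ 2) by exact: qcyl_mul.
have qfg : qcyl (fun eta => f eta * g eta) by exact: qcyl_mul.
set a := mu _; set b := mu _; set c := mu _.
have H s : 0 <= s ^+ 2 * b + 2 * s * a + c.
  have -> : s ^+ 2 * b + 2 * s * a + c = mu (fun eta => (s * f eta + g eta) ^+ 2).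
    have e1 : mu (fun eta => s ^+ 2 * f eta ^+ 2 + (2 * s * (f eta * g eta) + g eta ^+ 2)) = s ^+ 2 * b + 2 * s * a + c.
      by rewrite mu_lin ?mu_lin ?addrA//; exact: qcyl_lin.
    by rewrite -e1; congr mu; apply/funext => eta; ring.
  apply: mu_ge0; last by move=> eta; exact: sqr_ge0.
  by apply: qcyl_mul; exact: qcyl_lin.
have b0 : 0 <= b by apply: mu_ge0 => // eta; exact: sqr_ge0.
have [bz|bn] := eqVneq b 0.
  have := H (- (c + 1) / (2 * a)); rewrite bz !mul0r !mulr0 add0r.
  have [->|an] := eqVneq a 0; first by rewrite expr0n.
  have -> : 2 * (- (c + 1) / (2 * a)) * a = - (c + 1) by field.
  lra.
have {bn}b1 : 0 < b by rewrite lt_def bn.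
have := H (- a / b).
have -> : (- a / b) ^+ 2 * b + 2 * (- a / b) * a + c = (b * c - a ^+ 2) / b by field; rewrite gt_eqF.
by rewrite pmulr_lge0 ?invr_gt0// subr_ge0.
Qed.

Variables (W : config -> R) (cb : R).
Hypothesis cW : cylinder W.
Hypothesis Wb : forall eta, `|W eta| <= cb.

(* The Feynman-Kac step, conjugated so as to be symmetric in L^2(mu). *)
Definition tilt h f : config -> R := fun eta => expR (h / 2 * W eta) * S h (fun z => expR (h / 2 * W z) * f z) eta.
Definition fkstep h f : config -> R := S h (fun z => expR (h * W z) * f z).

Lemma cylinder_expW c : cylinder (fun z => expR (c * W z)).
Proof. exact: (cylinder_comp (fun x => expR (c * x))). Qed.

Lemma qcyl_expW c : qcyl (fun z => expR (c * W z)).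
Proof. exact/qcyl_cyl/cylinder_expW. Qed.

Lemma qcyl_tilt h f : 0 <= h -> qcyl f -> qcyl (tilt h f).
Proof.
move=> h0 qf; apply: qcyl_mul; first exact: qcyl_expW.
by apply: qcyl_S => //; apply: qcyl_mul => //; exact: qcyl_expW.
Qed.

Lemma qcyl_fkstep h f : 0 <= h -> qcyl f -> qcyl (fkstep h f).
Proof. by move=> h0 qf; apply: qcyl_S => //; apply: qcyl_mul => //; exact: qcyl_expW. Qed.

Lemma qcyl_iter_fkstep h n f : 0 <= h -> qcyl f -> qcyl (iter n (fkstep h) f).
Proof. by move=> h0 qf; elim: n => // n IH; exact: qcyl_fkstep. Qed.

Lemma qcyl_iter_tilt h n f : 0 <= h -> qcyl f -> qcyl (iter n (tilt h) f).
Proof. by move=> h0 qf; elim: n => // n IH; exact: qcyl_tilt. Qed.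

Lemma tilt_sym h f g : 0 <= h -> qcyl f -> qcyl g ->
  mu (fun eta => f eta * tilt h g eta) = mu (fun eta => tilt h f eta * g eta).
Proof.
move=> h0 qf qg.
have qa : qcyl (fun z => expR (h / 2 * W z) * f z) by apply: qcyl_mul => //; exact: qcyl_expW.
have qb : qcyl (fun z => expR (h / 2 * W z) * g z) by apply: qcyl_mul => //; exact: qcyl_expW.
transitivity (mu (fun eta => (expR (h / 2 * W eta) * f eta) * S h (fun z => expR (h / 2 * W z) * g z) eta)).
  by congr mu; apply/funext => eta; rewrite /tilt; ring.
by rewrite mu_S_sym//; congr mu; apply/funext => eta; rewrite /tilt; ring.
Qed.

Lemma iter_tilt_sym h n f g : 0 <= h -> qcyl f -> qcyl g ->
  mu (fun eta => f eta * iter n (tilt h) g eta) = mu (fun eta => iter n (tilt h) f eta * g eta).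
Proof.
move=> h0; elim: n f g => // n IH f g qf qg.
rewrite iterSr IH//; last exact: qcyl_tilt.
by rewrite tilt_sym//; exact: qcyl_iter_tilt.
Qed.

Lemma tilt_lin h a f g eta : 0 <= h -> qcyl f -> qcyl g ->
  tilt h (fun z => a * f z + g z) eta = a * tilt h f eta + tilt h g eta.
Proof.
move=> h0 qf qg; rewrite /tilt.
have -> : (fun z => expR (h / 2 * W z) * (a * f z + g z)) =
  (fun z => a * (expR (h / 2 * W z) * f z) + expR (h / 2 * W z) * g z) by apply/funext => z; ring.
rewrite (S_lin HS) ?mulrDr//; first by ring.
  by case: (qcyl_mul (qcyl_expW (h / 2)) qf).
by case: (qcyl_mul (qcyl_expW (h / 2)) qg).
Qed.

Lemma tilt_ge0 h f : 0 <= h -> qcyl f -> (forall z, 0 <= f z) -> forall eta, 0 <= tilt h f eta.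
Proof.
move=> h0 qf f0 eta; rewrite mulr_ge0 ?expR_ge0//; apply: (semigroup_ge0 HS) => //.
  by case: (qcyl_mul (qcyl_expW (h / 2)) qf).
by move=> z; rewrite mulr_ge0 ?expR_ge0.
Qed.

Lemma tilt_le h f g : 0 <= h -> qcyl f -> qcyl g -> (forall z, f z <= g z) ->
  forall eta, tilt h f eta <= tilt h g eta.
Proof.
move=> h0 qf qg fg eta; rewrite /tilt ler_wpM2l ?expR_ge0//; apply: (S_le HS) => //.
- by case: (qcyl_mul (qcyl_expW (h / 2)) qf).
- by case: (qcyl_mul (qcyl_expW (h / 2)) qg).
- by move=> z; rewrite ler_wpM2l ?expR_ge0.
Qed.

Lemma tilt_scale h a f eta : 0 <= h -> qcyl f -> tilt h (fun z => a * f z) eta = a * tilt h f eta.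
Proof.
move=> h0 qf; have := tilt_lin a eta h0 qf (qcyl_cst 0).
have -> : (fun z => a * f z + 0) = (fun z => a * f z) by apply/funext => z; rewrite addr0.
move=> ->; rewrite [X in _ + X](_ : _ = 0) ?addr0// /tilt.
have -> : (fun z => expR (h / 2 * W z) * 0) = (fun=> 0) by apply/funext => z; rewrite mulr0.
by rewrite (S_zero HS)// mulr0.
Qed.

Lemma iter_tilt_le h n f g : 0 <= h -> qcyl f -> qcyl g -> (forall z, f z <= g z) ->
  forall eta, iter n (tilt h) f eta <= iter n (tilt h) g eta.
Proof.
move=> h0 qf qg fg; elim: n => // n IH; apply: tilt_le => //; exact: qcyl_iter_tilt.
Qed.

Lemma iter_tilt_scale h n a f : 0 <= h -> qcyl f ->
  iter n (tilt h) (fun z => a * f z) = fun eta => a * iter n (tilt h) f eta.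
Proof.
move=> h0 qf; elim: n => // n IH; rewrite iterS IH; apply/funext => eta.
by rewrite tilt_scale//; exact: qcyl_iter_tilt.
Qed.

Lemma iter_tilt_ge0 h n f : 0 <= h -> qcyl f -> (forall z, 0 <= f z) -> forall eta, 0 <= iter n (tilt h) f eta.
Proof.
move=> h0 qf f0; elim: n => // n IH; apply: tilt_ge0 => //; exact: qcyl_iter_tilt.
Qed.

Lemma iter_fkstep h n f :
  (fun eta => expR (h / 2 * W eta) * iter n (fkstep h) f eta) =
  iter n (tilt h) (fun eta => expR (h / 2 * W eta) * f eta).
Proof.
elim: n => // n IH; rewrite !iterS -IH; apply/funext => eta; rewrite /tilt /fkstep.
congr (_ * S h _ eta); apply/funext => z; rewrite mulrA -expRD; congr (expR _ * _).
by field.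
Qed.

(** The plain and the symmetrized steps are conjugate by [exp (h W / 2)]; the discrepancy sits in
    two end functions that tend to 1 with [h]. *)
Lemma mu_fkstep h n :
  mu (iter n (fkstep h) (fun=> 1)) =
  mu (fun eta => expR (- (h / 2) * W eta) * iter n (tilt h) (fun z => expR (h / 2 * W z)) eta).
Proof.
have -> : (fun z => expR (h / 2 * W z)) = (fun z => expR (h / 2 * W z) * 1) by apply/funext => z; rewrite mulr1.
rewrite -iter_fkstep; congr mu; apply/funext => eta.
by rewrite mulrA -expRD mulNr addNr expR0 mul1r.
Qed.

(** Cauchy-Schwarz with weight [phi] gives [(B f)^2 <= B (f^2 / phi) * B phi <= l * phi * B (f^2 /
    phi)] for [B = tilt h]; symmetry then moves [B] onto [phi], where the hypothesis is used a
    second time. *)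
Lemma schur h phi c0 l f : 0 <= h -> cylinder phi -> 0 < c0 -> (forall z, c0 <= phi z) ->
  (forall z, tilt h phi z <= l * phi z) -> qcyl f ->
  mu (fun eta => tilt h f eta ^+ 2) <= l ^+ 2 * mu (fun eta => f eta ^+ 2).
Proof.
move=> h0 cphi c00 c0phi lphi qf.
have phi0 z : 0 < phi z by exact: lt_le_trans (c0phi z).
have qphi := qcyl_cyl cphi.
have qinv : qcyl (fun z => (phi z)^-1) by exact/qcyl_cyl/(cylinder_comp (fun x => x^-1)).
have l0 : 0 <= l.
  rewrite -(pmulr_lge0 _ (phi0 point)); apply: le_trans (lphi point).
  by apply: tilt_ge0 => // z; exact: ltW.
pose g z := f z ^+ 2 * (phi z)^-1.
have qff : qcyl (fun z => f z ^+ 2) by exact: qcyl_mul.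
have qg : qcyl g by exact: qcyl_mul.
have g0 z : 0 <= g z by rewrite mulr_ge0 ?sqr_ge0// invr_ge0 ltW.
have CS eta : tilt h f eta ^+ 2 <= tilt h g eta * (l * phi eta).
  have H s : 0 <= tilt h g eta + 2 * s * tilt h f eta + s ^+ 2 * tilt h phi eta.
    have e1 : tilt h (fun z => s ^+ 2 * phi z + (2 * s * f z + g z)) eta = tilt h g eta + 2 * s * tilt h f eta + s ^+ 2 * tilt h phi eta.
      rewrite tilt_lin ?tilt_lin//; first by ring.
      exact: qcyl_lin.
    rewrite -e1; apply: tilt_ge0 => //; first by do 2?apply: qcyl_lin.
    move=> z; have -> : s ^+ 2 * phi z + (2 * s * f z + g z) = (f z + s * phi z) ^+ 2 * (phi z)^-1.
      by rewrite /g; field; rewrite gt_eqF.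
    by rewrite mulr_ge0 ?sqr_ge0// invr_ge0 ltW.
  have G0 : 0 <= tilt h g eta by exact: tilt_ge0.
  apply: (@le_trans _ _ (tilt h g eta * tilt h phi eta)); last by rewrite ler_wpM2l.
  have P0 : 0 <= tilt h phi eta by apply: tilt_ge0 => // z; exact: ltW.
  move: H G0 P0; move: (tilt h g eta) (tilt h f eta) (tilt h phi eta) => a b c H a0 c00'.
  have [cz|cn] := eqVneq c 0.
    have [->|bn] := eqVneq b 0; first by rewrite expr0n mulr_ge0.
    have := H (- (a + 1) / (2 * b)); rewrite cz mulr0 addr0.
    have -> : 2 * (- (a + 1) / (2 * b)) * b = - (a + 1) by field.
    lra.
  have cp : 0 < c by rewrite lt_def cn.
  have := H (- b / c).
  have -> : a + 2 * (- b / c) * b + (- b / c) ^+ 2 * c = (a * c - b ^+ 2) / c by field.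
  by rewrite pmulr_lge0 ?invr_gt0// subr_ge0.
have qtf := qcyl_tilt h0 qf; have qtg := qcyl_tilt h0 qg; have qtp := qcyl_tilt h0 qphi.
apply: (@le_trans _ _ (mu (fun eta => l * (phi eta * tilt h g eta)))).
  apply: mu_le; first exact: qcyl_mul.
    by apply: qcyl_scale; exact: qcyl_mul.
  by move=> eta; have := CS eta; congr (_ <= _); ring.
rewrite mu_scale; last exact: qcyl_mul.
rewrite tilt_sym// expr2 -mulrA ler_wpM2l// -mu_scale//.
apply: mu_le; [exact: qcyl_mul|exact: qcyl_scale|].
move=> eta; have -> : l * f eta ^+ 2 = l * phi eta * g eta by rewrite /g; field; rewrite gt_eqF.
by rewrite ler_wpM2r.
Qed.

Lemma iter_schur h phi c0 l n f : 0 <= h -> cylinder phi -> 0 < c0 -> (forall z, c0 <= phi z) ->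
  (forall z, tilt h phi z <= l * phi z) -> qcyl f ->
  mu (fun eta => iter n (tilt h) f eta ^+ 2) <= (l ^+ n) ^+ 2 * mu (fun eta => f eta ^+ 2).
Proof.
move=> h0 cphi c00 c0phi lphi qf; elim: n => [|n IH]; first by rewrite expr0 expr1n mul1r.
apply: le_trans (schur h0 cphi c00 c0phi lphi (qcyl_iter_tilt n h0 qf)) _.
have -> : (l ^+ n.+1) ^+ 2 = l ^+ 2 * (l ^+ n) ^+ 2 by rewrite -exprMn -exprS.
by rewrite -mulrA ler_wpM2l// sqr_ge0.
Qed.

Lemma fkstep_upper h phi c0 l n : 0 <= h -> cylinder phi -> 0 < c0 -> (forall z, c0 <= phi z) -> 0 <= l ->
  (forall z, tilt h phi z <= l * phi z) ->
  mu (iter n (fkstep h) (fun=> 1)) <= expR (h * cb) * l ^+ n.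
Proof.
move=> h0 cphi c00 c0phi l0 lphi; rewrite mu_fkstep.
have q1 := qcyl_expW (- (h / 2)); have q2 := qcyl_iter_tilt n h0 (qcyl_expW (h / 2)).
have H := mu_CS q1 q2.
have bnd s : `|s| = h / 2 -> mu (fun eta => expR (s * W eta) ^+ 2) <= expR (h * cb).
  move=> sh; rewrite -[leRHS]mu_cst; apply: mu_le; [exact: (qcyl_mul (qcyl_expW s) (qcyl_expW s))|exact: qcyl_cst|].
  move=> eta; rewrite expr2 -expRD ler_expR; apply: le_trans (ler_norm _) _.
  by apply: le_trans (ler_normD _ _) _; rewrite -mulr2n -mulr_natr normrM sh; have := Wb eta; nra.
have X0 : 0 <= expR (h * cb) * l ^+ n by rewrite mulr_ge0 ?expR_ge0 ?exprn_ge0.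
rewrite -[leRHS]ger0_norm//; apply: le_trans (ler_norm _) _.
rewrite -ler_sqr ?nnegrE ?normr_ge0// !real_normK ?num_real//.
apply: le_trans H _.
have -> : (expR (h * cb) * l ^+ n) ^+ 2 = expR (h * cb) * ((l ^+ n) ^+ 2 * expR (h * cb)) by ring.
apply: ler_pM.
- by apply: mu_ge0 => [|eta]; [exact: (qcyl_mul q1 q1)|exact: sqr_ge0].
- by apply: mu_ge0 => [|eta]; [exact: (qcyl_mul q2 q2)|exact: sqr_ge0].
- by apply: bnd; rewrite normrN ger0_norm// divr_ge0.
- apply: le_trans (iter_schur n h0 cphi c00 c0phi lphi (qcyl_expW (h / 2))) _.
  by rewrite ler_wpM2l ?sqr_ge0//; apply: bnd; rewrite ger0_norm// divr_ge0.
Qed.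

(** By symmetry [<g, B^(2n) g>] is the squared norm of [B^n g], at least [<g, B^n g>^2] by
    Cauchy-Schwarz. Repeated doubling is the form of log-convexity used, which is why the lower
    bound runs along powers of two. *)
Lemma iter_tilt_pow h g k : 0 <= h -> qcyl g -> (forall z, 0 <= g z) -> mu (fun eta => g eta ^+ 2) = 1 ->
  mu (fun eta => g eta * tilt h g eta) ^+ (2 ^ k) <= mu (fun eta => g eta * iter (2 ^ k) (tilt h) g eta).
Proof.
move=> h0 qg g0 g1.
have p0 n : 0 <= mu (fun eta => g eta * iter n (tilt h) g eta).
  apply: mu_ge0 => [|eta]; first by apply: qcyl_mul => //; exact: qcyl_iter_tilt.
  by rewrite mulr_ge0// iter_tilt_ge0.
elim: k => [|k IH]; first by rewrite expn0 expr1.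
have qi := qcyl_iter_tilt (2 ^ k) h0 qg.
rewrite expnS mulnC exprM.
have -> : mu (fun eta => g eta * iter (2 ^ k * 2) (tilt h) g eta) = mu (fun eta => iter (2 ^ k) (tilt h) g eta ^+ 2).
  have -> : (2 ^ k * 2 = 2 ^ k + 2 ^ k)%N by lia.
  rewrite iterD iter_tilt_sym//; by congr mu; apply/funext => eta; rewrite expr2.
apply: (@le_trans _ _ (mu (fun eta => g eta * iter (2 ^ k) (tilt h) g eta) ^+ 2)).
  by rewrite lerXn2r ?nnegrE// exprn_ge0//; exact: (p0 1%N).
by apply: le_trans (mu_CS qg qi) _; rewrite g1 mul1r.
Qed.

Lemma fkstep_lower h g c k : 0 <= h -> 0 < c -> qcyl g -> (forall z, 0 <= g z <= c) -> mu (fun eta => g eta ^+ 2) = 1 ->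
  expR (- h * cb) / c ^+ 2 * mu (fun eta => g eta * tilt h g eta) ^+ (2 ^ k) <= mu (iter (2 ^ k) (fkstep h) (fun=> 1)).
Proof.
move=> h0 c0 qg gc g1; rewrite mu_fkstep.
have g0 z : 0 <= g z by case/andP: (gc z).
set n := (2 ^ k)%N.
(* [a * g] lies below both end functions [exp (h W / 2)] and [exp (- h W / 2)], and replaces them
   because [tilt] is monotone. *)
pose a := expR (- (h / 2) * cb) / c.
have a0 : 0 <= a by rewrite divr_ge0 ?expR_ge0// ltW.
have bnd s : `|s| = h / 2 -> forall eta, a * g eta <= expR (s * W eta).
  move=> sh eta; rewrite /a mulrAC ler_pdivrMr//; apply: ler_pM => //; rewrite ?expR_ge0//; last by case/andP: (gc eta).
  rewrite ler_expR mulNr lerNl -mulNr; apply: le_trans (ler_norm _) _.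
  by rewrite normrM normrN sh ler_wpM2l// divr_ge0.
apply: (@le_trans _ _ (a ^+ 2 * mu (fun eta => g eta * iter n (tilt h) g eta))).
  have -> : a ^+ 2 = expR (- h * cb) / c ^+ 2.
    rewrite /a expr_div_n [expR _ ^+ 2]expr2 -expRD; congr (expR _ / _); by field.
  have e0 : 0 <= expR (- h * cb) / c ^+ 2 by rewrite divr_ge0 ?expR_ge0 ?exprn_ge0 ?(ltW c0).
  by rewrite (ler_wpM2l e0)// iter_tilt_pow.
have qi := qcyl_iter_tilt n h0 qg.
rewrite -mu_scale; last exact: qcyl_mul.
apply: mu_le.
- by apply: qcyl_scale; exact: qcyl_mul.
- by apply: qcyl_mul; [exact: qcyl_expW|apply: qcyl_iter_tilt => //; exact: qcyl_expW].
move=> eta; have -> : a ^+ 2 * (g eta * iter n (tilt h) g eta) = (a * g eta) * (a * iter n (tilt h) g eta) by ring.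
apply: ler_pM.
- by rewrite mulr_ge0.
- by rewrite mulr_ge0// iter_tilt_ge0.
- by apply: bnd; rewrite normrN ger0_norm// divr_ge0.
- have := @iter_tilt_scale h n a g h0 qg => /(congr1 (fun u => u eta)) <-.
  apply: iter_tilt_le => //; [exact: qcyl_scale|exact: qcyl_expW|].
  by apply: bnd; rewrite ger0_norm// divr_ge0.
Qed.

(** [K] serves both as the error constant and as the bound on the admissible steps; the expansion is
    uniform in the configuration. *)
Lemma tilt_expand g : cylinder g -> exists2 K, 0 < K & forall h, 0 <= h -> h * K <= 1 ->
  forall eta, `|tilt h g eta - (g eta + h * (L g eta + W eta * g eta))| <= h ^+ 2 * K.
Proof.
move=> cg.
have cWg : cylinder (fun z => W z * g z) by exact: cylinderM.
have cL := cylinder_generator T cg; have cLL := cylinder_generator T cL; have cLW := cylinder_generator T cWg.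
have [k1 k10 b1] := cylinder_bounded cW; have [k2 k20 b2] := cylinder_bounded cg.
have [k3 k30 b3] := cylinder_bounded cL; have [k4 k40 b4] := cylinder_bounded cWg.
have [k5 k50 b5] := cylinder_bounded cLL; have [k6 k60 b6] := cylinder_bounded cLW.
pose K : R := 1 + (k1 + k2 + k3 + k4 + k5 + k6).
have K1 : 1 <= K by rewrite /K; lra.
have {}b1 z : `|W z| <= K by apply: le_trans (b1 z) _; rewrite /K; lra.
have {}b2 z : `|g z| <= K by apply: le_trans (b2 z) _; rewrite /K; lra.
have {}b3 z : `|L g z| <= K by apply: le_trans (b3 z) _; rewrite /K; lra.
have {}b4 z : `|W z * g z| <= K by apply: le_trans (b4 z) _; rewrite /K; lra.
have {}b5 z : `|L (L g) z| <= K by apply: le_trans (b5 z) _; rewrite /K; lra.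
have {}b6 z : `|L (fun z => W z * g z) z| <= K by apply: le_trans (b6 z) _; rewrite /K; lra.
clearbody K; clear k1 k10 k2 k20 k3 k30 k4 k40 k5 k50 k6 k60.
have KK3 : K <= K ^+ 3 by rewrite exprS ler_peMr ?exprn_ege1//; lra.
(* The remainder found below is [9/2 K^3 + 3/2 K^2], and [K >= 1]. *)
exists (6 * K ^+ 3); first by rewrite mulr_gt0// exprn_gt0//; lra.
move=> h h0 hK eta.
have hK1 : h * K <= 1 by apply: le_trans hK; rewrite ler_wpM2l//; lra.
pose e z := expR (h / 2 * W z); pose r z := e z - 1 - h / 2 * W z.
have hW z : `|h / 2 * W z| <= h * K / 2.
  by rewrite normrM ger0_norm ?divr_ge0// mulrAC ler_wpM2r// ler_wpM2l.
have rb z : `|r z| <= h ^+ 2 * K ^+ 2 / 2.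
  rewrite ger0_norm; last by rewrite /r /e; have := expR_ge1Dx (h / 2 * W z); lra.
  have := hW z; set x := h / 2 * W z => hx.
  have x2 : x <= 2^-1 by apply: le_trans (ler_norm _) _; apply: le_trans hx _; lra.
  have := expR_le_quadratic x2; rewrite /r /e -/x => hq.
  have hx2 : x ^+ 2 <= (h * K / 2) ^+ 2.
    by rewrite -[x ^+ 2]real_normK ?num_real// lerXn2r ?nnegrE// divr_ge0// mulr_ge0//; lra.
  have -> : h ^+ 2 * K ^+ 2 / 2 = 2 * (h * K / 2) ^+ 2 by field.
  lra.
have q r' : cylinder r' -> qcyl r' by exact: qcyl_cyl.
have cr : cylinder (fun z => r z * g z).
  by apply: cylinderM => //; apply: (cylinder_comp (fun x => expR (h / 2 * x) - 1 - h / 2 * x)).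
have E : S h (fun z => e z * g z) eta = S h g eta + (h / 2 * S h (fun z => W z * g z) eta + S h (fun z => r z * g z) eta).
  have cc := cylinder_continuous core.
  rewrite -(S_lin HS) -?(S_add HS)//; try by apply: cc.
    by congr (S h _ eta); apply/funext => z; rewrite /r; ring.
  by apply: continuous_lin; apply: cc.
set A := S h (fun z => W z * g z) eta in E; set C := S h (fun z => r z * g z) eta in E.
have hA : `|A - W eta * g eta| <= h * K by exact: (S_lip HS core).
have hG : `|S h g eta - g eta - h * L g eta| <= h ^+ 2 * K by exact: (S_taylor T0 HS core).
have hC : `|C| <= h ^+ 2 * K ^+ 3 / 2.
  apply: (S_contr HS) => //; first exact: (cylinder_continuous core).
  move=> z; rewrite normrM.
  have -> : h ^+ 2 * K ^+ 3 / 2 = h ^+ 2 * K ^+ 2 / 2 * K by ring.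
  exact: ler_pM.
set E1 := (S h g eta - g eta - h * L g eta) + h / 2 * (A - W eta * g eta) + C.
have h2 : 0 <= h ^+ 2 by exact: sqr_ge0.
have hE1 : `|E1| <= 2 * (h ^+ 2 * K ^+ 3).
  rewrite /E1; apply: le_trans (ler_normD _ _) _.
  have := ler_normD (S h g eta - g eta - h * L g eta) (h / 2 * (A - W eta * g eta)).
  have : `|h / 2 * (A - W eta * g eta)| <= h / 2 * (h * K).
    by rewrite normrM ger0_norm ?divr_ge0// ler_wpM2l// divr_ge0.
  have : h ^+ 2 * K <= h ^+ 2 * K ^+ 3 by rewrite ler_wpM2l.
  have -> : h / 2 * (h * K) = h ^+ 2 * K / 2 by ring.
  lra.
have -> : tilt h g eta - (g eta + h * (L g eta + W eta * g eta)) =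
   e eta * E1 + (r eta + h / 2 * W eta) * (h * L g eta + h / 2 * (W eta * g eta)) + r eta * g eta.
  rewrite /tilt -/(e _).
  have -> : S h (fun z => expR (h / 2 * W z) * g z) eta = S h (fun z => e z * g z) eta by [].
  by rewrite E /E1 /r; field.
have hK0 : 0 <= h * K by rewrite mulr_ge0//; lra.
have hK2 : h ^+ 2 * K ^+ 2 <= h * K.
  by rewrite -exprMn expr2 ler_piMl.
have he1 : `|r eta + h / 2 * W eta| <= h * K.
  apply: le_trans (ler_normD _ _) _; have := rb eta; have := hW eta; lra.
have he : `|e eta| <= 2.
  have -> : e eta = 1 + (r eta + h / 2 * W eta) by rewrite /r; ring.
  by apply: le_trans (ler_normD _ _) _; rewrite normr1; lra.
have hw : `|h * L g eta + h / 2 * (W eta * g eta)| <= 3 / 2 * (h * K).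
  apply: le_trans (ler_normD _ _) _; rewrite (normrM h) (normrM (h / 2)).
  rewrite [`|h|]ger0_norm// [`|h / 2|]ger0_norm ?divr_ge0//.
  have : h * `|L g eta| <= h * K by rewrite ler_wpM2l.
  have : h / 2 * `|W eta * g eta| <= h / 2 * K by rewrite ler_wpM2l// divr_ge0.
  lra.
apply: le_trans (ler_normD _ _) _.
apply: (@le_trans _ _ ((2 * (2 * (h ^+ 2 * K ^+ 3)) + h * K * (3 / 2 * (h * K))) + h ^+ 2 * K ^+ 2 / 2 * K)).
  apply: lerD; last by rewrite normrM ler_pM.
  apply: le_trans (ler_normD _ _) _; apply: lerD; rewrite normrM; exact: ler_pM.
have -> : 2 * (2 * (h ^+ 2 * K ^+ 3)) + h * K * (3 / 2 * (h * K)) + h ^+ 2 * K ^+ 2 / 2 * K =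
  h ^+ 2 * (9 / 2 * K ^+ 3 + 3 / 2 * K ^+ 2) by field.
rewrite ler_wpM2l//.
have : K ^+ 2 <= K ^+ 3 by rewrite [leRHS]exprS ler_peMl// sqr_ge0.
have : 0 <= K ^+ 2 by exact: sqr_ge0.
lra.
Qed.

(** One step multiplies [phi] by at most [exp (h l + h^2 K / c0)]; [n = 1 / h] steps leave [l] and
    an error of order [1 / n]. [C] is at once the error constant and the threshold for [n]. *)
Lemma fk_upper phi c0 l : cylinder phi -> 0 < c0 -> (forall z, c0 <= phi z) ->
  (forall z, L phi z + W z * phi z <= l * phi z) ->
  exists2 C, 0 <= C & forall n : nat, C <= n%:R -> (0 < n)%N ->
    mu (iter n (fkstep n%:R^-1) (fun=> 1)) <= expR (l + C / n%:R).
Proof.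
move=> cphi c00 c0phi lphi; have [K K0 H] := tilt_expand cphi.
have cb0 : 0 <= cb by apply: le_trans (Wb point).
have Kc : 0 <= K / c0 by rewrite divr_ge0 ?ltW.
exists (K + (cb + K / c0)); first by rewrite !addr_ge0// ltW.
move=> n Cn n0; have n1 : 0 < n%:R :> R by rewrite ltr0n.
pose h : R := n%:R^-1; have h0 : 0 <= h by rewrite invr_ge0 ltW.
have hK : h * K <= 1 by rewrite mulrC ler_pdivrMr// mul1r; apply: le_trans Cn; lra.
set m := expR (h * l + h ^+ 2 * (K / c0)).
have step z : tilt h phi z <= m * phi z.
  have p0 := lt_le_trans c00 (c0phi z).
  have := H h h0 hK z; rewrite ler_norml => /andP[_]; rewrite lerBlDr => /le_trans; apply.
  apply: (@le_trans _ _ ((1 + (h * l + h ^+ 2 * (K / c0))) * phi z)); last by rewrite ler_wpM2r ?expR_ge1Dx// ltW.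
  have := lphi z => hl.
  have : h * (L phi z + W z * phi z) <= h * (l * phi z) by rewrite ler_wpM2l.
  have : h ^+ 2 * K <= h ^+ 2 * (K / c0) * phi z.
    rewrite -mulrA ler_wpM2l ?sqr_ge0// -mulrA ler_peMr ?(ltW K0)// mulrC.
    by rewrite ler_pdivlMr// mul1r.
  lra.
apply: le_trans (fkstep_upper n h0 cphi c00 c0phi (expR_ge0 _) step) _.
rewrite -expRM_natr -expRD ler_expR.
have -> : (h * l + h ^+ 2 * (K / c0)) * n%:R = l + h * (K / c0).
  by rewrite /h; field; rewrite !gt_eqF.
rewrite -/h [(K + _) * h]mulrC mulrDr; have := mulr_ge0 h0 (ltW K0); lra.
Qed.

Lemma expR_quadratic_le (y : R) : `|y| <= 10^-1 -> expR (y - 4 * y ^+ 2) <= 1 + y.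
Proof.
rewrite ler_norml => /andP[y1 y2].
have q : y - 4 * y ^+ 2 <= 2^-1 by have := sqr_ge0 y; lra.
apply: le_trans (expR_le_quadratic q) _.
have -> : 1 + (y - 4 * y ^+ 2) + 2 * (y - 4 * y ^+ 2) ^+ 2 = 1 + y - y ^+ 2 * (4 - 2 * (1 - 4 * y) ^+ 2) by ring.
rewrite lerBlDr lerDl mulr_ge0 ?sqr_ge0//; nra.
Qed.

(** [1 + y], with [y] close to [h q], bounds the one-step value [<g, B g>] from below; comparing its
    [n]-th power with [exp (n y)] by [expR_quadratic_le] costs [n y^2], of order [1 / n]. *)
Lemma fk_lower g c q : cylinder g -> 0 < c -> (forall z, 0 <= g z <= c) -> mu (fun eta => g eta ^+ 2) = 1 ->
  mu (fun eta => g eta * (L g eta + W eta * g eta)) = q ->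
  exists2 C, 0 <= C & forall k : nat, C <= (2 ^ k)%:R ->
    expR (q - C / (2 ^ k)%:R) / c ^+ 2 <= mu (iter (2 ^ k) (fkstep (2 ^ k)%:R^-1) (fun=> 1)).
Proof.
move=> cg c0 gc g1 gq; have [K K0 H] := tilt_expand cg.
have cb0 : 0 <= cb by apply: le_trans (Wb point).
pose D : R := `|q| + K * c.
have D0 : 0 <= D by rewrite addr_ge0// mulr_ge0// ltW.
have KC0 : 0 <= K * c by rewrite mulr_ge0 ?ltW.
exists (1 + K + 10 * D + (cb + K * c + 4 * D ^+ 2)).
  by rewrite !addr_ge0 ?mulr_ge0 ?sqr_ge0// ltW.
move=> k; set n := (2 ^ k)%N => Cn.
have n0 : 0 < n%:R :> R by rewrite ltr0n expn_gt0.
have D2 := sqr_ge0 D.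
pose h : R := n%:R^-1; have h0 : 0 <= h by rewrite invr_ge0 ltW.
have hK : h * K <= 1 by rewrite mulrC ler_pdivrMr// mul1r; apply: le_trans Cn; lra.
have h1 : h <= 1 by rewrite -[h]mul1r ler_pdivrMr// mul1r; apply: le_trans Cn; lra.
have hD : h * D <= 10^-1 by rewrite mulrC ler_pdivrMr// -(ler_pM2l (ltr0n R 10)) mulrA divff ?mul1r//; apply: le_trans Cn; lra.
have qg := qcyl_cyl cg.
have g0 z : 0 <= g z by case/andP: (gc z).
apply: le_trans (fkstep_lower k h0 c0 qg gc g1).
rewrite -/n [leRHS]mulrAC ler_pM2r ?invr_gt0 ?exprn_gt0//.
pose y : R := h * q - h ^+ 2 * (K * c).
have hy : `|y| <= h * D.
  apply: le_trans (ler_normB _ _) _; rewrite normrM [`|h|]ger0_norm// [`|h ^+ 2 * _|]ger0_norm ?mulr_ge0 ?sqr_ge0 ?(ltW K0) ?(ltW c0)//.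
  by rewrite mulrDr lerD// expr2 -mulrA ler_wpM2l// ler_piMl// mulr_ge0.
have B1 : 1 + y <= mu (fun eta => g eta * tilt h g eta).
  have qL := qcyl_cyl (cylinder_generator T cg).
  have qW := qcyl_cyl cW.
  have q1 : qcyl (fun eta => g eta * (L g eta + W eta * g eta)).
    by apply: qcyl_mul => //; apply: qcyl_add => //; exact: qcyl_mul.
  have q2 : qcyl (fun eta => g eta ^+ 2) by exact: qcyl_mul.
  have -> : 1 + y = mu (fun eta => h * (g eta * (L g eta + W eta * g eta)) + (g eta ^+ 2 - h ^+ 2 * (K * c))).
    rewrite mu_lin//; last by apply: qcyl_sub => //; exact: qcyl_cst.
    by rewrite mu_sub//; [rewrite gq g1 mu_cst /y; ring|exact: qcyl_cst].
  apply: mu_le.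
  - by apply: qcyl_lin => //; apply: qcyl_sub => //; exact: qcyl_cst.
  - by apply: qcyl_mul => //; exact: qcyl_tilt.
  move=> eta; have := H h h0 hK eta; rewrite ler_norml => /andP[+ _].
  have /andP[ga gb] := gc eta.
  move=> H1; have : g eta * (- (h ^+ 2 * K)) <= g eta * (tilt h g eta - (g eta + h * (L g eta + W eta * g eta))).
    by rewrite ler_wpM2l.
  have : g eta * (h ^+ 2 * K) <= c * (h ^+ 2 * K) by rewrite ler_wpM2r// mulr_ge0 ?sqr_ge0 ?ltW.
  lra.
have B2 : expR (y - 4 * y ^+ 2) <= mu (fun eta => g eta * tilt h g eta).
  by apply: le_trans B1; apply: expR_quadratic_le; exact: le_trans hy hD.
have B3 : expR (y - 4 * y ^+ 2) ^+ n <= mu (fun eta => g eta * tilt h g eta) ^+ n.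
  by rewrite lerXn2r ?nnegrE ?expR_ge0// (le_trans _ B2) ?expR_ge0.
apply: (@le_trans _ _ (expR (- h * cb) * expR (y - 4 * y ^+ 2) ^+ n)); last by rewrite ler_wpM2l ?expR_ge0.
rewrite -expRM_natr -expRD ler_expR.
have hy2 : y ^+ 2 <= (h * D) ^+ 2.
  by rewrite -[y ^+ 2]real_normK ?num_real// lerXn2r ?nnegrE ?mulr_ge0.
have hn : h * n%:R = 1 by rewrite /h mulVf// gt_eqF.
have -> : (y - 4 * y ^+ 2) * n%:R = q - h * (K * c) - 4 * y ^+ 2 * n%:R.
  by rewrite /y; ring: hn.
have : 4 * y ^+ 2 * n%:R <= 4 * D ^+ 2 * h.
  have -> : 4 * D ^+ 2 * h = 4 * (h * D) ^+ 2 * n%:R by ring: hn.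
  by rewrite ler_wpM2r ?(ltW n0)// ler_wpM2l.
rewrite -/h; set X := 1 + K + 10 * D; have X0 : 0 <= X by rewrite /X; lra.
have := mulr_ge0 X0 h0; lra.
Qed.

End QuasiCylinder.

(** * Path space *)

Section Coordinates.
Variable R : realType.
Implicit Types (x : cadlag_path R) (z : site) (r s t p q : R).
Local Notation Om := (path_space R).

Lemma entourage_coord z : entourage [set ab : config * config | ab.1 z = ab.2 z].
Proof.
rewrite /entourage /= /sup_ent.
pose E := [set ab : config * config | ab.1 z = ab.2 z].
have ez : @entourage (initial_topology (fun f : config => f z)) E.
  exists [set ab : bool * bool | ab.1 = ab.2]; last by move=> [a b].
  by rewrite uniform_discrete => _ [b _ <-].
exists E => //.
(* The product uniformity is generated by the entourages pulled back along single coordinates; [E]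
   is one of them. *)
match goal with |- @finI_from ?J ?T ?D ?f _ =>
  have H : exists i : J, f i = E; [by exists (exist _ (z, E) (asboolT ez))|];
  case: H => i <-; exact: (@finI_from1 J T D f i I) end.
Qed.

Lemma coord_right_continuous x z t : 0 <= t -> exists2 d, 0 < d & forall s, t <= s < t + d -> x s z = x t z.
Proof.
move=> t0; have := path_right_continuous t0 (c := x).
have nb : nbhs (x t) [set eta : config | eta z = x t z].
  have := @proj_continuous site (fun _ => bool) z (x t) [set x t z].
  by apply; exact: (@discrete_set1 bool).
move=> /(_ _ nb); rewrite /= /at_right => -[d /= d0 H].
exists d => // s /andP[]; rewrite le_eqVlt => /orP[/eqP <-//|ts sd].
by apply: (H s) => //=; rewrite ltr_distl; apply/andP; split; lra.
Qed.

(* These sets are Skorohod open, and by right continuity the event [x r z] is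
   the intersection of the sets hits r (r + m.+1%:R^-1) z. *)
Definition hits p q z : set (cadlag_path R) := [set x : cadlag_path R | exists s, p < s < q /\ x s z].

(** By right continuity the particle stays at [z] on an interval that starts at [s]. The time change
    eventually moves its midpoint by less than half its length, hence keeps it inside. *)
Lemma hits_open p q z : 0 <= p -> skorohod_open (hits p q z).
Proof.
move=> p0 x xn [s [/andP[ps sq] xs]] [l [lt cv]].
have s0 : 0 <= s by lra.
have [d d0 H] := coord_right_continuous x z s0.
set e := Num.min d (q - s).
have e0 : 0 < e by rewrite lt_min d0 subr_gt0.
have [ed eq] : e <= d /\ e <= q - s by rewrite /e; split; rewrite ge_min lexx ?orbT.
have N0 : 0 < s + e by lra.
have [uc ec] := cv _ N0.
have e2 : 0 < e / 2 by rewrite divr_gt0.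
have near1 : \forall n \near \oo, `|l n (s + e / 2) - (s + e / 2)| < e / 2.
  lapply (uc [set u : R -> R | forall y, `[0, s + e]%classic y -> `|y - u y| < e / 2]).
    move=> H1.
    have H2 : \forall n \near \oo, forall y, `[0, s + e]%classic y -> `|y - l n y| < e / 2 by exact: H1.
    apply: filterS H2 => n /= /(_ (s + e / 2)); rewrite distrC; apply.
    by rewrite /= in_itv /=; apply/andP; split; lra.
  apply/uniform_nbhs; exists [set xy | `|xy.1 - xy.2| < e / 2]; split => //.
  by rewrite -(@entourage_ballE R R); exists (e / 2).
have near2 := ec _ (entourage_coord z).
near=> n; exists (s + e / 2); split; first by apply/andP; split; lra.
have h1 : `|l n (s + e / 2) - (s + e / 2)| < e / 2 by near: n.
have h2 : forall u, 0 <= u <= s + e -> xn n u z = x (l n u) z by near: n; exact: near2.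
rewrite h2; last by apply/andP; split; lra.
rewrite H ?xs//; move: h1; rewrite ltr_distl => /andP[h1 h1']; apply/andP; split; lra.
Unshelve. all: by end_near. Qed.

Lemma measurable_hits p q z : 0 <= p -> measurable (hits p q z : set Om).
Proof. by move=> p0; apply: sub_sigma_algebra; exact: hits_open. Qed.

Lemma coord_hits r z : 0 <= r ->
  [set x : cadlag_path R | x r z] = \bigcap_(m : nat) hits r (r + m.+1%:R^-1) z.
Proof.
move=> r0; apply/seteqP; split => x.
  move=> /= xr m _; have [d d0 H] := coord_right_continuous x z r0.
  set k : R := m.+1%:R^-1; have k0 : 0 < k by rewrite invr_gt0.
  set e := Num.min d k.
  have e0 : 0 < e by rewrite lt_min d0.
  have [ed ek] : e <= d /\ e <= k by rewrite /e; split; rewrite ge_min lexx ?orbT.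
  exists (r + e / 2); split; first by apply/andP; split; lra.
  by rewrite H//; apply/andP; split; lra.
move=> xh /=; have [d d0 H] := coord_right_continuous x z r0.
have [s [/andP[rs sr] xs]] := xh (Num.truncn d^-1) I.
rewrite -(H s)//; apply/andP; split; first exact: ltW.
apply: lt_le_trans sr _; rewrite lerD2l -[leRHS]invrK lef_pV2 ?posrE ?invr_gt0//.
exact/ltW/truncnS_gt.
Qed.

Lemma measurable_coord r z : 0 <= r -> measurable ([set x : cadlag_path R | x r z] : set Om).
Proof.
move=> r0; rewrite coord_hits//; apply: bigcapT_measurable => m; exact: measurable_hits.
Qed.

Lemma measurable_past s (A : set (cadlag_path R)) : past s A -> measurable (A : set Om).
Proof.
apply: smallest_sub; first exact: sigma_algebra_measurable.
by move=> _ [r [z [/andP[r0 _] ->]]]; exact: measurable_coord.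
Qed.

Lemma past_coord r s z : 0 <= r -> r <= s -> past s [set x : cadlag_path R | x r z].
Proof. by move=> r0 rs; apply: sub_sigma_algebra; exists r, z; rewrite r0. Qed.

Lemma pastI s (A B : set (cadlag_path R)) : past s A -> past s B -> past s (A `&` B).
Proof.
move=> pA pB.
exact: (@measurableI _ (g_sigma_algebraType [set A | exists (r : R) (z : site), 0 <= r <= s /\ A = [set x : cadlag_path R | x r z]])).
Qed.

Lemma pastC s (A : set (cadlag_path R)) : past s A -> past s (~` A).
Proof.
move=> pA.
exact: (@measurableC _ (g_sigma_algebraType [set A | exists (r : R) (z : site), 0 <= r <= s /\ A = [set x : cadlag_path R | x r z]])).
Qed.

Lemma pastT s : past s [set: cadlag_path R].
Proof.
exact: (@measurableT _ (g_sigma_algebraType [set A | exists (r : R) (z : site), 0 <= r <= s /\ A = [set x : cadlag_path R | x r z]])).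
Qed.

Lemma past_mono s t (A : set (cadlag_path R)) : s <= t -> past s A -> past t A.
Proof.
move=> st; apply: smallest_sub; first exact: smallest_sigma_algebra.
move=> _ [r [z [/andP[r0 rs] ->]]]; apply: past_coord => //; exact: le_trans st.
Qed.

Definition at_pattern (t : R) (A : seq site) (m : seq bool) : set (cadlag_path R) :=
  [set x : cadlag_path R | [seq x t z | z <- A] == m].

Lemma past_pattern t A m : 0 <= t -> past t (at_pattern t A m).
Proof.
move=> t0; elim: A m => [|z A IH] [|b m].
- by have := @pastT t; congr (past t _); apply/seteqP; split.
- have := pastC (@pastT t); congr (past t _); rewrite setCT; apply/seteqP; split => //.
- have := pastC (@pastT t); congr (past t _); rewrite setCT; apply/seteqP; split => //.
have -> : at_pattern t (z :: A) (b :: m) = [set x : cadlag_path R | x t z = b] `&` at_pattern t A m.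
  apply/seteqP; split => x; rewrite /at_pattern /= eqseq_cons; first by move=> /andP[/eqP].
  by move=> [-> ->]; rewrite eqxx.
apply: pastI => //; case: b; first exact: past_coord.
have := pastC (past_coord z t0 (lexx t)); congr (past t _).
by apply/seteqP; split => x /=; case: (x t z).
Qed.

End Coordinates.

(** * Expectations of bounded random variables *)

Section BoundedMeasurable.
Variables (R : realType) (d : measure_display) (Om : measurableType d) (P : probability Om R).
Implicit Types (X Y : Om -> R).

Definition bounded_rv X := measurable_fun setT X /\ exists c : R, forall w, `|X w| <= c.

Lemma bounded_rv_cst c : bounded_rv (fun=> c).
Proof. by split; [exact: measurable_cst|exists `|c|]. Qed.

Lemma bounded_rv_indic (A : set Om) : measurable A -> bounded_rv (\1_A).
Proof.
move=> mA; split; first exact: measurable_indic.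
by exists 1 => w; rewrite indicE; case: (_ \in _); rewrite ?normr1 ?normr0.
Qed.

Lemma bounded_rv_add X Y : bounded_rv X -> bounded_rv Y -> bounded_rv (fun w => X w + Y w).
Proof.
move=> [mX [c Xc]] [mY [c' Yc]]; split; first exact: measurable_funD.
by exists (c + c') => w; apply: le_trans (ler_normD _ _) _; exact: lerD.
Qed.

Lemma bounded_rv_mul X Y : bounded_rv X -> bounded_rv Y -> bounded_rv (fun w => X w * Y w).
Proof.
move=> [mX [c Xc]] [mY [c' Yc]]; split; first exact: measurable_funM.
by exists (c * c') => w; rewrite normrM; apply: ler_pM.
Qed.

Lemma bounded_rv_sum (I : Type) (r : seq I) (F : I -> Om -> R) : (forall i, bounded_rv (F i)) -> bounded_rv (fun w => \sum_(i <- r) F i w).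
Proof.
move=> h; elim: r => [|i r IH].
  by under [X in bounded_rv X]funext => w do rewrite big_nil; exact: bounded_rv_cst.
by under [X in bounded_rv X]funext => w do rewrite big_cons; exact: bounded_rv_add.
Qed.

Lemma bounded_rv_prod (I : Type) (r : seq I) (F : I -> Om -> R) : (forall i, bounded_rv (F i)) -> bounded_rv (fun w => \prod_(i <- r) F i w).
Proof.
move=> h; elim: r => [|i r IH].
  by under [X in bounded_rv X]funext => w do rewrite big_nil; exact: bounded_rv_cst.
by under [X in bounded_rv X]funext => w do rewrite big_cons; exact: bounded_rv_mul.
Qed.

Lemma bounded_rv_expR X : bounded_rv X -> bounded_rv (fun w => expR (X w)).
Proof.
move=> [mX [c Xc]]; split; first by apply: measurableT_comp => //; exact: measurable_expR.
exists (expR c) => w; rewrite ger0_norm ?expR_ge0// ler_expR; exact: le_trans (ler_norm _) (Xc w).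
Qed.

Lemma bounded_rv_lim (X_ : nat -> Om -> R) X c : (forall n, bounded_rv (X_ n)) -> (forall n w, `|X_ n w| <= c) ->
  (forall w, X_ ^~ w @ \oo --> X w) -> bounded_rv X.
Proof.
move=> h hc cv; split.
  by apply: (@measurable_fun_cvg _ _ _ _ X_) => [m|w _]; [case: (h m)|exact: cv].
exists c => w; have cvn := cvg_norm (cv w).
have <- := cvg_lim (@Rhausdorff R) (cvn _).
apply: limr_le; first by apply: (cvgP `|X w|); exact: cvn.
by apply: nearW => n.
Qed.

Lemma bounded_rv_integrable X (A : set Om) : measurable A -> bounded_rv X -> P.-integrable A (EFin \o X).
Proof.
move=> mA [mX [c Xc]]; apply: measurable_bounded_integrable => //.
- by apply: le_lt_trans (probability_le1 P mA) _; rewrite ltry.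
- by apply: measurable_funTS.
- exists c; split; first exact: num_real.
  by move=> M cM w _; apply: le_trans (Xc w) _; exact: ltW.
Qed.

Definition Ex X : R := \int[P]_w X w.

Lemma Ex_lin a X Y : bounded_rv X -> bounded_rv Y -> Ex (fun w => a * X w + Y w) = a * Ex X + Ex Y.
Proof.
move=> bX bY; rewrite /Ex RintegralD ?RintegralZl//; try exact: bounded_rv_integrable.
by apply: bounded_rv_integrable => //; apply: bounded_rv_mul => //; exact: bounded_rv_cst.
Qed.

Lemma Ex_cst c : Ex (fun=> c) = c.
Proof. rewrite /Ex Rintegral_cst//.
rewrite [X in fine X](_ : _ = 1%E) ?mulr1//; exact: probability_setT. Qed.

Lemma Ex_le X Y : bounded_rv X -> bounded_rv Y -> (forall w, X w <= Y w) -> Ex X <= Ex Y.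
Proof. by move=> bX bY XY; apply: le_Rintegral => //; exact: bounded_rv_integrable. Qed.

Lemma Ex_ge0 X : (forall w, 0 <= X w) -> 0 <= Ex X.
Proof. by move=> X0; apply: Rintegral_ge0. Qed.

Lemma Ex_add X Y : bounded_rv X -> bounded_rv Y -> Ex (fun w => X w + Y w) = Ex X + Ex Y.
Proof. by move=> bX bY; rewrite /Ex RintegralD//; exact: bounded_rv_integrable. Qed.

Lemma Ex_scale a X : bounded_rv X -> Ex (fun w => a * X w) = a * Ex X.
Proof. by move=> bX; rewrite /Ex RintegralZl//; exact: bounded_rv_integrable. Qed.

Lemma Ex_sum (I : Type) (r : seq I) (F : I -> Om -> R) : (forall i, bounded_rv (F i)) ->
  Ex (fun w => \sum_(i <- r) F i w) = \sum_(i <- r) Ex (F i).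
Proof.
move=> h; elim: r => [|i r IH].
  by under [X in Ex X]funext => w do rewrite big_nil; rewrite big_nil Ex_cst.
under [X in Ex X]funext => w do rewrite big_cons; rewrite big_cons Ex_add ?IH//; exact: bounded_rv_sum.
Qed.

Lemma Ex_indic (A : set Om) : measurable A -> (Ex (\1_A))%:E = P A.
Proof.
move=> mA; rewrite /Ex /Rintegral integral_indic// setIT fineK//.
by rewrite fin_num_measure.
Qed.

Lemma Rintegral_indicE (A : set Om) X : \int[P]_(w in A) X w = Ex (fun w => \1_A w * X w).
Proof.
rewrite /Ex Rintegral_mkcond; apply: eq_Rintegral => w _; rewrite patchE indicE.
by case: ifP; rewrite ?mul1r ?mul0r.
Qed.

Lemma Ex_lim (X_ : nat -> Om -> R) X c : (forall n, bounded_rv (X_ n)) -> (forall n w, `|X_ n w| <= c) ->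
  (forall w, X_ ^~ w @ \oo --> X w) -> (fun n => Ex (X_ n)) @ \oo --> Ex X.
Proof.
move=> h hc cv; have bX := bounded_rv_lim h hc cv.
have [] := @dominated_convergence _ _ _ P setT measurableT (fun n => EFin \o X_ n) (EFin \o X) (EFin \o cst c).
- by move=> n; apply/measurable_EFinP; case: (h n).
- by apply/measurable_EFinP; case: bX.
- by apply: aeW => w _; apply: cvg_EFin; [exact: nearW|exact: cv].
- by apply: bounded_rv_integrable => //; exact: bounded_rv_cst.
- by apply: aeW => w n _ /=; rewrite lee_fin.
move=> _ _ H; apply: (@fine_cvg R _ _ _ (fun n => (\int[P]_w (X_ n w)%:E)%E)).
rewrite /Ex /Rintegral fineK//; apply: integrable_fin_num => //; exact: bounded_rv_integrable.
Qed.

End BoundedMeasurable.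

(** * Riemann sums of right-continuous step paths *)

Section Riemann.
Variables (R : realType) (f : R -> R) (c : R).
Hypothesis fc : forall s, `|f s| <= c.
Hypothesis f_right : forall t, 0 <= t -> exists2 d, 0 < d & forall s, t <= s < t + d -> f s = f t.
Local Notation leb := (@lebesgue_measure R).
Local Notation D := (`[0, 1[%classic : set R).

Definition cell (n i : nat) : set R := `[i%:R / n.+1%:R, i.+1%:R / n.+1%:R[%classic.
(** Right endpoints are used: pointwise convergence then follows from right continuity, and the
    sampling times are those of the discrete Feynman-Kac formula. *)
Definition step_fun (n : nat) (s : R) : R := \sum_(i < n.+1) f (i.+1%:R / n.+1%:R) * \1_(cell n i) s.

Lemma mem_cell n i (s : R) : (s \in cell n i) = (i%:R <= s * n.+1%:R < i.+1%:R).
Proof.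
have n0 : 0 < n.+1%:R :> R by rewrite ltr0n.
by apply/idP/idP; rewrite in_setE /cell /= in_itv /= ler_pdivrMr// ltr_pdivlMr.
Qed.

Lemma step_funE n s : 0 <= s < 1 -> step_fun n s = f ((Num.truncn (s * n.+1%:R)).+1%:R / n.+1%:R).
Proof.
move=> /andP[s0 s1]; have n0 : 0 < n.+1%:R :> R by rewrite ltr0n.
have sn : 0 <= s * n.+1%:R by rewrite mulr_ge0// ltW.
have /andP[k1 k2] := truncn_itv sn.
have kn : (Num.truncn (s * n.+1%:R) < n.+1)%N.
  rewrite -(ltr_nat R); apply: le_lt_trans k1 _; by rewrite gtr_pMl.
rewrite /step_fun (bigD1 (Ordinal kn))//= indicE mem_cell k1 k2 mulr1 big1 ?addr0// => i ik.
rewrite indicE mem_cell; case: andP => //; last by rewrite mulr0.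
move=> [i1 i2]; case/negP: ik; apply/eqP/val_inj => /=; apply/eqP; rewrite eqn_leq.
apply/andP; split; rewrite -ltnS -(ltr_nat R).
  exact: le_lt_trans i1 k2.
exact: le_lt_trans k1 i2.
Qed.

Lemma measurable_step n : measurable_fun setT (step_fun n).
Proof.
apply: measurable_sum => i; apply: measurable_funM; first exact: measurable_cst.
apply: measurable_indic; exact: measurable_itv.
Qed.

Lemma step_cvg s : D s -> step_fun ^~ s @ \oo --> f s.
Proof.
rewrite /= in_itv /= => s01; have /andP[s0 s1] := s01.
have [d d0 H] := f_right s0.
apply: cvg_near_cst; near=> n.
rewrite step_funE// H//.
have n0 : 0 < n.+1%:R :> R by rewrite ltr0n.
have sn : 0 <= s * n.+1%:R by rewrite mulr_ge0// ltW.
have /andP[k1 k2] := truncn_itv sn.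
apply/andP; split; first by rewrite ler_pdivlMr// ltW.
rewrite ltr_pdivrMr// mulrDl -natr1; apply: ler_ltD => //.
rewrite mulrC -ltr_pdivrMr// mul1r; apply: lt_le_trans (truncnS_gt _) _.
rewrite ler_nat ltnS; near: n; exact: nbhs_infty_ge.
Unshelve. all: by end_near. Qed.

Let mD : measurable D.
Proof. exact: measurable_itv. Qed.

Let leb_itv a b : a <= b -> leb `[a, b[%classic = (b - a)%:E.
Proof.
move=> ab; rewrite lebesgue_measure_itv /= lte_fin; case: ltP => // ba.
by congr EFin; lra.
Qed.

Let D1 : leb D = 1%E.
Proof. by rewrite leb_itv// subr0. Qed.

Let D_int (g : R -> R) k : measurable_fun setT g -> (forall s, `|g s| <= k) -> leb.-integrable D (EFin \o g).
Proof.
move=> mg gk; apply: measurable_bounded_integrable => //.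
- rewrite [X in (X < _)%E](_ : _ = 1%E) ?ltry//; exact: D1.
- exact: measurable_funTS.
- exists k; split; first exact: num_real.
  by move=> M kM w _; apply: le_trans (gk w) _; exact: ltW.
Qed.

Let indic_bound (A : set R) (s : R) : `|\1_A s : R| <= 1.
Proof. by rewrite indicE; case: (_ \in _); rewrite ?normr1 ?normr0. Qed.

Lemma step_integral n : \int[leb]_(s in D) step_fun n s = n.+1%:R^-1 * \sum_(i < n.+1) f (i.+1%:R / n.+1%:R).
Proof.
rewrite mulr_sumr /step_fun.
have term (i : 'I_n.+1) : leb.-integrable D (EFin \o (fun s => f (i.+1%:R / n.+1%:R) * \1_(cell n i) s)) /\
   \int[leb]_(s in D) (f (i.+1%:R / n.+1%:R) * \1_(cell n i) s) = n.+1%:R^-1 * f (i.+1%:R / n.+1%:R).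
  have mi : measurable (cell n i) by exact: measurable_itv.
  have n0 : 0 < n.+1%:R :> R by rewrite ltr0n.
  split.
    apply: (D_int (k := c * 1)).
      by apply: measurable_funM; [exact: measurable_cst|exact: measurable_indic].
    by move=> s; rewrite normrM; apply: ler_pM.
  rewrite RintegralZl//; last by apply: (D_int (k := 1)) => //; exact: measurable_indic.
  rewrite mulrC; congr (_ * _); rewrite /Rintegral integral_indic//.
  have -> : cell n i `&` D = cell n i.
    apply/setIidPl => s /= ; rewrite /cell /= !in_itv /= => /andP[h1 h2]; apply/andP; split.
      by apply: le_trans h1; rewrite divr_ge0// ltW.
    apply: lt_le_trans h2 _; rewrite ler_pdivrMr// mul1r ler_nat; exact: ltn_ord.
  have E : leb (cell n i) = (i.+1%:R / n.+1%:R - i%:R / n.+1%:R)%:E.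
    by apply: leb_itv; rewrite ler_pM2r ?invr_gt0// ler_nat.
  rewrite [X in fine X](_ : _ = (i.+1%:R / n.+1%:R - i%:R / n.+1%:R)%:E)//= -mulrBl -natr1.
  by rewrite addrAC subrr add0r mul1r.
suff G (r : seq 'I_n.+1) : leb.-integrable D (EFin \o (fun s => \sum_(i <- r) f (i.+1%:R / n.+1%:R) * \1_(cell n i) s)) /\
  \int[leb]_(s in D) (\sum_(i <- r) f (i.+1%:R / n.+1%:R) * \1_(cell n i) s) = \sum_(i <- r) n.+1%:R^-1 * f (i.+1%:R / n.+1%:R).
  by case: (G (index_enum 'I_n.+1)).
elim: r => [|i r [IH1 IH2]].
  under [X in EFin \o X]funext => s do rewrite big_nil.
  rewrite big_nil; split; first by apply: (D_int (k := 0)) => // s; rewrite normr0.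
  transitivity (\int[leb]_(s in D) (cst 0) s).
    by apply: eq_Rintegral => s _; rewrite big_nil.
  by rewrite Rintegral_cst// mul0r.
under [X in EFin \o X]funext => s do rewrite big_cons.
have [t1 t2] := term i; split.
  by apply: (integrableD _ t1 IH1); exact: measurable_itv.
rewrite big_cons -t2 -IH2 -RintegralD//; apply: eq_Rintegral => s _; by rewrite big_cons.
Qed.

Lemma riemann_cvg :
  (fun n => n.+1%:R^-1 * \sum_(i < n.+1) f (i.+1%:R / n.+1%:R)) @ \oo --> \int[leb]_(s in `[0, 1]) f s.
Proof.
have mf : measurable_fun D f.
  apply: (@measurable_fun_cvg _ _ _ _ step_fun) => [m|]; last exact: step_cvg.
  exact: measurable_funTS (measurable_step m).
have c0 : 0 <= c by apply: le_trans (fc 0).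
have bst n s : D s -> `|step_fun n s| <= c.
  by rewrite /= in_itv /= => s01; rewrite step_funE.
have [] := @dominated_convergence _ _ _ leb D mD (fun n => EFin \o step_fun n) (EFin \o f) (EFin \o cst c).
- by move=> n; apply/measurable_EFinP; exact: measurable_funTS (measurable_step n).
- exact/measurable_EFinP.
- by apply: aeW => w Dw; apply: cvg_EFin; [exact: nearW|exact: step_cvg].
- by apply: (D_int (k := c)) => // s; rewrite ger0_norm.
- by apply: aeW => w n Dw /=; rewrite lee_fin bst.
move=> fi _ H; rewrite -Rintegral_itv_bndo_bndc//.
have := @fine_cvg R _ _ _ (fun n => (\int[leb]_(w in D) (step_fun n w)%:E)%E) (\int[leb]_(s in D) f s).
rewrite {1}/Rintegral fineK; last exact: integrable_fin_num.
move=> /(_ _ _ H) H1.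
under eq_fun => n do rewrite -step_integral.
exact: H1.
Qed.

End Riemann.

(** * Feynman-Kac formula on path space and the initial law *)

Section PathLaw.
Variables (R : realType) (T alpha : R) (P : probability (path_space R) R).
Variable S : R -> (config -> R) -> (config -> R).
Hypothesis T0 : 0 <= T.
Hypothesis HS : markov_semigroup S.
Local Notation L := (ssep_generator T).
Hypothesis core : forall f, cylinder f -> generator_graph S f (L f).
Hypothesis bern : starts_from_bernoulli alpha P.
Hypothesis markov : markov_property S P.
Local Notation Om := (path_space R).
Implicit Types (f g : config -> R) (x : cadlag_path R).

Lemma bounded_rv_pattern t A m : 0 <= t -> bounded_rv (\1_(at_pattern t A m) : Om -> R).
Proof. by move=> t0; apply: bounded_rv_indic; apply: measurable_past; exact: past_pattern. Qed.

Lemma at_cylinder f A t x : dep A f -> f (x t) =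
  \sum_(m : (size A).-tuple bool) f (config_of (mask m A)) * \1_(at_pattern t A m) x.
Proof.
move=> Af; rewrite (cylinder_pattern Af); apply: eq_bigr => m _; congr (_ * _).
rewrite indicE; congr ((nat_of_bool _)%:R); apply/idP/idP; by rewrite in_setE.
Qed.

Lemma bounded_rv_cyl t f : 0 <= t -> cylinder f -> bounded_rv (fun x : Om => f (x t)).
Proof.
move=> t0 [A Af]; under [X in bounded_rv X]funext => x do rewrite (at_cylinder _ _ Af).
by apply: bounded_rv_sum => m; apply: bounded_rv_mul; [exact: bounded_rv_cst|exact: bounded_rv_pattern].
Qed.

Lemma bounded_rv_at t f : 0 <= t -> qcyl f -> bounded_rv (fun x : Om => f (x t)).
Proof.
move=> t0 qf; have [c c0 fc] := qcyl_bounded qf.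
have /choice[g Hg] : forall n : nat, exists g : config -> R, cylinder g /\ forall eta, `|f eta - g eta| <= n.+1%:R^-1.
  by move=> n; have [|g cg fg] := qf.2 n.+1%:R^-1; [rewrite invr_gt0|exists g].
apply: (@bounded_rv_lim R _ _ (fun n (x : Om) => g n (x t)) _ (c + 1)).
- by move=> n; apply: bounded_rv_cyl => //; case: (Hg n).
- move=> n x; have [_ /(_ (x t)) h] := Hg n.
  rewrite -[g n _](subrK (f (x t))) addrC; apply: le_trans (ler_normD _ _) _.
  apply: lerD => //; rewrite distrC; apply: le_trans h _.
  by rewrite invf_le1// ler1n.
- move=> x; apply/cvgrPdist_le => e e0; near=> n.
  have [_ /(_ (x t)) h] := Hg n; apply: le_trans h _.
  rewrite -[leRHS]invrK lef_pV2 ?posrE ?invr_gt0//; apply/ltW/(lt_le_trans (truncnS_gt _)).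
  rewrite ler_nat ltnS; near: n; exact: nbhs_infty_ge.
Unshelve. all: by end_near. Qed.

Lemma Ex_markov s t f (A : set (cadlag_path R)) : 0 <= s -> 0 <= t -> continuous f -> past s A ->
  Ex P (fun x : Om => \1_A x * f (x (s + t))) = Ex P (fun x : Om => \1_A x * S t f (x s)).
Proof. by move=> s0 t0 cf pA; rewrite -!Rintegral_indicE; exact: markov. Qed.

Variable W : config -> R.
Hypothesis cW : cylinder W.

(** The Markov property is stated on past events, so the weight at time [s + h] is expanded into
    pattern indicators, which are merged with the event [A]. The induction hypothesis must therefore
    cover all past events. *)
Lemma fk_paths h m s (A : set (cadlag_path R)) : 0 <= s -> 0 <= h -> past s A ->
  Ex P (fun x : Om => \1_A x * \prod_(i < m) expR (h * W (x (s + i.+1%:R * h)))) =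
  Ex P (fun x : Om => \1_A x * iter m (fkstep S W h) (fun=> 1) (x s)).
Proof.
move=> s0 h0; elim: m s s0 A => [|m IH] s s0 A pA.
  by congr (Ex P); apply/funext => x; rewrite big_ord0.
have sh : 0 <= s + h by rewrite addr_ge0.
pose M eta := expR (h * W eta).
have cM : cylinder M := cylinder_expW cW h.
have [B BM] := cM.
have mA : measurable (A : set Om) by exact: measurable_past pA.
have bP : bounded_rv (fun x : Om => \prod_(i < m) expR (h * W (x (s + h + i.+1%:R * h)))).
  apply: bounded_rv_prod => i; apply: (bounded_rv_at (f := fun eta => expR (h * W eta))).
    by rewrite addr_ge0// mulr_ge0.
  exact: (qcyl_cyl core).
have qF : qcyl (iter m (fkstep S W h) (fun=> 1)).
  by apply: (qcyl_iter_fkstep T0 HS core cW) => //; exact: (qcyl_cst core).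
have bF : bounded_rv (fun x : Om => iter m (fkstep S W h) (fun=> 1) (x (s + h))) by exact: bounded_rv_at.
have split_pattern (Y : Om -> R) : bounded_rv Y -> Ex P (fun x : Om => \1_A x * (M (x (s + h)) * Y x)) =
  \sum_(k : (size B).-tuple bool) M (config_of (mask k B)) * Ex P (fun x : Om => \1_(A `&` at_pattern (s + h) B k) x * Y x).
  move=> bY.
  have bk k : bounded_rv (fun x : Om => \1_(A `&` at_pattern (s + h) B k) x * Y x).
    by apply: bounded_rv_mul => //; apply: bounded_rv_indic; apply: measurableI => //; apply: measurable_past; exact: past_pattern.
  under [RHS]eq_bigr => k _ do rewrite -Ex_scale//.
  rewrite -Ex_sum; last by move=> k; apply: bounded_rv_mul => //; exact: bounded_rv_cst.
  congr (Ex P); apply/funext => x; rewrite (at_cylinder _ _ BM) mulr_suml mulr_sumr.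
  by apply: eq_bigr => k _; rewrite indicI /=; ring.
transitivity (Ex P (fun x : Om => \1_A x * (M (x (s + h)) * \prod_(i < m) expR (h * W (x (s + h + i.+1%:R * h)))))).
  congr (Ex P); apply/funext => x; rewrite big_ord_recl /= mul1r; congr (_ * (_ * _)).
  apply: eq_bigr => i _; congr (expR (_ * W (x _))).
  by rewrite /bump /= add1n -[i.+2%:R]natr1; ring.
rewrite split_pattern//.
transitivity (Ex P (fun x : Om => \1_A x * (M (x (s + h)) * iter m (fkstep S W h) (fun=> 1) (x (s + h))))).
  rewrite split_pattern//; apply: eq_bigr => k _; congr (_ * _); apply: IH => //.
  apply: pastI; last exact: past_pattern.
  by apply: past_mono pA; rewrite lerDl.
have qMF := qcyl_mul (qcyl_cyl core cM) qF.
rewrite (Ex_markov (f := fun eta => M eta * iter m (fkstep S W h) (fun=> 1) eta))//.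
by case: qMF.
Qed.

Definition riem (n : nat) f x : R := n%:R^-1 * \sum_(i < n) f (x (i.+1%:R / n%:R)).
Definition init f : R := Ex P (fun x : Om => f (x 0)).

Lemma bounded_rv_riem n f : qcyl f -> bounded_rv (riem n f : Om -> R).
Proof.
move=> qf; apply: bounded_rv_mul; first exact: bounded_rv_cst.
by apply: bounded_rv_sum => i; apply: bounded_rv_at => //; rewrite divr_ge0.
Qed.

Lemma fk_riem n : Ex P (fun x : Om => expR (riem n W x)) = init (iter n (fkstep S W n%:R^-1) (fun=> 1)).
Proof.
have n0 : 0 <= n%:R^-1 :> R by rewrite invr_ge0.
have := fk_paths n (lexx 0) n0 (@pastT R 0).
rewrite /init; congr (_ = _); congr (Ex P); apply/funext => x; rewrite indicT mul1r//.
rewrite /riem mulr_sumr expR_sum; apply: eq_bigr => i _.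
by rewrite add0r.
Qed.

Lemma Ex_at t f : 0 <= t -> continuous f -> Ex P (fun x : Om => f (x t)) = init (S t f).
Proof.
move=> t0 cf; have := Ex_markov (lexx 0) t0 cf (@pastT R 0).
by rewrite /init; congr (_ = _); congr (Ex P); apply/funext => x; rewrite indicT mul1r// add0r.
Qed.

Lemma init_lin a f g : qcyl f -> qcyl g -> init (fun eta => a * f eta + g eta) = a * init f + init g.
Proof. by move=> qf qg; rewrite /init Ex_lin//; exact: bounded_rv_at. Qed.

Lemma init_scale a f : qcyl f -> init (fun eta => a * f eta) = a * init f.
Proof. by move=> qf; rewrite /init Ex_scale//; exact: bounded_rv_at. Qed.

Lemma init_ge0 f : qcyl f -> (forall eta, 0 <= f eta) -> 0 <= init f.
Proof. by move=> _ f0; apply: Ex_ge0. Qed.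

Lemma init1 : init (fun=> 1) = 1.
Proof. exact: Ex_cst. Qed.

Definition weight (h : site -> bool -> R) z := alpha * h z true + (1 - alpha) * h z false.

(** The initial law is given on patterns: the induction moves one site at a time from the product
    into the pattern and sums over its two states. *)
Lemma init_pattern_prod (A B : seq site) (zeta : config) (h : site -> bool -> R) : uniq (A ++ B) ->
  init (fun eta => [forall z : seq_sub A, eta (val z) == zeta (val z)]%:R * \prod_(z <- B) h z (eta z)) =
  (\prod_(z <- A) (if zeta z then alpha else 1 - alpha)) * \prod_(z <- B) weight h z.
Proof.
elim: B A zeta => [|b B IH] A zeta.
  rewrite cats0 => uA; rewrite big_nil mulr1.
  have := bern zeta uA; rewrite -Ex_indic; last first.
    rewrite (_ : [set _ | _] = \bigcap_(z in [set` A]) [set x : cadlag_path R | x 0 z = zeta z]); last first.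
      by apply/seteqP; split => x /= h' z zA; apply: h'.
    apply: fin_bigcap_measurable => [|z _]; first exact: finite_seq.
    apply: measurable_past; have := past_pattern [:: z] [:: zeta z] (lexx (0 : R)).
    congr (past _ _); apply/seteqP; split => x; rewrite /at_pattern /= eqseq_cons andbT; first by move=> /eqP.
    by move=> ->; rewrite eqxx.
  move=> [<-]; congr (Ex P); apply/funext => x; rewrite big_nil mulr1 indicE; congr ((nat_of_bool _)%:R).
  apply/idP/idP; rewrite in_setE.
    by move=> /forallP h' z zA; apply/eqP; exact: (h' (SeqSub zA)).
  by move=> h'; apply/forallP => z; apply/eqP/h'; exact: valP.
rewrite -cat_rcons => u.
have bA : b \notin A.
  by move: u; rewrite cat_uniq rcons_uniq => /andP[/andP[]].
pose zb (v : bool) : config := fun z => if z == b then v else zeta z.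
have E (v : bool) : (\prod_(z <- rcons A b) (if zb v z then alpha else 1 - alpha)) =
   (\prod_(z <- A) (if zeta z then alpha else 1 - alpha)) * (if v then alpha else 1 - alpha).
  rewrite -cats1 big_cat big_seq1 /= {2}/zb eqxx; congr (_ * _); apply: eq_big_seq => z zA.
  by rewrite /zb; case: eqP => // zb'; move: bA; rewrite -zb' zA.
have H1 := IH _ (zb true) u; have H2 := IH _ (zb false) u.
have q v : qcyl (fun eta : config => [forall z : seq_sub (rcons A b), eta (val z) == zb v (val z)]%:R * \prod_(z <- B) h z (eta z)).
  apply: (qcyl_cyl core); apply: cylinderM.
    exists (rcons A b) => eta et e; congr ((nat_of_bool _)%:R); apply: eq_forallb => z; rewrite e//; exact: valP.
  by apply: cylinder_prod => z; exact: cylinder_at.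
rewrite big_cons mulrA /weight mulrDr mulrDl.
transitivity (h b true * init (fun eta : config => [forall z : seq_sub (rcons A b), eta (val z) == zb true (val z)]%:R * \prod_(z <- B) h z (eta z)) +
   h b false * init (fun eta : config => [forall z : seq_sub (rcons A b), eta (val z) == zb false (val z)]%:R * \prod_(z <- B) h z (eta z))); last first.
  by rewrite H1 H2 !E /=; ring.
have q2 : qcyl (fun eta : config => h b false * ([forall z : seq_sub (rcons A b), eta (val z) == zb false (val z)]%:R * \prod_(z <- B) h z (eta z))).
  by apply: qcyl_mul => //; exact: (qcyl_cst core).
rewrite -(init_scale (h b false))// -init_lin//.
congr init; apply/funext => eta; rewrite big_cons.
have F v : [forall z : seq_sub (rcons A b), eta (val z) == zb v (val z)] =
  [forall z : seq_sub A, eta (val z) == zeta (val z)] && (eta b == v).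
  apply/forallP/andP => [H|[/forallP H /eqP eb] z].
    split; last by have bb : b \in rcons A b; [rewrite mem_rcons mem_head|have := H (SeqSub bb); rewrite /zb /= eqxx].
    apply/forallP => z; have zA : val z \in rcons A b by rewrite mem_rcons inE (valP z) orbT.
    have := H (SeqSub zA); rewrite /zb /=; case: (eqVneq (ssval z) b) => [zb' _|//].
    by move: bA; rewrite -zb' (valP z).
  rewrite /zb /=; case: (eqVneq (ssval z) b) => [->|zb']; first by rewrite eb.
  have := valP z; rewrite /= mem_rcons inE (negbTE zb') /= => zA; exact: (H (SeqSub zA)).
by rewrite !F; case: (eta b); rewrite /= ?eqxx ?andbT ?andbF mul0r mulr0 ?addr0 ?add0r mulrCA.
Qed.

Lemma init_prod (B : seq site) (h : site -> bool -> R) : uniq B ->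
  init (fun eta => \prod_(z <- B) h z (eta z)) = \prod_(z <- B) weight h z.
Proof.
move=> uB; have := @init_pattern_prod [::] B (fun=> true) h uB; rewrite big_nil mul1r => <-.
congr init; apply/funext => eta; have -> : [forall z : seq_sub (@nil site), eta (val z) == true] by apply/forallP => -[].
by rewrite mul1r.
Qed.

Lemma prod_indicator (I : Type) (r : seq I) (p : pred I) : \prod_(i <- r) (p i)%:R = (all p r)%:R :> R.
Proof.
elim: r => [|i r IH]; first by rewrite big_nil.
by rewrite big_cons IH /=; case: (p i); rewrite ?mul1r ?mul0r.
Qed.

(** On a list of sites stable under the swap, [f] is a combination of products over sites; the
    weights do not depend on the site, so permuting the factors changes nothing. *)
Lemma init_exchange y z f : cylinder f -> init (fun eta => f (exchange y z eta)) = init f.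
Proof.
move=> [A Af]; pose B := undup (y :: z :: A).
have uB : uniq B by exact: undup_uniq.
have {Af}Bf : dep B f by apply: dep_sub Af => w wA; rewrite mem_undup !inE wA !orbT.
have sB : perm_eq [seq swap y z w | w <- B] B.
  apply: uniq_perm => //; first by rewrite map_inj_uniq//; exact: (can_inj (swapK y z)).
  have yB : y \in B by rewrite mem_undup mem_head.
  have zB : z \in B by rewrite mem_undup !inE eqxx orbT.
  have sw w : w \in B -> swap y z w \in B by rewrite /swap; case: eqP => // _; case: eqP.
  move=> w; apply/mapP/idP => [[v vB ->]|wB]; first exact: sw.
  by exists (swap y z w); [exact: sw|rewrite swapK].
pose hm (m : (size B).-tuple bool) (w : site) (b : bool) : R := (b == config_of (mask m B) w)%:R.
have patt (eta : config) (m : (size B).-tuple bool) : ([seq eta w | w <- B] == m)%:R = \prod_(w <- B) hm m w (eta w) :> R.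
  rewrite /hm prod_indicator; congr ((nat_of_bool _)%:R).
  have mE : [seq config_of (mask m B) w | w <- B] = m.
    rewrite /config_of; have := size_tuple m; move: (tval m) uB.
    elim: (B) => [|w B' IH] [|b m']//= /andP[wB uB'] [sm]; congr (_ :: _).
      case: b; rewrite ?mem_head//; apply/negbTE; apply: contra wB; exact: mem_mask.
    rewrite -[RHS](IH _ uB' sm); apply/eq_in_map => v vB; case: b => //; rewrite inE.
    by case: eqP => // vw; move: wB; rewrite -vw vB.
  rewrite -{1}mE; apply/eqP/allP => [/eq_in_map H w wB|H]; first by rewrite H.
  by apply/eq_in_map => w /H /eqP.
have qh (h : site -> bool -> R) (c : R) : qcyl (fun eta : config => c * \prod_(w <- B) h w (eta w)).
  by apply: (qcyl_cyl core); apply: cylinderM; [exact: cylinder_cst|apply: cylinder_prod => w; exact: cylinder_at].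
have isum (h : (size B).-tuple bool -> site -> bool -> R) :
  init (fun eta => \sum_(m : (size B).-tuple bool) f (config_of (mask m B)) * \prod_(w <- B) h m w (eta w)) =
  \sum_(m : (size B).-tuple bool) f (config_of (mask m B)) * \prod_(w <- B) weight (h m) w.
  rewrite /init Ex_sum; last by move=> m; apply: (bounded_rv_at (f := fun eta => f (config_of (mask m B)) * \prod_(w <- B) h m w (eta w))).
  apply: eq_bigr => m _; rewrite Ex_scale; first by congr (_ * _); exact: init_prod.
  apply: (bounded_rv_at (f := fun eta => \prod_(w <- B) h m w (eta w))) => //.
  by have := qh (h m) 1; under [X in qcyl X -> _]funext => eta do rewrite mul1r.
transitivity (\sum_(m : (size B).-tuple bool) f (config_of (mask m B)) * \prod_(w <- B) weight (fun w => hm m (swap y z w)) w).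
  rewrite -isum; congr init; apply/funext => eta; rewrite (cylinder_pattern Bf).
  apply: eq_bigr => m _; rewrite patt; congr (_ * _).
  rewrite -(perm_big _ sB) big_map /=; apply: eq_bigr => w _.
  by rewrite exchangeE swapK.
transitivity (\sum_(m : (size B).-tuple bool) f (config_of (mask m B)) * \prod_(w <- B) weight (hm m) w).
  apply: eq_bigr => m _; congr (_ * _).
  by rewrite -[RHS](perm_big _ sB) big_map.
rewrite -isum; congr init; apply/funext => eta; rewrite (cylinder_pattern Bf).
by apply: eq_bigr => m _; rewrite patt.
Qed.

End PathLaw.

Section OccupationTime.
Variables (R : realType).
Local Notation Om := (path_space R).

Definition occ0 : config -> R := fun eta => (eta 0)%:R.

Lemma cylinder_occ0 : cylinder occ0.
Proof. exact: (cylinder_at 0 (fun b => b%:R)). Qed.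

Lemma occ0_bound eta : `|occ0 eta| <= 1.
Proof. by rewrite /occ0; case: (eta 0); rewrite ?normr1 ?normr0. Qed.

Lemma riem_occ (x : cadlag_path R) : (fun n => riem n.+1 occ0 x) @ \oo --> occupation_time x.
Proof.
apply: (@riemann_cvg R (fun s => (x s 0)%:R) 1).
  by move=> s; exact: (occ0_bound (x s)).
move=> t t0; have [d d0 H] := coord_right_continuous x 0 t0.
by exists d => // s ts; rewrite H.
Qed.

Lemma riem_occ01 n (x : cadlag_path R) : 0 <= riem n.+1 occ0 x <= 1.
Proof.
rewrite /riem; apply/andP; split; first by rewrite mulr_ge0 ?invr_ge0 ?sumr_ge0.
rewrite mulrC ler_pdivrMr// mul1r.
apply: le_trans (ler_sum _ (fun i _ => le_trans (ler_norm _) (occ0_bound _))) _.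
by rewrite sumr_const card_ord.
Qed.

End OccupationTime.

Lemma lim_le (R : realType) (u v : nat -> R) (a b : R) : u @ \oo --> a -> v @ \oo --> b ->
  (\forall n \near \oo, u n <= v n) -> a <= b.
Proof. by move=> ua vb uv; apply: (ler_cvg_to ua vb). Qed.

(** * Exponential moments of the occupation time *)

Section OccupationMgf.
Variables (R : realType) (T alpha : R) (P : probability (path_space R) R).
Hypothesis T0 : 0 <= T.
Hypothesis law : ssep_law T alpha P.
Local Notation L := (ssep_generator T).
Local Notation Om := (path_space R).
Local Notation init := (init P).
Implicit Types (f g : config -> R) (x : cadlag_path R).

(** Jensen's inequality, from the tangent line of the exponential at the mean. *)
Lemma expR_mean_le n (a : 'I_n.+1 -> R) :
  expR (n.+1%:R^-1 * \sum_(i < n.+1) a i) <= n.+1%:R^-1 * \sum_(i < n.+1) expR (a i).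
Proof.
have n0 : 0 < n.+1%:R :> R by rewrite ltr0n.
set m := n.+1%:R^-1 * _.
have t i : expR m * (1 + (a i - m)) <= expR (a i).
  have -> : a i = m + (a i - m) by ring.
  rewrite [expR (m + _)]expRD; have -> : m + (a i - m) - m = a i - m by ring.
  by rewrite ler_wpM2l ?expR_ge0 ?expR_ge1Dx.
rewrite mulrC ler_pdivlMr//; apply: le_trans (ler_sum _ (fun i _ => t i)).
rewrite -mulr_sumr ler_wpM2l ?expR_ge0// big_split /= sumrB !sumr_const card_ord.
rewrite -[m *+ _]mulr_natr /m mulrAC mulVf ?gt_eqF// mul1r subrr addr0; lra.
Qed.

Lemma mgf_cvg (th : R) : (fun n => Ex P (fun x : Om => expR (th * riem n.+1 (@occ0 R) x))) @ \oo -->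
  Ex P (fun x : Om => expR (th * occupation_time x)).
Proof.
have [S [HS core bern mk]] := law.
have q0 : qcyl ((@occ0 R)) := qcyl_cyl core (cylinder_occ0 R).
apply: (@Ex_lim R _ _ P _ _ (expR `|th|)).
- move=> n; apply: bounded_rv_expR; apply: bounded_rv_mul; first exact: bounded_rv_cst.
  exact: bounded_rv_riem.
- move=> n x; rewrite ger0_norm ?expR_ge0// ler_expR; apply: le_trans (ler_norm _) _.
  rewrite normrM ler_piMr//; have /andP[h1 h2] := riem_occ01 n x.
  by rewrite ger0_norm.
- move=> x; apply: continuous_cvg; first exact: continuous_expR.
  by apply: cvgM; [exact: cvg_cst|]; exact: (@riem_occ R x).
Qed.

Lemma occ01 x : 0 <= occupation_time (R := R) x <= 1.
Proof.
have h := @riem_occ R x; apply/andP; split.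
  apply: (@lim_le R (fun=> 0) _ _ _ (cvg_cst _) h); apply: nearW => n; by case/andP: (riem_occ01 n x).
apply: (@lim_le R _ (fun=> 1) _ _ h (cvg_cst _)); apply: nearW => n; by case/andP: (riem_occ01 n x).
Qed.

Lemma measurable_occ : measurable_fun setT (@occupation_time R : Om -> R).
Proof.
have [S [HS core bern mk]] := law.
have q0 : qcyl ((@occ0 R)) := qcyl_cyl core (cylinder_occ0 R).
apply: (@measurable_fun_cvg _ _ _ _ (fun n (x : Om) => riem n.+1 (@occ0 R) x)) => [m|x _].
  by case: (bounded_rv_riem m.+1 q0).
exact: (@riem_occ R x).
Qed.

(** The potential [k occ0 - Y] of the supersolution contains an unwanted statistic [Y]. Where the
    time average of [Y] is at most [d], it costs a factor [exp d]. Elsewhere [exp (q (Y - d))]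
    exceeds 1, and Jensen together with stationarity reduces it to the initial law. [r] absorbs the
    gap between [th] and [k]. *)
Lemma occ_upper (Y phi : config -> R) (th k c0 l r d q : R) :
  cylinder Y -> cylinder phi -> 0 < c0 -> (forall z, c0 <= phi z) ->
  (forall z, L phi z + (k * (@occ0 R) z - Y z) * phi z <= l * phi z) ->
  (forall s, 0 <= s <= 1 -> th * s <= k * s + r) -> 0 <= q ->
  Ex P (fun x : Om => expR (th * occupation_time x)) <=
    expR (r + d + l) + expR (`|th| - q * d) * init (fun z => expR (q * Y z)).
Proof.
move=> cY cphi c00 c0phi lphi kr q0.
have [S [HS core bern mk]] := law.
pose W z := k * (@occ0 R) z - Y z.
have c0y := cylinder_occ0 R.
have cW : cylinder W by apply: (cylinder_comp2 (fun a b => k * a - b)).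
have [cb cb0 Wb] := cylinder_bounded cW.
have [C C0 H] := fk_upper T0 HS core (init_lin P) (init_ge0 P) (init1 P) (init_exchange core bern) cW Wb cphi c00 c0phi lphi.
have qocc := qcyl_cyl core c0y; have qY := qcyl_cyl core cY; have qW := qcyl_cyl core cW.
set K := expR (`|th| - q * d) * _.
apply: (@lim_le R (fun n => Ex P (fun x : Om => expR (th * riem n.+1 (@occ0 R) x))) (fun n => expR (r + d + l + C / n.+1%:R) + K)).
- exact: mgf_cvg.
- apply: cvgD; last exact: cvg_cst.
  apply: continuous_cvg; first exact: continuous_expR.
  rewrite -[X in _ --> X]addr0; apply: cvgD; first exact: cvg_cst.
  rewrite -[X in _ --> X](mulr0 C); apply: cvgM; [exact: cvg_cst|]; exact: cvg_harmonic.
near=> n.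
have nC : C <= n.+1%:R.
  apply/ltW/(lt_le_trans (truncnS_gt _)); rewrite ler_nat ltnS; near: n; exact: nbhs_infty_ge.
have bw : bounded_rv (riem n.+1 W : Om -> R) by exact: bounded_rv_riem.
have by' : bounded_rv (riem n.+1 Y : Om -> R) by exact: bounded_rv_riem.
have bo : bounded_rv (riem n.+1 (@occ0 R) : Om -> R) by exact: bounded_rv_riem.
have bs (a : R) X : bounded_rv X -> bounded_rv (fun x : Om => a * X x) by move=> bX; apply: bounded_rv_mul => //; exact: bounded_rv_cst.
apply: (@le_trans _ _ (Ex P (fun x : Om => expR (r + d) * expR (riem n.+1 W x) + expR (`|th| - q * d) * expR (q * riem n.+1 Y x)))).
  apply: Ex_le; first by apply: bounded_rv_expR; exact: bs.
    by apply: bounded_rv_add; apply: (bs _ _); apply: bounded_rv_expR => //; exact: bs.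
  move=> x; have /andP[X0 X1] := riem_occ01 n x.
  have Wx : riem n.+1 W x = k * riem n.+1 (@occ0 R) x - riem n.+1 Y x.
    by rewrite /riem mulrCA -mulrBr; congr (_ * _); rewrite mulr_sumr -sumrB.
  have := kr (riem n.+1 (@occ0 R) x); rewrite X0 X1 => /(_ isT) krx.
  rewrite -!expRD.
  case: (leP (riem n.+1 Y x) d) => yd.
    apply: (@le_trans _ _ (expR (r + d + riem n.+1 W x))); last by rewrite lerDl expR_ge0.
    by rewrite ler_expR Wx; lra.
  apply: (@le_trans _ _ (expR (`|th| - q * d + q * riem n.+1 Y x))); last by rewrite lerDr expR_ge0.
  rewrite ler_expR.
  have h1 : th * riem n.+1 (@occ0 R) x <= `|th|.
    by apply: le_trans (ler_norm _) _; rewrite normrM ler_piMr// ger0_norm.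
  have h2 : q * d <= q * riem n.+1 Y x by rewrite ler_wpM2l// ltW.
  lra.
rewrite Ex_add; try (apply: (bs _ _); apply: bounded_rv_expR => //; exact: bs).
rewrite !Ex_scale; try (apply: bounded_rv_expR => //; exact: bs).
apply: lerD.
  have -> : r + d + l + C / n.+1%:R = (r + d) + (l + C / n.+1%:R) by ring.
  rewrite (fk_riem T0 HS core mk cW) [leRHS]expRD ler_wpM2l ?expR_ge0//.
  exact: H.
rewrite /K ler_wpM2l ?expR_ge0//.
apply: (@le_trans _ _ (Ex P (fun x : Om => n.+1%:R^-1 * \sum_(i < n.+1) expR (q * Y (x (i.+1%:R / n.+1%:R)))))).
  have bi (i : 'I_n.+1) : bounded_rv (fun x : Om => expR (q * Y (x (i.+1%:R / n.+1%:R)))).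
    by apply: bounded_rv_expR; apply: (bs _ _); apply: bounded_rv_at => //; rewrite divr_ge0.
  apply: Ex_le; first by apply: bounded_rv_expR; exact: bs.
    by apply: (bs _ _); exact: bounded_rv_sum.
  move=> x; rewrite /riem mulrCA mulr_sumr; exact: expR_mean_le.
have cE : cylinder (fun z => expR (q * Y z)) by exact: (cylinder_comp (fun a => expR (q * a)) cY).
have qE := qcyl_cyl core cE.
have bi (i : 'I_n.+1) : bounded_rv (fun x : Om => expR (q * Y (x (i.+1%:R / n.+1%:R)))).
  by apply: (bounded_rv_at (f := fun z => expR (q * Y z))) => //; rewrite divr_ge0.
rewrite Ex_scale ?Ex_sum//; last exact: bounded_rv_sum.
rewrite (eq_bigr (fun=> init (fun z => expR (q * Y z)))); last first.
  move=> i _; have t0 : 0 <= i.+1%:R / n.+1%:R :> R by rewrite divr_ge0.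
  rewrite (Ex_at mk (f := fun z => expR (q * Y z)))//; last by case: qE.
  exact: (mu_S T0 HS core (init_lin P) (init_ge0 P) (init1 P) (init_exchange core bern)).
by rewrite sumr_const card_ord -[init _ *+ _]mulr_natr mulrCA mulVf ?mulr1// pnatr_eq0.
Unshelve. all: by end_near. Qed.

Lemma occ_lower (g : config -> R) (th c : R) : cylinder g -> 0 < c -> (forall z, 0 <= g z <= c) ->
  init (fun z => g z ^+ 2) = 1 ->
  expR (init (fun z => g z * L g z) + th * init (fun z => g z ^+ 2 * (@occ0 R) z)) / c ^+ 2 <=
  Ex P (fun x : Om => expR (th * occupation_time x)).
Proof.
move=> cg c0 gc g1.
have [S [HS core bern mk]] := law.
have c0y := cylinder_occ0 R.
pose W z : R := th * (@occ0 R) z.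
have cW : cylinder W by exact: (cylinder_comp (fun a => th * a) c0y).
have [cb cb0 Wb] := cylinder_bounded cW.
have qg := qcyl_cyl core cg; have qL := qcyl_cyl core (cylinder_generator T cg).
have qo := qcyl_cyl core c0y.
have E : init (fun z => g z * (L g z + W z * g z)) = init (fun z => g z * L g z) + th * init (fun z => g z ^+ 2 * (@occ0 R) z).
  have q1 : qcyl (fun z => g z * L g z) by exact: qcyl_mul.
  have q2 : qcyl (fun z => g z ^+ 2 * (@occ0 R) z) by do 2?apply: qcyl_mul.
  rewrite addrC -(init_lin P th q2 q1); congr (init _); apply/funext => z; rewrite /W; ring.
have [C C0 H] := fk_lower T0 HS core (init_lin P) (init_ge0 P) (init1 P) (init_exchange core bern) cW Wb cg c0 gc g1 E.
(* [fk_lower] covers powers of two only, and [mgf_cvg] is indexed by [n.+1], hence the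
   predecessor. *)
have pow : (fun k => (2 ^ k).-1) @ \oo --> \oo.
  apply/cvgnyPge => A; near=> k.
  have h : (A <= k)%N by near: k; exact: nbhs_infty_ge.
  by have := ltn_expl k (isT : (1 < 2)%N); lia.
rewrite -E.
apply: (@lim_le R (fun k => expR (init (fun z => g z * (L g z + W z * g z)) - C / (2 ^ k).-1.+1%:R) / c ^+ 2) (fun k => Ex P (fun x : Om => expR (th * riem (2 ^ k).-1.+1 (@occ0 R) x)))).
- apply: cvgM; last exact: cvg_cst.
  apply: continuous_cvg; first exact: continuous_expR.
  rewrite -[X in _ --> X]subr0; apply: cvgB; first exact: cvg_cst.
  rewrite -[X in _ --> X](mulr0 C); apply: cvgM; first exact: cvg_cst.
  exact: (cvg_comp _ _ pow (@cvg_harmonic R)).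
- exact: (cvg_comp _ _ pow (@mgf_cvg th)).
near=> k.
have -> : (2 ^ k).-1.+1 = (2 ^ k)%N by rewrite prednK// expn_gt0.
have nC : C <= (2 ^ k)%:R.
  apply/ltW/(lt_le_trans (truncnS_gt _)); rewrite ler_nat.
  apply: leq_trans (ltnW (ltn_expl k (isT : (1 < 2)%N))).
  by near: k; exact: nbhs_infty_ge.
have := H k nC; rewrite -E => /le_trans; apply.
rewrite -(fk_riem T0 HS core mk cW).
rewrite le_eqVlt; apply/orP; left; apply/eqP; congr (Ex P); apply/funext => x; congr expR.
by rewrite /riem mulrCA; congr (_ * _); rewrite mulr_sumr.
Unshelve. all: by end_near. Qed.

End OccupationMgf.

(** * The test functions *)

Section ProductTilt.
Variables (R : realType) (M : nat) (a0 a1 B : R).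
Hypothesis M0 : (0 < M)%N.
Hypothesis B1 : 1 <= B.
Hypothesis HB : forall z, Num.min a0 a1 <= z <= Num.max a0 a1 ->
  [/\ 0 < sin z, 0 < cos z & 1 <= B * (sin z * cos z)].
Local Notation D := (a1 - a0).
Hypothesis DB : `|D| <= B.
Local Notation u := (gprof R M).
Local Notation w := (gunit R M).
Local Notation xi := (xi M a0 a1).
Local Notation dens := (dens M a0 a1).
Local Notation sgrad := (sgrad M a0 a1).
Local Notation tgrad := (tgrad M a0 a1).
Local Notation angle := (angle M a0 a1).
Variable A : seq site.
Hypotheses (uA : uniq A) (HA : forall x, u x != 0 -> x \in A).
Implicit Types (eta : config).

Definition occupied eta : site -> R := fun z => (eta z)%:R.

Lemma occupied01 eta z : 0 <= occupied eta z <= 1.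
Proof. by rewrite /occupied; case: (eta z); rewrite ?lexx ?ler01. Qed.

Definition tilt_factor (z : site) (b : bool) : R :=
  if b then sin (angle z) / sin a0 else cos (angle z) / cos a0.
(* phi0 ^+ 2 is the density of the product measure with angles [angle z]
   with respect to the one with constant angle a0. *)
Definition phi0 eta : R := \prod_(z <- A) tilt_factor z (eta z).

Let a0P : [/\ 0 < sin a0, 0 < cos a0 & 1 <= B * (sin a0 * cos a0)].
Proof. by apply: HB; rewrite ge_min le_max lexx. Qed.

Lemma tilt_factor_gt0 z b : 0 < tilt_factor z b.
Proof.
have [s0 c0 _] := a0P; have [s c _] := angle_trig M0 HB z.
by rewrite /tilt_factor; case: b; rewrite divr_gt0.
Qed.

Lemma tilt_factor_out z b : z \notin A -> tilt_factor z b = 1.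
Proof.
move=> zA; have uz : u z = 0 by apply/eqP; apply: contraNT zA; exact: HA.
have [s0 c0 _] := a0P.
by rewrite /tilt_factor /angle uz mulr0 addr0; case: b; rewrite divff// gt_eqF.
Qed.

Lemma phi0_gt0 eta : 0 < phi0 eta.
Proof. by apply: prodr_gt0 => z _; exact: tilt_factor_gt0. Qed.

Lemma cylinder_phi0 : cylinder phi0.
Proof. by apply: cylinder_prod => z; exact: cylinder_at. Qed.

Lemma prod_out (F : site -> bool -> R) C eta : (forall z b, z \notin A -> F z b = 1) -> uniq C ->
  {subset A <= C} -> \prod_(z <- C) F z (eta z) = \prod_(z <- A) F z (eta z).
Proof.
move=> F1 uC AC; rewrite (bigID (mem A)) /= [X in _ * X]big1 ?mulr1; last first.
  by move=> z zA; exact: F1.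
rewrite -big_filter; apply: perm_big; apply: uniq_perm => //; first exact: filter_uniq.
by move=> z; rewrite mem_filter; apply/andP/idP => [[]//|zA]; split=> //; exact: AC.
Qed.

Definition others x y := [seq z <- A | (z != x) && (z != y)].

Lemma uniq_others x y : x != y -> uniq (x :: y :: others x y).
Proof.
move=> xy; rewrite /= inE negb_or xy !mem_filter !eqxx /= ?andbF /=; exact: filter_uniq.
Qed.

Lemma sub_others x y : {subset A <= x :: y :: others x y}.
Proof.
move=> z zA; rewrite !inE mem_filter zA andbT.
by case: (z == x) => //=; case: (z == y).
Qed.

Lemma prod_pair (F : site -> bool -> R) x y eta : (forall z b, z \notin A -> F z b = 1) -> x != y ->
  \prod_(z <- A) F z (eta z) = F x (eta x) * (F y (eta y) * \prod_(z <- others x y) F z (eta z)).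
Proof.
move=> F1 xy; rewrite -(prod_out eta F1 (uniq_others xy) (@sub_others x y)).
by rewrite !big_cons.
Qed.

Lemma unit_vector_neq0 (j : 'I_2) : unit_vector j != 0.
Proof. by apply/eqP => /matrixP /(_ 0 j); rewrite !mxE !eqxx. Qed.

Lemma bond_neq x (j : 'I_2) : x != x + unit_vector j.
Proof. by rewrite -subr_eq0 opprD addNKr oppr_eq0 unit_vector_neq0. Qed.

Lemma phi0_pair x y eta : x != y -> phi0 eta =
  tilt_factor x (eta x) * (tilt_factor y (eta y) * \prod_(z <- others x y) tilt_factor z (eta z)).
Proof. by apply: prod_pair; exact: tilt_factor_out. Qed.

Lemma others_exchange (F : site -> bool -> R) x y eta :
  \prod_(z <- others x y) F z (exchange x y eta z) = \prod_(z <- others x y) F z (eta z).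
Proof.
apply: eq_big_seq => z; rewrite mem_filter => /andP[/andP[zx zy] _].
by rewrite /exchange (negbTE zx) (negbTE zy).
Qed.

(** Only the factors at the two sites change. By the addition formulas their ratios are
    [cos d + sin d xi x] and [cos d - sin d xi y], where [d] is the angle increment along the
    bond. *)
Lemma phi0_exchange x (j : 'I_2) eta : phi0 (exchange x (x + unit_vector j) eta) =
  (1 + bondX M a0 a1 (occupied eta) j x) * phi0 eta.
Proof.
set y := x + unit_vector j; have xy : x != y := bond_neq x j.
rewrite !(phi0_pair _ xy) others_exchange.
have -> : exchange x y eta x = eta y by rewrite /exchange eqxx.
have -> : exchange x y eta y = eta x by rewrite /exchange eq_sym (negbTE xy) eqxx.
set p := \prod_(z <- _) _.
have [s0 c0 _] := a0P; have [sx cx _] := angle_trig M0 HB x; have [sy cy _] := angle_trig M0 HB y.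
set d := D * grad j u x.
have Ey : angle y = angle x + d by rewrite /d -angle_grad /y; ring.
have -> : 1 + bondX M a0 a1 (occupied eta) j x = (cos d + sin d * xi (occupied eta) x) * (cos d - sin d * xi (occupied eta) y).
  rewrite /bondX -/y /sgrad -/d; have := cos2Dsin2 d; move: (cos d) (sin d) => c s E.
  rewrite -[X in X + (_ + _) = _]E; ring.
have xi1 z : eta z -> xi (occupied eta) z = cos (angle z) / sin (angle z).
  move=> ez; have [sz cz _] := angle_trig M0 HB z.
  have e : (eta z)%:R - sin (angle z) ^+ 2 = cos (angle z) ^+ 2.
    by rewrite ez -[true%:R](cos2Dsin2 (angle z)) addrK.
  rewrite /xi /occupied /rfac /dens e; field; by rewrite !gt_eqF.
have xi0 z : ~~ eta z -> xi (occupied eta) z = - (sin (angle z) / cos (angle z)).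
  move=> ez; have [sz cz _] := angle_trig M0 HB z.
  have e : (eta z)%:R - sin (angle z) ^+ 2 = - sin (angle z) ^+ 2 by rewrite (negbTE ez) sub0r.
  rewrite /xi /occupied /rfac /dens e; field; by rewrite !gt_eqF.
have F1 b : (if b then eta x else ~~ eta x) -> cos d + sin d * xi (occupied eta) x = tilt_factor y b / tilt_factor x b.
  case: b => ex; rewrite /tilt_factor.
    rewrite xi1// Ey sinD; field; by rewrite !gt_eqF.
  rewrite xi0// Ey cosD; field; by rewrite !gt_eqF.
have Ex : angle x = angle y - d by rewrite Ey; ring.
have F2 b : (if b then eta y else ~~ eta y) -> cos d - sin d * xi (occupied eta) y = tilt_factor x b / tilt_factor y b.
  case: b => ey; rewrite /tilt_factor.
    rewrite xi1// Ex sinB; field; by rewrite !gt_eqF.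
  rewrite xi0// Ex cosB; field; by rewrite !gt_eqF.
rewrite (F1 (eta x)) ?(F2 (eta y)); try by [case: (eta x)|case: (eta y)].
field; by rewrite !gt_eqF// tilt_factor_gt0.
Qed.

Variables (g : 'I_2 -> site -> R) (Mc : 'I_2 -> nat) (N eps : R).
Hypotheses (fg : forall i, fsupp (g i)) (ge : forall i z, g i (- z) = g i z).
Hypothesis geps : forall i, lsum (fun z => `|pair_kernel (g i) z - (nbrk R i z - srw2 R (Mc i).*2 z)|) <= eps.
Hypotheses (N1 : 1 <= N) (gN : forall i, norm1 (g i) <= N).
Hypothesis small : 64 * N * B ^+ 4 * w <= 2^-1.

(** One form for each direction: [pair_part] leaves a nearest-neighbour form in direction [i] cut
    off by [tgrad i], which [g i] is built to cancel. *)
Definition quad_corr eta : R :=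
  \sum_(i < 2) bil (g i) (cen (tgrad i) dens (occupied eta)) (cen (tgrad i) dens (occupied eta)).
Definition phi eta : R := phi0 eta * expR (quad_corr eta).

Lemma phi_gt0 eta : 0 < phi eta.
Proof. by rewrite mulr_gt0 ?phi0_gt0 ?expR_gt0. Qed.

Lemma cylinder_cen (F : (site -> R) -> R) (t : site -> R) : fsupp t ->
  cylinder (fun eta => F (cen t dens (occupied eta))).
Proof.
move=> [s ts]; exists s => eta zeta e; congr F; apply/funext => x; rewrite /cen /occupied.
by have [->|/ts xs] := eqVneq (t x) 0; [rewrite !mul0r|rewrite e].
Qed.

Lemma cylinder_phi : cylinder phi.
Proof.
apply: (cylinder_comp2 (fun a b => a * expR b)); first exact: cylinder_phi0.
apply: cylinder_sum => i.
exact: (cylinder_cen (fun v => bil (g i) v v) (fsupp_tgrad M a0 a1 i)).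
Qed.

Lemma occupied_exchange x (j : 'I_2) eta :
  occupied (exchange x (x + unit_vector j) eta) = swapped x (x + unit_vector j) (occupied eta).
Proof.
apply/funext => z; rewrite /occupied /swapped /exchange; have := bond_neq x j.
set y := x + _ => xy; case: (eqVneq z x) => [->|zx]; first by rewrite (negbTE xy) subr0 mulr1 addrC subrK.
case: (eqVneq z y) => [->|zy]; last by rewrite subrr mulr0 addr0.
by rewrite sub0r mulrN1 opprB addrC subrK.
Qed.

Lemma phi_exchange x (j : 'I_2) eta : phi (exchange x (x + unit_vector j) eta) =
  (1 + bondX M a0 a1 (occupied eta) j x) * expR (bondG M a0 a1 g (occupied eta) j x) * phi eta.
Proof.
rewrite /phi phi0_exchange.
have -> : quad_corr (exchange x (x + unit_vector j) eta) = quad_corr eta + bondG M a0 a1 g (occupied eta) j x.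
  rewrite /quad_corr /bondG -big_split /=; apply: eq_bigr => i _.
  by rewrite occupied_exchange (bil_swapped dens (fg i) (ge i) (fsupp_tgrad M a0 a1 i)).
by rewrite expRD; ring.
Qed.

Variable T : R.
Hypothesis T0 : 0 <= T.

(** The factor [T / 2] of the generator times the factor [4 w^2 D] of [super_ineq]. *)
Definition drift : R := 2 * T * w ^+ 2 * D.
(* The Laplacian of u has a point mass at 0, which produces the occupation time,
   and a part proportional to srw2 R M.*2, which produces this statistic. *)
Definition cloud eta : R := drift * lsum (fun x => xi (occupied eta) x * srw2 R M.*2 x).
Definition super_error : R := 8 * eps * B ^+ 4 * w ^+ 2 + 300 * 100 * N ^+ 2 * B ^+ 8 * w ^+ 3.

Lemma cylinder_cloud : cylinder cloud.
Proof.
have [s ps] := fsupp_srw2 R M.*2; exists s => eta zeta e; congr (_ * _); apply: eq_lsum => x.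
have [->|/ps xs] := eqVneq (srw2 R M.*2 x) 0; first by rewrite !mulr0.
by rewrite /xi /occupied e.
Qed.

(** [super_ineq] read for the generator: since [u 0 = 1], the angle at the origin is [a1], and [xi]
    at 0 is an affine function of [occ0], whose linear part becomes the potential. *)
Lemma phi_super eta : ssep_generator T phi eta +
    (drift / (sin a1 * cos a1) * occ0 R eta - cloud eta) * phi eta <=
  (drift / (sin a1 * cos a1) * sin a1 ^+ 2 - 2 * T * w ^+ 2 * D ^+ 2 + T / 2 * super_error) * phi eta.
Proof.
have -> : ssep_generator T phi eta = T / 2 *
    (\sum_(j < 2) lsum (fun x => (1 + bondX M a0 a1 (occupied eta) j x) * expR (bondG M a0 a1 g (occupied eta) j x) - 1)) * phi eta.
  rewrite generatorE -[RHS]mulrA mulr_suml; congr (_ * _); apply: eq_bigr => j _.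
  rewrite -lsumZr; apply: eq_lsum => x; rewrite phi_exchange; ring.
rewrite -mulrDl ler_pM2r ?phi_gt0//.
have H := super_ineq M0 B1 HB DB fg geps N1 gN small (occupied01 eta).
have {}H := ler_wpM2l (_ : 0 <= T / 2) H.
have T2 : 0 <= T / 2 by rewrite divr_ge0.
have X0 : xi (occupied eta) 0 = (occ0 R eta - sin a1 ^+ 2) / (sin a1 * cos a1).
  by rewrite /xi /rfac /dens /angle gprof0// mulr1 addrC subrK mulrC.
move: (H T2); rewrite X0 /super_error /cloud /drift.
set r := (sin a1 * cos a1)^-1.
lra.
Qed.

End ProductTilt.

(** * The test functions under the Bernoulli measure *)

Section InitialExpectations.
Variables (R : realType) (M : nat) (a0 a1 B : R).
Hypothesis M0 : (0 < M)%N.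
Hypothesis B1 : 1 <= B.
Hypothesis HB : forall z, Num.min a0 a1 <= z <= Num.max a0 a1 ->
  [/\ 0 < sin z, 0 < cos z & 1 <= B * (sin z * cos z)].
Local Notation D := (a1 - a0).
Hypothesis DB : `|D| <= B.
Local Notation u := (gprof R M).
Local Notation w := (gunit R M).
Local Notation xi := (xi M a0 a1).
Local Notation dens := (dens M a0 a1).
Local Notation sgrad := (sgrad M a0 a1).
Local Notation angle := (angle M a0 a1).
Local Notation rfac := (rfac M a0 a1).
Local Notation tf := (tilt_factor M a0 a1).
Variable A : seq site.
Hypotheses (uA : uniq A) (HA : forall x, u x != 0 -> x \in A).
Local Notation phi0 := (phi0 M a0 a1 A).
Variables (T : R) (P : probability (path_space R) R) (S : R -> (config -> R) -> (config -> R)).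
Hypothesis T0 : 0 <= T.
Hypothesis core : forall f, cylinder f -> generator_graph S f (ssep_generator T f).
Hypothesis bern : starts_from_bernoulli (sin a0 ^+ 2) P.
Local Notation init := (init P).
Local Notation weight := (weight (sin a0 ^+ 2)).
Implicit Types (eta : config).

Let a0P : [/\ 0 < sin a0, 0 < cos a0 & 1 <= B * (sin a0 * cos a0)].
Proof. by apply: HB; rewrite ge_min le_max lexx. Qed.

Let co2 : 1 - sin a0 ^+ 2 = cos a0 ^+ 2.
Proof. by rewrite -[X in X - _](cos2Dsin2 a0) addrK. Qed.

(** The left side is the Hellinger affinity of two Bernoulli laws; angles turn it into a cosine. *)
Lemma weight_pair x y : weight (fun _ b => tf x b * tf y b) 0 = cos (angle y - angle x).
Proof.
have [s0 c0 _] := a0P; rewrite /weight co2 /tilt_factor cosB.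
field; by rewrite !gt_eqF.
Qed.

Lemma weight_sqr z : weight (fun z b => tf z b ^+ 2) z = 1.
Proof.
by have := weight_pair z z; rewrite subrr cos0 /weight.
Qed.

Lemma init_phi0_sqr : init (fun eta => phi0 eta ^+ 2) = 1.
Proof.
transitivity (init (fun eta => \prod_(z <- A) (tf z (eta z)) ^+ 2)).
  by congr init; apply/funext => eta; rewrite /phi0 prodrXl.
rewrite (init_prod core bern (fun z b => tf z b ^+ 2) uA).
by apply: big1 => z _; exact: weight_sqr.
Qed.

Lemma init_phi0_sqr_occ : init (fun eta => phi0 eta ^+ 2 * occ0 R eta) = sin a1 ^+ 2.
Proof.
have A0 : 0 \in A by apply: HA; rewrite gprof0// oner_neq0.
pose F (z : site) (b : bool) : R := tf z b ^+ 2 * (if z == 0 then b%:R else 1).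
transitivity (init (fun eta => \prod_(z <- A) F z (eta z))).
  congr init; apply/funext => eta; rewrite /phi0 -prodrXl /F [RHS]big_split /=.
  rewrite [X in _ = _ * X](_ : _ = occ0 R eta)//.
  by rewrite (bigD1_seq 0)//= eqxx big1 ?mulr1// => z /negbTE ->.
rewrite (init_prod core bern F uA) (bigD1_seq 0)//= big1 ?mulr1; last first.
  by move=> z /negbTE z0; rewrite -(weight_sqr z) /weight /F z0 !mulr1.
have [s0 c0 _] := a0P.
rewrite /weight /F eqxx /tilt_factor mulr1n mulr0n !mulr0 addr0 mulr1 /angle gprof0// mulr1 addrC subrK.
by field; rewrite gt_eqF.
Qed.

Lemma init_phi0_exchange x (j : 'I_2) :
  init (fun eta => phi0 eta * phi0 (exchange x (x + unit_vector j) eta)) = cos (D * grad j u x) ^+ 2.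
Proof.
set y := x + unit_vector j; have xy : x != y := bond_neq x j.
pose F (z : site) (b : bool) : R := if (z == x) || (z == y) then tf x b * tf y b else tf z b ^+ 2.
transitivity (init (fun eta => \prod_(z <- x :: y :: others A x y) F z (eta z))).
  congr init; apply/funext => eta; rewrite !(phi0_pair HB uA HA _ xy) others_exchange !big_cons.
  have -> : exchange x y eta x = eta y by rewrite /exchange eqxx.
  have -> : exchange x y eta y = eta x by rewrite /exchange eq_sym (negbTE xy) eqxx.
  have -> : \prod_(z <- others A x y) F z (eta z) = (\prod_(z <- others A x y) tf z (eta z)) ^+ 2.
    rewrite -prodrXl; apply: eq_big_seq => z; rewrite mem_filter => /andP[/andP[zx zy] _].
    by rewrite /F (negbTE zx) (negbTE zy).
  rewrite /F !eqxx orbT /=; ring.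
rewrite (init_prod core bern F (uniq_others uA xy)) !big_cons big_seq big1 ?mulr1; last first.
  move=> z; rewrite mem_filter => /andP[/andP[zx zy] _].
  by rewrite -(weight_sqr z) /weight /F (negbTE zx) (negbTE zy).
have e z : (z == x) || (z == y) -> weight F z = cos (D * grad j u x).
  by move=> h; rewrite -angle_grad -weight_pair /weight /F h.
by rewrite !e ?eqxx ?orbT// expr2.
Qed.

(** Each end of a bond contributes one affinity, so the bond costs [1 - cos^2], the squared sine of
    the angle increment; the energy of [u] bounds the sum. *)
Lemma init_phi0_generator :
  - (2 * T * D ^+ 2 * w ^+ 2) <= init (fun eta => phi0 eta * ssep_generator T phi0 eta).
Proof.
have Ap : dep A phi0.
  by move=> eta zeta e; apply: eq_big_seq => z zA; rewrite e.
have cp : cylinder phi0 by exists A.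
have cexch x (j : 'I_2) : cylinder (fun eta => phi0 eta * phi0 (exchange x (x + unit_vector j) eta)).
  by apply: cylinderM => //; exact: cylinder_exchange.
have csqr : cylinder (fun eta => phi0 eta ^+ 2) by exact: cylinderM.
have q1 x (j : 'I_2) := qcyl_cyl core (cexch x j).
have q2 := qcyl_cyl core csqr.
have E : init (fun eta => phi0 eta * ssep_generator T phi0 eta) =
   \sum_(j < 2) \sum_(x <- bonds A) (T / 2 * (cos (D * grad j u x) ^+ 2 - 1)).
  have qd x (j : 'I_2) : qcyl (fun eta => T / 2 * (phi0 eta * phi0 (exchange x (x + unit_vector j) eta) - phi0 eta ^+ 2)).
    by apply: (qcyl_scale core); exact: qcyl_sub.
  transitivity (init (fun eta => \sum_(j < 2) \sum_(x <- bonds A) (T / 2 * (phi0 eta * phi0 (exchange x (x + unit_vector j) eta) - phi0 eta ^+ 2)))).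
    congr init; apply/funext => eta; rewrite (generator_seq _ _ Ap) mulr_sumr; apply: eq_bigr => j _.
    rewrite mulr_sumr; apply: eq_bigr => x _; ring.
  have bd x (j : 'I_2) := bounded_rv_at (lexx 0) (qd x j).
  rewrite /init Ex_sum; last by move=> j; apply: bounded_rv_sum => x; exact: bd.
  apply: eq_bigr => j _; rewrite Ex_sum; last by move=> x; exact: bd.
  apply: eq_bigr => x _.
  transitivity (init (fun eta => T / 2 * (phi0 eta * phi0 (exchange x (x + unit_vector j) eta) - phi0 eta ^+ 2))) => //.
  rewrite init_scale; last exact: qcyl_sub.
  congr (_ * _); rewrite -init_phi0_exchange -[X in _ - X]init_phi0_sqr.
  rewrite [RHS]addrC -mulN1r -init_lin//; congr init; apply/funext => eta; ring.
rewrite E.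
have fg j : fsupp (grad j u) := fsupp_grad j (fsupp_gprof R M).
have S1 (j : 'I_2) : - (T / 2 * (D ^+ 2 * lsum (fun x => grad j u x ^+ 2))) <= \sum_(x <- bonds A) (T / 2 * (cos (D * grad j u x) ^+ 2 - 1)).
  rewrite -mulr_sumr -mulrN ler_wpM2l ?divr_ge0//.
  rewrite (@lsum_seq _ _ (bonds A)); last 2 first.
  - exact: undup_uniq.
  - move=> x; apply: contraR => /(mem_bonds j)[xA yA].
    have z0 z : z \notin A -> u z = 0 by move=> zA; apply/eqP; apply: contraNT zA; exact: HA.
    by rewrite /grad !z0// subrr expr0n.
  rewrite mulr_sumr -sumrN; apply: ler_sum => x _.
  have := sin_sqr_le (D * grad j u x); have := cos2Dsin2 (D * grad j u x).
  have -> : D ^+ 2 * grad j u x ^+ 2 = (D * grad j u x) ^+ 2 by ring.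
  lra.
apply: le_trans (ler_sum _ (fun j _ => S1 j)).
have := grad_energy_le R M0; rewrite !sum2; set X := lsum _; set Y := lsum _ => h.
have T2 : 0 <= T / 2 * D ^+ 2 by rewrite mulr_ge0 ?divr_ge0 ?sqr_ge0.
have := ler_wpM2l T2 h; lra.
Qed.

(** Each factor is at most [1 + B^2 u z], and [u] has total mass [2 M w^2]. This is the bound that
    limits [M] in the lower estimate. *)
Lemma phi0_le eta : 0 <= phi0 eta <= expR (2 * B ^+ 2 * M%:R * w ^+ 2).
Proof.
rewrite (ltW (phi0_gt0 M0 HB A eta)) /=.
have B0 : 0 <= B := le_trans ler01 B1.
have [s0 c0 h0] := a0P.
have is0 : (sin a0)^-1 <= B.
  rewrite -[leLHS]mul1r ler_pdivrMr//; apply: le_trans h0 _.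
  by rewrite ler_wpM2l// ler_piMr ?cos_le1// ltW.
have ic0 : (cos a0)^-1 <= B.
  rewrite -[leLHS]mul1r ler_pdivrMr//; apply: le_trans h0 _.
  by rewrite ler_wpM2l// ler_piMl ?sin_le1// ltW.
have t z b : tf z b <= expR (B ^+ 2 * u z).
  apply: le_trans _ (expR_ge1Dx _); have /andP[u0 u1] := gprof01 R M0 z.
  have du : `|angle z - a0| <= B * u z.
    by rewrite /angle addrAC subrr add0r normrM [`|u z|]ger0_norm// ler_wpM2r.
  have dB : `|angle z - a0| * B <= B ^+ 2 * u z by rewrite expr2 -mulrA mulrC ler_wpM2l.
  rewrite /tilt_factor; case: b.
    have h : sin (angle z) <= sin a0 + `|angle z - a0|.
      by have := sin_lip a0 (angle z); have := ler_norm (sin (angle z) - sin a0); lra.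
    apply: le_trans (_ : (sin a0 + `|angle z - a0|) / sin a0 <= _); first by rewrite ler_pM2r ?invr_gt0.
    rewrite mulrDl divff ?gt_eqF// lerD2l; apply: le_trans dB; exact: ler_wpM2l.
  have h : cos (angle z) <= cos a0 + `|angle z - a0|.
    by have := cos_lip a0 (angle z); have := ler_norm (cos (angle z) - cos a0); lra.
  apply: le_trans (_ : (cos a0 + `|angle z - a0|) / cos a0 <= _); first by rewrite ler_pM2r ?invr_gt0.
  rewrite mulrDl divff ?gt_eqF// lerD2l; apply: le_trans dB; exact: ler_wpM2l.
apply: (@le_trans _ _ (\prod_(z <- A) expR (B ^+ 2 * u z))).
  by apply: ler_prod => z _; rewrite t ltW// (tilt_factor_gt0 M0 HB).
rewrite -expR_sum ler_expR -mulr_sumr -(lsum_seq uA HA) lsum_gprof//.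
rewrite -muln2 natrM le_eqVlt; apply/orP; left; apply/eqP; ring.
Qed.

(** The sites are independent, and each gives a mean and a quadratic term. The means sum to a
    multiple of [w^2] by [lsum_gprof_srw2], the squares to a multiple of [1 / M] because the kernel
    is at most [1 / (2M)]; the hypothesis on [q] keeps every exponent within 1/2. *)
Lemma init_cloud (q : R) : `|q * drift M a0 a1 T| * B <= M%:R ->
  init (fun eta => expR (q * cloud M a0 a1 T eta)) <=
  expR (2 * `|q * drift M a0 a1 T| * B * `|D| * w ^+ 2 + (q * drift M a0 a1 T) ^+ 2 * B ^+ 2 / M%:R).
Proof.
set c := q * drift M a0 a1 T => cB.
have B0 : 0 <= B := le_trans ler01 B1.
set p := srw2 R M.*2.
have p0 x : 0 <= p x by exact: srw2_ge0.
have fp : fsupp p := fsupp_srw2 R M.*2.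
have [C0 C0p] := fp; pose C := undup C0.
have uC : uniq C by exact: undup_uniq.
have Cp x : p x != 0 -> x \in C by rewrite mem_undup; exact: C0p.
have Mr : 0 < M%:R :> R by rewrite ltr0n.
have pM x : p x <= (2 * M%:R)^-1.
  have e : M.*2%:R = 2 * M%:R :> R by rewrite -mul2n natrM.
  have [h|h] := srw2_le_inv R M.*2 x; first by rewrite -e.
  by move: M0; rewrite -double_gt0 h.
pose s z := c * rfac z * p z.
have r0 z : 0 < rfac z <= B := rfac_bound M0 HB z.
have sB z : `|s z| <= `|c| * B * p z.
  have /andP[rp rB] := r0 z.
  by rewrite /s (normrM (c * rfac z)) (normrM c) [`|p z|]ger0_norm// ler_wpM2r// (gtr0_norm rp) ler_wpM2l.
have s2 z : `|s z| <= 2^-1.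
  apply: le_trans (sB z) _; apply: (@le_trans _ _ (M%:R * (2 * M%:R)^-1)).
    by apply: ler_pM => //; rewrite mulr_ge0.
  by rewrite le_eqVlt; apply/orP; left; apply/eqP; field; rewrite gt_eqF.
pose F z (b : bool) : R := expR (s z * (b%:R - dens z)).
have -> : init (fun eta => expR (q * cloud M a0 a1 T eta)) = \prod_(z <- C) weight F z.
  rewrite -(init_prod core bern F uC); congr init; apply/funext => eta.
  rewrite /F -expR_sum; congr expR; rewrite /cloud mulrA -/c (lsum_seq uC).
    by rewrite mulr_sumr; apply: eq_bigr => z _; rewrite /xi /s -/p; ring.
  by move=> z; rewrite mulf_eq0 negb_or => /andP[_]; exact: Cp.
have wF z : weight F z <= expR (s z * (sin a0 ^+ 2 - dens z) + 2 * s z ^+ 2).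
  rewrite /weight /F mulr1n mulr0n sub0r.
  have -> : sin a0 ^+ 2 * expR (s z * (1 - dens z)) + (1 - sin a0 ^+ 2) * expR (s z * - dens z) =
    expR (s z * - dens z) * (1 + sin a0 ^+ 2 * (expR (s z) - 1)).
    have -> : s z * (1 - dens z) = s z * - dens z + s z by ring.
    by rewrite expRD; ring.
  have -> : s z * (sin a0 ^+ 2 - dens z) + 2 * s z ^+ 2 = s z * - dens z + (s z * sin a0 ^+ 2 + 2 * s z ^+ 2) by ring.
  rewrite [leRHS]expRD ler_wpM2l ?expR_ge0//; apply: le_trans _ (expR_ge1Dx _).
  have sz : s z <= 2^-1 by apply: le_trans (ler_norm _) (s2 z).
  have := expR_le_quadratic sz; rewrite lerD2l => h.
  have a01 : 0 <= sin a0 ^+ 2 <= 1 by rewrite sqr_ge0 /= expr_le1 ?sin_le1//; case: a0P => /ltW.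
  have s20 := sqr_ge0 (s z).
  have h2 : sin a0 ^+ 2 * (expR (s z) - 1) <= sin a0 ^+ 2 * (s z + 2 * s z ^+ 2).
    by rewrite ler_wpM2l ?sqr_ge0//; lra.
  have h3 : sin a0 ^+ 2 * (2 * s z ^+ 2) <= 2 * s z ^+ 2.
    by case/andP: a01 => a00 a11; rewrite ler_piMl// mulr_ge0.
  lra.
apply: (@le_trans _ _ (\prod_(z <- C) expR (s z * (sin a0 ^+ 2 - dens z) + 2 * s z ^+ 2))).
  apply: ler_prod => z _; rewrite wF andbT /weight co2 addr_ge0// mulr_ge0 ?sqr_ge0 ?expR_ge0//.
rewrite -expR_sum ler_expR big_split /=; apply: lerD.
  apply: (@le_trans _ _ (\sum_(z <- C) (`|c| * B * (2 * `|D|)) * (u z * p z))).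
    apply: ler_sum => z _; apply: le_trans (ler_norm _) _; rewrite normrM.
    have /andP[u0 u1] := gprof01 R M0 z.
    have -> : `|c| * B * (2 * `|D|) * (u z * p z) = (`|c| * B * p z) * (2 * (`|D| * u z)) by ring.
    apply: ler_pM => //; rewrite /dens.
    have -> : sin a0 ^+ 2 - sin (angle z) ^+ 2 = (sin a0 - sin (angle z)) * (sin a0 + sin (angle z)) by ring.
    rewrite normrM mulrC; apply: ler_pM => //.
      by apply: le_trans (ler_normD _ _) _; have := sin_max a0; have := sin_max (angle z); lra.
    apply: le_trans (sin_lip _ _) _; rewrite /angle opprD addrA subrr add0r normrN normrM.
    by rewrite [`|u z|]ger0_norm.
  rewrite -mulr_sumr -(@lsum_seq R site C (fun z => u z * p z))//; last first.
    by move=> z; rewrite mulf_eq0 negb_or => /andP[_]; exact: Cp.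
  have /andP[_ h] := lsum_gprof_srw2 R M0.
  have k0 : 0 <= `|c| * B * (2 * `|D|) by rewrite !mulr_ge0.
  by apply: le_trans (ler_wpM2l k0 h) _; rewrite le_eqVlt; apply/orP; left; apply/eqP; ring.
apply: (@le_trans _ _ (\sum_(z <- C) (c ^+ 2 * B ^+ 2 / M%:R) * p z)).
  apply: ler_sum => z _.
  have h : s z ^+ 2 <= (`|c| * B * p z) ^+ 2.
    have k0 : 0 <= `|c| * B * p z := le_trans (normr_ge0 _) (sB z).
    by rewrite -[leLHS]real_normK ?num_real//; apply: lerXn2r; rewrite ?nnegrE.
  apply: (@le_trans _ _ (2 * (c ^+ 2 * B ^+ 2) * p z * p z)).
    have -> : 2 * (c ^+ 2 * B ^+ 2) * p z * p z = 2 * (`|c| ^+ 2 * B ^+ 2 * p z ^+ 2) by rewrite real_normK ?num_real//; ring.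
    have -> : `|c| ^+ 2 * B ^+ 2 * p z ^+ 2 = (`|c| * B * p z) ^+ 2 by ring.
    by rewrite ler_wpM2l.
  rewrite ler_wpM2r//.
  have k1 : 0 <= 2 * (c ^+ 2 * B ^+ 2) by rewrite mulr_ge0// (mulr_ge0 (sqr_ge0 c) (sqr_ge0 B)).
  apply: le_trans (ler_wpM2l k1 (pM z)) _.
  by rewrite le_eqVlt; apply/orP; left; apply/eqP; field; rewrite gt_eqF.
by rewrite -mulr_sumr -(lsum_seq uC Cp) lsum_srw2 mulr1.
Qed.

End InitialExpectations.

(** * Growth of the Green function *)

Section WallisProduct.
Variable R : realType.
Implicit Types (x : R).

(* The primitive of sin ^+ n vanishing at 0. *)
Fixpoint sin_primitive_pair (n : nat) : (R -> R) * (R -> R) :=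
  if n is n'.+1 then
    let: (F, F') := sin_primitive_pair n' in
    (F', fun x => (n'.+2%:R)^-1 * (n'.+1%:R * F x - sin x ^+ n'.+1 * cos x))
  else (id, fun x => 1 - cos x).
Definition sin_primitive n := (sin_primitive_pair n).1.

Lemma sin_primitiveSS n x : sin_primitive n.+2 x =
  (n.+2%:R)^-1 * (n.+1%:R * sin_primitive n x - sin x ^+ n.+1 * cos x).
Proof. by rewrite /sin_primitive /=; case: (sin_primitive_pair n). Qed.

Lemma sin_primitive_ind (Q : nat -> Prop) : Q 0%N -> Q 1%N -> (forall n, Q n -> Q n.+2) -> forall n, Q n.
Proof.
move=> Q0 Q1 QS n; suff [] : Q n /\ Q n.+1 by [].
by elim: n => // n [h1 h2]; split => //; exact: QS.
Qed.

Lemma is_derive_sin_primitive n x : is_derive x 1 (sin_primitive n) (sin x ^+ n).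
Proof.
elim/sin_primitive_ind: n x => [x|x|n IH x].
- by rewrite expr0; exact: is_derive_id.
- rewrite expr1; have -> : sin x = 0 - (- sin x) by rewrite sub0r opprK.
  have -> : sin_primitive 1 = cst 1 - cos by apply/funext.
  exact: is_deriveB.
have -> : sin_primitive n.+2 = (n.+2%:R)^-1 \*: (n.+1%:R \*: sin_primitive n - sin ^+ n.+1 * cos).
  apply/funext => y; rewrite sin_primitiveSS.
  rewrite [RHS]/GRing.scale /=; congr (_ * _); rewrite [RHS]/GRing.add /=; congr (_ - _).
  by rewrite [RHS]/GRing.mul /= exprfctE.
have H := IH x.
have Hs : is_derive x 1 (sin ^+ n.+1) ((n.+1%:R * sin x ^+ n) *: cos x) by apply: is_derive_eq; rewrite -mulr_natl.
have Hm := is_deriveM Hs (is_derive_cos x).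
have Hd := is_deriveZ n.+2%:R^-1 (is_deriveB (is_deriveZ n.+1%:R H) Hm).
apply: (is_derive_eq Hd); rewrite /GRing.scale /=.
have c2 : cos x ^+ 2 = 1 - sin x ^+ 2 by rewrite -[X in X - _](cos2Dsin2 x) addrK.
have n0 : n.+2%:R != 0 :> R by rewrite pnatr_eq0.
rewrite exprfctE.
have -> : sin x ^+ n.+2 = sin x ^+ n * sin x ^+ 2 by rewrite -exprD addn2.
have -> : sin x ^+ n.+1 = sin x ^+ n * sin x by rewrite exprSr.
apply: (mulfI n0); rewrite mulrA divff// mul1r.
have -> : n.+2%:R = n.+1%:R + 1 :> R by rewrite natr1.
transitivity (sin x ^+ n * (n.+1%:R - n.+1%:R * cos x ^+ 2 + sin x ^+ 2)); first by ring.
by rewrite c2; ring.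
Qed.

Definition wallis_integral n := sin_primitive n (pi / 2).

Lemma wallis_integralSS n : wallis_integral n.+2 = n.+1%:R / n.+2%:R * wallis_integral n.
Proof.
rewrite /wallis_integral sin_primitiveSS cos_pihalf mulr0 subr0; by rewrite mulrCA mulrA.
Qed.

Lemma sin_primitive0 n : sin_primitive n 0 = 0.
Proof.
elim/sin_primitive_ind: n => [//||n IH]; first by rewrite /sin_primitive /= cos0 subrr.
by rewrite sin_primitiveSS IH sin0 expr0n /= mul0r mulr0 subrr mulr0.
Qed.

Lemma wallis_integral_noninc n : wallis_integral n.+1 <= wallis_integral n.
Proof.
rewrite -subr_ge0.
suff : (sin_primitive n - sin_primitive n.+1) 0 <= (sin_primitive n - sin_primitive n.+1) (pi / 2).
  rewrite [X in X <= _](_ : _ = sin_primitive n 0 - sin_primitive n.+1 0)//.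
  by rewrite !sin_primitive0 subrr.
have p0 := @pi_gt0 R.
have fd (y : R) : is_derive y 1 (sin_primitive n - sin_primitive n.+1) (sin y ^+ n - sin y ^+ n.+1).
  by have h1 := is_derive_sin_primitive n y; have h2 := is_derive_sin_primitive n.+1 y; exact: is_deriveB.
apply: (@ger0_derive1_le_cc _ (sin_primitive n - sin_primitive n.+1) 0 (pi / 2)).
- by move=> y _; exact: (@ex_derive _ _ _ _ _ _ _ (fd y)).
- move=> y; rewrite in_itv /= => /andP[y0 y1]; rewrite derive1E (@derive_val _ _ _ _ _ _ _ (fd y)).
  have s0 : 0 <= sin y by rewrite sin_ge0_pi// (ltW y0)/=; lra.
  by rewrite subr_ge0 exprS ler_piMl ?exprn_ge0// sin_le1.
- by apply: derivable_within_continuous => y _; exact: (@ex_derive _ _ _ _ _ _ _ (fd y)).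
- by rewrite in_itv/= lexx divr_ge0// ltW.
- by rewrite in_itv/= lexx andbT divr_ge0// ltW.
- by rewrite divr_ge0// ltW.
Qed.

Lemma wallis_integral_even m : wallis_integral m.*2 = pi / 2 * wallis R m.
Proof.
elim: m => [|m IH]; first by rewrite /wallis_integral /sin_primitive /= /wallis /= mulr1.
by rewrite doubleS wallis_integralSS IH wallisS; ring.
Qed.

Lemma wallis_integral_odd m : wallis_integral m.*2.+1 * (m.*2.+1%:R * wallis R m) = 1.
Proof.
elim: m => [|m IH].
  by rewrite /wallis_integral /sin_primitive /= cos_pihalf subr0 /wallis /= !mulr1.
rewrite doubleS wallis_integralSS wallisS -[RHS]IH; field.
by rewrite -!natr1 -!(natrD R _ 1); apply/andP; split; rewrite ?pnatr_eq0// -natrD pnatr_eq0.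
Qed.

(** The integrals of the powers of sine decrease with the exponent; the even ones are
    [pi / 2 * wallis m], the odd ones [1 / ((2m+1) wallis m)]. *)
Lemma wallis_sqr_bounds m : m%:R * (pi * wallis R m ^+ 2) <= 1 <= (m%:R + 2^-1) * (pi * wallis R m ^+ 2).
Proof.
have p0 := @pi_gt0 R; have w0 := wallis_gt0 R m.
have d : m.*2%:R = 2 * m%:R :> R by rewrite -mul2n natrM.
apply/andP; split.
  case: m w0 d => [|m] w0 d; first by rewrite mul0r ler01.
  have h := wallis_integral_noninc m.*2.+1; rewrite -doubleS wallis_integral_even in h.
  have k0 : 0 <= m.*2.+1%:R * wallis R m by rewrite mulr_ge0// ltW// wallis_gt0.
  have := ler_wpM2r k0 h; rewrite wallis_integral_odd; apply: le_trans.
  rewrite le_eqVlt; apply/orP; left; apply/eqP.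
  have e : m.*2.+1%:R * wallis R m = m.+1.*2%:R * wallis R m.+1.
    have b0 : m.*2.+2%:R != 0 :> R by rewrite pnatr_eq0.
    rewrite wallisS doubleS; move: (m.*2.+2%:R) (m.*2.+1%:R) b0 => b a b0; by field.
  by rewrite e d; field.
have h := wallis_integral_noninc m.*2; rewrite wallis_integral_even in h.
have k0 : 0 <= m.*2.+1%:R * wallis R m by rewrite mulr_ge0// ltW.
have := ler_wpM2r k0 h; rewrite wallis_integral_odd => /le_trans; apply.
rewrite le_eqVlt; apply/orP; left; apply/eqP.
by rewrite -[m.*2.+1%:R]natr1 d; field.
Qed.

Lemma ln_succ_le n : (0 < n)%N -> ln n.+1%:R - ln n%:R <= n%:R^-1 :> R.
Proof.
move=> n0; have np : 0 < n%:R :> R by rewrite ltr0n.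
have -> : n.+1%:R = n%:R * (1 + n%:R^-1) :> R by rewrite -natr1; field; rewrite gt_eqF.
have ip : 0 < n%:R^-1 :> R by rewrite invr_gt0.
have ip1 : 0 < 1 + n%:R^-1 :> R by lra.
rewrite lnM ?posrE//.
rewrite addrAC subrr add0r; apply: le_ln1Dx; lra.
Qed.

Lemma ln_succ_ge n : (0 < n)%N -> n.+1%:R^-1 <= ln n.+1%:R - ln n%:R :> R.
Proof.
move=> n0; have np : 0 < n%:R :> R by rewrite ltr0n.
have sp : 0 < n.+1%:R :> R by rewrite ltr0n.
have i1 : n.+1%:R^-1 < 1 :> R by rewrite invf_lt1// ltr1n ltnS.
have e : n%:R = n.+1%:R * (1 + - n.+1%:R^-1) :> R by rewrite -[n.+1%:R]natr1; field; rewrite natr1 gt_eqF.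
rewrite [in ln n%:R]e lnM ?posrE//; last by rewrite subr_gt0.
have h : ln (1 + - n.+1%:R^-1) <= - n.+1%:R^-1 :> R by apply: le_ln1Dx; rewrite ltrN2.
by rewrite opprD addrA subrr add0r lerNr.
Qed.

(** [wallis m ^+ 2] is [1 / (pi m)] up to a bounded shift of [m], and the harmonic sum is compared
    with [ln] term by term. *)
Lemma green_mass_bounds M : (0 < M)%N -> ln M%:R / pi <= green_mass R M <= 2 + ln M%:R / pi.
Proof.
move=> M0; have p0 := @pi_gt0 R; have p2 := @pi_ge2 R.
rewrite /green_mass green0; apply/andP; split.
  apply: (@le_trans _ _ (ln M.+1%:R / pi)).
    by rewrite ler_pM2r ?invr_gt0// ler_ln ?posrE ?ltr0n// ler_nat.
  elim: (M) => [|n IH]; first by rewrite ln1 mul0r big_ord0.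
  rewrite big_ord_recr /=; have := ln_succ_le (ltn0Sn n).
  have /andP[_ h] := wallis_sqr_bounds n.
  have h2 : n.+1%:R^-1 / pi <= wallis R n ^+ 2.
    rewrite -invfM -[leLHS]mul1r ler_pdivrMr ?mulr_gt0// ?ltr0n//.
    have -> : wallis R n ^+ 2 * (n.+1%:R * pi) = n.+1%:R * (pi * wallis R n ^+ 2) by ring.
    apply: le_trans h _; apply: ler_wpM2r; first by rewrite mulr_ge0 ?sqr_ge0 ?(ltW p0).
    by rewrite -[n.+1%:R]natr1 lerD2l; lra.
  move=> h3; apply: le_trans (lerD IH h2).
  by rewrite -mulrDl ler_pM2r ?invr_gt0// -lerBlDl.
suff H n : \sum_(m < n.+2) wallis R m ^+ 2 <= 1 + (1 + ln n.+1%:R) / pi.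
  case: M M0 => // n _; apply: (@le_trans _ _ (\sum_(m < n.+2) wallis R m ^+ 2)).
    by rewrite [leRHS]big_ord_recr /= lerDl sqr_ge0.
  apply: le_trans (H n) _; have : 1 / pi <= 1 :> R by rewrite ler_pdivrMr//; lra.
  rewrite mulrDl; lra.
have S m : (0 < m)%N -> wallis R m ^+ 2 <= m%:R^-1 / pi.
  move=> m0; have /andP[h _] := wallis_sqr_bounds m.
  have mp : 0 < m%:R :> R by rewrite ltr0n.
  rewrite -invfM -[leRHS]mul1r ler_pdivlMr ?mulr_gt0//; apply: le_trans _ h.
  by rewrite le_eqVlt; apply/orP; left; apply/eqP; ring.
elim: n => [|n IH].
  rewrite !big_ord_recr big_ord0 /= add0r ln1 addr0.
  have -> : wallis R 0 ^+ 2 = 1 by rewrite /wallis /= expr1n.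
  by rewrite lerD2l; have := S 1%N isT; rewrite invr1.
rewrite big_ord_recr /=; have := ln_succ_ge (ltn0Sn n) => h.
apply: le_trans (lerD IH (S n.+2 isT)) _.
have h2 : n.+2%:R^-1 / pi <= (ln n.+2%:R - ln n.+1%:R) / pi :> R by rewrite ler_pM2r ?invr_gt0.
move: h2; move: (ln n.+2%:R) (ln n.+1%:R) (n.+2%:R^-1) => a b c h2; rewrite !mulrDl in h2 *; lra.
Qed.

End WallisProduct.

(** * Exponential moments at the scale T / log T *)

Section MgfBounds.
Variables (R : realType) (a0 a1 B : R).
Hypothesis B1 : 1 <= B.
Hypothesis HB : forall z, Num.min a0 a1 <= z <= Num.max a0 a1 ->
  [/\ 0 < sin z, 0 < cos z & 1 <= B * (sin z * cos z)].
Local Notation D := (a1 - a0).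
Hypothesis DB : `|D| <= B.
Local Notation sc := (sin a1 * cos a1).
Local Notation occ := (@occupation_time R).

(** The Wallis bound for [m = 1], where [wallis] is 1/2. *)
Lemma pi_le4 : pi <= 4 :> R.
Proof.
have /andP[h _] := wallis_sqr_bounds R 1; move: h; rewrite wallisS.
have -> : wallis R 0 = 1 by [].
have -> : 1 * (0.*2.+1%:R / 0.*2.+2%:R) = 2^-1 :> R by rewrite /= !mul1r.
by have := @pi_gt0 R; lra.
Qed.

Lemma gprof_support M : exists2 A : seq site, uniq A & forall x, gprof R M x != 0 -> x \in A.
Proof.
have [A0 hA] := fsupp_gprof R M; exists (undup A0); first exact: undup_uniq.
by move=> x /hA; rewrite mem_undup.
Qed.

Lemma cylinder_lower_bound (f : config -> R) : cylinder f -> (forall z, 0 < f z) ->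
  exists2 c, 0 < c & forall z, c <= f z.
Proof.
move=> cf f0; have [c c0 fc] := cylinder_bounded (cylinder_comp (fun x => x^-1) cf).
have c1 : 0 < c + 1 by lra.
exists (c + 1)^-1; first by rewrite invr_gt0.
move=> z; rewrite -[leRHS]invrK lef_pV2 ?posrE ?invr_gt0//.
by have := fc z; rewrite ger0_norm ?invr_ge0 ?(ltW (f0 z))//; lra.
Qed.

Lemma gunit_sqr_bounds M : (1 < M)%N ->
  pi / (ln M%:R + 2 * pi) <= gunit R M ^+ 2 <= pi / ln M%:R.
Proof.
move=> M1; have M0 : (0 < M)%N by exact: ltnW.
have p0 := @pi_gt0 R; have l0 : 0 < ln M%:R :> R by rewrite ln_gt0// ltr1n.
have /andP[g1 g2] := green_mass_bounds R M0; rewrite gunit_sqr//.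
have g0 := green_mass_gt0 R M0.
have lp : 0 < ln M%:R / pi :> R by rewrite divr_gt0.
have e1 : pi / (ln M%:R + 2 * pi) = (2 + ln M%:R / pi)^-1 :> R.
  have -> : 2 + ln M%:R / pi = (ln M%:R + 2 * pi) / pi :> R by rewrite mulrDl mulfK ?gt_eqF// addrC.
  by rewrite invf_div.
have e2 : pi / ln M%:R = (ln M%:R / pi)^-1 :> R by rewrite invf_div.
rewrite e1 e2 !lef_pV2 ?posrE//; first by rewrite g1 g2.
by rewrite addr_gt0.
Qed.

(** [l] will be [ln T], and [M] the first integer above [T]. The constant 36 comes from
    [pi (1 + 2 pi) <= 4 * 9]. *)
Lemma green_log_close M (l : R) : (1 < M)%N -> 0 < l -> l <= ln M%:R -> ln M%:R <= l + 1 ->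
  l * gunit R M ^+ 2 <= pi /\ pi - l * gunit R M ^+ 2 <= 36 / l.
Proof.
move=> M1 l0 lM Ml; have /andP[] := gunit_sqr_bounds M1; move: (gunit R M ^+ 2) => w w1 w2.
have p0 := @pi_gt0 R; have p4 := pi_le4.
have lM0 : 0 < ln M%:R :> R by exact: lt_le_trans l0 lM.
move: (ln M%:R) lM Ml w1 w2 lM0 => m lm ml w1 w2 m0.
have s0 : 0 < l + 1 + 2 * pi by lra.
have m2 : 0 < m + 2 * pi by lra.
split.
  apply: (@le_trans _ _ (l * (pi / m))); first by apply: ler_wpM2l => //; exact: ltW.
  by rewrite mulrCA ler_piMr ?(ltW p0)// ler_pdivrMr// mul1r.
have h : l * (pi / (l + 1 + 2 * pi)) <= l * w.
  rewrite ler_wpM2l ?(ltW l0)//; apply: le_trans w1.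
  by rewrite ler_pM2l// lef_pV2 ?posrE//; lra.
have h1 : pi - l * (pi / (l + 1 + 2 * pi)) <= 36 / l.
  have -> : pi - l * (pi / (l + 1 + 2 * pi)) = pi * (1 + 2 * pi) / (l + 1 + 2 * pi).
    by field; rewrite gt_eqF//; lra.
  have h2 : pi * (1 + 2 * pi) <= 36 :> R.
    have : pi * (1 + 2 * pi) <= 4 * (1 + 2 * pi) :> R by apply: ler_wpM2r => //; lra.
    lra.
  apply: (@le_trans _ _ (36 / (l + 1 + 2 * pi))); first by rewrite ler_pM2r ?invr_gt0//; lra.
  by rewrite ler_pM2l// lef_pV2 ?posrE//; lra.
lra.
Qed.

Let B0 : 0 < B. Proof. exact: lt_le_trans ltr01 B1. Qed.

Let a1P : [/\ 0 < sin a1, 0 < cos a1 & 1 <= B * (sin a1 * cos a1)].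
Proof. by apply: HB; rewrite ge_min le_max lexx !orbT. Qed.

Let sc0 : 0 < sc. Proof. by case: a1P => *; rewrite mulr_gt0. Qed.

Let scB : sc^-1 <= B.
Proof. by case: a1P => _ _ h; rewrite -[leLHS]mul1r ler_pdivrMr. Qed.

Let b01 : 0 <= sin a1 ^+ 2 <= 1.
Proof. by case: a1P => /ltW s0 _ _; rewrite sqr_ge0 /= expr_le1 ?sin_le1. Qed.

Lemma mgf_upper_raw (g : 'I_2 -> site -> R) (Mc : 'I_2 -> nat) (N eps : R) (M : nat) (T : R)
    (P : probability (path_space R) R) (th r d q : R) :
  (forall i, fsupp (g i)) -> (forall i z, g i (- z) = g i z) ->
  (forall i, lsum (fun z => `|pair_kernel (g i) z - (nbrk R i z - srw2 R (Mc i).*2 z)|) <= eps) ->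
  1 <= N -> (forall i, norm1 (g i) <= N) -> 64 * N * B ^+ 4 * gunit R M <= 2^-1 ->
  (0 < M)%N -> 0 <= T -> ssep_law T (sin a0 ^+ 2) P ->
  (forall s, 0 <= s <= 1 -> th * s <= drift M a0 a1 T / sc * s + r) -> 0 <= q ->
  `|q * drift M a0 a1 T| * B <= M%:R ->
  Ex P (fun x : path_space R => expR (th * occ x)) <=
  expR (r + d + (drift M a0 a1 T / sc * sin a1 ^+ 2 - 2 * T * gunit R M ^+ 2 * D ^+ 2
     + T / 2 * super_error M B N eps)) +
  expR (`|th| - q * d) * expR (2 * `|q * drift M a0 a1 T| * B * `|D| * gunit R M ^+ 2
     + (q * drift M a0 a1 T) ^+ 2 * B ^+ 2 / M%:R).
Proof.
move=> fg ge geps N1 gN small M0 T0 law kr q0 qM.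
have [A uA HA] := gprof_support M.
have [c0 c00 c0phi] := cylinder_lower_bound (cylinder_phi M a0 a1 A g) (phi_gt0 M0 HB A g).
have S := phi_super M0 B1 HB DB uA HA fg ge geps N1 gN small T0.
have H := @occ_upper R T _ P T0 law _ _ th _ c0 _ r d q (cylinder_cloud M a0 a1 T) (cylinder_phi M a0 a1 A g) c00 c0phi S kr q0.
apply: le_trans H _; rewrite lerD2l ler_wpM2l ?expR_ge0//.
have [St [HS core bern mk]] := law.
exact: (init_cloud M0 B1 HB core bern).
Qed.

Lemma mgf_lower_raw (M : nat) (T : R) (P : probability (path_space R) R) (th : R) :
  (0 < M)%N -> 0 <= T -> ssep_law T (sin a0 ^+ 2) P ->
  expR (th * sin a1 ^+ 2 - 2 * T * D ^+ 2 * gunit R M ^+ 2 - 4 * B ^+ 2 * M%:R * gunit R M ^+ 2) <=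
  Ex P (fun x : path_space R => expR (th * occ x)).
Proof.
move=> M0 T0 law.
have [A uA HA] := gprof_support M.
have [St [HS core bern mk]] := law.
have H := occ_lower T0 law th (cylinder_phi0 M a0 a1 A) (expR_gt0 _) (phi0_le M0 B1 HB DB uA HA)
  (init_phi0_sqr M HB uA core bern).
apply: le_trans H; rewrite [expR _ ^+ 2]expr2 -expRD -expRN -[leRHS]expRD ler_expR.
rewrite (init_phi0_sqr_occ M0 HB uA HA core bern).
have := init_phi0_generator M0 HB uA HA T0 core bern; lra.
Qed.

Variables (T L a : R).
Hypotheses (LT : L = ln T) (T1 : 1 < T) (aT : a = T / L).

Let T0 : 0 < T. Proof. exact: lt_trans ltr01 T1. Qed.
Let L0 : 0 < L. Proof. by rewrite LT ln_gt0. Qed.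
Let a_gt0 : 0 < a. Proof. by rewrite aT divr_gt0. Qed.
Let TaL : T = a * L. Proof. by rewrite aT divfK// gt_eqF. Qed.

(** From [expR L >= 1 + L^2 / 2]; it turns lower bounds on [ln T] into lower bounds on the speed. *)
Lemma half_ln_le : L / 2 <= a.
Proof.
rewrite aT ler_pdivlMr//.
have := expR_ge1Dxn 1 (ltW L0); rewrite [in leRHS]LT lnK ?posrE//.
have -> : (2`!)%:R = 2 :> R by [].
by rewrite expr2; lra.
Qed.

Lemma mgf_lower_scaled (P : probability (path_space R) R) (th e : R) :
  ssep_law T (sin a0 ^+ 2) P -> 0 < e ->
  1 <= L -> 4 * (32 * B ^+ 2 + 2 * e) ^+ 2 <= L * e ^+ 2 -> 128 * B ^+ 2 <= L * e -> 1 <= a ->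
  expR (a * (th * sin a1 ^+ 2 - 2 * pi * D ^+ 2 - e)) <=
  Ex P (fun x : path_space R => expR (th * a * occ x)).
Proof.
move=> law e0 L1 Lc1 Lc2 ha.
have p0 := @pi_gt0 R; have p4 := pi_le4.
have B2 : 1 <= B ^+ 2 by rewrite exprn_ege1.
(* [eta] is the relative loss in [ln M >= (1 - eta) L]. The first summand makes its cost
   [4 pi eta D^2] at most [e / 2], the second keeps [eta] at most 1/2. *)
pose eta := e / (32 * B ^+ 2 + 2 * e).
have den0 : 0 < 32 * B ^+ 2 + 2 * e by lra.
have eta0 : 0 < eta by rewrite divr_gt0.
have eta2 : eta <= 2^-1 by rewrite ler_pdivrMr//; lra.
have etaB : eta * (32 * B ^+ 2) <= e.
  by rewrite /eta mulrAC ler_pdivrMr//; have := mulr_gt0 e0 e0; nra.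
(* [ln L = 2 ln (sqrt L) <= 2 sqrt L], and the lower bound on [L] gives [eta sqrt L >= 2]. *)
have lnL : ln L <= eta * L.
  have s0 : 0 < Num.sqrt L by rewrite sqrtr_gt0.
  have sL : Num.sqrt L ^+ 2 = L by rewrite sqr_sqrtr// ltW.
  have h : 2 <= eta * Num.sqrt L.
    rewrite -(@ler_pXn2r _ 2)// ?nnegrE ?(mulr_ge0 (ltW eta0) (ltW s0))//.
    rewrite exprMn sL /eta expr_div_n mulrAC ler_pdivlMr ?exprn_gt0//.
    by move: Lc1; rewrite [L * _]mulrC; have -> : (2 : R) ^+ 2 = 4 by ring.
  rewrite -[in ln L]sL lnXn// -mulr_natr.
  have := ln_sublinear s0 => hs; rewrite -[in leRHS]sL expr2 mulrA.
  apply: (@le_trans _ _ (2 * Num.sqrt L)); last by rewrite ler_wpM2r// ltW.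
  lra.
clearbody eta.
(* [M] is of order [T / L]: the supremum of [phi0] then costs only a multiple of [a / L], while
   [ln M] is still close to [L]. *)
have [M [aM Ma]] : exists M : nat, a < M%:R /\ M%:R <= a + 1.
  exists (Num.truncn a).+1; split; first exact: truncnS_gt.
  by rewrite -natr1 lerD2r; have /andP[] := truncn_itv (ltW a_gt0).
have M1 : (1 < M)%N by rewrite -(ltr_nat R); apply: le_lt_trans aM.
have lM : (1 - eta) * L <= ln M%:R.
  have la : ln a = L - ln L by rewrite aT ln_div ?posrE// -LT.
  apply: (@le_trans _ _ (ln a)); first by rewrite la; lra.
  by rewrite ler_ln ?posrE ?ltW// (lt_trans a_gt0).
have lM2 : L / 2 <= ln M%:R by apply: le_trans lM; nra.
have lM0 : 0 < ln M%:R :> R by apply: lt_le_trans lM2; lra.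
have /andP[_ w2] := gunit_sqr_bounds M1.
have w20 := sqr_ge0 (gunit R M).
have Lw : L * gunit R M ^+ 2 <= pi * (1 + 2 * eta).
  apply: (@le_trans _ _ (L * (pi / ln M%:R))); first by rewrite ler_wpM2l// ltW.
  rewrite mulrCA; apply: (ler_wpM2l (ltW p0)); rewrite ler_pdivrMr// [leRHS]mulrC.
  apply: (@le_trans _ _ ((1 - eta) * L * (1 + 2 * eta))); last by rewrite ler_wpM2r//; lra.
  have -> : (1 - eta) * L * (1 + 2 * eta) = L + L * (eta * (1 - 2 * eta)) by ring.
  by rewrite lerDl !mulr_ge0 ?(ltW L0) ?(ltW eta0)//; lra.
have wL : gunit R M ^+ 2 <= 8 / L.
  apply: le_trans w2 _; rewrite ler_pdivrMr// mulrAC ler_pdivlMr//; nra.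
have D2 : D ^+ 2 <= B ^+ 2.
  by rewrite -[leLHS]real_normK ?num_real// lerXn2r ?nnegrE// ltW.
have := mgf_lower_raw (th * a) (ltnW M1) (ltW T0) law; apply: le_trans.
rewrite ler_expR.
have t1 : 2 * T * D ^+ 2 * gunit R M ^+ 2 <= a * (2 * pi * D ^+ 2 + e / 2).
  have -> : 2 * T * D ^+ 2 * gunit R M ^+ 2 = a * (2 * D ^+ 2 * (L * gunit R M ^+ 2)) by rewrite TaL; ring.
  rewrite ler_wpM2l ?(ltW a_gt0)//.
  have h : 2 * D ^+ 2 * (L * gunit R M ^+ 2) <= 2 * D ^+ 2 * (pi * (1 + 2 * eta)).
    by rewrite ler_wpM2l// mulr_ge0 ?sqr_ge0.
  apply: le_trans h _.
  have -> : 2 * D ^+ 2 * (pi * (1 + 2 * eta)) = 2 * pi * D ^+ 2 + 4 * (pi * (eta * D ^+ 2)) by ring.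
  rewrite lerD2l.
  have h2 : pi * (eta * D ^+ 2) <= 4 * (eta * B ^+ 2).
    apply: ler_pM => //; first exact: ltW.
      by rewrite mulr_ge0 ?sqr_ge0 ?(ltW eta0).
    by apply: ler_wpM2l => //; exact: ltW.
  lra.
have t2 : 4 * B ^+ 2 * M%:R * gunit R M ^+ 2 <= a * (e / 2).
  have h : M%:R * gunit R M ^+ 2 <= (2 * a) * (8 / L).
    by apply: ler_pM => //; lra.
  have h2 : 4 * B ^+ 2 * (M%:R * gunit R M ^+ 2) <= 4 * B ^+ 2 * ((2 * a) * (8 / L)).
    by rewrite ler_wpM2l// mulr_ge0 ?sqr_ge0.
  have -> : 4 * B ^+ 2 * M%:R * gunit R M ^+ 2 = 4 * B ^+ 2 * (M%:R * gunit R M ^+ 2) by ring.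
  apply: le_trans h2 _.
  have -> : 4 * B ^+ 2 * ((2 * a) * (8 / L)) = a * (64 * B ^+ 2 / L) by ring.
  rewrite ler_wpM2l ?(ltW a_gt0)// ler_pdivrMr//; lra.
lra.
Qed.

End MgfBounds.

(** The budget [e] is spent in quarters: on the threshold [d] of [occ_upper], on [super_error], on
    three times [r], and on the sum of two exponentials. *)
Lemma mgf_upper_scaled (R : realType) (a0 a1 B T L a : R) (g : 'I_2 -> site -> R) (Mc : 'I_2 -> nat) (N eps om q : R)
    (P : probability (path_space R) R) (e : R) :
  1 <= B -> (forall z, Num.min a0 a1 <= z <= Num.max a0 a1 ->
    [/\ 0 < sin z, 0 < cos z & 1 <= B * (sin z * cos z)]) -> `|(a1 - a0)| <= B ->
  L = ln T -> 1 < T -> a = T / L ->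
  ssep_law T (sin a0 ^+ 2) P -> 0 < e ->
  (forall i, fsupp (g i)) -> (forall i z, g i (- z) = g i z) ->
  (forall i, lsum (fun z => `|pair_kernel (g i) z - (nbrk R i z - srw2 R (Mc i).*2 z)|) <= eps) ->
  1 <= N -> (forall i, norm1 (g i) <= N) ->
  128 * eps * B ^+ 4 = e -> 0 < om -> 128 * N * B ^+ 4 * om <= 1 ->
  4800 * 100 * N ^+ 2 * B ^+ 8 * om <= e -> q * e = 4 * (24 * B ^+ 2 + 1) ->
  1 <= L -> 4 <= L * om ^+ 2 -> 9 * 100 * B ^+ 2 <= L * e -> 8 * q * B ^+ 2 <= L ->
  64 * (q + q ^+ 2) * B ^+ 4 <= L -> 8 <= L * e ->
  Ex P (fun x : path_space R => expR (2 * pi * (a1 - a0) / (sin a1 * cos a1) * a * (@occupation_time R) x)) <=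
  expR (a * (2 * pi * (a1 - a0) / (sin a1 * cos a1) * sin a1 ^+ 2 - 2 * pi * (a1 - a0) ^+ 2 + e)).
Proof.
move=> B1 HB DB LT T1 aT law e0 fg ge geps N1 gN epsE om0 om1 om2 qE L1 Lom LB Lq Lq2 Le.
have B0 : 0 < B := lt_le_trans ltr01 B1.
have [sa1 ca1 sca1] : [/\ 0 < sin a1, 0 < cos a1 & 1 <= B * (sin a1 * cos a1)].
  by apply: HB; rewrite ge_min le_max lexx !orbT.
have sc0 : 0 < (sin a1 * cos a1) by rewrite mulr_gt0.
have scB : (sin a1 * cos a1)^-1 <= B by rewrite -[leLHS]mul1r ler_pdivrMr.
have b01 : 0 <= sin a1 ^+ 2 <= 1 by rewrite sqr_ge0 /= expr_le1 ?sin_le1// ltW.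
have T0 : 0 < T := lt_trans ltr01 T1.
have L0 : 0 < L by rewrite LT ln_gt0.
have a_gt0 : 0 < a by rewrite aT divr_gt0.
have TaL : T = a * L by rewrite aT divfK// gt_eqF.
have La2 := half_ln_le LT T1 aT.
have p0 := @pi_gt0 R; have p4 := pi_le4 R.
have B2 : 1 <= B ^+ 2 by rewrite exprn_ege1.
have q0 : 0 < q by rewrite -(pmulr_lgt0 _ e0) qE; clear - B2; lra.
have bx := (om1, om2, Lom, LB, Lq, Lq2, Le, qE, epsE, N1).
clear om1 om2 Lom LB Lq Lq2 Le qE epsE N1.
(* [M] is of order [T]: the quadratic term of [init_cloud], of order [a^2 / M], is then of order
   [a / L], and [ln M] is within 1 of [L]. *)
have [M [TM MT]] : exists M : nat, T < M%:R /\ M%:R <= T + 1.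
  exists (Num.truncn T).+1; split; first exact: truncnS_gt.
  by rewrite -natr1 lerD2r; have /andP[] := truncn_itv (ltW T0).
have M1 : (1 < M)%N by rewrite -(ltr_nat R); apply: lt_trans TM.
have Mp : 0 < M%:R :> R by exact: lt_trans TM.
have lM : L <= ln M%:R by rewrite LT ler_ln ?posrE// ltW.
have lM2 : ln M%:R <= L + 1.
  have : ln M%:R <= ln (2 * T).
    have T2 : T + 1 <= 2 * T by rewrite mulr_natl mulr2n lerD2l ltW.
    by rewrite ler_ln ?posrE ?mulr_gt0//; exact: le_trans MT T2.
  rewrite lnM ?posrE// -LT => /le_trans; apply.
  have : ln (1 + 1) <= 1 :> R by apply: le_ln1Dx; rewrite (@lt_trans _ _ 0)// oppr_lt0.
  have -> : 1 + 1 = 2 :> R by ring.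
  clear; lra.
have lM0 : 0 < ln M%:R :> R by exact: lt_le_trans L0 lM.
have /andP[w1 w2] := gunit_sqr_bounds R M1.
set w := gunit R M in w1 w2 *.
have w0 : 0 < w := gunit_gt0 R (ltnW M1).
have w20 := sqr_ge0 w.
pose kp := L * w ^+ 2.
have [kpi kpL] : kp <= pi /\ pi - kp <= 36 / L by exact: (green_log_close M1 L0 lM lM2).
have kp0 : 0 <= kp by rewrite mulr_ge0// ltW.
have kpE : kp = L * w ^+ 2 by [].
clearbody kp.
have wL : w ^+ 2 <= 4 / L by rewrite ler_pdivlMr// mulrC -kpE; apply: le_trans kpi p4.
have wom : w <= om.
  rewrite -(@ler_pXn2r _ 2)// ?nnegrE ?(ltW w0) ?(ltW om0)//.
  apply: le_trans wL _; rewrite ler_pdivrMr// mulrC; by case: bx => [[[[[[[[[]]]]]]]]].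
have D2 : (a1 - a0) ^+ 2 <= B ^+ 2.
  by rewrite -[leLHS]real_normK ?num_real// lerXn2r ?nnegrE// ltW.
have drE : drift M a0 a1 T = 2 * a * kp * (a1 - a0) by rewrite /drift -/w TaL kpE; ring.
pose r := 72 * a * B ^+ 2 / L.
have r0 : 0 <= r by rewrite !mulr_ge0 ?invr_ge0 ?(ltW a_gt0) ?(ltW L0) ?(ltW B0).
have rE : r = 72 * a * B ^+ 2 / L by [].
clearbody r.
have DscB : `|(a1 - a0) / (sin a1 * cos a1)| <= B ^+ 2.
  rewrite normrM expr2; apply: ler_pM => //.
  by rewrite gtr0_norm ?invr_gt0.
have diff : `|2 * a * (pi - kp) * ((a1 - a0) / (sin a1 * cos a1))| <= r.
  have k1 : 0 <= 2 * a * (pi - kp) by rewrite !mulr_ge0 ?(ltW a_gt0)// subr_ge0.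
  rewrite normrM [`|2 * a * _|]ger0_norm//.
  have -> : r = 2 * a * (36 / L) * B ^+ 2 by rewrite rE; ring.
  by apply: ler_pM => //; rewrite ler_wpM2l// mulr_ge0// ltW.
pose th := 2 * pi * (a1 - a0) / (sin a1 * cos a1) * a.
have kr s : 0 <= s <= 1 -> th * s <= drift M a0 a1 T / (sin a1 * cos a1) * s + r.
  move=> /andP[s0 s1]; rewrite -lerBlDl drE.
  have -> : th * s - 2 * a * kp * (a1 - a0) / (sin a1 * cos a1) * s = (2 * a * (pi - kp) * ((a1 - a0) / (sin a1 * cos a1))) * s by rewrite /th; ring.
  apply: le_trans (ler_norm _) _; rewrite normrM (ger0_norm s0).
  by apply: le_trans diff; rewrite ler_piMr.
have N1 : 1 <= N by case: bx.
have N0 : 0 <= N := le_trans ler01 N1.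
have small : 64 * N * B ^+ 4 * w <= 2^-1.
  have om1 : 128 * N * B ^+ 4 * om <= 1 by case: bx => [[[[[[[[[]]]]]]]]].
  have : 128 * N * B ^+ 4 * w <= 128 * N * B ^+ 4 * om.
    by rewrite ler_wpM2l// !mulr_ge0 ?exprn_ge0 ?(ltW B0).
  clear - om1; lra.
have drB : `|drift M a0 a1 T| <= 8 * a * B.
  have k0 : 0 <= 2 * a * kp by rewrite !mulr_ge0 ?(ltW a_gt0).
  rewrite drE normrM (ger0_norm k0); apply: ler_pM => //.
  have : a * kp <= a * 4 by rewrite ler_wpM2l ?(ltW a_gt0)// (le_trans kpi).
  clear; lra.
have qdr : `|q * drift M a0 a1 T| <= 8 * q * a * B.
  rewrite normrM (gtr0_norm q0); have := ler_wpM2l (ltW q0) drB; clear; lra.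
have qM : `|q * drift M a0 a1 T| * B <= M%:R.
  apply: (@le_trans _ _ (8 * q * a * B * B)); first by rewrite ler_wpM2r// ltW.
  have -> : 8 * q * a * B * B = a * (8 * q * B ^+ 2) by ring.
  apply: (@le_trans _ _ (a * L)); first by rewrite ler_wpM2l ?(ltW a_gt0)//; case: bx => [[[[[[[[[]]]]]]]]].
  by rewrite -TaL ltW.
move: bx => [[[[[[[[[om1 om2] Lom] LB] Lq] Lq2] Le] qE] epsE] _].
have H := mgf_upper_raw B1 HB DB (a * (e / 4)) fg ge geps N1 gN small (ltnW M1) (ltW T0) law kr (ltW q0) qM.
apply: le_trans H _.
set E := 2 * pi * (a1 - a0) / (sin a1 * cos a1) * sin a1 ^+ 2 - 2 * pi * (a1 - a0) ^+ 2.
have [b0 b1] := andP b01.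
have rL : 3 * r <= a * (e / 4).
  rewrite rE; have -> : 3 * (72 * a * B ^+ 2 / L) = a * (216 * B ^+ 2 / L) by ring.
  rewrite ler_wpM2l ?(ltW a_gt0)// ler_pdivrMr//; clear - LB B2; lra.
have p1 : r + a * (e / 4) + (drift M a0 a1 T / (sin a1 * cos a1) * sin a1 ^+ 2 - 2 * T * w ^+ 2 * (a1 - a0) ^+ 2 + T / 2 * super_error M B N eps) <= a * (E + 3 * e / 4).
  have x1 : drift M a0 a1 T / (sin a1 * cos a1) * sin a1 ^+ 2 <= a * (2 * pi * (a1 - a0) / (sin a1 * cos a1) * sin a1 ^+ 2) + r.
    rewrite -lerBlDl drE.
    have -> : 2 * a * kp * (a1 - a0) / (sin a1 * cos a1) * sin a1 ^+ 2 - a * (2 * pi * (a1 - a0) / (sin a1 * cos a1) * sin a1 ^+ 2) = - (2 * a * (pi - kp) * ((a1 - a0) / (sin a1 * cos a1))) * sin a1 ^+ 2 by ring.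
    apply: le_trans (ler_norm _) _; rewrite normrM normrN (ger0_norm b0).
    by apply: le_trans diff; rewrite ler_piMr.
  have x2 : - (2 * T * w ^+ 2 * (a1 - a0) ^+ 2) <= - (a * (2 * pi * (a1 - a0) ^+ 2)) + r.
    have -> : 2 * T * w ^+ 2 * (a1 - a0) ^+ 2 = 2 * a * kp * (a1 - a0) ^+ 2 by rewrite kpE TaL; ring.
    have : 2 * a * (pi - kp) * (a1 - a0) ^+ 2 <= r.
      have -> : r = 2 * a * (36 / L) * B ^+ 2 by rewrite rE; ring.
      apply: ler_pM => //; first by rewrite !mulr_ge0 ?(ltW a_gt0)// subr_ge0.
        exact: sqr_ge0.
      by rewrite ler_wpM2l// mulr_ge0// ltW.
    clear; lra.
  have x3 : T / 2 * super_error M B N eps <= a * (e / 4).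
    have -> : T / 2 * super_error M B N eps = a * (kp * (4 * eps * B ^+ 4 + 150 * 100 * N ^+ 2 * B ^+ 8 * w)).
      by rewrite /super_error -/w kpE TaL; field.
    rewrite ler_wpM2l ?(ltW a_gt0)//.
    have y1 : 150 * 100 * N ^+ 2 * B ^+ 8 * w <= 150 * 100 * N ^+ 2 * B ^+ 8 * om.
      by rewrite ler_wpM2l// !mulr_ge0 ?exprn_ge0 ?(ltW B0).
    have y2 : 4 * eps * B ^+ 4 + 150 * 100 * N ^+ 2 * B ^+ 8 * w <= e / 16 by clear - y1 om2 epsE; lra.
    have y0 : 0 <= 4 * eps * B ^+ 4 + 150 * 100 * N ^+ 2 * B ^+ 8 * w.
      have n0 : 0 <= 150 * 100 * N ^+ 2 * B ^+ 8 * w.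
        by rewrite !mulr_ge0 ?exprn_ge0 ?(ltW B0) ?(ltW w0).
      clear - n0 epsE e0; lra.
    have -> : e / 4 = 4 * (e / 16) by field.
    by apply: ler_pM => //; exact: le_trans p4.
  rewrite /E; clear - x1 x2 x3 rL; lra.
(* The exceptional event: [q e / 4 = 24 B^2 + 1] pays for [8 B^2] from the tilt, 1 from the moment
   of the cloud, and [16 B^2], a bound for [- E]. *)
have p2 : `|th| - q * (a * (e / 4)) + (2 * `|q * drift M a0 a1 T| * B * `|(a1 - a0)| * w ^+ 2 + (q * drift M a0 a1 T) ^+ 2 * B ^+ 2 / M%:R) <= a * (E + 3 * e / 4).
  have ppi : `|2 * pi * ((a1 - a0) / (sin a1 * cos a1))| <= 8 * B ^+ 2.
    by rewrite normrM ger0_norm ?mulr_ge0 ?(ltW p0)//; apply: ler_pM => //; clear - p4 p0; lra.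
  have z1 : `|th| <= a * (8 * B ^+ 2).
    have -> : th = a * (2 * pi * ((a1 - a0) / (sin a1 * cos a1))) by rewrite /th; ring.
    by rewrite normrM (gtr0_norm a_gt0) ler_wpM2l// ltW.
  have z2 : 2 * `|q * drift M a0 a1 T| * B * `|(a1 - a0)| * w ^+ 2 <= a * (64 * q * B ^+ 4 / L).
    have h1 : `|q * drift M a0 a1 T| * `|(a1 - a0)| <= 8 * q * a * B * B by apply: ler_pM.
    have h2 : `|q * drift M a0 a1 T| * `|(a1 - a0)| * w ^+ 2 <= 8 * q * a * B * B * (4 / L).
      by apply: ler_pM => //; rewrite mulr_ge0.
    have h3 := ler_wpM2l (ltW B0) h2.
    have b3 : B ^+ 3 <= B ^+ 4 by rewrite ler_weXn2l.
    have k0 : 0 <= 64 * (q * a / L) by rewrite !mulr_ge0 ?invr_ge0 ?(ltW q0) ?(ltW a_gt0) ?(ltW L0).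
    have h4 := ler_wpM2l k0 b3.
    have -> : a * (64 * q * B ^+ 4 / L) = 64 * (q * a / L) * B ^+ 4 by ring.
    apply: le_trans h4.
    have -> : 64 * (q * a / L) * B ^+ 3 = 2 * (B * (8 * q * a * B * B * (4 / L))) by ring.
    have -> : 2 * `|q * drift M a0 a1 T| * B * `|(a1 - a0)| * w ^+ 2 = 2 * (B * (`|q * drift M a0 a1 T| * `|(a1 - a0)| * w ^+ 2)) by ring.
    by rewrite ler_wpM2l.
  have z3 : (q * drift M a0 a1 T) ^+ 2 * B ^+ 2 / M%:R <= a * (64 * q ^+ 2 * B ^+ 4 / L).
    have h1 : (q * drift M a0 a1 T) ^+ 2 <= (8 * q * a * B) ^+ 2.
      rewrite -[leLHS]real_normK ?num_real// lerXn2r ?nnegrE//.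
      by rewrite !mulr_ge0 ?(ltW q0) ?(ltW a_gt0) ?(ltW B0).
    apply: (@le_trans _ _ ((8 * q * a * B) ^+ 2 * B ^+ 2 / T)).
      apply: ler_pM.
      - by apply: mulr_ge0; exact: sqr_ge0.
      - by rewrite invr_ge0 ltW.
      - by apply: ler_wpM2r => //; exact: sqr_ge0.
      - by rewrite lef_pV2 ?posrE// ltW.
    rewrite le_eqVlt; apply/orP; left; apply/eqP; rewrite TaL.
    by field; rewrite !gt_eqF.
  have z4 : 64 * q * B ^+ 4 / L + 64 * q ^+ 2 * B ^+ 4 / L <= 1.
    by rewrite -mulrDl ler_pdivrMr//; clear - Lq2; lra.
  have z5 : - (16 * B ^+ 2) <= E.
    have h1 : `|2 * pi * ((a1 - a0) / (sin a1 * cos a1)) * sin a1 ^+ 2| <= 8 * B ^+ 2.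
      by rewrite normrM (ger0_norm b0); apply: le_trans ppi; rewrite ler_piMr.
    have h2 : 2 * pi * (a1 - a0) ^+ 2 <= 8 * B ^+ 2.
      by apply: ler_pM => //; [rewrite mulr_ge0 ?(ltW p0)|exact: sqr_ge0|clear - p4; lra].
    move: h1; rewrite ler_norml => /andP[h1 _].
    have -> : E = 2 * pi * ((a1 - a0) / (sin a1 * cos a1)) * sin a1 ^+ 2 - 2 * pi * (a1 - a0) ^+ 2 by rewrite /E; ring.
    clear - h1 h2; lra.
  have z6 : a * (8 * B ^+ 2 - q * e / 4 + (64 * q * B ^+ 4 / L + 64 * q ^+ 2 * B ^+ 4 / L)) <= a * (E + 3 * e / 4).
    by rewrite ler_wpM2l ?(ltW a_gt0)// qE; clear - z4 z5 e0; lra.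
  clear - z1 z2 z3 z6; lra.
(* The last quarter of [e] absorbs the factor 2 of a sum of two exponentials. *)
have ae : 2 <= expR (a * (e / 4)).
  apply: le_trans (expR_ge1Dx _).
  have : L / 2 * (e / 4) <= a * (e / 4) by rewrite ler_wpM2r ?La2// ltW// divr_gt0.
  clear - Le; lra.
have -> : expR (a * (E + e)) = expR (a * (e / 4)) * expR (a * (E + 3 * e / 4)) by rewrite -expRD; congr expR; field.
apply: (@le_trans _ _ (2 * expR (a * (E + 3 * e / 4)))); last by rewrite ler_wpM2r ?expR_ge0.
have -> : 2 * expR (a * (E + 3 * e / 4)) = expR (a * (E + 3 * e / 4)) + expR (a * (E + 3 * e / 4)) by ring.
by apply: lerD; rewrite -?expRD ler_expR.
Qed.

(** * Large deviations *)

Section Angles.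
Variable R : realType.
Implicit Types c x y z a b beta : R.

Lemma sin_le x y : - (pi / 2) <= x -> x <= y -> y <= pi / 2 -> sin x <= sin y.
Proof.
move=> x0 xy y1; rewrite leNgt ltr_sin -?leNgt// in_itv/=; apply/andP; split=> //.
  exact: le_trans xy.
exact: le_trans y1.
Qed.

Lemma cos_le x y : 0 <= x -> x <= y -> y <= pi -> cos y <= cos x.
Proof.
move=> x0 xy y1; rewrite leNgt ltr_cos -?leNgt// in_itv/=; apply/andP; split=> //.
  exact: le_trans xy.
exact: le_trans y1.
Qed.

(** Strict decrease of [sin x / x] on []0, pi[]. With [y = x + h] it reduces to [x cos x <= sin x],
    [sin h <= h] and [cos h < 1]; beyond [pi / 2] the cosine of [x] is nonpositive instead. *)
Lemma sin_chord x y : 0 < x -> x < y -> y < pi -> x * sin y < y * sin x.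
Proof.
move=> x0 xy yp; pose h := y - x.
have h0 : 0 < h by rewrite /h; lra.
have hp : h < pi by rewrite /h; lra.
have -> : y = x + h by rewrite /h; ring.
clearbody h; rewrite sinD.
have sx : 0 < sin x by apply: sin_gt0_pi; apply/andP; split; lra.
have sh : 0 < sin h by apply: sin_gt0_pi; apply/andP; split.
have c1 : cos h < 1.
  by rewrite -(@cos0 R) ltr_cos ?in_itv/=; lra.
have shh : sin h <= h by have := norm_sin_le h; rewrite !gtr0_norm.
have t1 : x * (sin x * cos h) < x * sin x by rewrite ltr_pM2l// gtr_pMr.
have t2 : x * (cos x * sin h) <= h * sin x.
  have [x1|/ltW x1] := leP x (pi / 2).
    have := @xcos_le_sin R x; rewrite (ltW x0) x1 => /(_ isT) xc.
    apply: (@le_trans _ _ (sin x * sin h)); first by rewrite mulrA ler_wpM2r// ltW.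
    by rewrite mulrC ler_wpM2r// ltW.
  have cx : cos x <= 0.
    by rewrite -(@cos_pihalf R); have p0 := @pi_gt0 R; apply: cos_le; lra.
  apply: (@le_trans _ _ 0); last by rewrite mulr_ge0 ?ltW.
  by rewrite mulrCA mulr_le0_ge0// mulr_ge0 ?ltW.
by rewrite mulrDr mulrDl; lra.
Qed.

(** [(x - c) / sin x] is increasing: the inequality combines, with weights [pi - c] and [c],
    [sin_chord] at [x, y] and at the reflected points [pi - y, pi - x]. *)
Lemma sin_chord_shift c x y : 0 < c -> c < pi -> 0 < x -> x < y -> y < pi ->
  (x - c) * sin y < (y - c) * sin x.
Proof.
move=> c0 cp x0 xy yp; have h := sin_chord x0 xy yp.
have := @sin_chord (pi - y) (pi - x); rewrite !subr_gt0 ltrD2l ltrN2 gtrBl x0 xy yp => /(_ isT isT isT).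
have sp z : sin (pi - z) = sin z by rewrite sinB sinpi cospi; ring.
rewrite !sp => h'; have p0 := @pi_gt0 R.
rewrite -subr_gt0 -(pmulr_rgt0 _ p0).
have -> : pi * ((y - c) * sin x - (x - c) * sin y) = (pi - c) * (y * sin x - x * sin y) +
   c * ((pi - x) * sin y - (pi - y) * sin x) by ring.
by rewrite addr_gt0// mulr_gt0 ?subr_gt0.
Qed.

(** The derivative of [cost a0 b] with respect to the density [sin^2 b], that is [4 pi (b - a0)]
    divided by [2 sin b cos b]. *)
Definition dual_tilt (a0 b : R) := 2 * pi * (b - a0) / (sin b * cos b).
Definition cost (a0 b : R) := 2 * pi * (b - a0) ^+ 2.

Lemma angle_sin_gt0 b : 0 < b < pi / 2 -> 0 < sin b.
Proof. exact: sin_gt0_pihalf. Qed.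

Lemma angle_cos_gt0 b : 0 < b < pi / 2 -> 0 < cos b.
Proof. by move=> /andP[b0 b1]; apply: cos_gt0_pihalf; apply/andP; split=> //; lra. Qed.

(** [dual_tilt a0 b] is [2 pi (z - c) / sin z] at [z = 2 b], [c = 2 a0]. *)
Lemma tilt_lt (a0 x y : R) : 0 < a0 < pi / 2 -> 0 < x < pi / 2 -> 0 < y < pi / 2 -> x < y ->
  dual_tilt a0 x < dual_tilt a0 y.
Proof.
move=> ha hx hy xy; have p0 := @pi_gt0 R.
have sx := angle_sin_gt0 hx; have sy := angle_sin_gt0 hy.
have cx := angle_cos_gt0 hx; have cy := angle_cos_gt0 hy.
have : (2 * x - 2 * a0) * sin (2 * y) < (2 * y - 2 * a0) * sin (2 * x).
  by apply: sin_chord_shift; move: ha hx hy => /andP[? ?] /andP[? ?] /andP[? ?]; lra.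
have s2 (z : R) : sin (2 * z) = 2 * (sin z * cos z).
  by rewrite mulr_natl sin_mulr2n mulr2n; ring.
rewrite !s2 => h.
rewrite /dual_tilt ltr_pdivrMr ?mulr_gt0// [ltRHS]mulrAC ltr_pdivlMr ?mulr_gt0//.
rewrite -!mulrA ltr_pM2l// ltr_pM2l//; lra.
Qed.

Lemma angle_bounds (a0 a1 : R) : 0 < a0 < pi / 2 -> 0 < a1 < pi / 2 -> exists B,
  [/\ 1 <= B, `|a1 - a0| <= B & forall z, Num.min a0 a1 <= z <= Num.max a0 a1 ->
  [/\ 0 < sin z, 0 < cos z & 1 <= B * (sin z * cos z)]].
Proof.
move=> h0 h1; have p0 := @pi_gt0 R.
pose l := Num.min a0 a1; pose u := Num.max a0 a1.
have hl : 0 < l < pi / 2 by rewrite /l minElt; case: ifP.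
have hu : 0 < u < pi / 2 by rewrite /u maxElt; case: ifP.
have sl := angle_sin_gt0 hl; have cu := angle_cos_gt0 hu.
have i0 : 0 < (sin l * cos u)^-1 by rewrite invr_gt0 mulr_gt0.
exists (1 + `|a1 - a0| + (sin l * cos u)^-1); have n0 := normr_ge0 (a1 - a0).
split=> [||z /andP[]]; [lra|lra|rewrite -/l -/u => lz zu].
have hz : 0 < z < pi / 2 by move: hl hu => /andP[? ?] /andP[? ?]; apply/andP; split; lra.
have sz := angle_sin_gt0 hz; have cz := angle_cos_gt0 hz.
split=> //.
have slz : sin l <= sin z.
  by move: hl hz => /andP[? ?] /andP[? ?]; apply: sin_le; lra.
have czu : cos u <= cos z.
  by move: hu hz => /andP[? ?] /andP[? ?]; apply: cos_le; lra.
apply: (@le_trans _ _ ((sin l * cos u)^-1 * (sin z * cos z))).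
  by rewrite ler_pdivlMl ?mulr_gt0// mulr1 ler_pM// ltW.
by rewrite ler_wpM2r ?mulr_ge0 ?(ltW sz) ?(ltW cz)//; lra.
Qed.

(** The angle in [[0, pi / 2]] whose squared sine is [beta]. The arcsine of [2 beta - 1] is twice
    this angle minus [pi / 2], so the prefactor [pi / 2] of [rate] becomes the [2 pi] of [cost]. *)
Definition half_angle beta := (asin (2 * beta - 1) + pi / 2) / 2.

Lemma half_angle_itv beta : 0 <= beta <= 1 -> 0 <= half_angle beta <= pi / 2.
Proof.
move=> /andP[b0 b1]; have hb : -1 <= 2 * beta - 1 <= 1 by apply/andP; split; lra.
have := asin_geNpi2 hb; have := asin_lepi2 hb; rewrite /half_angle => h1 h2.
by apply/andP; split; lra.
Qed.

Lemma half_angle_itv_oo beta : 0 < beta < 1 -> 0 < half_angle beta < pi / 2.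
Proof.
move=> /andP[b0 b1].
have h1 : asin (2 * beta - 1) < pi / 2 by apply: asin_ltpi2; apply/andP; split; lra.
have h2 : - (pi / 2) < asin (2 * beta - 1) by apply: asin_gtNpi2; apply/andP; split; lra.
by rewrite /half_angle; apply/andP; split; lra.
Qed.

Lemma sin_half_angle beta : 0 <= beta <= 1 -> sin (half_angle beta) ^+ 2 = beta.
Proof.
move=> /andP[b0 b1].
have s : sin (asin (2 * beta - 1)) = 2 * beta - 1 by rewrite asinK// in_itv/=; apply/andP; split; lra.
have : cos (half_angle beta *+ 2) = 1 - 2 * beta.
  have -> : half_angle beta *+ 2 = asin (2 * beta - 1) + pi / 2 by rewrite /half_angle -mulr_natr; field.
  by rewrite cosDpihalf s; ring.
by rewrite cos_mulr2n -[_ *+ 2]mulr_natr; have := cos2Dsin2 (half_angle beta); lra.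
Qed.

Lemma rate_half_angle (alpha beta : R) : rate alpha beta = cost (half_angle alpha) (half_angle beta).
Proof. by rewrite /rate /cost /half_angle; field. Qed.

Lemma sin_sqr_le_angle x y : 0 <= x <= pi / 2 -> 0 <= y <= pi / 2 -> x <= y -> sin x ^+ 2 <= sin y ^+ 2.
Proof.
move=> /andP[x0 x1] /andP[y0 y1] xy.
have sx : 0 <= sin x by apply: sin_ge0_pi; apply/andP; split; lra.
have sy : 0 <= sin y by apply: sin_ge0_pi; apply/andP; split; lra.
by rewrite ler_sqr ?nnegrE//; apply: sin_le => //; lra.
Qed.

End Angles.

Lemma le_of_sum_le (R : realType) (l c1 c2 c3 c4 c5 : R) :
  0 < c1 -> 0 < c2 -> 0 < c3 -> 0 < c4 -> 0 < c5 -> 1 + (c1 + c2 + c3 + c4 + c5) <= l ->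
  [/\ 1 <= l, c1 <= l, c2 <= l & [/\ c3 <= l, c4 <= l & c5 <= l]].
Proof. by move=> *; split; [lra|lra|lra|split; lra]. Qed.

(** * Asymptotics of the exponential moments *)

Section MgfAsymptotics.
Variables (R : realType) (a0 : R) (P : R -> probability (path_space R) R).
Hypothesis h0 : 0 < a0 < pi / 2.
Hypothesis hP : forall T : R, 1 < T -> ssep_law T (sin a0 ^+ 2) (P T).
Local Notation occ := (@occupation_time R).
Local Notation mgf T t := (Ex (P T) (fun x : path_space R => expR (t * (T / ln T) * occ x))).

Lemma near_ln (c : R) : \forall T \near +oo%R, 1 < T /\ c <= ln T.
Proof.
exists (expR `|c|); split; first exact: num_real.
move=> T hT; have h1 : 1 <= expR `|c| by rewrite -expR0 ler_expR.
have T1 : 1 < T by apply: le_lt_trans hT.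
split=> //; apply: le_trans (ler_norm c) _.
by rewrite -[leLHS]expRK ler_ln ?posrE ?expR_gt0 ?(ltW hT)//; lra.
Qed.

(** [om] is an upper bound to be imposed on [w], and [c1], ..., [c5] are the lower bounds that
    [mgf_upper_scaled] asks of [ln T] once the corrector, [om] and [q] are fixed. *)
Lemma mgf_upper (b e : R) : 0 < b < pi / 2 -> 0 < e -> \forall T \near +oo%R,
  mgf T (dual_tilt a0 b) <= expR (T / ln T * (dual_tilt a0 b * sin b ^+ 2 - cost a0 b + e)).
Proof.
move=> hb e0; have [B [B1 DB HB]] := angle_bounds h0 hb.
have Bn n : 0 < B ^+ n by rewrite exprn_gt0//; lra.
pose eps := e / (128 * B ^+ 4).
have num n : 0 < n.+1%:R :> R by rewrite ltr0n.
have eps0 : 0 < eps by exact: divr_gt0 e0 (mulr_gt0 (num 127) (Bn 4)).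
have epsB : 128 * eps * B ^+ 4 = e.
  have nz : 128 * B ^+ 4 != 0 := lt0r_neq0 (mulr_gt0 (num 127) (Bn 4)).
  by rewrite mulrAC [LHS]mulrC /eps (divfK nz).
clearbody eps.
have [g [Mc hg]] : exists (g : 'I_2 -> site -> R) (Mc : 'I_2 -> nat), forall i,
    [/\ fsupp (g i), forall z, g i (- z) = g i z &
    lsum (fun z => `|pair_kernel (g i) z - (nbrk R i z - srw2 R (Mc i).*2 z)|) <= eps].
  have [g hg] := choice (fun i => corrector i eps0); have [Mc hMc] := choice hg.
  by exists g, Mc.
pose N := 1 + norm1 (g ord0) + norm1 (g ord_max).
have n0 i : 0 <= norm1 (g i) by exact: norm1_ge0.
have N1 : 1 <= N by rewrite /N; have := n0 ord0; have := n0 ord_max; lra.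
have gN i : norm1 (g i) <= N.
  rewrite /N; have := n0 ord0; have := n0 ord_max.
  case: (eqVneq i ord0) => [->|i0]; first lra.
  suff -> : i = ord_max by lra.
  by apply/val_inj; case: i i0 => [[|[|]]].
clearbody N; have N0 : 0 < N by lra.
pose om := Num.min (128 * N * B ^+ 4)^-1 (e / (4800 * 100 * N ^+ 2 * B ^+ 8)).
have den1 : 0 < 128 * N * B ^+ 4 by exact: mulr_gt0 (mulr_gt0 (num 127) N0) (Bn 4).
have N2 : 0 < N ^+ 2 by rewrite exprn_gt0.
have den2 : 0 < 4800 * 100 * N ^+ 2 * B ^+ 8.
  by apply: mulr_gt0 (Bn 8); apply: mulr_gt0 N2; lra.
have om0 : 0 < om by rewrite /om lt_min invr_gt0 den1 divr_gt0.
have om1 : 128 * N * B ^+ 4 * om <= 1.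
  by rewrite -ler_pdivlMl// mulr1 ge_min lexx.
have om2 : 4800 * 100 * N ^+ 2 * B ^+ 8 * om <= e.
  by rewrite mulrC -ler_pdivlMr// ge_min lexx orbT.
pose q := 4 * (24 * B ^+ 2 + 1) / e.
have qB : 0 < 24 * B ^+ 2 + 1 by apply: addr_gt0 => //; apply: mulr_gt0 (Bn 2).
have q0 : 0 < q by rewrite divr_gt0// mulr_gt0.
clearbody om.
pose c1 := 4 / om ^+ 2; pose c2 := 9 * 100 * B ^+ 2 / e; pose c3 := 8 * q * B ^+ 2.
pose c4 := 64 * (q + q ^+ 2) * B ^+ 4; pose c5 := 8 / e.
have p1 : 0 < c1 by rewrite divr_gt0// exprn_gt0.
have p2 : 0 < c2 by rewrite divr_gt0// mulr_gt0// mulr_gt0.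
have p3 : 0 < c3 by rewrite mulr_gt0// mulr_gt0.
have p4 : 0 < c4 by rewrite mulr_gt0// mulr_gt0// addr_gt0// exprn_gt0.
have p5 : 0 < c5 by rewrite divr_gt0.
near=> T; have [T1 hL] : 1 < T /\ 1 + (c1 + c2 + c3 + c4 + c5) <= ln T.
  by near: T; exact: near_ln.
have [l0 l1 l2 [l3 l4 l5]] := le_of_sum_le p1 p2 p3 p4 p5 hL.
have := mgf_upper_scaled (B := B) (L := ln T) (a := T / ln T) (g := g) (Mc := Mc) (N := N) (eps := eps) (om := om) (q := q) (P := P T) (e := e).
apply => //.
- exact: hP.
- by move=> i; case: (hg i).
- by move=> i; case: (hg i).
- by move=> i; case: (hg i).
- by rewrite divfK// gt_eqF.
- by rewrite -ler_pdivrMr ?exprn_gt0.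
- by rewrite -ler_pdivrMr.
- by rewrite -ler_pdivrMr.
Unshelve. all: by end_near.
Qed.

Lemma mgf_lower (b t e : R) : 0 < b < pi / 2 -> 0 < e -> \forall T \near +oo%R,
  expR (T / ln T * (t * sin b ^+ 2 - cost a0 b - e)) <= mgf T t.
Proof.
move=> hb e0; have [B [B1 DB HB]] := angle_bounds h0 hb.
have B2 : 0 < B ^+ 2 by rewrite exprn_gt0//; lra.
have e2 : 0 < e ^+ 2 by rewrite exprn_gt0.
pose c1 := 4 * (32 * B ^+ 2 + 2 * e) ^+ 2 / e ^+ 2; pose c2 := 128 * B ^+ 2 / e.
have p0 : 0 < 32 * B ^+ 2 + 2 * e by lra.
have p1 : 0 < c1 by rewrite divr_gt0// mulr_gt0// exprn_gt0.
have p2 : 0 < c2 by apply: divr_gt0 e0; apply: mulr_gt0 B2; rewrite ltr0n.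
near=> T; have [T1 hL] : 1 < T /\ 2 + (c1 + c2) <= ln T by near: T; exact: near_ln.
have ha := half_ln_le (erefl (ln T)) T1 (erefl (T / ln T)).
apply: (mgf_lower_scaled B1 HB DB (erefl (ln T)) T1 (erefl (T / ln T)) t (hP T1) e0).
- by clearbody c1 c2; lra.
- by rewrite -ler_pdivrMr// -/c1; clearbody c1 c2; lra.
- by rewrite -ler_pdivrMr// -/c2; clearbody c1 c2; lra.
- by apply: le_trans ha; clearbody c1 c2; lra.
Unshelve. all: by end_near.
Qed.

End MgfAsymptotics.

(** * Chebyshev bounds and exponential tilting *)

Section LocalEstimates.
Variables (R : realType) (a0 : R) (P : R -> probability (path_space R) R).
Hypothesis h0 : 0 < a0 < pi / 2.
Hypothesis hP : forall T : R, 1 < T -> ssep_law T (sin a0 ^+ 2) (P T).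
Local Notation occ := (@occupation_time R).
Local Notation Om := (path_space R).
Implicit Types (A : set Om) (b c e m r t T : R).

Lemma bounded_rv_mgf T t : 1 < T -> bounded_rv (fun x : Om => expR (t * occ x)).
Proof.
move=> T1; apply: bounded_rv_expR; apply: bounded_rv_mul; first exact: bounded_rv_cst.
split; first exact: measurable_occ (hP T1).
by exists 1 => x; have /andP[x0 x1] := occ01 x; rewrite ger0_norm.
Qed.

Lemma measurable_occ_preimage (B : set R) : measurable B -> measurable ([set x | B (occ x)] : set Om).
Proof.
move=> mB; have T1 : 1 < 2 :> R by lra.
by have := measurable_occ (hP T1) measurableT mB; rewrite setTI.
Qed.

Lemma speed_gt0 T : 1 < T -> 0 < T / ln T.
Proof. by move=> T1; rewrite divr_gt0 ?ln_gt0//; lra. Qed.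

(** On [A] the tilted exponent is at least its value at the density [sin^2 b]; subtracting that
    value from the exponential moment leaves the cost alone. *)
Lemma chernoff b e A : 0 < b < pi / 2 -> 0 < e -> measurable A ->
  (forall x, A x -> 0 <= dual_tilt a0 b * (occ x - sin b ^+ 2)) ->
  \forall T \near +oo%R, Ex (P T) \1_A <= expR (T / ln T * (e - cost a0 b)).
Proof.
move=> hb e0 mA hA; near=> T.
have [T1 _] : 1 < T /\ 1 <= ln T by near: T; exact: near_ln.
have U : Ex (P T) (fun x : Om => expR (dual_tilt a0 b * (T / ln T) * occ x)) <=
    expR (T / ln T * (dual_tilt a0 b * sin b ^+ 2 - cost a0 b + e)).
  by near: T; exact: mgf_upper.
have s0 := speed_gt0 T1; set s := T / ln T in U s0 *.
have bY : bounded_rv (fun x : Om => expR (dual_tilt a0 b * s * occ x)) by exact: bounded_rv_mgf T1.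
apply: (@le_trans _ _ (Ex (P T) (fun x : Om => expR (- (s * (dual_tilt a0 b * sin b ^+ 2))) * expR (dual_tilt a0 b * s * occ x)))).
  apply: Ex_le; [exact: bounded_rv_indic|by apply: bounded_rv_mul => //; exact: bounded_rv_cst|move=> x].
  rewrite indicE; case: (boolP (x \in A)) => [|_]; last by rewrite mulr_ge0 ?expR_ge0.
  rewrite inE => /hA h; rewrite -expRD -[leLHS]expR0 ler_expR.
  have := mulr_ge0 (ltW s0) h; lra.
rewrite Ex_scale//; apply: (le_trans (ler_wpM2l (expR_ge0 _) U)).
by rewrite -expRD ler_expR; lra.
Unshelve. all: by end_near.
Qed.

Lemma far_angle_cover c e : c != a0 -> 0 < e -> exists S : set Om, [/\ measurable S,
  forall x, 0 <= (c - a0) * (half_angle (occ x) - c) -> S x &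
  \forall T \near +oo%R, Ex (P T) \1_S <= expR (T / ln T * (e - cost a0 c))].
Proof.
move=> ca e0; have p0 := @pi_gt0 R.
have C0 : 0 < cost a0 c.
  have p2 : 0 < 2 * pi :> R by lra.
  by rewrite /cost pmulr_rgt0// exprn_even_gt0//= subr_eq0.
(* The loss [(1 - k^2) cost a0 c <= 2 (1 - k) cost a0 c] is at most [e / 2]. *)
pose k := 1 - e / (4 * cost a0 c + e).
have d0 : 0 < 4 * cost a0 c + e by lra.
have ke : (1 - k) * (4 * cost a0 c + e) = e by rewrite /k; field; rewrite gt_eqF.
have k1 : k < 1 by rewrite /k gtrBl divr_gt0.
have k0 : 0 < k by rewrite /k subr_gt0 ltr_pdivrMr//; lra.
pose b := a0 + k * (c - a0).
have cb : cost a0 b = k ^+ 2 * cost a0 c by rewrite /cost /b; ring.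
have cb2 : cost a0 c - e / 2 <= cost a0 b.
  rewrite cb; have := mulr_ge0 (sqr_ge0 (1 - k)) (ltW C0).
  have := mulr_gt0 (_ : 0 < 1 - k) e0; rewrite subr_gt0 => /(_ k1); move: (cost a0 c) C0 ke => C C0 ke.
  by rewrite sqrrB expr1n mul1r; lra.
clearbody k; have cc : c - b = (1 - k) * (c - a0) by rewrite /b; ring.
have ba : b - a0 = k * (c - a0) by rewrite /b; ring.
clearbody b; case: (boolP (0 < b < pi / 2)) => hb; last first.
  exists set0; split=> //; last first.
    by near=> T; rewrite indic0 Ex_cst expR_ge0.
  move=> x; have := half_angle_itv (occ01 x) => /andP[x0 x1] h; exfalso.
  move: hb h0; rewrite negb_and -!leNgt => hb /andP[a00 a01].
  have [ac|ca'|E] := ltgtP a0 c; last by rewrite E eqxx in ca.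
    have : c <= half_angle (occ x) by move: h; rewrite pmulr_rge0 ?subr_ge0// subr_gt0.
    have := mulr_gt0 (_ : 0 < 1 - k) (_ : 0 < c - a0); rewrite !subr_gt0 -cc => /(_ k1 ac).
    have := mulr_gt0 k0 (_ : 0 < c - a0); rewrite subr_gt0 -ba => /(_ ac).
    by case/orP: hb => hb; lra.
  have : half_angle (occ x) <= c by move: h; rewrite nmulr_rge0 ?subr_le0// subr_lt0.
  have := mulr_gt0 (_ : 0 < 1 - k) (_ : 0 < a0 - c); rewrite !subr_gt0 => /(_ k1 ca').
  have := mulr_gt0 k0 (_ : 0 < a0 - c); rewrite subr_gt0 => /(_ ca').
  by case/orP: hb => hb; lra.
have mS : measurable ([set x | 0 <= dual_tilt a0 b * (occ x - sin b ^+ 2)] : set Om).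
  apply: (measurable_occ_preimage (B := [set y | 0 <= dual_tilt a0 b * (y - sin b ^+ 2)])).
  have -> : [set y | 0 <= dual_tilt a0 b * (y - sin b ^+ 2)] = (fun y => dual_tilt a0 b * (y - sin b ^+ 2)) @^-1` `[0, +oo[%classic.
    by apply/seteqP; split => y /=; rewrite in_itv/= andbT.
  rewrite -[X in measurable X]setTI.
  apply: (_ : measurable_fun setT (fun y : R => dual_tilt a0 b * (y - sin b ^+ 2))) => //.
  by apply: measurable_funM; [exact: measurable_cst|apply: measurable_funB => //; exact: measurable_cst].
exists [set x | 0 <= dual_tilt a0 b * (occ x - sin b ^+ 2)]; split.
- exact: mS.
- move=> x /= h.
  have tb : dual_tilt a0 b = 2 * pi / (sin b * cos b) * (b - a0) by rewrite /dual_tilt mulrAC.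
  have w0 : 0 < 2 * pi / (sin b * cos b).
    by rewrite divr_gt0 ?mulr_gt0// ?angle_sin_gt0 ?angle_cos_gt0.
  rewrite tb -mulrA pmulr_rge0// ba -mulrA pmulr_rge0//.
  have hx := half_angle_itv (occ01 x); have sx := sin_half_angle (occ01 x); rewrite -{1}sx.
  have hb' : 0 <= b <= pi / 2 by case/andP: hb => ? ?; apply/andP; split; lra.
  have [ac|ca'|E] := ltgtP a0 c; last by rewrite E eqxx in ca.
    rewrite pmulr_rge0 ?subr_gt0// subr_ge0 sin_sqr_le_angle//.
    have : c <= half_angle (occ x) by move: h; rewrite pmulr_rge0 ?subr_ge0// subr_gt0.
    have := mulr_gt0 (_ : 0 < 1 - k) (_ : 0 < c - a0); rewrite !subr_gt0 -cc => /(_ k1 ac); lra.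
  rewrite nmulr_rge0 ?subr_lt0// subr_le0 sin_sqr_le_angle//.
  have : half_angle (occ x) <= c by move: h; rewrite nmulr_rge0 ?subr_le0// subr_lt0.
  have := mulr_gt0 (_ : 0 < 1 - k) (_ : 0 < a0 - c); rewrite !subr_gt0 => /(_ k1 ca'); lra.
- have e2 : 0 < e / 2 by lra.
  near=> T; apply: (@le_trans _ _ (expR (T / ln T * (e / 2 - cost a0 b)))).
    by near: T; exact: (chernoff hb e2 mS (fun x h => h)).
  have [T1 _] : 1 < T /\ 1 <= ln T by near: T; exact: near_ln.
  by rewrite ler_expR ler_pM2l ?speed_gt0//; lra.
Unshelve. all: by end_near.
Qed.

(** In the angle the cost is a multiple of the squared distance to [a0], so [A] lies in two
    half-lines at distance [rho] from [a0]; each contributes one exponential, hence the factor 2. *)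
Lemma ldp_upper A m e : measurable A -> 0 <= m -> 0 < e ->
  (forall x, A x -> m <= cost a0 (half_angle (occ x))) ->
  \forall T \near +oo%R, Ex (P T) \1_A <= 2 * expR (T / ln T * (e - m)).
Proof.
move=> mA m0 e0 hA; have p0 := @pi_gt0 R.
pose rho := Num.sqrt (m / (2 * pi)).
have rho2 : 2 * pi * rho ^+ 2 = m.
  rewrite /rho sqr_sqrtr; last by rewrite divr_ge0// ?mulr_ge0 ?pi_ge0.
  by rewrite mulrC divfK// gt_eqF//; lra.
have rho0 : 0 <= rho by rewrite sqrtr_ge0.
clearbody rho; move: rho0; rewrite le_eqVlt => /predU1P[r0|r0].
  near=> T; have [T1 _] : 1 < T /\ 1 <= ln T by near: T; exact: near_ln.
  apply: (@le_trans _ _ 1).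
    rewrite -(Ex_cst (P T) 1); apply: Ex_le; [exact: bounded_rv_indic|exact: bounded_rv_cst|move=> x].
    by rewrite indicE; case: (_ \in _).
  have m00 : m = 0 by rewrite -rho2 -r0 expr0n mulr0.
  have : 1 <= expR (T / ln T * (e - m)).
    by rewrite -expR0 ler_expR mulr_ge0 ?(ltW (speed_gt0 T1))// m00; lra.
  lra.
have [|S1 [mS1 cS1 hS1]] := @far_angle_cover (a0 + rho) e _ e0.
  by rewrite -subr_eq0 addrC addKr gt_eqF.
have [|S2 [mS2 cS2 hS2]] := @far_angle_cover (a0 - rho) e _ e0.
  by rewrite -subr_eq0 addrC addKr oppr_eq0 gt_eqF.
have C1 : cost a0 (a0 + rho) = m by rewrite -rho2 /cost; ring.
have C2 : cost a0 (a0 - rho) = m by rewrite -rho2 /cost; ring.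
rewrite C1 in hS1; rewrite C2 in hS2.
near=> T.
apply: (@le_trans _ _ (Ex (P T) (fun x => \1_S1 x + \1_S2 x))).
  apply: Ex_le; [exact: bounded_rv_indic|by apply: bounded_rv_add; exact: bounded_rv_indic|move=> x].
  rewrite !indicE; case: (boolP (x \in A)) => [|_]; last exact: addr_ge0.
  rewrite inE => /hA; rewrite -rho2 /cost ler_pM2l ?mulr_gt0// => h.
  have [h1|h1] := leP a0 (half_angle (occ x)).
    have : rho <= half_angle (occ x) - a0 by rewrite -ler_sqr ?nnegrE ?subr_ge0// ltW.
    move=> h2; have /cS1 hx : 0 <= (a0 + rho - a0) * (half_angle (occ x) - (a0 + rho)).
      by rewrite mulr_ge0; lra.
    by rewrite (mem_set hx) lerDl.
  have : rho <= a0 - half_angle (occ x).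
    rewrite -ler_sqr ?nnegrE ?subr_ge0 ?(ltW h1) ?(ltW r0)//.
    by rewrite -[(a0 - _) ^+ 2]sqrrN opprB.
  move=> h2; have /cS2 hx : 0 <= (a0 - rho - a0) * (half_angle (occ x) - (a0 - rho)).
    by rewrite mulr_le0; lra.
  by rewrite (mem_set hx) lerDr.
rewrite Ex_add; [|exact: bounded_rv_indic|exact: bounded_rv_indic].
rewrite mulr_natl mulr2n; apply: lerD; [near: T; exact: hS1|near: T; exact: hS2].
Unshelve. all: by end_near.
Qed.

Lemma tilt_split (a t t1 t2 be r y : R) : 0 < a -> t < t1 -> t2 < t ->
  expR (t * a * y) <= expR (a * (t * be + `|t| * r)) * (`|y - be| < r)%R%:R +
   (expR (a * - ((t1 - t) * (be + r))) * expR (t1 * a * y) +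
    expR (a * ((t - t2) * (be - r))) * expR (t2 * a * y)).
Proof.
move=> a_gt0 tt1 tt2; have [yr|ry] := ltP `|y - be| r.
  rewrite mulr1 -[leLHS]addr0 lerD ?addr_ge0 ?mulr_ge0 ?expR_ge0// ler_expR.
  rewrite -[t * a]mulrC -mulrA ler_pM2l//.
  have : t * (y - be) <= `|t| * r.
    by apply: le_trans (ler_norm _) _; rewrite normrM ler_wpM2l// ltW.
  by rewrite mulrBr; lra.
rewrite mulr0 add0r -!expRD.
have [h|h] : be + r <= y \/ y <= be - r by move: ry; rewrite ler_normr => /orP[]; lra.
  apply: (@le_trans _ _ (expR (a * - ((t1 - t) * (be + r)) + t1 * a * y))); last by rewrite lerDl expR_ge0.
  rewrite ler_expR -subr_ge0.
  have -> : a * - ((t1 - t) * (be + r)) + t1 * a * y - t * a * y = a * ((t1 - t) * (y - (be + r))) by ring.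
  by rewrite mulr_ge0 ?(ltW a_gt0)// mulr_ge0 ?subr_ge0// ltW.
apply: (@le_trans _ _ (expR (a * ((t - t2) * (be - r)) + t2 * a * y))); last by rewrite lerDr expR_ge0.
rewrite ler_expR -subr_ge0.
have -> : a * ((t - t2) * (be - r)) + t2 * a * y - t * a * y = a * ((t - t2) * (be - r - y)) by ring.
by rewrite mulr_ge0 ?(ltW a_gt0)// mulr_ge0 ?subr_ge0// ltW.
Qed.

(** Convex duality between [cost] and [dual_tilt], obtained without computation: the two sides are
    the exponents of a lower and of an upper bound for the same exponential moment. *)
Lemma tilt_dual b c : 0 < b < pi / 2 -> 0 < c < pi / 2 ->
  dual_tilt a0 b * sin c ^+ 2 - cost a0 c <= dual_tilt a0 b * sin b ^+ 2 - cost a0 b.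
Proof.
move=> hb hc; apply/ler_addgt0Pr => e e0; have e2 : 0 < e / 2 by lra.
have [T [T1 U L]] : exists T, [/\ 1 < T,
   Ex (P T) (fun x : Om => expR (dual_tilt a0 b * (T / ln T) * occ x)) <=
    expR (T / ln T * (dual_tilt a0 b * sin b ^+ 2 - cost a0 b + e / 2)) &
   expR (T / ln T * (dual_tilt a0 b * sin c ^+ 2 - cost a0 c - e / 2)) <=
   Ex (P T) (fun x : Om => expR (dual_tilt a0 b * (T / ln T) * occ x))].
  apply: (@filter_ex _ (nbhs +oo%R)); near=> T.
  have [T1 _] : 1 < T /\ 1 <= ln T by near: T; exact: near_ln.
  split=> //; first by near: T; exact: mgf_upper.
  by near: T; exact: mgf_lower.
move: (le_trans L U); rewrite ler_expR ler_pM2l ?speed_gt0//; lra.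
Unshelve. all: by end_near.
Qed.

Lemma sin_sqr_lip (x y : R) : `|sin x ^+ 2 - sin y ^+ 2| <= 2 * `|x - y|.
Proof.
have -> : sin x ^+ 2 - sin y ^+ 2 = (sin x + sin y) * (sin x - sin y) by ring.
rewrite normrM; apply: ler_pM => //; last exact: sin_lip.
by apply: le_trans (ler_normD _ _) _; have := sin_max x; have := sin_max y; lra.
Qed.

Lemma measurable_occ_ball c r : measurable ([set x : Om | `|occ x - c| < r]).
Proof.
apply: (measurable_occ_preimage (B := [set y | `|y - c| < r])).
have -> : [set y | `|y - c| < r] = `]c - r, c + r[%classic; last exact: measurable_itv.
by apply/seteqP; split => y /=; rewrite in_itv/= ltr_distl.
Qed.

Lemma expR_mulr_le (x y c : R) : c <= 1 + y -> expR x * c <= expR (x + y).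
Proof. by move=> h; rewrite expRD ler_wpM2l ?expR_ge0//; apply: le_trans h (expR_ge1Dx y). Qed.

(** The margin [k] pays [k / 4] for the slack in [q], [k / 4] for [d], and the factor 4 by
    [4 <= 1 + 3] and [a k >= 6]. *)
Lemma tilt_side_le (a x y V k d q : R) : 0 <= a -> 6 <= a * k -> d <= k / 4 ->
  a * (x + y) <= a * (V - k) -> q <= expR (a * (x + k / 4)) ->
  expR (a * y) * q <= expR (a * (V - d)) / 4.
Proof.
move=> a_ge0 ak dk h hq; have adk := ler_wpM2l a_ge0 dk.
rewrite ler_pdivlMr//; apply: (le_trans (ler_wpM2r _ (ler_wpM2l (expR_ge0 _) hq))) => //.
rewrite -expRD; apply: le_trans (@expR_mulr_le _ 3 _ _) _; first by rewrite -natr1 addrC.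
by rewrite ler_expR; lra.
Qed.

(** The two sides take away at most half of the exponential moment. The factor 2 costs 1 in the
    exponent, and [e] is shared in thirds by this, [d] and [m]. *)
Lemma tilt_main_le (a x z m e d p q1 q2 : R) : 0 <= a -> 3 <= a * e -> d <= e / 3 -> m <= e / 3 ->
  q1 <= expR (a * (x - z - d)) / 4 -> q2 <= expR (a * (x - z - d)) / 4 ->
  expR (a * (x - z - d)) <= expR (a * (x + m)) * p + (q1 + q2) ->
  expR (- (a * (z + e))) <= p.
Proof.
move=> a_ge0 ae de me h1 h2 h.
have main : expR (a * (x - z - d)) / 2 <= expR (a * (x + m)) * p by lra.
rewrite -(ler_pM2l (expR_gt0 (a * (x + m)))); apply: le_trans main.
rewrite -expRD ler_pdivlMr//; apply: le_trans (@expR_mulr_le _ 1 _ _) _; first lra.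
by rewrite ler_expR; have := ler_wpM2l a_ge0 me; have := ler_wpM2l a_ge0 de; lra.
Qed.

(** Under the tilt of [b] the occupation time concentrates at [sin^2 b]: comparison with the tilts
    of nearby angles [b2 < b < b1] shows that the complement of the ball carries an exponentially
    smaller part of the moment. Strict monotonicity of the tilt provides the margin. *)
Lemma ldp_lower b r e : 0 < b < pi / 2 -> 0 < r -> 0 < e ->
  \forall T \near +oo%R, expR (- (T / ln T * (cost a0 b + e))) <=
    Ex (P T) \1_[set x : Om | `|occ x - sin b ^+ 2| < r].
Proof.
move=> hb r0 e0; pose t := dual_tilt a0 b.
(* Shrinking the ball only lowers its probability; [|t| r] bounds the variation of the tilted
   exponent inside it. *)
wlog rt : r r0 / `|t| * r <= e / 3.
  move=> H; pose r' := Num.min r (e / 3 / (1 + `|t|)).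
  have t0 := normr_ge0 t.
  have r'0 : 0 < r' by rewrite /r' lt_min r0 divr_gt0//; lra.
  have r't : `|t| * r' <= e / 3.
    apply: (@le_trans _ _ ((1 + `|t|) * r')); first by rewrite ler_wpM2r ?(ltW r'0)//; lra.
    by rewrite -ler_pdivlMl; [rewrite mulrC ge_min lexx orbT|lra].
  have r'r : r' <= r by rewrite ge_min lexx.
  have m (q : R) : measurable ([set x : Om | `|occ x - sin b ^+ 2| < q]) by exact: measurable_occ_ball.
  near=> T; apply: (@le_trans _ _ (Ex (P T) \1_[set x : Om | `|occ x - sin b ^+ 2| < r'])); first by near: T; exact: H.
  apply: Ex_le; [exact: bounded_rv_indic|exact: bounded_rv_indic|move=> x].
  rewrite !indicE ler_nat; case: (boolP (x \in _)) => //; rewrite inE /= => h.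
  by rewrite mem_set//=; exact: lt_le_trans r'r.
pose be := sin b ^+ 2.
have [b1 [hb1 bb1 be1]] : exists b1, [/\ 0 < b1 < pi / 2, b < b1 & sin b1 ^+ 2 - be <= r / 2].
  (* [sin^2] is 2-Lipschitz, so a step of [r / 4] moves the density by at most [r / 2]; the other
     entry keeps the angle below [pi / 2]. *)
  pose h := Num.min (r / 4) ((pi / 2 - b) / 2); case/andP: hb => b0 b1.
  have hh1 : h <= r / 4 by rewrite ge_min lexx.
  have hh2 : h <= (pi / 2 - b) / 2 by rewrite ge_min lexx orbT.
  have h_gt0 : 0 < h by rewrite lt_min; apply/andP; split; lra.
  exists (b + h); split; [apply/andP; split; lra|lra|].
  apply: le_trans (ler_norm _) _; apply: le_trans (sin_sqr_lip _ _) _.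
  by rewrite addrAC subrr add0r gtr0_norm//; lra.
have [b2 [hb2 bb2 be2]] : exists b2, [/\ 0 < b2 < pi / 2, b2 < b & be - sin b2 ^+ 2 <= r / 2].
  pose h := Num.min (r / 4) (b / 2); case/andP: hb => b0 b1'.
  have hh1 : h <= r / 4 by rewrite ge_min lexx.
  have hh2 : h <= b / 2 by rewrite ge_min lexx orbT.
  have h_gt0 : 0 < h by rewrite lt_min; apply/andP; split; lra.
  exists (b - h); split; [apply/andP; split; lra|lra|].
  apply: le_trans (ler_norm _) _; apply: le_trans (sin_sqr_lip _ _) _.
  by rewrite opprB addrC subrK gtr0_norm//; lra.
pose t1 := dual_tilt a0 b1; pose t2 := dual_tilt a0 b2.
have tt1 : t < t1 by exact: tilt_lt.
have tt2 : t2 < t by exact: tilt_lt.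
pose V := t * be - cost a0 b.
have d1 := tilt_dual hb hb1; have d2 := tilt_dual hb hb2.
rewrite -/t -/be -/V in d1 d2.
(* Half of the radius is left after the shift to [b1] or [b2]; times the increment of the tilt it is
   the amount by which both side exponents stay below [V]. *)
pose k := Num.min ((t1 - t) * (r / 2)) ((t - t2) * (r / 2)).
have k0 : 0 < k by rewrite lt_min !mulr_gt0 ?subr_gt0 ?divr_gt0.
have k1 : k <= (t1 - t) * (r / 2) by rewrite ge_min lexx.
have k2 : k <= (t - t2) * (r / 2) by rewrite ge_min lexx orbT.
have f1 : t1 * sin b1 ^+ 2 - cost a0 b1 - (t1 - t) * (be + r) <= V - k.
  have : (t1 - t) * (sin b1 ^+ 2 - be - r) <= (t1 - t) * (- (r / 2)).
    by rewrite ler_pM2l ?subr_gt0//; lra.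
  by move: d1 k1; rewrite /V; lra.
have f2 : t2 * sin b2 ^+ 2 - cost a0 b2 + (t - t2) * (be - r) <= V - k.
  have : (t - t2) * (be - sin b2 ^+ 2 - r) <= (t - t2) * (- (r / 2)).
    by rewrite ler_pM2l ?subr_gt0//; lra.
  by move: d2 k2; rewrite /V; lra.
clear d1 d2 k1 k2 be1 be2; pose d := Num.min (k / 4) (e / 3).
have dk : d <= k / 4 by rewrite ge_min lexx.
have de : d <= e / 3 by rewrite ge_min lexx orbT.
have d0 : 0 < d by rewrite lt_min; apply/andP; split; lra.
have k4 : 0 < k / 4 by lra.
clearbody k d; near=> T.
have [T1 hL] : 1 < T /\ 2 * (6 / k + 3 / e) <= ln T by near: T; exact: near_ln.
have ha := half_ln_le (erefl (ln T)) T1 (erefl (T / ln T)).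
have U1 : Ex (P T) (fun x : Om => expR (t1 * (T / ln T) * occ x)) <=
    expR (T / ln T * (t1 * sin b1 ^+ 2 - cost a0 b1 + k / 4)).
  by near: T; exact: mgf_upper.
have U2 : Ex (P T) (fun x : Om => expR (t2 * (T / ln T) * occ x)) <=
    expR (T / ln T * (t2 * sin b2 ^+ 2 - cost a0 b2 + k / 4)).
  by near: T; exact: mgf_upper.
have Lo : expR (T / ln T * (t * be - cost a0 b - d)) <= Ex (P T) (fun x : Om => expR (t * (T / ln T) * occ x)).
  by near: T; exact: mgf_lower.
have s0 := speed_gt0 T1.
have bY u : bounded_rv (fun x : Om => expR (u * (T / ln T) * occ x)) by exact: bounded_rv_mgf T1.
move: (T / ln T) => a in U1 U2 Lo s0 ha bY *.
have ke1 : 6 / k + 3 / e <= a.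
  by apply: le_trans ha; rewrite ler_pdivlMr// mulrC.
have ak : 6 <= a * k.
  by rewrite -ler_pdivrMr//; apply: (le_trans _ ke1); rewrite lerDl divr_ge0// ltW.
have ae : 3 <= a * e.
  by rewrite -ler_pdivrMr//; apply: (le_trans _ ke1); rewrite lerDr divr_ge0// ltW.
set A := [set x : Om | _].
have mA : measurable A by exact: measurable_occ_ball.
pose c0 := expR (a * (t * be + `|t| * r)).
pose c1 := expR (a * - ((t1 - t) * (be + r))).
pose c2 := expR (a * ((t - t2) * (be - r))).
have split_le : Ex (P T) (fun x : Om => expR (t * a * occ x)) <= c0 * Ex (P T) \1_A +
   (c1 * Ex (P T) (fun x : Om => expR (t1 * a * occ x)) + c2 * Ex (P T) (fun x : Om => expR (t2 * a * occ x))).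
  rewrite -[c1 * _]Ex_scale// -[c2 * _]Ex_scale// -Ex_add; [|by apply: bounded_rv_mul => //; exact: bounded_rv_cst|by apply: bounded_rv_mul => //; exact: bounded_rv_cst].
  rewrite -Ex_lin; [|exact: bounded_rv_indic|by apply: bounded_rv_add; apply: bounded_rv_mul => //; exact: bounded_rv_cst].
  apply: Ex_le => //.
    apply: bounded_rv_add; first by apply: bounded_rv_mul; [exact: bounded_rv_cst|exact: bounded_rv_indic].
    by apply: bounded_rv_add; apply: bounded_rv_mul => //; exact: bounded_rv_cst.
  move=> x; apply: le_trans (@tilt_split a t t1 t2 be r (occ x) s0 tt1 tt2) _.
  rewrite lerD2r ler_wpM2l ?expR_ge0// indicE ler_nat.
  by case: ltP => // h; rewrite mem_set.
have g1 := tilt_side_le (ltW s0) ak dk (ler_wpM2l (ltW s0) f1) U1.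
have g2 := tilt_side_le (ltW s0) ak dk (ler_wpM2l (ltW s0) f2) U2.
apply: (tilt_main_le (ltW s0) ae de rt _ _ (le_trans Lo split_le)).
  exact: g1.
exact: g2.
Unshelve. all: by end_near.
Qed.

End LocalEstimates.

(** * Upper and lower limits on the logarithmic scale *)

Section Limits.
Variable R : realType.
Implicit Types (s v e p c : R) (f : R -> \bar R).

Lemma limf_esup_le f (c : \bar R) : (forall e, 0 < e -> \forall T \near +oo%R, (f T <= c + e%:E)%E) ->
  (limf_esup f +oo%R <= c)%E.
Proof.
move=> h; apply/lee_addgt0Pr => e e0; rewrite limf_esupE.
apply: (@le_trans _ _ (ereal_sup [set f T | T in [set T | (f T <= c + e%:E)%E]])).
  by apply: ereal_inf_lbound; exists [set T | (f T <= c + e%:E)%E] => //; exact: h.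
by apply: ge_ereal_sup => _ [T hT <-].
Qed.

Lemma limf_einf_ge f (c : \bar R) : (forall e, 0 < e -> \forall T \near +oo%R, (c - e%:E <= f T)%E) ->
  (c <= limf_einf f +oo%R)%E.
Proof.
move=> h; apply/lee_subgt0Pr => e e0; rewrite limf_einfE.
apply: (@le_trans _ _ (ereal_inf [set f T | T in [set T | (c - e%:E <= f T)%E]])).
  by apply: le_ereal_inf_tmp => _ [T hT <-].
by apply: ereal_sup_ubound; exists [set T | (c - e%:E <= f T)%E] => //; exact: h.
Qed.

(** [lne] is [-oo] at nonpositive numbers, a case treated apart; the factor 2 is absorbed by
    [s e >= 1]. *)
Lemma lne_scale_le s v e p : 0 < s -> 1 <= s * e -> p <= 2 * expR (s * v) ->
  (s^-1%:E * lne p%:E <= (v + e)%:E)%E.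
Proof.
move=> s0 se hp; rewrite /lne; case: ifPn => p0; first by rewrite gt0_muleNy ?lte_fin ?invr_gt0// leNye.
rewrite -ltNge in p0; rewrite -EFinM lee_fin mulrC ler_pdivrMr//.
have : p <= expR ((v + e) * s).
  apply: (le_trans hp); have -> : (v + e) * s = s * e + s * v by ring.
  by rewrite expRD ler_wpM2r ?expR_ge0//; have := expR_ge1Dx (s * e); lra.
by rewrite -ler_ln ?posrE ?expR_gt0// expRK.
Qed.

Lemma lne_scale_ge s v p : 0 < s -> expR (s * v) <= p -> (v%:E <= s^-1%:E * lne p%:E)%E.
Proof.
move=> s0 hp; have p0 : 0 < p by apply: lt_le_trans hp; exact: expR_gt0.
rewrite /lne [p <= 0]leNgt p0 /= -EFinM lee_fin mulrC ler_pdivlMr// mulrC.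
by rewrite -[leLHS]expRK ler_ln ?posrE ?expR_gt0.
Qed.

End Limits.

(** A step towards the interior point [a0] lowers the cost and enters the open interval; this covers
    the densities 0 and 1, where [sin b * cos b] vanishes. As [|a0 - b1| <= 2], the density moves by
    at most [4 k <= d / 4]. *)
Lemma angle_interior_approx (R : realType) (a0 b1 d : R) : 0 < a0 < pi / 2 -> 0 <= b1 <= pi / 2 -> 0 < d ->
  exists b, [/\ 0 < b < pi / 2, cost a0 b <= cost a0 b1 & `|sin b ^+ 2 - sin b1 ^+ 2| < d / 2].
Proof.
move=> /andP[a00 a01] /andP[b10 b11] d0; have p4 := pi_le4 R; have p0 := @pi_gt0 R.
pose k := Num.min (1 / 2) (d / 16).
have k1 : k <= 1 / 2 by rewrite ge_min lexx.
have kd : k <= d / 16 by rewrite ge_min lexx orbT.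
have k0 : 0 < k by rewrite lt_min; apply/andP; split; lra.
clearbody k; have ka : 0 < k * a0 by exact: mulr_gt0.
have kb : k * a0 < k * (pi / 2) by rewrite ltr_pM2l.
have kb1 : (1 - k) * b1 <= (1 - k) * (pi / 2) by rewrite ler_wpM2l//; lra.
have kb0 : 0 <= (1 - k) * b1 by rewrite mulr_ge0//; lra.
exists (k * a0 + (1 - k) * b1); split.
- by apply/andP; split; lra.
- have -> : cost a0 (k * a0 + (1 - k) * b1) = (1 - k) ^+ 2 * cost a0 b1 by rewrite /cost; ring.
  rewrite ler_piMl//; last by rewrite expr_le1//; lra.
  by rewrite /cost mulr_ge0 ?sqr_ge0// mulr_ge0 ?ltW.
- apply: le_lt_trans (sin_sqr_lip _ _) _.
  have -> : k * a0 + (1 - k) * b1 - b1 = k * (a0 - b1) by ring.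
  rewrite normrM gtr0_norm//.
  have ab : `|a0 - b1| <= 2 by rewrite ler_norml; apply/andP; split; lra.
  have := ler_wpM2l (ltW k0) ab; lra.
Qed.

Theorem theorem2p4 (R : realType) (alpha : R) (halpha : 0 < alpha < 1)
    (P : R -> probability (path_space R) R)
    (hP : forall T : R, 1 < T -> ssep_law T alpha (P T)) :
  (forall F : set R, F `<=` `[0, 1] ->
     closed (F : set (subspace `[0, 1])) ->
     (limf_esup
        (fun T : R => (ln T / T)%:E *
           lne (P T [set x : cadlag_path R | F (occupation_time x)])) +oo%R
      <= - ereal_inf [set (rate alpha beta)%:E | beta in F])%E) /\
  (forall G : set R, G `<=` `[0, 1] ->
     open (G : set (subspace `[0, 1])) ->
     (- ereal_inf [set (rate alpha beta)%:E | beta in G]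
      <= limf_einf
        (fun T : R => (ln T / T)%:E *
           lne (P T [set x : cadlag_path R | G (occupation_time x)])) +oo%R)%E).
Proof.
have h0 := half_angle_itv_oo halpha; set a0 := half_angle alpha in h0.
have sa : sin a0 ^+ 2 = alpha by apply: sin_half_angle; move: halpha => /andP[? ?]; apply/andP; split; lra.
have hQ (T : R) : 1 < T -> ssep_law T (sin a0 ^+ 2) (P T) by rewrite sa; exact: hP.
have speedV (T : R) : ln T / T = (T / ln T)^-1 by rewrite invf_div.
split=> [F F01 cF|G G01 oG].
- have mF : measurable F.
    have [V cV VF] := (closed_subspaceP _ _).1 cF.
    have -> : F = V `&` `[0, 1] by rewrite VF; apply/esym/setIidPl.
    by apply: measurableI; [exact: closed_measurable|exact: measurable_itv].
  have mA := measurable_occ_preimage hQ mF.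
  (* Stated for real levels [m], because the infimum is [+oo] when [F] is empty. *)
  have key (m : R) : 0 <= m -> (m%:E <= ereal_inf [set (rate alpha beta)%:E | beta in F])%E ->
    (limf_esup (fun T : R => (ln T / T)%:E *
           lne (P T [set x : cadlag_path R | F (occupation_time x)])) +oo%R <= (- m)%:E)%E.
    move=> m0 hm; apply: limf_esup_le => e e0; have e2 : 0 < e / 2 by lra.
    near=> T; have [T1 hL] : 1 < T /\ 4 / e <= ln T by near: T; exact: near_ln.
    rewrite speedV -(Ex_indic _ mA) -EFinD.
    have -> : - m + e = (e / 2 - m) + e / 2 by field.
    apply: lne_scale_le; first exact: speed_gt0.
      have := half_ln_le (erefl (ln T)) T1 (erefl (T / ln T)); move: (T / ln T) => a ha.
      rewrite -ler_pdivrMr// mul1r invf_div.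
      by apply: le_trans ha; move: hL; lra.
    near: T; apply: (ldp_upper h0 hQ mA m0 e2) => x Fx.
    rewrite -rate_half_angle -lee_fin; apply: (le_trans hm); apply: ereal_inf_lbound.
    by exists (occupation_time x).
  have i0 : (0 <= ereal_inf [set (rate alpha beta)%:E | beta in F])%E.
    apply: le_ereal_inf_tmp => _ [beta _ <-]; rewrite lee_fin /rate mulr_ge0 ?sqr_ge0//.
    by rewrite divr_ge0 ?pi_ge0.
  (* A real infimum is itself a level; an infinite one allows every level, so the upper limit is
     [-oo]. *)
  move: i0 key; case: (ereal_inf _) => [r i0 key|_ key|//]; first by apply: key; rewrite -?lee_fin.
  rewrite (eq_ninfty (x := limf_esup _ _)) ?leNye// => r.
  apply: (le_trans (key `|r| _ _)); rewrite ?leey//.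
  by rewrite lee_fin; have := ler_norm (- r); rewrite normrN; lra.
- rewrite leeNl; apply: le_ereal_inf_tmp => _ [beta Gb <-]; rewrite leeNl -EFinN.
  have [V oV VG] := (open_subspaceP _ _).1 oG.
  have GE : G = V `&` `[0, 1] by rewrite VG; apply/esym/setIidPl.
  have mG : measurable G.
    by rewrite GE; apply: measurableI; [exact: open_measurable|exact: measurable_itv].
  have hb : 0 <= beta <= 1 by have := G01 _ Gb; rewrite /= in_itv.
  (* [beta] may be an end of [[0, 1]]: the ball is taken relative to [[0, 1]], where the occupation
     time has its values. *)
  have [d d0 hd] : exists2 d : R, 0 < d & forall y, 0 <= y <= 1 -> `|y - beta| < d -> G y.
    have Vb : V beta by move: Gb; rewrite GE => -[].
    have [d /= d0 hd] := (nbhs_ballP _ _).1 (open_nbhs_nbhs (conj oV Vb)).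
    exists d => // y hy yd; rewrite GE; split; last by rewrite /= in_itv.
    by apply: hd; rewrite /ball /= distrC.
  have sb := sin_half_angle hb; have hab := half_angle_itv hb; set b1 := half_angle beta in sb hab.
  have [b [hb' cb bd]] := angle_interior_approx h0 hab d0; rewrite sb in bd.
  apply: limf_einf_ge => e e0; have d2 : 0 < d / 2 by lra.
  near=> T; have [T1 _] : 1 < T /\ 1 <= ln T by near: T; exact: near_ln.
  rewrite speedV -(Ex_indic _ (measurable_occ_preimage hQ mG)) -EFinD.
  apply: lne_scale_ge; first exact: speed_gt0.
  apply: (@le_trans _ _ (expR (- (T / ln T * (cost a0 b + e))))).
    by rewrite rate_half_angle ler_expR -[leRHS]mulrN ler_pM2l ?speed_gt0// -/a0 -/b1; lra.
  apply: (@le_trans _ _ (Ex (P T) \1_[set x : path_space R | `|occupation_time x - sin b ^+ 2| < d / 2])).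
    by near: T; exact: ldp_lower.
  apply: Ex_le; [apply: bounded_rv_indic; exact: (measurable_occ_ball hQ)|by apply: bounded_rv_indic; exact: (measurable_occ_preimage hQ mG)|move=> x].
  rewrite !indicE ler_nat; case: (boolP (x \in _)) => //; rewrite inE /= => h.
  rewrite mem_set//=; apply: hd; first exact: occ01.
  have -> : occupation_time x - beta = (occupation_time x - sin b ^+ 2) + (sin b ^+ 2 - beta) by ring.
  by apply: le_lt_trans (ler_normD _ _) _; lra.
Unshelve. all: by end_near.
Qed.
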